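(* Fix $\alpha>0$. For every positive integer $d$ (large enough that $\lfloor \alpha d^2\rfloor\geq 1$), let $W_d$ be a $(d^2,\lfloor \alpha d^2 \rfloor)$-Wishart matrix (real or complex), and let $Y_d=W_d^\Gamma$ be the partial transposition of $W_d$. Then, for every $\varepsilon > 0$, \[ \lim_{d \to \infty} \mathbf{P} \left( \left| \lambda_{\max}(Y_d) - \left(1+\frac{2}{\sqrt{\alpha}}\right) \right| > \varepsilon \right) = 0 ,\] \[ \lim_{d \to \infty} \mathbf{P} \left( \left| \lambda_{\min}(Y_d) - \left(1-\frac{2}{\sqrt{\alpha}}\right) \right| > \varepsilon \right) = 0 .\]
   Context: A $(n,p)$-Wishart matrix is a random $n\times n$ matrix $W=\frac1p GG^\dagger$, where $G$ is an $n\times p$ matrix with independent $N(0,1)$ entries, either all real or all complex. A complex $N(0,1)$ variable has independent real and imaginary parts, each real $N(0,\frac12)$. The result is asserted in both the real and the complex case. For $n=d^2$, an $n\times n$ matrix $A$ is viewed as a $d\times d$ block matrix with $d\times d$ blocks, with entries $A_{i,j}^{k,l}$ ($i,j,k,l\in\{1,\dots,d\}$): $i$ is the block row index, $j$ the block column index, $k$ the row index and $l$ the column index inside block $(i,j)$. The partial transposition $A^\Gamma$ is obtained by transposing each block: $(A^\Gamma)_{i,j}^{k,l}=A_{i,j}^{l,k}$. $\lambda_{\min}(A)$ and $\lambda_{\max}(A)$ denote the smallest and largest eigenvalues of a Hermitian matrix $A$. *)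

(* Defs.v *)
From HB Require Import structures.
From mathcomp Require Import all_boot all_order all_algebra.
From mathcomp Require Import complex.
From mathcomp Require Import all_classical all_reals all_analysis.

Set Implicit Arguments.
Unset Strict Implicit.
Unset Printing Implicit Defensive.

Import Order.TTheory GRing.Theory Num.Theory.
Import numFieldNormedType.Exports.

Local Open Scope classical_set_scope.
Local Open Scope ring_scope.
Local Open Scope complex_scope.
Local Open Scope sesquilinear_scope.

Section Independence.
Context {R : realType} {dT dE : measure_display}.
Context {T : measurableType dT} {E : measurableType dE}.

Definition mutually_independent (P : probability T R) (I : finType)
    (X : I -> T -> E) : Prop :=
  forall (J : {set I}) (B : I -> set E), (forall i, measurable (B i)) ->
    (P (\bigcap_(i in [set` J]) (X i @^-1` B i)) =
     \prod_(i in J) P (X i @^-1` B i))%E.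

End Independence.

Section Gaussian.
Context {R : realType} {dT : measure_display} {T : measurableType dT}.

(* The library's [normal_prob m s] takes the standard deviation [s]. *)
Definition is_normal (P : probability T R) (m variance : R) (X : T -> R) : Prop :=
  measurable_fun [set: T] X /\
  forall B : set R, measurable B ->
    P (X @^-1` B) = normal_prob m (Num.sqrt variance) B.

Definition is_complex_normal (P : probability T R) (Z : T -> R[i]) : Prop :=
  [/\ is_normal P 0 (1 / 2) (fun w => complex.Re (Z w)),
      is_normal P 0 (1 / 2) (fun w => complex.Im (Z w)) &
      mutually_independent P
        (fun (b : bool) w => if b then complex.Re (Z w) else complex.Im (Z w))].

Definition real_gaussian_matrix (P : probability T R) (n p : nat)
    (G : T -> 'M[R]_(n, p)) : Prop :=
  (forall i j, is_normal P 0 1 (fun w => G w i j)) /\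
  mutually_independent P (fun (ij : 'I_n * 'I_p) w => G w ij.1 ij.2).

(* [R[i]] carries no sigma-algebra in the library: independence of the complex
   entries is expressed in the product Borel space [R * R]. *)
Definition complex_gaussian_matrix (P : probability T R) (n p : nat)
    (G : T -> 'M[R[i]]_(n, p)) : Prop :=
  (forall i j, is_complex_normal P (fun w => G w i j)) /\
  mutually_independent P (fun (ij : 'I_n * 'I_p) w =>
    (complex.Re (G w ij.1 ij.2), complex.Im (G w ij.1 ij.2))).

Variant entry_kind := RealEntries | ComplexEntries.

Definition gaussian_matrix (k : entry_kind) (P : probability T R) (n p : nat)
    (G : T -> 'M[R[i]]_(n, p)) : Prop :=
  match k with
  | RealEntries => exists2 G0 : T -> 'M[R]_(n, p), real_gaussian_matrix P G0 &
      forall w, G w = map_mx (real_complex R) (G0 w)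
  | ComplexEntries => complex_gaussian_matrix P G
  end.

Definition is_wishart (k : entry_kind) (P : probability T R) (n p : nat)
    (W : T -> 'M[R[i]]_n) : Prop :=
  exists2 G : T -> 'M[R[i]]_(n, p), gaussian_matrix k P G &
    forall w, W w = p%:R^-1 *: (G w *m (G w)^t*).

End Gaussian.

Section PartialTransposition.
Variables (K : Type) (d : nat).

(* [mxvec_index i k] is the index [i * d + k]: position [k] inside block [i]. *)
Definition block_entry (A : 'M[K]_(d * d)) (i j k l : 'I_d) : K :=
  A (mxvec_index i k) (mxvec_index j l).

Definition block_index (r : 'I_(d * d)) : 'I_d * 'I_d :=
  enum_val (cast_ord (esym (mxvec_cast d d)) r).

Definition partial_transpose (A : 'M[K]_(d * d)) : 'M[K]_(d * d) :=
  \matrix_(r, s) block_entry A (block_index r).1 (block_index s).1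
                               (block_index s).2 (block_index r).2.

Lemma mxvec_indexK (i k : 'I_d) : block_index (mxvec_index i k) = (i, k).
Proof. by rewrite /block_index /mxvec_index cast_ordK enum_rankK. Qed.

Lemma val_mxvec_index (i k : 'I_d) : mxvec_index i k = (i * d + k)%N :> nat.
Proof.
rewrite /mxvec_index /= /enum_rank enum_rank_in.unlock insubdK; last first.
  by rewrite -[_ \in _]/(_ < _)%N cardE index_mem mem_enum.
rewrite enumT unlock /=.
have -> : prod_enum 'I_d 'I_d = [seq (x, y) | x <- enum 'I_d, y <- enum 'I_d].
  by [].
have H (s : seq 'I_d) : i \in s ->
    index (i, k) [seq (x, y) | x <- s, y <- enum 'I_d] = (index i s * d + k)%N.
  elim: s => //= x s IH; rewrite inE eq_sym index_cat size_map size_enum_ord.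
  have [-> _|xi /= /IH ->] := eqVneq x i.
    rewrite map_f ?mem_enum // index_map ?index_enum_ord //.
    by move=> y z [].
  rewrite ifN; last by apply/mapP => -[y _ [/esym/eqP]]; rewrite (negPf xi).
  by rewrite mulSn addnA.
by rewrite H ?mem_enum // index_enum_ord.
Qed.

Lemma partial_transposeE (A : 'M[K]_(d * d)) (i j k l : 'I_d) :
  block_entry (partial_transpose A) i j k l = block_entry A i j l k.
Proof. by rewrite {1}/block_entry mxE !mxvec_indexK. Qed.

End PartialTransposition.

Lemma partial_transpose_hermitian (R : realType) (d : nat)
    (A : 'M[R[i]]_(d * d)) :
  A \is hermsymmx -> partial_transpose A \is hermsymmx.
Proof.
move=> /is_hermitianmxP; rewrite expr0 scale1r => AA.
apply/is_hermitianmxP; rewrite expr0 scale1r; apply/matrixP => r s.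
by rewrite !mxE /block_entry {1}AA !mxE.
Qed.

Lemma wishart_hermitian (R : realType) (dT : measure_display)
    (T : measurableType dT) (k : entry_kind) (P : probability T R) (n p : nat)
    (W : T -> 'M[R[i]]_n) (w : T) : is_wishart k P p W -> W w \is hermsymmx.
Proof.
case=> G _ ->; apply/is_hermitianmxP; rewrite expr0 scale1r.
rewrite linearZ /= map_mxZ trmx_mul map_mxM fmorphV rmorph_nat.
by rewrite [in RHS]trmxCK.
Qed.

Section ExtremeEigenvalues.
Variables (R : realType) (n : nat).
Implicit Type A : 'M[R[i]]_n.

(* For Hermitian [A] with [n > 0], this set is finite and nonempty, so that its
   supremum and infimum are attained; see [lambda_maxP] and [lambda_minP]. *)
Definition spectrum A : set R := [set x : R | eigenvalue A x%:C].

Definition lambda_max A : R := sup (spectrum A).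
Definition lambda_min A : R := inf (spectrum A).

Lemma hermitian_eigenvalue_real A (a : R[i]) :
  A \is hermsymmx -> eigenvalue A a -> a = (complex.Re a)%:C.
Proof.
move=> /is_hermitianmxP; rewrite expr0 scale1r => AA /eigenvalueP[u uA u0].
have uu0 : (u *m u^t*) 0 0 != 0.
  apply: contra u0 => /eqP; rewrite mxE => uu0; apply/eqP/rowP => j; rewrite mxE.
  have H (i : 'I_n) : true -> 0 <= u 0 i * (u^t*) i 0.
    by move=> _; rewrite !mxE mul_conjC_ge0.
  have /(_ j isT)/eqP := psumr_eq0P H uu0.
  by rewrite !mxE mul_conjC_eq0 => /eqP.
have E1 : u *m A *m u^t* = a *: (u *m u^t*) by rewrite uA scalemxAl.
have E2 : u *m A *m u^t* = Num.conj a *: (u *m u^t*).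
  rewrite -mulmxA {1}AA -map_mxM -trmx_mul uA.
  by rewrite linearZ /= map_mxZ -scalemxAr.
have /(congr1 (fun M : 'M[R[i]]_1 => M 0 0)) :
  a *: (u *m u^t*) = Num.conj a *: (u *m u^t*).
  by rewrite -E1 E2.
rewrite ![in LHS]mxE ![in RHS]mxE => /(mulIf _) aE.
rewrite RRe_real //; apply/CrealP; apply/esym/aE.
by move: uu0; rewrite mxE.
Qed.

Lemma spectrum_seq A : (0 < n)%N -> A \is hermsymmx ->
  exists2 s : seq R, s != [::] & forall x, spectrum A x <-> x \in s.
Proof.
move=> n0 hA; have [r rE] := closed_field_poly_normal (char_poly A).
have rP a : eigenvalue A a = (a \in r).
  rewrite eigenvalue_root_char rE rootZ ?root_prod_XsubC //.
  by rewrite lead_coef_eq0 monic_neq0 // char_poly_monic.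
exists (map (@complex.Re R) r).
  have [a] := eigenvalue_closed A n0.
  by rewrite rP; case: (r).
move=> x; split => [|/mapP[a ar ->]]; rewrite /spectrum /= ?rP.
  by move=> xr; apply/mapP; exists x%:C.
by rewrite -(hermitian_eigenvalue_real hA) ?rP.
Qed.

Lemma lambda_maxP A : (0 < n)%N -> A \is hermsymmx ->
  eigenvalue A (lambda_max A)%:C /\
  (forall x : R, eigenvalue A x%:C -> x <= lambda_max A).
Proof.
move=> n0 hA; have [s s0 sP] := spectrum_seq n0 hA.
have [m ms mP] : exists2 m, m \in s & forall x, x \in s -> x <= m.
  elim: (s) s0 => // x [|y t] IH _.
    by exists x => [|z]; rewrite inE ?eqxx // => /eqP ->.
  have [//|m mt mP] := IH; have [xm|mx] := leP x m.
    exists m => [|z]; first by rewrite inE mt orbT.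
    by rewrite inE => /predU1P[-> //|/mP].
  exists x => [|z]; first by rewrite mem_head.
  by rewrite inE => /predU1P[-> //|/mP zm]; rewrite (le_trans zm) ?ltW.
have ubm : ubound (spectrum A) m by move=> x /sP/mP.
suff -> : lambda_max A = m by split=> [|x xA]; [exact/sP | exact: ubm].
apply/eqP; rewrite eq_le; apply/andP; split.
  by apply: ge_sup => //; exists m; exact/sP.
by apply: ub_le_sup; [exists m | exact/sP].
Qed.

Lemma lambda_minP A : (0 < n)%N -> A \is hermsymmx ->
  eigenvalue A (lambda_min A)%:C /\
  (forall x : R, eigenvalue A x%:C -> lambda_min A <= x).
Proof.
move=> n0 hA; have [s s0 sP] := spectrum_seq n0 hA.
have [m ms mP] : exists2 m, m \in s & forall x, x \in s -> m <= x.
  elim: (s) s0 => // x [|y t] IH _.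
    by exists x => [|z]; rewrite inE ?eqxx // => /eqP ->.
  have [//|m mt mP] := IH; have [mx|xm] := leP m x.
    exists m => [|z]; first by rewrite inE mt orbT.
    by rewrite inE => /predU1P[-> //|/mP].
  exists x => [|z]; first by rewrite mem_head.
  by rewrite inE => /predU1P[-> //|/mP mz]; rewrite (le_trans _ mz) ?ltW.
have lbm : lbound (spectrum A) m by move=> x /sP/mP.
suff -> : lambda_min A = m by split=> [|x xA]; [exact/sP | exact: lbm].
apply/eqP; rewrite eq_le; apply/andP; split.
  by apply: ge_inf; [exists m | exact/sP].
by apply: lb_le_inf => //; exists m; exact/sP.
Qed.

End ExtremeEigenvalues.

(* Main.v *)
Require Import Defs.
From HB Require Import structures.
From mathcomp Require Import all_boot all_order all_algebra.
From mathcomp Require Import complex.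
From mathcomp Require Import all_classical all_reals all_analysis.
From mathcomp Require Import measurable_realfun.
From mathcomp Require Import zify ring lra.

(* Up to a scalar factor, [W^Gamma - 1] is a sum [S] of independent centred increments, one for
   each column of the Gaussian matrix; its limiting spectral law is the semicircle law on [-2, 2].
   The columns are added one at a time, while a barrier [u] moves from [u0 > 1] to [u0 + u0^-1].
   Let [X_q] be the normalized trace of [(u - S)^-q]. A second-order expansion of the resolvent,
   together with the moments of the increments given by Wick's formula, shows that at each of the
   [p] steps the Lyapunov function [D (X_1 - u0^-1)^2 + (max 0 (X_2 - y))^2 + X_q / n] grows on
   average by a factor [1 + O(1 / p)] and an error [o(1 / p)]; here [y] follows the differential
   equation satisfied by [X_2] in the limit, and increments of large operator norm, rare by an
   epsilon-net argument, stop the process. Hence with high probability the function stays below 1: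
   the term [X_q / n] keeps every eigenvalue of [S] below the barrier, and [X_1] ends close to
   [u0^-1]. Letting [u0] decrease to 1 bounds the spectrum by 2, and comparing [X_1] at two final
   barriers shows that it reaches 2. The smallest eigenvalue of [W^Gamma] is obtained from [- S]. *)

Set Implicit Arguments.
Unset Strict Implicit.
Unset Printing Implicit Defensive.

Import Order.TTheory GRing.Theory Num.Theory.
Import numFieldNormedType.Exports.

Local Open Scope classical_set_scope.
Local Open Scope ring_scope.
Local Open Scope complex_scope.
Local Open Scope sesquilinear_scope.

(** * Traces, norms and Schatten bounds *)

Section ConjugateTranspose.
Variable C : numClosedFieldType.

Lemma trmxC_mul m n p (A : 'M[C]_(m, n)) (B : 'M[C]_(n, p)) :
  (A *m B)^t* = B^t* *m A^t*.
Proof. by rewrite trmx_mul map_mxM. Qed.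

Lemma trmxC_add m n (A B : 'M[C]_(m, n)) : (A + B)^t* = A^t* + B^t*.
Proof. by rewrite linearD map_mxD. Qed.

Lemma trmxC_sub m n (A B : 'M[C]_(m, n)) : (A - B)^t* = A^t* - B^t*.
Proof. by rewrite linearB map_mxB. Qed.

Lemma trmxC1 n : (1%:M : 'M[C]_n)^t* = 1%:M.
Proof. by rewrite trmx1 map_mx1. Qed.

Lemma trmxC_exp n (A : 'M[C]_n) k : (A ^+ k)^t* = A^t* ^+ k.
Proof.
elim: k => [|k IH]; first by rewrite !expr0 trmxC1.
by rewrite exprS exprSr -IH trmxC_mul.
Qed.

Lemma trmxC_mulCt n (X : 'M[C]_n) : (X^t* * X)^t* = X^t* * X.
Proof. by rewrite trmxC_mul trmxCK. Qed.

Lemma mxtrace_mulCtE m n (A B : 'M[C]_(m, n)) :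
  \tr (A *m B^t*) = \sum_i \sum_j A i j * (B i j)^*.
Proof. by apply: eq_bigr => i _; rewrite mxE; apply: eq_bigr => j _; rewrite !mxE. Qed.

Lemma mxtrace_mulCt_ge0 m n (A : 'M[C]_(m, n)) : 0 <= \tr (A *m A^t*).
Proof.
rewrite mxtrace_mulCtE; apply: sumr_ge0 => i _; apply: sumr_ge0 => j _.
by rewrite mul_conjC_ge0.
Qed.

Lemma mxtrace_dotmx m n (A B : 'M[C]_(m, n)) :
  \tr (A *m B^t*) = dotmx (mxvec A) (mxvec B).
Proof.
rewrite mxtrace_mulCtE dotmxE mxE (reindex _ (curry_mxvec_bij _ _)) /= pair_bigA /=.
by apply: eq_bigr => -[i j] _; rewrite !mxE /= !mxvecE.
Qed.

Lemma mxtrace_CauchySchwarz m n (A B : 'M[C]_(m, n)) :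
  `|\tr (A *m B^t*)| ^+ 2 <= \tr (A *m A^t*) * \tr (B *m B^t*).
Proof. by rewrite !mxtrace_dotmx; exact: (CauchySchwarz (@dotmx C _) _ _).1. Qed.

Lemma mxtrace_mulrC n (A B : 'M[C]_n) : \tr (A * B) = \tr (B * A).
Proof. exact: mxtrace_mulC. Qed.

Lemma mxtrace_exprn_mulC n (A B : 'M[C]_n) k :
  (0 < k)%N -> \tr ((A * B) ^+ k) = \tr ((B * A) ^+ k).
Proof.
case: k => // k _; have -> : (A * B) ^+ k.+1 = A * ((B * A) ^+ k * B).
  elim: k => [|k IH]; first by rewrite expr1 expr0 mul1r.
  by rewrite exprS IH exprS !mulrA.
by rewrite mxtrace_mulrC -mulrA -exprSr.
Qed.

End ConjugateTranspose.

Section QuadraticForm.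
Variable C : numClosedFieldType.

Definition quadform n (A : 'M[C]_n) (v : 'rV[C]_n) : C := (v *m A *m v^t*) 0 0.
Definition sqnorm n (v : 'rV[C]_n) : C := (v *m v^t*) 0 0.

Lemma sqnormE n (v : 'rV[C]_n) : sqnorm v = \sum_i `|v 0 i| ^+ 2.
Proof. by rewrite /sqnorm mxE; apply: eq_bigr => i _; rewrite !mxE normCK. Qed.

Lemma sqnorm_ge0 n (v : 'rV[C]_n) : 0 <= sqnorm v.
Proof. by rewrite sqnormE sumr_ge0 // => i _; rewrite exprn_ge0. Qed.

Lemma sqnorm_eq0 n (v : 'rV[C]_n) : sqnorm v = 0 -> v = 0.
Proof.
rewrite sqnormE => /psumr_eq0P v0; apply/rowP => i; rewrite mxE; apply/eqP.
by rewrite -normr_eq0 -sqrf_eq0 v0 // => j _; rewrite exprn_ge0.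
Qed.

Lemma sqnormZ n (c : C) (v : 'rV[C]_n) : sqnorm (c *: v) = `|c| ^+ 2 * sqnorm v.
Proof.
by rewrite !sqnormE mulr_sumr; apply: eq_bigr => i _; rewrite mxE normrM exprMn.
Qed.

Lemma dot_CauchySchwarz n (v w : 'rV[C]_n) :
  `|(v *m w^t*) 0 0| ^+ 2 <= sqnorm v * sqnorm w.
Proof. by have := mxtrace_CauchySchwarz v w; rewrite /mxtrace !big_ord1. Qed.

Lemma sqnorm_triangle n (v w : 'rV[C]_n) (a b : C) : 0 <= a -> 0 <= b ->
  sqnorm v <= a ^+ 2 -> sqnorm w <= b ^+ 2 -> sqnorm (v + w) <= (a + b) ^+ 2.
Proof.
move=> a0 b0 va wb.
have sqnorm_dotmx (u : 'rV[C]_n) : sqnorm u = dotmx u u by rewrite dotmxE.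
have sqrtC_le u c : 0 <= c -> sqnorm u <= c ^+ 2 -> sqrtC (sqnorm u) <= c.
  move=> c0 uc; rewrite -(@ler_pXn2r _ 2) ?nnegrE ?sqrtC_ge0 ?sqnorm_ge0 //.
  by rewrite sqrtCK.
rewrite -[leLHS]sqrtCK ler_pXn2r ?nnegrE ?sqrtC_ge0 ?sqnorm_ge0 ?addr_ge0 //.
have : sqrtC (dotmx (v + w) (v + w)) <= sqrtC (dotmx v v) + sqrtC (dotmx w w).
  exact: (triangle_lerif (@dotmx C n) v w).1.
by rewrite -!sqnorm_dotmx => /le_trans; apply; apply: lerD; exact: sqrtC_le.
Qed.

Lemma quadformB n (A B : 'M[C]_n) v :
  quadform (A - B) v = quadform A v - quadform B v.
Proof. by rewrite /quadform mulmxBr mulmxBl !mxE. Qed.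

Lemma quadformZ n c (A : 'M[C]_n) v : quadform (c *: A) v = c * quadform A v.
Proof. by rewrite /quadform -scalemxAr -scalemxAl mxE. Qed.

Lemma quadform_scalar n (a : C) (v : 'rV[C]_n) : quadform a%:M v = a * sqnorm v.
Proof. by rewrite /quadform mul_mx_scalar -scalemxAl mxE. Qed.

Lemma quadform_real n (A : 'M[C]_n) v : A^t* = A -> quadform A v \is Num.real.
Proof.
move=> hermA; apply/CrealP; rewrite /quadform.
have {2}<- : (v *m A *m v^t*)^t* = v *m A *m v^t*.
  by rewrite !trmxC_mul trmxCK hermA mulmxA.
by rewrite [RHS]mxE [X in _ = Num.conj X]mxE.
Qed.

Lemma quadform_mulCt n (A : 'M[C]_n) v : quadform (A^t* * A) v = sqnorm (v *m A^t*).
Proof. by rewrite /sqnorm /quadform trmxC_mul trmxCK -!mulmxE !mulmxA. Qed.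

Lemma mxtrace_quadform m n (X : 'M[C]_(m, n)) (M : 'M[C]_n) :
  \tr (X *m M *m X^t*) = \sum_i quadform M (row i X).
Proof.
apply: eq_bigr => i _; rewrite /quadform -row_mul !mxE.
by apply: eq_bigr => j _; rewrite !mxE.
Qed.

Lemma mxtrace_sqnorm m n (X : 'M[C]_(m, n)) :
  \tr (X *m X^t*) = \sum_i sqnorm (row i X).
Proof.
rewrite -[X in \tr (X *m _)]mulmx1 mxtrace_quadform; apply: eq_bigr => i _.
by rewrite quadform_scalar mul1r.
Qed.

Definition psdmx n (A : 'M[C]_n) := forall v : 'rV[C]_n, 0 <= quadform A v.

Lemma psdmx_mxtrace m n (X : 'M[C]_(m, n)) (M : 'M[C]_n) : psdmx M ->
  0 <= \tr (X *m M *m X^t*).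
Proof. by move=> M0; rewrite mxtrace_quadform sumr_ge0. Qed.

End QuadraticForm.

Section OperatorNorm.
Variable C : numClosedFieldType.

Definition opnorm_le n (c : C) (A : 'M[C]_n) :=
  0 <= c /\ forall v : 'rV[C]_n, sqnorm (v *m A) <= c ^+ 2 * sqnorm v.

Lemma opnorm_le_trans n (a b : C) (A : 'M[C]_n) :
  a <= b -> opnorm_le a A -> opnorm_le b A.
Proof.
move=> ab [a0 Aa]; split; first exact: le_trans ab.
move=> v; apply: le_trans (Aa v) _; apply: ler_wpM2r; first exact: sqnorm_ge0.
by rewrite ler_pXn2r ?nnegrE // (le_trans a0).
Qed.

Lemma opnorm_leM n (a b : C) (A B : 'M[C]_n) :
  opnorm_le a A -> opnorm_le b B -> opnorm_le (a * b) (A * B).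
Proof.
move=> [a0 Aa] [b0 Bb]; split; first exact: mulr_ge0.
move=> v; rewrite mulmxA; apply: le_trans (Bb _) _.
rewrite exprMn [_ * b ^+ 2]mulrC -[leRHS]mulrA; apply: ler_wpM2l => //.
by rewrite exprn_ge0.
Qed.

Lemma opnorm_le1 n : opnorm_le 1 (1 : 'M[C]_n).
Proof. by split=> // v; rewrite mulmx1 expr1n mul1r. Qed.

Lemma opnorm_leX n (a : C) (A : 'M[C]_n) k : opnorm_le a A -> opnorm_le (a ^+ k) (A ^+ k).
Proof.
move=> Aa; elim: k => [|k IH]; first exact: opnorm_le1.
by rewrite !exprS; exact: opnorm_leM.
Qed.

Lemma opnorm_le_scalar n (a : C) : opnorm_le `|a| (a%:M : 'M[C]_n).
Proof. by split=> // v; rewrite mul_mx_scalar sqnormZ. Qed.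

Lemma opnorm_leZ n (a c : C) (A : 'M[C]_n) : opnorm_le a A -> opnorm_le (`|c| * a) (c *: A).
Proof. by move=> /(opnorm_leM (opnorm_le_scalar n c)); rewrite -mul_scalar_mx. Qed.

Lemma opnorm_leN n (a : C) (A : 'M[C]_n) : opnorm_le a A -> opnorm_le a (- A).
Proof. by move=> /(opnorm_leZ (-1)); rewrite normrN1 mul1r scaleN1r. Qed.

Lemma opnorm_leD n (a b : C) (A B : 'M[C]_n) :
  opnorm_le a A -> opnorm_le b B -> opnorm_le (a + b) (A + B).
Proof.
move=> [a0 Aa] [b0 Bb]; split; first exact: addr_ge0.
move=> v; rewrite mulmxDr -[sqnorm v]sqrtCK -exprMn mulrDl; apply: sqnorm_triangle.
- by rewrite mulr_ge0 ?sqrtC_ge0 ?sqnorm_ge0.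
- by rewrite mulr_ge0 ?sqrtC_ge0 ?sqnorm_ge0.
- by rewrite exprMn sqrtCK.
- by rewrite exprMn sqrtCK.
Qed.

Lemma opnorm_le_quadform n (c : C) (A : 'M[C]_n) v :
  opnorm_le c A -> `|quadform A v| <= c * sqnorm v.
Proof.
move=> [c0 Ac]; rewrite -(@ler_pXn2r _ 2) ?nnegrE ?mulr_ge0 ?sqnorm_ge0 //.
apply: le_trans (dot_CauchySchwarz _ _) _.
rewrite exprMn [sqnorm v ^+ 2]expr2 mulrA; apply: ler_wpM2r => //.
exact: sqnorm_ge0.
Qed.

Lemma opnorm_le_mxtrace_mulCt m n (c : C) (X : 'M[C]_(m, n)) (M : 'M[C]_n) :
  opnorm_le c M -> `|\tr (X *m M *m X^t*)| <= c * \tr (X *m X^t*).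
Proof.
move=> Mc; rewrite mxtrace_quadform mxtrace_sqnorm mulr_sumr.
apply: le_trans (ler_norm_sum _ _ _) _; apply: ler_sum => i _.
exact: opnorm_le_quadform.
Qed.

Lemma opnorm_le_mxtrace n (c : C) (M : 'M[C]_n) : opnorm_le c M -> `|\tr M| <= c * n%:R.
Proof.
move/(opnorm_le_mxtrace_mulCt (1%:M : 'M[C]_n)).
by rewrite trmxC1 !mulmx1 mul1mx mxtrace1.
Qed.

Lemma frobenius_opnorm_le n (W : 'M[C]_n) (c : C) : 0 <= c ->
  \tr (W *m W^t*) <= c ^+ 2 -> opnorm_le c W.
Proof.
move=> c0 Wc; split => // v; rewrite mulrC.
rewrite sqnormE; apply: (@le_trans _ _ (\sum_j sqnorm v * \sum_i `|W i j| ^+ 2)).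
  apply: ler_sum => j _; have := dot_CauchySchwarz v ((col j W)^t*).
  rewrite trmxCK; congr (`|_| ^+ 2 <= _ * _).
    by rewrite !mxE; apply: eq_bigr => i _; rewrite !mxE.
  by rewrite sqnormE; apply: eq_bigr => i _; rewrite !mxE norm_conjC.
rewrite -mulr_sumr; apply: ler_wpM2l; first exact: sqnorm_ge0.
apply: le_trans Wc; rewrite mxtrace_mulCtE exchange_big /=.
by apply: ler_sum => i _; apply: ler_sum => j _; rewrite -normCK.
Qed.

End OperatorNorm.

Section Schatten.
Variables (C : numClosedFieldType) (n : nat).
Implicit Types A B M X Y : 'M[C]_n.

(* The Schatten norm of exponent [2 ^ k.+1], raised to that exponent. *)
Definition schatten k X : C := \tr ((X^t* * X) ^+ (2 ^ k)).

Lemma schatten_trmxC k X : schatten k (X^t*) = schatten k X.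
Proof. by rewrite /schatten trmxCK mxtrace_exprn_mulC // expn_gt0. Qed.

Lemma schatten_herm k A : A^t* = A -> schatten k A = \tr (A ^+ (2 ^ k.+1)).
Proof. by move=> hermA; rewrite /schatten hermA -expr2 -exprM -expnS. Qed.

Lemma schattenS k X : schatten k.+1 X = schatten k (X^t* * X).
Proof. by rewrite [RHS]schatten_herm // trmxC_mulCt. Qed.

Lemma schatten_ge0 k X : 0 <= schatten k X.
Proof.
elim: k X => [|k IH] X; last by rewrite schattenS.
by rewrite /schatten expr1 mxtrace_mulrC mxtrace_mulCt_ge0.
Qed.

Lemma mxtrace_schatten0 A B : `|\tr (A * B)| ^+ 2 <= schatten 0 A * schatten 0 B.
Proof.
rewrite -{1}[B]trmxCK; apply: le_trans (mxtrace_CauchySchwarz _ _) _.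
by rewrite -[schatten 0 A]schatten_trmxC /schatten !expr1 !trmxCK.
Qed.

Definition schatten_submul k :=
  forall X Y, schatten k (X * Y) ^+ 2 <= schatten k.+1 X * schatten k.+1 Y.

Lemma schatten0_exprn_le k M : (forall i, (i < k)%N -> schatten_submul i) ->
  schatten 0 (M ^+ (2 ^ k)) <= schatten k M.
Proof.
move=> submul; suff halving j : (j <= k)%N ->
    schatten 0 (M ^+ (2 ^ k)) ^+ (2 ^ j) <= schatten j (M ^+ (2 ^ (k - j))) ^+ (2 ^ j).
  have := halving k (leqnn k); rewrite subnn expn0 expr1.
  by rewrite ler_pXn2r ?nnegrE ?schatten_ge0 // expn_gt0.
elim: j => [|j IH] jk; first by rewrite subn0 !expn0 !expr1.
rewrite expnS mulnC !exprM.
apply: (@le_trans _ _ ((schatten j (M ^+ (2 ^ (k - j))) ^+ (2 ^ j)) ^+ 2)).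
  by rewrite ler_pXn2r ?nnegrE ?exprn_ge0 ?schatten_ge0 // IH // ltnW.
rewrite -!exprM mulnC !exprM ler_pXn2r ?nnegrE ?exprn_ge0 ?schatten_ge0 ?expn_gt0 //.
have -> : (2 ^ (k - j) = 2 ^ (k - j.+1) + 2 ^ (k - j.+1))%N.
  by rewrite addnn -mul2n -expnS subnSK.
by rewrite exprD [leRHS]expr2; exact: submul.
Qed.

Lemma mxtrace_exprn_schatten k M : (forall i, (i < k)%N -> schatten_submul i) ->
  `|\tr (M ^+ (2 ^ k.+1))| <= schatten k M.
Proof.
move=> submul; rewrite expnS mul2n -addnn exprD.
rewrite -(@ler_pXn2r _ 2) ?nnegrE ?schatten_ge0 //.
apply: le_trans (mxtrace_schatten0 _ _) _.
by rewrite expr2; apply: ler_pM; rewrite ?schatten_ge0 //; exact: schatten0_exprn_le.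
Qed.

Lemma schatten_mulE k X Y :
  schatten k (X * Y) = `|\tr (((X^t* * X) * (Y * Y^t*)) ^+ (2 ^ k))|.
Proof.
rewrite -[LHS]ger0_norm ?schatten_ge0 // /schatten trmxC_mul -mulmxE.
congr `|_|; rewrite -!mulmxA mulmxE mxtrace_exprn_mulC ?expn_gt0 //.
by rewrite -!mulmxE !mulmxA.
Qed.

Lemma schattenM k : schatten_submul k.
Proof.
elim/ltn_ind: k => -[|k] IH X Y.
  rewrite schatten_mulE expr1; apply: le_trans (mxtrace_schatten0 _ _) _.
  by rewrite -[in leRHS](schatten_trmxC 1 Y) !schattenS trmxCK.
apply: (@le_trans _ _ (schatten k ((X^t* * X) * (Y * Y^t*)) ^+ 2)).
  rewrite ler_pXn2r ?nnegrE ?schatten_ge0 // schatten_mulE.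
  by apply: mxtrace_exprn_schatten => i ik; apply: IH; exact: ltnW.
apply: le_trans (IH k (ltnSn k) _ _) _.
by rewrite -(schatten_trmxC k.+2 Y) (schattenS k.+1 X) (schattenS k.+1 (Y^t*)) trmxCK.
Qed.

Lemma size_halves_expn2 (T : Type) j (s : seq T) : size s = (2 ^ j.+1)%N ->
  size (take (2 ^ j) s) = (2 ^ j)%N /\ size (drop (2 ^ j) s) = (2 ^ j)%N.
Proof.
move=> sj; rewrite size_take size_drop sj expnS mul2n -addnn addnK.
by rewrite -[ltnLHS]add0n ltn_add2r expn_gt0.
Qed.

Lemma schatten_word k j (s : seq 'M[C]_n) : size s = (2 ^ j)%N ->
  schatten k (\prod_(A <- s) A) ^+ (2 ^ j) <= \prod_(A <- s) schatten (k + j) A.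
Proof.
elim: j k s => [|j IH] k s sj.
  by case: s sj => [|A [|]] //= _; rewrite !big_cons !big_nil !mulr1 expr1 addn0.
have [size_l size_r] := size_halves_expn2 sj.
rewrite -[s](cat_take_drop (2 ^ j)) !big_cat /= expnS exprM.
apply: (@le_trans _ _ ((schatten k.+1 (\prod_(A <- take (2 ^ j) s) A) *
    schatten k.+1 (\prod_(A <- drop (2 ^ j) s) A)) ^+ (2 ^ j))).
  rewrite ler_pXn2r ?nnegrE ?mulr_ge0 ?exprn_ge0 ?schatten_ge0 ?expn_gt0 //.
  exact: schattenM.
rewrite exprMn addnS -addSn.
by apply: ler_pM; rewrite ?exprn_ge0 ?schatten_ge0 //; exact: IH.
Qed.

Lemma mxtrace_word j (s : seq 'M[C]_n) : size s = (2 ^ j.+1)%N ->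
  `|\tr (\prod_(A <- s) A)| ^+ (2 ^ j.+1) <= \prod_(A <- s) schatten j A.
Proof.
move=> /[dup] sj /size_halves_expn2[size_l size_r].
rewrite -[s](cat_take_drop (2 ^ j)) !big_cat /= expnS exprM.
apply: (@le_trans _ _ ((schatten 0 (\prod_(A <- take (2 ^ j) s) A) *
    schatten 0 (\prod_(A <- drop (2 ^ j) s) A)) ^+ (2 ^ j))).
  rewrite ler_pXn2r ?nnegrE ?mulr_ge0 ?exprn_ge0 ?schatten_ge0 ?expn_gt0 //.
  exact: mxtrace_schatten0.
rewrite exprMn.
by apply: ler_pM; rewrite ?exprn_ge0 ?schatten_ge0 //; exact: schatten_word.
Qed.

Definition schatten_le j (t c : C) A :=
  0 <= c /\ schatten j A <= c ^+ (2 ^ j.+1) * t.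

Lemma schatten_le_trans j t a b A :
  0 <= t -> a <= b -> schatten_le j t a A -> schatten_le j t b A.
Proof.
move=> t0 ab [a0 Aa]; split; first exact: le_trans ab.
apply: le_trans Aa _; apply: ler_wpM2r => //.
by rewrite ler_pXn2r ?nnegrE ?expn_gt0 // (le_trans a0).
Qed.

Lemma mxtrace_word_schatten_le j (t : C) (s : seq ('M[C]_n * C)) : 0 <= t ->
  size s = (2 ^ j.+1)%N -> (forall x, x \in s -> schatten_le j t x.2 x.1) ->
  `|\tr (\prod_(x <- s) x.1)| <= (\prod_(x <- s) x.2) * t.
Proof.
move=> t0 size_s le_s.
have prod_ge0 : 0 <= \prod_(x <- s) x.2.
  by rewrite big_seq; apply: prodr_ge0 => x /le_s[].
rewrite -(@ler_pXn2r _ (2 ^ j.+1)) ?nnegrE ?mulr_ge0 ?expn_gt0 //.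
have := @mxtrace_word j [seq x.1 | x <- s]; rewrite size_map => /(_ size_s).
rewrite !big_map => /le_trans; apply.
have -> : (\prod_(x <- s) x.2 * t) ^+ (2 ^ j.+1) =
    \prod_(x <- s) (x.2 ^+ (2 ^ j.+1) * t).
  by rewrite big_split /= prodrXl big_const_seq count_predT iter_mulr_1 size_s exprMn.
rewrite big_seq [leRHS]big_seq; apply: ler_prod => x xs.
by rewrite schatten_ge0 /=; exact: (le_s x xs).2.
Qed.

Lemma mxtrace_psd_expr_le m (c : C) X Y : psdmx (c *: (X^t* * X) - Y^t* * Y) ->
  \tr ((Y^t* * Y) ^+ (m.*2.+2)) <= c * \tr ((Y^t* * Y) ^+ (m.*2.+1) * (X^t* * X)).
Proof.
set A := Y^t* * Y => XY; have hermA : A^t* = A by exact: trmxC_mulCt.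
have sandwich M : \tr ((Y * A ^+ m) *m M *m (Y * A ^+ m)^t*) = \tr (A ^+ m.*2.+1 * M).
  rewrite mxtrace_mulC trmxC_mul trmxC_exp hermA !mulmxE; congr (\tr _).
  rewrite !mulrA -[_ * Y^t* * Y]mulrA -/A -exprSr -exprD; congr (A ^+ _ * M).
  by rewrite -addnn.
have := psdmx_mxtrace (Y * A ^+ m) XY; rewrite sandwich mulrBr linearB /=.
by rewrite -!mulmxE -scalemxAr linearZ /= !mulmxE -exprSr subr_ge0.
Qed.

Lemma mxtrace_expr_mul_schatten j A B : A^t* = A -> B^t* = B ->
  `|\tr (A ^+ (2 ^ j.+1).-1 * B)| ^+ (2 ^ j.+1) <=
  \tr (A ^+ (2 ^ j.+1)) ^+ (2 ^ j.+1).-1 * \tr (B ^+ (2 ^ j.+1)).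
Proof.
move=> hermA hermB; have := @mxtrace_word j (rcons (nseq (2 ^ j.+1).-1 A) B).
rewrite size_rcons size_nseq prednK ?expn_gt0 // => /(_ erefl).
by rewrite !big_rcons /= !big_nseq !iter_mulr_1 !schatten_herm.
Qed.

Lemma schatten_psd_le j (c : C) X Y : 0 <= c ->
  psdmx (c *: (X^t* * X) - Y^t* * Y) -> schatten j Y <= c ^+ (2 ^ j) * schatten j X.
Proof.
move=> c0 XY; set A := Y^t* * Y; set B := X^t* * X.
case: j => [|j].
  rewrite /schatten !expr1 -/A -/B -subr_ge0.
  by have := psdmx_mxtrace (1%:M : 'M[C]_n) XY; rewrite trmxC1 mulmx1 mul1mx linearB linearZ.
have [hermA hermB] : A^t* = A /\ B^t* = B by rewrite !trmxC_mulCt.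
set m := (2 ^ j.+1)%N; set a := schatten j.+1 Y; set b := schatten j.+1 X.
have a_ge0 : 0 <= a by exact: schatten_ge0.
have m_gt0 : (0 < m)%N by rewrite expn_gt0.
have a_le : a <= c * \tr (A ^+ m.-1 * B).
  have mE : m = (2 ^ j - 1).*2.+2.
    by rewrite /m expnS; have : (0 < 2 ^ j)%N by [rewrite expn_gt0]; lia.
  by rewrite /a /schatten -/m mE; exact: mxtrace_psd_expr_le.
have hoelder := mxtrace_expr_mul_schatten j hermA hermB; rewrite -/m in hoelder.
have [a_eq0|a_neq0] := eqVneq a 0; first by rewrite a_eq0 mulr_ge0 ?exprn_ge0 ?schatten_ge0.
have a_gt0 : 0 < a by rewrite lt_neqAle eq_sym a_neq0.
rewrite -(ler_pM2l (exprn_gt0 m.-1 a_gt0)) -exprSr prednK // mulrCA.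
apply: (@le_trans _ _ ((c * `|\tr (A ^+ m.-1 * B)|) ^+ m)); last first.
  by rewrite exprMn ler_wpM2l ?exprn_ge0.
rewrite ler_pXn2r ?nnegrE ?mulr_ge0 //.
apply: (@le_trans _ _ `|c * \tr (A ^+ m.-1 * B)|).
  by rewrite ger0_norm // (le_trans a_ge0 a_le).
by rewrite normrM (ger0_norm c0).
Qed.

Lemma schatten_mul_opnorm j (c : C) X Y : opnorm_le c (Y^t*) ->
  schatten j (Y * X) <= c ^+ (2 ^ j.+1) * schatten j X.
Proof.
move=> [c0 Yc]; rewrite expnS exprM; apply: schatten_psd_le; first by rewrite exprn_ge0.
move=> v; rewrite quadformB quadformZ subr_ge0 !quadform_mulCt trmxC_mul mulmxA.
exact: Yc.
Qed.

Lemma schatten_leM j (t a c : C) X Y :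
  opnorm_le c (Y^t*) -> schatten_le j t a X -> schatten_le j t (c * a) (Y * X).
Proof.
move=> Yc [a0 Xa]; split; first by rewrite mulr_ge0 // Yc.1.
apply: le_trans (schatten_mul_opnorm _ _ Yc) _.
by rewrite exprMn -mulrA ler_wpM2l // exprn_ge0 // Yc.1.
Qed.

End Schatten.

(** * Second-order expansion of the resolvent *)

Section TelescopedPowers.

Lemma exprn_telescope (T : pzRingType) (A B : T) q :
  B ^+ q = A ^+ q + \sum_(i < q) B ^+ i * (B - A) * A ^+ (q - 1 - i).
Proof.
elim: q => [|q IH]; first by rewrite big_ord0 addr0.
rewrite big_ord_recr /= subSS subn0 subnn expr0 mulr1 exprSr.
have -> : B ^+ q * B = B ^+ q * A + B ^+ q * (B - A) by rewrite -mulrDr addrC subrK.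
rewrite {1}IH mulrDl -exprSr -addrA mulr_suml; congr (_ + (_ + _)).
apply: eq_bigr => i _.
by rewrite -mulrA -exprSr -subnDA add1n subnSK.
Qed.

Lemma mxtrace_exprn_telescope3 (C : comNzRingType) n (A B : 'M[C]_n) q (D := B - A) :
  \tr (B ^+ q) = \tr (A ^+ q) + q%:R * \tr (A ^+ (q - 1) * D) +
    \sum_(i < q) \sum_(k < i) \tr (A ^+ k * D * A ^+ (i - 1 - k) * D * A ^+ (q - 1 - i)) +
    \sum_(i < q) \sum_(k < i) \sum_(l < k)
      \tr (B ^+ l * D * A ^+ (k - 1 - l) * D * A ^+ (i - 1 - k) * D * A ^+ (q - 1 - i)).
Proof.
have first_step : \tr (B ^+ q) = \tr (A ^+ q) + \sum_(i < q) \tr (B ^+ i * D * A ^+ (q - 1 - i)).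
  by rewrite (exprn_telescope A B q) linearD raddf_sum.
have second_step (i : nat) :
    \tr (B ^+ i * D * A ^+ (q - 1 - i)) = \tr (A ^+ i * D * A ^+ (q - 1 - i)) +
    \sum_(k < i) \tr (B ^+ k * D * A ^+ (i - 1 - k) * D * A ^+ (q - 1 - i)).
  by rewrite (exprn_telescope A B i) -/D !mulrDl linearD /= !mulr_suml raddf_sum.
have third_step (i k : nat) :
    \tr (B ^+ k * D * A ^+ (i - 1 - k) * D * A ^+ (q - 1 - i)) =
    \tr (A ^+ k * D * A ^+ (i - 1 - k) * D * A ^+ (q - 1 - i)) +
    \sum_(l < k) \tr (B ^+ l * D * A ^+ (k - 1 - l) * D * A ^+ (i - 1 - k) * D * A ^+ (q - 1 - i)).
  by rewrite (exprn_telescope A B k) -/D !mulrDl linearD /= !mulr_suml raddf_sum.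
have first_order : \sum_(i < q) \tr (A ^+ i * D * A ^+ (q - 1 - i)) = q%:R * \tr (A ^+ (q - 1) * D).
  rewrite (eq_bigr (fun=> \tr (A ^+ (q - 1) * D))) ?sumr_const ?card_ord ?mulr_natl // => i _.
  have := ltn_ord i; rewrite [LHS]mxtrace_mulC mulmxE mulrA -exprD => iq.
  by have -> : (q - 1 - i + i = q - 1)%N by lia.
rewrite first_step (eq_bigr _ (fun (i : 'I_q) _ => second_step i)) big_split /= first_order.
rewrite (eq_bigr _ (fun (i : 'I_q) _ => eq_bigr _ (fun (k : 'I_i) _ => third_step i k))).
by rewrite (eq_bigr _ (fun (i : 'I_q) _ => big_split _ _ _ _ _)) big_split /= !addrA.
Qed.

Lemma ler_norm_sum_ord (C : numDomainType) q Q (F : 'I_q -> C) (c : C) : 0 <= c -> (q <= Q)%N ->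
  (forall i, `|F i| <= c) -> `|\sum_(i < q) F i| <= Q%:R * c.
Proof.
move=> c0 qQ Fc; apply: le_trans (ler_norm_sum _ _ _) _.
apply: (@le_trans _ _ (\sum_(i < q) c)); first by apply: ler_sum => i _; exact: Fc.
by rewrite sumr_const card_ord -[leLHS]mulr_natl ler_wpM2r // ler_nat.
Qed.

End TelescopedPowers.

Section ResolventExpansion.
Variables (C : numClosedFieldType) (n : nat).

(* Second-order expansion of [\tr (B ^+ q)] in [W], for [B] as in the resolvent
   identity [B = A + B * W * A]. *)
Definition resolvent_order2 (A W : 'M[C]_n) q : C :=
  \tr (A ^+ q) + q%:R * \tr (A ^+ q.+1 * W) + q%:R * \tr (A ^+ q.+1 * W * A * W) +
  \sum_(i < q) \sum_(k < i) \tr (A ^+ (q + 1 - i + k) * W * A ^+ (i + 1 - k) * W).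

Definition expansion_const (R : pzSemiRingType) (q : nat) : R :=
  q%:R + 2 * q%:R ^+ 2 + 2 ^+ q * q%:R ^+ 3.

Variables (A B W : 'M[C]_n) (K kap : C).
Hypotheses (hermA : A^t* = A) (hermB : B^t* = B) (hermW : W^t* = W).
Hypothesis resolvent_id : B = A + B * W * A.
Hypotheses (opA : opnorm_le K A) (opB : opnorm_le (2 * K) B) (opW : opnorm_le kap W).
Let eps := 2 * K * kap.
Hypothesis eps_le1 : eps <= 1.

Let K_ge0 : 0 <= K. Proof. by case: opA. Qed.
Let kap_ge0 : 0 <= kap. Proof. by case: opW. Qed.
Let eps_ge0 : 0 <= eps. Proof. by rewrite !mulr_ge0. Qed.
Let Kkap_le : K * kap <= eps.
Proof. by rewrite /eps -mulrA ler_peMl ?mulr_ge0 ?ler1n. Qed.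

Let D := B - A.
Let D1 := A * W * A.
Let D2 := D - D1.

Let DE : D = B * W * A. Proof. by rewrite /D {1}resolvent_id addrC addKr. Qed.

Let D2E : D2 = B * W * A * W * A.
Proof. by rewrite /D2 DE /D1 -!mulrA -mulrBl -/D DE !mulrA. Qed.

Lemma opnorm_le_third_order : opnorm_le (eps ^+ 3) (B * W * A * W * A * W).
Proof.
have := opnorm_leM (opnorm_leM (opnorm_leM (opnorm_leM (opnorm_leM opB opW) opA) opW) opA) opW.
apply: opnorm_le_trans.
have -> : 2 * K * kap * K * kap * K * kap = eps * ((K * kap) * (K * kap)) by rewrite /eps; ring.
have -> : eps ^+ 3 = eps * (eps * eps) by ring.
by apply: ler_wpM2l => //; apply: ler_pM; rewrite ?mulr_ge0.
Qed.

Lemma mxtrace_resolvent_difference q : (0 < q)%N ->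
  \tr (A ^+ (q - 1) * D) = \tr (A ^+ q.+1 * W) + \tr (A ^+ q.+1 * W * A * W) +
     \tr (A ^+ q * (B * W * A * W * A * W)).
Proof.
move=> q0; have -> : D = A * W * A + A * W * A * W * A + B * W * A * W * A * W * A.
  rewrite -addrA -[_ + B * W * A * W * A * W * A](_ : B * W * A * W * A = _).
    by rewrite -D2E /D2 /D1 addrC subrK.
  by rewrite {1}resolvent_id !mulrDl.
have cycle M : \tr (A ^+ (q - 1) * (M * A)) = \tr (A ^+ q * M).
  by rewrite mulrA mxtrace_mulrC mulrA -exprS subn1 prednK.
by rewrite !mulrDr !linearD /= !cycle !mulrA -!exprSr.
Qed.

Lemma resolvent_expansion_trace : `|\tr B - resolvent_order2 A W 1| <= eps ^+ 3 * K * n%:R.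
Proof.
have := @mxtrace_resolvent_difference 1 isT; rewrite subnn expr0 mul1r expr1 => trD.
rewrite /resolvent_order2 big_ord_recl !big_ord0 !addr0 !mul1r expr1.
have -> : \tr B = \tr A + \tr D by rewrite -linearD /= /D addrC subrK.
rewrite trD [X in `|X|](_ : _ = \tr (A * (B * W * A * W * A * W))); last by ring.
apply: opnorm_le_mxtrace; rewrite mulrC.
exact: opnorm_leM opnorm_le_third_order.
Qed.

Section DyadicPower.
Variable j : nat.
Let Q := (2 ^ j.+1)%N.
Let t := \tr (A ^+ Q).

Let tE : t = schatten j A. Proof. by rewrite schatten_herm. Qed.
Let t_ge0 : 0 <= t. Proof. by rewrite tE schatten_ge0. Qed.
Let Q_gt0 : (0 < Q)%N. Proof. by rewrite expn_gt0. Qed.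

Let schatten_le_A : schatten_le j t 1 A.
Proof. by split; rewrite // expr1n mul1r tE. Qed.

Let schatten_le_mulA c (M : 'M[C]_n) : opnorm_le c (M^t*) -> schatten_le j t c (M * A).
Proof. by move=> /schatten_leM/(_ schatten_le_A); rewrite mulr1. Qed.

Let opnorm_le_WB : opnorm_le eps (W * B).
Proof. by have := opnorm_leM opW opB; rewrite mulrC. Qed.

Let schatten_le_D : schatten_le j t eps D.
Proof. by rewrite DE; apply: schatten_le_mulA; rewrite trmxC_mul hermW hermB. Qed.

Let schatten_le_B : schatten_le j t 2 B.
Proof.
rewrite resolvent_id -[X in X + _]mul1r -mulrDl.
apply: (schatten_le_trans t_ge0 (_ : 1 + eps <= 2)); first by rewrite -lerBrDl -[2]/(1 + 1) addrK.
apply: schatten_le_mulA; rewrite trmxC_add trmxC1 trmxC_mul hermW hermB.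
by apply: opnorm_leD => //; exact: opnorm_le1.
Qed.

Let schatten_le_D1 : schatten_le j t eps D1.
Proof.
apply: schatten_le_mulA; rewrite trmxC_mul hermW hermA.
by have := opnorm_leM opW opA; apply: opnorm_le_trans; rewrite mulrC.
Qed.

Let schatten_le_D2 : schatten_le j t (eps ^+ 2) D2.
Proof.
rewrite D2E; apply: schatten_le_mulA; rewrite !trmxC_mul hermW hermB hermA.
have := opnorm_leM opW (opnorm_leM opA opnorm_le_WB); apply: opnorm_le_trans.
by rewrite mulrA [kap * K]mulrC expr2 ler_wpM2r.
Qed.

Let mxtrace_word2_le X Y x y a b c : schatten_le j t x X -> schatten_le j t y Y ->
  (a + b + c + 2 = Q)%N -> `|\tr (A ^+ a * X * A ^+ b * Y * A ^+ c)| <= x * y * t.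
Proof.
move=> le_X le_Y length.
pose s := nseq a (A, 1 : C) ++ (X, x) :: nseq b (A, 1 : C) ++ (Y, y) :: nseq c (A, 1 : C).
have size_s : size s = Q.
  by rewrite /s !(size_cat, size_nseq) /= !(size_cat, size_nseq) /= size_nseq; lia.
have le_s z : z \in s -> schatten_le j t z.2 z.1.
  rewrite !(mem_cat, inE, mem_nseq).
  by move=> /orP[/andP[_ /eqP->]|/orP[/eqP->|/orP[/andP[_ /eqP->]|/orP[/eqP->|/andP[_ /eqP->]]]]].
have := mxtrace_word_schatten_le t_ge0 size_s le_s.
rewrite /s; do ?rewrite !(big_cat, big_cons) /=; rewrite !big_nseq !iter_mulr_1.
by rewrite !expr1n !mul1r mulr1 !mulrA.
Qed.

Let mxtrace_third_order_le a b c d : (a + b + c + d + 3 = Q)%N ->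
  `|\tr (B ^+ a * D * A ^+ b * D * A ^+ c * D * A ^+ d)| <= 2 ^+ Q * eps ^+ 3 * t.
Proof.
move=> length.
pose s := nseq a (B, 2 : C) ++ (D, eps) :: nseq b (A, 1 : C) ++ (D, eps) :: nseq c (A, 1 : C)
  ++ (D, eps) :: nseq d (A, 1 : C).
have size_s : size s = Q.
  rewrite /s !(size_cat, size_nseq) /= !(size_cat, size_nseq) /= !(size_cat, size_nseq) /=.
  by rewrite size_nseq; lia.
have le_s z : z \in s -> schatten_le j t z.2 z.1.
  rewrite !(mem_cat, inE, mem_nseq).
  by move=> /orP[/andP[_ /eqP->]|/orP[/eqP->|/orP[/andP[_ /eqP->]|/orP[/eqP->|
      /orP[/andP[_ /eqP->]|/orP[/eqP->|/andP[_ /eqP->]]]]]]].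
have := mxtrace_word_schatten_le t_ge0 size_s le_s.
rewrite /s; do ?rewrite !(big_cat, big_cons) /=; rewrite !big_nseq !iter_mulr_1.
rewrite !expr1n !mul1r mulr1 !mulrA => /le_trans; apply; apply: ler_wpM2r => //.
rewrite [leLHS](_ : _ = 2 ^+ a * eps ^+ 3); last by rewrite /eps /=; ring.
rewrite [leRHS](_ : _ = 2 ^+ Q * eps ^+ 3); last by rewrite /eps; ring.
apply: ler_wpM2r; first by rewrite exprn_ge0.
by rewrite ler_weXn2l ?ler1n //; lia.
Qed.

Let mxtrace_D1_word i k : (k < i)%N -> (i < Q)%N ->
  \tr (A ^+ k * D1 * A ^+ (i - 1 - k) * D1 * A ^+ (Q - 1 - i)) =
  \tr (A ^+ (Q + 1 - i + k) * W * A ^+ (i + 1 - k) * W).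
Proof.
move=> ki iQ.
have -> : A ^+ k * D1 * A ^+ (i - 1 - k) * D1 * A ^+ (Q - 1 - i) =
    A ^+ (k + 1) * W * A ^+ (i + 1 - k) * W * A ^+ (Q - 1 - i + 1).
  have -> : (i + 1 - k = 1 + (i - 1 - k) + 1)%N by lia.
  rewrite [X in X * W * _ * _ * _]exprD [_ ^+ (Q - 1 - i + 1)]exprD.
  rewrite [X in _ * X * W * _]exprD [X in _ * (X * _) * W * _]exprD !expr1.
  by rewrite -[A ^+ (Q - 1 - i) * A]exprSr exprS /D1 !mulrA.
rewrite [LHS]mxtrace_mulrC !mulrA -exprD.
by have -> : (Q - 1 - i + 1 + (k + 1) = Q + 1 - i + k)%N by lia.
Qed.

Let mxtrace_second_order_le i k : (k < i)%N -> (i < Q)%N ->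
  `|\tr (A ^+ k * D * A ^+ (i - 1 - k) * D * A ^+ (Q - 1 - i)) -
    \tr (A ^+ (Q + 1 - i + k) * W * A ^+ (i + 1 - k) * W)| <= 2 * eps ^+ 3 * t.
Proof.
move=> ki iQ; have length : (k + (i - 1 - k) + (Q - 1 - i) + 2 = Q)%N by lia.
rewrite -mxtrace_D1_word // -linearB /=.
have subr_words (X Y P1 P2 P3 : 'M[C]_n) : P1 * X * P2 * X * P3 - P1 * Y * P2 * Y * P3 =
    P1 * (X - Y) * P2 * X * P3 + P1 * Y * P2 * (X - Y) * P3.
  by rewrite !(mulrBr, mulrBl) addrA subrK.
rewrite subr_words -/D2 linearD /=; apply: le_trans (ler_normD _ _) _.
rewrite [leRHS](_ : _ = eps ^+ 3 * t + eps ^+ 3 * t); last by ring.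
apply: lerD.
  by apply: le_trans (mxtrace_word2_le schatten_le_D2 schatten_le_D length) _; rewrite -exprSr.
by apply: le_trans (mxtrace_word2_le schatten_le_D1 schatten_le_D2 length) _; rewrite -exprS.
Qed.

Let mxtrace_first_order_le :
  `|\tr (A ^+ Q * (B * W * A * W * A * W))| <= eps ^+ 3 * t.
Proof.
have QE : A ^+ Q = A ^+ (2 ^ j) * A ^+ (2 ^ j) by rewrite -exprD addnn -mul2n -expnS.
rewrite QE -mulrA mxtrace_mulrC.
have := opnorm_le_mxtrace_mulCt (A ^+ (2 ^ j)) opnorm_le_third_order.
by rewrite trmxC_exp hermA !mulmxE -QE.
Qed.

Lemma resolvent_expansion_dyadic :
  `|\tr (B ^+ Q) - resolvent_order2 A W Q| <= expansion_const C Q * eps ^+ 3 * t.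
Proof.
have -> : \tr (B ^+ Q) - resolvent_order2 A W Q =
   Q%:R * \tr (A ^+ Q * (B * W * A * W * A * W)) +
   \sum_(i < Q) \sum_(k < i) (\tr (A ^+ k * D * A ^+ (i - 1 - k) * D * A ^+ (Q - 1 - i)) -
      \tr (A ^+ (Q + 1 - i + k) * W * A ^+ (i + 1 - k) * W)) +
   \sum_(i < Q) \sum_(k < i) \sum_(l < k)
     \tr (B ^+ l * D * A ^+ (k - 1 - l) * D * A ^+ (i - 1 - k) * D * A ^+ (Q - 1 - i)).
  rewrite (mxtrace_exprn_telescope3 A B Q) -/D mxtrace_resolvent_difference //.
  rewrite (eq_bigr (P := xpredT) (F1 := fun i : 'I_Q => \sum_(k < i) (_ - _)) _
    (fun (i : 'I_Q) _ => sumrB _ _ _ _)) sumrB /=.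
  by rewrite /resolvent_order2 -/t; ring.
have third_ge0 : 0 <= 2 ^+ Q * eps ^+ 3 * t :> C by rewrite !mulr_ge0 ?exprn_ge0.
apply: le_trans (ler_normD _ _) _; apply: le_trans (lerD (ler_normD _ _) (lexx _)) _.
rewrite /expansion_const ![in leRHS]mulrDl; apply: lerD; first apply: lerD.
- by rewrite normrM normr_nat -[leRHS]mulrA; apply: ler_wpM2l.
- rewrite [leRHS](_ : _ = Q%:R * (Q%:R * (2 * eps ^+ 3 * t))); last by ring.
  apply: ler_norm_sum_ord => // [|i]; first by rewrite !mulr_ge0 ?exprn_ge0.
  have iQ : (i < Q)%N := ltn_ord i.
  apply: ler_norm_sum_ord => [||k]; [by rewrite !mulr_ge0 ?exprn_ge0 | exact: ltnW |].
  exact: mxtrace_second_order_le.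
- rewrite [leRHS](_ : _ = Q%:R * (Q%:R * (Q%:R * (2 ^+ Q * eps ^+ 3 * t)))); last by ring.
  apply: ler_norm_sum_ord => // [|i]; first by rewrite !mulr_ge0 ?exprn_ge0.
  have iQ : (i < Q)%N := ltn_ord i.
  apply: ler_norm_sum_ord => [||k]; [by rewrite mulr_ge0 | exact: ltnW |].
  have ki : (k < i)%N := ltn_ord k.
  apply: ler_norm_sum_ord => // [|l]; first by apply: ltnW; apply: ltn_trans iQ.
  have lk : (l < k)%N := ltn_ord l.
  by apply: mxtrace_third_order_le; lia.
Qed.

End DyadicPower.
End ResolventExpansion.

(** * Spectral decompositions *)

Section RealComplex.
Variable R : rcfType.
Implicit Types (x b : R) (z : R[i]).

Lemma conjC_real_complex x : Num.conj (x%:C : R[i]) = x%:C.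
Proof. exact: conjc_real. Qed.

Lemma normC_real_complex x : `|x%:C : R[i]| = `|x|%:C.
Proof. by rewrite normc_def /= expr0n addr0 sqrtr_sqr. Qed.

Lemma complex_Im0 z : complex.Im z = 0 -> z = (complex.Re z)%:C.
Proof. by case: z => a b /= ->. Qed.

Lemma ler_norm_Re z b : `|z| <= b%:C -> `|complex.Re z| <= b.
Proof. by move=> zb; rewrite -lecR; apply: le_trans zb; exact: normc_ge_Re. Qed.

Lemma trmxC_real_scalar n x : ((x%:C)%:M : 'M[R[i]]_n)^t* = (x%:C)%:M.
Proof. by rewrite tr_scalar_mx map_scalar_mx /= conjC_real_complex. Qed.

End RealComplex.

Section SpectralDecomposition.
Variables (C : numClosedFieldType) (n : nat).
Implicit Types (S P : 'M[C]_n) (D : 'rV[C]_n).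

Definition spectral_dec S P D :=
  [/\ P *m P^t* = 1%:M, P^t* *m P = 1%:M & S = P^t* *m diag_mx D *m P].

Section Decomposition.
Variables (S P : 'M[C]_n) (D : 'rV[C]_n).
Hypothesis decS : spectral_dec S P D.

Let PPt : P *m P^t* = 1%:M. Proof. by case: decS. Qed.
Let PtP : P^t* *m P = 1%:M. Proof. by case: decS. Qed.
Let SE : S = P^t* *m diag_mx D *m P. Proof. by case: decS. Qed.

Lemma spectral_dec_sqnorm (v : 'rV_n) : sqnorm v = sqnorm (v *m P^t*).
Proof. by rewrite /sqnorm trmxC_mul trmxCK -mulmxA (mulmxA _ P) PtP mul1mx. Qed.

Lemma spectral_dec_mulmx (v : 'rV_n) i : (v *m S *m P^t*) 0 i = D 0 i * (v *m P^t*) 0 i.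
Proof. by rewrite SE -!mulmxA PPt mulmx1 mulmxA mul_mx_diag mxE mulrC. Qed.

Lemma spectral_dec_eigenvalue i : eigenvalue S (D 0 i).
Proof.
apply/eigenvalueP; exists (row i P).
  rewrite SE !mulmxA -!row_mul PPt mul1mx.
  by apply/rowP => k; rewrite mul_diag_mx !mxE.
apply/eqP => Pi0; have := congr1 (fun M : 'M[C]_n => M i i) PPt.
rewrite mxE big1 ?mxE ?eqxx => [/eqP|k _]; first by rewrite eq_sym oner_eq0.
by have /rowP/(_ k) := Pi0; rewrite !mxE => ->; rewrite mul0r.
Qed.

Lemma spectral_dec_eigenvalueP (x : C) : eigenvalue S x -> exists i, x = D 0 i.
Proof.
move=> /eigenvalueP[v vS v0].
have vP0 : v *m P^t* != 0.
  by apply: contra v0 => /eqP vP0; rewrite -[v]mulmx1 -PtP mulmxA vP0 mul0mx eqxx.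
have [i vPi0] : exists i, (v *m P^t*) 0 i != 0.
  apply/existsP; apply: contraNT vP0; rewrite negb_exists => /forallP vP0.
  by apply/eqP/rowP => i; have := vP0 i; rewrite negbK => /eqP ->; rewrite mxE.
by exists i; have := spectral_dec_mulmx v i; rewrite vS -scalemxAl mxE => /(mulIf _)->.
Qed.

Lemma spectral_dec_quadform (v : 'rV_n) :
  quadform S v = \sum_i D 0 i * `|(v *m P^t*) 0 i| ^+ 2.
Proof.
rewrite /quadform -[v in v^t*]mulmx1 -PtP (mulmxA v) trmxC_mul mulmxA mxE.
by apply: eq_bigr => i _; rewrite spectral_dec_mulmx !mxE normCK mulrA.
Qed.

Lemma spectral_dec_exprn q : spectral_dec (S ^+ q) P (\row_i (D 0 i ^+ q)).
Proof.
split=> //; elim: q => [|q IH].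
  rewrite expr0 (_ : diag_mx _ = 1%:M) ?mulmx1 ?PtP //.
  by apply/matrixP => i j; rewrite !mxE expr0.
rewrite exprS IH {1}SE -mulmxE -!mulmxA; congr (_ *m _).
rewrite (mulmxA P) PPt mul1mx mulmxA mul_diag_mx; congr (_ *m _).
apply/matrixP => i j; rewrite !mxE exprS.
by case: eqP => _; rewrite ?mulr1n ?mulr0n ?mulr0.
Qed.

Lemma spectral_dec_mxtrace : \tr S = \sum_i D 0 i.
Proof. by rewrite SE mxtrace_mulC mulmxA PPt mul1mx mxtrace_diag. Qed.

Lemma spectral_dec_shift (u : C) : spectral_dec (u%:M - S) P (\row_i (u - D 0 i)).
Proof.
split=> //.
have -> : u%:M = P^t* *m diag_mx (const_mx u) *m P.
  by rewrite diag_const_mx mul_mx_scalar -scalemxAl PtP scalemx1.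
rewrite {1}SE -mulmxBl -mulmxBr; congr (_ *m _ *m _); apply/matrixP => i j.
by rewrite !mxE mulrnBl.
Qed.

Lemma spectral_dec_invmx : (forall i, D 0 i != 0) ->
  (S \in unitmx) /\ spectral_dec (invmx S) P (\row_i (D 0 i)^-1).
Proof.
move=> D0; pose M := P^t* *m diag_mx (\row_i (D 0 i)^-1) *m P.
have SM1 : S *m M = 1%:M.
  rewrite SE /M -!mulmxA (mulmxA P) PPt mul1mx (mulmxA (diag_mx _)) mul_diag_mx.
  rewrite [X in X *m P](_ : _ = 1%:M) ?mul1mx ?PtP //.
  apply/matrixP => i j; rewrite !mxE; case: eqP => [->|_]; last by rewrite !mulr0n mulr0.
  by rewrite !mulr1n mulfV.
have unitS := (mulmx1_unit SM1).1; split=> //.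
by rewrite (_ : invmx S = M) // -[LHS]mulmx1 -SM1 mulmxA mulVmx // mul1mx.
Qed.

End Decomposition.

Lemma spectral_dec_resolvent S P D (u : C) : spectral_dec S P D -> (forall i, u != D 0 i) ->
  (u%:M - S \in unitmx) /\ spectral_dec (invmx (u%:M - S)) P (\row_i (u - D 0 i)^-1).
Proof.
move=> decS uD; have := spectral_dec_invmx (spectral_dec_shift decS u).
rewrite (_ : \row_i _ = \row_i (u - D 0 i)^-1); last by apply/rowP => i; rewrite !mxE.
by apply => i; rewrite mxE subr_eq0.
Qed.

Lemma hermitian_spectral_dec S : S^t* = S ->
  exists P D, spectral_dec S P D /\ forall i, D 0 i \is Num.real.
Proof.
move=> hermS; have hS : S \is hermsymmx by apply/is_hermitianmxP; rewrite expr0 scale1r hermS.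
have /orthomx_spectralP SE := hermitian_normalmx hS.
have realD := hermitian_spectral_diag_real hS.
have unitP := spectral_unitarymx S.
exists (spectralmx S), (spectral_diag S); split; last by move=> i; exact: (mxOverP realD).
have PPt : spectralmx S *m (spectralmx S)^t* = 1%:M by apply/unitarymxP.
by split; [exact: PPt | exact: mulmx1C | rewrite -(invmx_unitary unitP) [LHS]SE].
Qed.

End SpectralDecomposition.

Section RealSpectralDecomposition.
Variables (R : rcfType) (n : nat).
Local Notation C := R[i].
Implicit Types (S P : 'M[C]_n) (l : 'I_n -> R).

Definition real_spectral_dec S P l := spectral_dec S P (\row_i (l i)%:C).

Lemma hermitian_real_spectral_dec S : S^t* = S -> exists P l, real_spectral_dec S P l.
Proof.
move=> /hermitian_spectral_dec[P [D [decS realD]]].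
exists P, (fun i => complex.Re (D 0 i)); rewrite /real_spectral_dec.
by rewrite (_ : \row_i _ = D) //; apply/rowP => i; rewrite mxE RRe_real.
Qed.

Lemma real_spectral_dec_hermitian S P l : real_spectral_dec S P l -> S^t* = S.
Proof.
move=> [_ _ ->]; rewrite !trmxC_mul trmxCK mulmxA.
suff -> : (diag_mx (\row_i (l i)%:C))^t* = diag_mx (\row_i (l i)%:C) by [].
apply/matrixP => i j; rewrite !mxE eq_sym; case: eqP => [->|_].
  by rewrite !mulr1n conjC_real_complex.
by rewrite !mulr0n conjC0.
Qed.

Section Decomposition.
Variables (S P : 'M[C]_n) (l : 'I_n -> R).
Hypothesis decS : real_spectral_dec S P l.

Lemma real_spectral_dec_eigenvalue i : eigenvalue S (l i)%:C.
Proof. by have := spectral_dec_eigenvalue decS i; rewrite mxE. Qed.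

Lemma real_spectral_dec_eigenvalueP (x : C) : eigenvalue S x -> exists i, x = (l i)%:C.
Proof. by move=> /(spectral_dec_eigenvalueP decS)[i ->]; exists i; rewrite mxE. Qed.

Lemma real_spectral_dec_opnorm_le (c : R) :
  0 <= c -> (forall i, `|l i| <= c) -> opnorm_le c%:C S.
Proof.
move=> c0 lc; split=> [|v]; first by rewrite ler0c.
rewrite (spectral_dec_sqnorm decS) (spectral_dec_sqnorm decS v) !sqnormE mulr_sumr.
apply: ler_sum => i _.
rewrite (spectral_dec_mulmx decS) mxE normrM exprMn ler_wpM2r ?exprn_ge0 //.
by rewrite normC_real_complex ler_pXn2r ?nnegrE ?ler0c // lecR.
Qed.

Lemma real_spectral_dec_quadform_ge (c : R) (v : 'rV_n) :
  (forall i, c <= l i) -> c%:C * sqnorm v <= quadform S v.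
Proof.
move=> cl; rewrite (spectral_dec_quadform decS) (spectral_dec_sqnorm decS) sqnormE mulr_sumr.
by apply: ler_sum => i _; rewrite [(\row_i _) 0 i]mxE ler_wpM2r ?exprn_ge0 // lecR.
Qed.

Lemma real_spectral_dec_mxtrace_exprn q : \tr (S ^+ q) = (\sum_i l i ^+ q)%:C.
Proof.
rewrite (spectral_dec_mxtrace (spectral_dec_exprn decS q)) rmorph_sum.
by apply: eq_bigr => i _; rewrite !mxE rmorphXn.
Qed.

Lemma real_spectral_dec_shift (u : R) : real_spectral_dec (u%:C%:M - S) P (fun i => u - l i).
Proof.
have rowE : \row_i (u - l i)%:C = \row_i (u%:C - (\row_i (l i)%:C) 0 i).
  by apply/rowP => i; rewrite !mxE rmorphB.
by rewrite /real_spectral_dec rowE; exact: spectral_dec_shift decS u%:C.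
Qed.

Lemma real_spectral_dec_resolvent (u : R) : (forall i, 0 < u - l i) ->
  (u%:C%:M - S \in unitmx) /\
  real_spectral_dec (invmx (u%:C%:M - S)) P (fun i => (u - l i)^-1).
Proof.
move=> ul.
have rowE : \row_i ((u - l i)^-1)%:C = \row_i (u%:C - (\row_i (l i)%:C) 0 i)^-1.
  by apply/rowP => i; rewrite !mxE fmorphV rmorphB.
rewrite /real_spectral_dec rowE; apply: (spectral_dec_resolvent decS) => i.
by rewrite mxE; apply: contraTneq (ul i) => /complexI ->; rewrite subrr ltxx.
Qed.

End Decomposition.

Lemma resolvent_opnorm_le S P l (u K : R) : real_spectral_dec S P l -> 0 <= K ->
  (forall i, 0 < u - l i) -> (forall i, (u - l i)^-1 <= K) ->
  opnorm_le K%:C (invmx (u%:C%:M - S)).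
Proof.
move=> decS K0 ul lK; have [_ decA] := real_spectral_dec_resolvent decS ul.
apply: (real_spectral_dec_opnorm_le decA K0) => i.
by rewrite ger0_norm // invr_ge0 ltW.
Qed.

Lemma invmx_resolvent_identity (M N : 'M[C]_n) : M \in unitmx -> N \in unitmx ->
  invmx N = invmx M + invmx N * (M - N) * invmx M.
Proof.
move=> unitM unitN; rewrite -!mulmxE mulmxBr mulmxBl mulVmx // mul1mx -mulmxA mulmxV //.
by rewrite mulmx1 [RHS]addrC subrK.
Qed.

Lemma quadform_perturb_ge (M W : 'M[C]_n) (c kap : R) (v : 'rV_n) : W^t* = W ->
  opnorm_le kap%:C W -> c%:C * sqnorm v <= quadform M v ->
  (c - kap)%:C * sqnorm v <= quadform (M - W) v.
Proof.
move=> hermW opW Mc; rewrite quadformB rmorphB mulrBl lerB //.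
apply: le_trans (opnorm_le_quadform _ opW).
by rewrite real_ler_norm // quadform_real.
Qed.

Lemma real_spectral_dec_shift_ge S P l (u c : R) : real_spectral_dec S P l ->
  (forall v, c%:C * sqnorm v <= quadform (u%:C%:M - S) v) -> forall i, c <= u - l i.
Proof.
move=> decS quad_ge i; have /eigenvalueP[v vS v0] := real_spectral_dec_eigenvalue decS i.
have v_gt0 : 0 < sqnorm v.
  rewrite lt_neqAle sqnorm_ge0 andbT eq_sym; apply: contra v0.
  by move=> /eqP/sqnorm_eq0 ->.
have := quad_ge v; rewrite quadformB quadform_scalar {1}/quadform vS -scalemxAl mxE.
by rewrite -mulrBl -rmorphB ler_pM2r // lecR.
Qed.

Lemma resolvent_perturbation (S W S' P : 'M[C]_n) l (u u' K kap : R) :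
  real_spectral_dec S P l -> (forall i, 0 < u - l i) -> (forall i, (u - l i)^-1 <= K) ->
  0 < K -> W^t* = W -> opnorm_le kap%:C W -> 2 * K * kap <= 1 ->
  u'%:C%:M - S' = u%:C%:M - S - W ->
  let A := invmx (u%:C%:M - S) in let B := invmx (u'%:C%:M - S') in
  [/\ exists P' l', real_spectral_dec S' P' l' /\ (forall i, 0 < u' - l' i),
      B = A + B * W * A, opnorm_le K%:C A & opnorm_le (2 * K)%:C B].
Proof.
move=> decS ul lK K0 hermW opW Kkap shiftE A B.
have [unitA decA] := real_spectral_dec_resolvent decS ul.
have hermS' : S'^t* = S'.
  have -> : S' = u'%:C%:M - (u%:C%:M - S - W) by rewrite -shiftE subKr.
  by rewrite !trmxC_sub !trmxC_real_scalar (real_spectral_dec_hermitian decS) hermW.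
have [P' [l' decS']] := hermitian_real_spectral_dec hermS'.
have K_ge0 := ltW K0; have twoK_gt0 : 0 < 2 * K by rewrite mulr_gt0.
have half_gap : (2 * K)^-1 <= K^-1 - kap.
  rewrite invfM lerBrDr -lerBrDl -[X in _ <= X - _]mul1r -mulrBl.
  rewrite (_ : 1 - 2^-1 = 2^-1); last by field.
  by rewrite -invfM -[leRHS]mul1r ler_pdivlMr // mulrC.
have l'_gap i : (2 * K)^-1 <= u' - l' i.
  apply: le_trans half_gap _; apply: (real_spectral_dec_shift_ge decS') => v.
  rewrite shiftE; apply: quadform_perturb_ge => //.
  apply: (real_spectral_dec_quadform_ge (real_spectral_dec_shift decS u)) => k.
  by rewrite -[leRHS]invrK lef_pV2 ?posrE ?invr_gt0.
have ul' i : 0 < u' - l' i by apply: lt_le_trans (l'_gap i); rewrite invr_gt0.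
have [unitB _] := real_spectral_dec_resolvent decS' ul'.
split; first by exists P', l'.
- have -> : W = (u%:C%:M - S) - (u'%:C%:M - S') by rewrite shiftE opprB addrC subrK.
  exact: invmx_resolvent_identity.
- exact: (resolvent_opnorm_le decS).
- apply: (resolvent_opnorm_le decS') => // [|i]; first exact: ltW.
  by rewrite -[leRHS]invrK lef_pV2 ?posrE ?invr_gt0.
Qed.

End RealSpectralDecomposition.

(** * Independence and integration *)

Lemma independent_sigma_algebra {R : realType} {d : measure_display} {T : measurableType d}
    (P : probability T R) (G : set (set T)) (A B : set T) :
  setI_closed G -> G setT -> G `<=` measurable -> measurable B ->
  (forall C, G C -> P (C `&` B) = P C * P B)%E -> <<s G >> A -> (P (A `&` B) = P A * P B)%E.
Proof.
move=> GI GT Gm mB GB sA; have PB_ge0 : 0 <= fine (P B) by rewrite fine_ge0.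
pose m2 : {measure set T -> \bar R} := mscale (NngNum PB_ge0) P.
pose m1 : {measure set T -> \bar R} := mrestr P mB.
have m2E C : (m2 C = P C * P B)%E.
  by rewrite /m2 /= /mscale /= fineK ?fin_num_measure // muleC.
have m1E C : m1 C = P (C `&` B) by [].
have cover : \bigcup_(k : nat) [set: T] = setT by rewrite bigcup_const //; exists 0%N.
have finite (k : nat) : (m1 [set: T] < +oo)%E by rewrite m1E setTI ltey_eq fin_num_measure.
have agree C : G C -> m1 C = m2 C by move=> GC; rewrite m1E m2E GB.
rewrite -m1E -m2E.
exact: (g_sigma_algebra_measure_unique _ Gm (fun=> setT) (fun=> GT) cover m1 m2 GI agree finite).
Qed.

Section CoordinateSigmaAlgebra.
Context {R : realType} {dT dE : measure_display}.
Context {T : measurableType dT} {E : measurableType dE}.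
Variables (P : probability T R) (I : finType) (X : I -> T -> E).

Definition cylinders (J : {set I}) : set (set T) :=
  [set A | exists2 B : I -> set E, (forall i, measurable (B i)) &
     A = \bigcap_(i in [set` J]) (X i @^-1` B i)].

Lemma cylinders_setI J : setI_closed (cylinders J).
Proof.
move=> _ _ [B mB ->] [B' mB' ->]; exists (fun i => B i `&` B' i).
  by move=> i; exact: measurableI.
by rewrite -bigcapI; apply: eq_bigcapr => i _; rewrite preimage_setI.
Qed.

Lemma cylinders_setT J : cylinders J setT.
Proof.
exists (fun=> setT); first by move=> i; exact: measurableT.
by apply/seteqP; split=> // x _ i _.
Qed.

Definition coord_sigma (J : {set I}) := g_sigma_algebraType (cylinders J).

Definition to_coord_sigma (J : {set I}) : T -> coord_sigma J := id.

Definition coord_measurable (J : {set I}) (f : T -> R) :=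
  measurable_fun setT (f : coord_sigma J -> R).

Lemma measurable_coord (J : {set I}) i :
  i \in J -> measurable_fun [set: coord_sigma J] (X i : coord_sigma J -> E).
Proof.
move=> iJ _ A mA; rewrite setTI; apply: sub_sigma_algebra.
exists (fun j => if j == i then A else setT); first by move=> j; case: ifP.
apply/seteqP; split=> [w Aw j jJ|w /(_ i iJ)] /=; last by rewrite eqxx.
by case: eqP => [->|].
Qed.

Hypothesis mX : forall i, measurable_fun [set: T] (X i).

Lemma cylinders_measurable J : cylinders J `<=` measurable.
Proof.
move=> _ [B mB ->]; apply: fin_bigcap_measurable; first exact: finite_finset.
by move=> i _; rewrite -[_ @^-1` _]setTI; exact: mX.
Qed.

Lemma coord_sigma_measurable J A : <<s cylinders J >> A -> measurable A.
Proof. exact: (smallest_sub (@sigma_algebra_measurable _ T) (@cylinders_measurable J)). Qed.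

Lemma measurable_to_coord_sigma J : measurable_fun [set: T] (to_coord_sigma J).
Proof. by move=> _ A mA; rewrite setTI; exact: (coord_sigma_measurable mA). Qed.

Lemma coord_measurable_fun J f : coord_measurable J f -> measurable_fun setT f.
Proof. by move=> mf; exact: (measurableT_comp mf (@measurable_to_coord_sigma J)). Qed.

Hypothesis indepX : mutually_independent P X.

Lemma cylinders_independent (J K : {set I}) A B : [disjoint J & K]%B ->
  cylinders J A -> cylinders K B -> (P (A `&` B) = P A * P B)%E.
Proof.
move=> JK [A' mA ->] [B' mB ->].
pose D i := if i \in J then A' i else B' i.
have mD i : measurable (D i) by rewrite /D; case: ifP.
have EJ : \bigcap_(i in [set` J]) (X i @^-1` A' i) = \bigcap_(i in [set` J]) (X i @^-1` D i).
  by apply: eq_bigcapr => i /= iJ; rewrite /D iJ.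
have EK : \bigcap_(i in [set` K]) (X i @^-1` B' i) = \bigcap_(i in [set` K]) (X i @^-1` D i).
  by apply: eq_bigcapr => i /= iK; rewrite /D (disjointFl JK iK).
rewrite EJ EK -bigcap_setU.
have -> : [set` J] `|` [set` K] = [set` (J :|: K)%SET].
  by apply/seteqP; split => i /=; rewrite inE => /orP.
rewrite !indepX // (eq_bigl [in [predU J & K]]); last by move=> i; rewrite !inE.
by rewrite bigU.
Qed.

Lemma coord_sigma_independent (J K : {set I}) A B : [disjoint J & K]%B ->
  <<s cylinders J >> A -> <<s cylinders K >> B -> (P (A `&` B) = P A * P B)%E.
Proof.
move=> JK sA sB.
apply: (independent_sigma_algebra (@cylinders_setI J) (cylinders_setT J)
  (@cylinders_measurable J) _ _ sA) => [|C CJ]; first exact: coord_sigma_measurable sB.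
rewrite setIC muleC; apply: (independent_sigma_algebra (@cylinders_setI K)
  (cylinders_setT K) (@cylinders_measurable K) _ _ sB) => [|D DK].
  exact: cylinders_measurable CJ.
by rewrite setIC muleC; exact: cylinders_independent CJ DK.
Qed.

End CoordinateSigmaAlgebra.

Section IndependentPair.
Context {R : realType} {d d1 d2 : measure_display}.
Context {T : measurableType d} {T1 : measurableType d1} {T2 : measurableType d2}.
Variables (P : probability T R) (f1 : {mfun T >-> T1}) (f2 : {mfun T >-> T2}).
Variable F : (T1 * T2)%type -> \bar R.
Hypothesis mF : measurable_fun setT F.
Hypothesis F_ge0 : forall x, (0 <= F x)%E.

Let f12 : T -> (T1 * T2)%type := fun w => (f1 w, f2 w).
Let measurable_f12 : measurable_fun setT f12.
Proof. by apply/measurable_fun_pairP; split; exact: measurable_funP. Qed.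
Let f12_isMeasurable := isMeasurableFun.Build _ _ _ _ _ measurable_f12.
Let f12_mfun : {mfun T >-> (T1 * T2)%type} := HB.pack f12 f12_isMeasurable.

Let inner_integralE x :
  (\int[distribution P f2]_y F (x, y) = \int[P]_w F (x, f2 w))%E.
Proof.
rewrite ge0_integral_pushforward ?preimage_setT //.
exact/measurableT_comp/pair1_measurable.
Qed.

Lemma measurable_inner_integral : measurable_fun setT (fun x => \int[P]_w F (x, f2 w))%E.
Proof.
rewrite (_ : (fun x => _) = fun x => (\int[distribution P f2]_y F (x, y))%E).
  exact: measurable_fun_fubini_tonelli_F.
by apply/funext => x; rewrite inner_integralE.
Qed.

Lemma ge0_integral_independent_pair :
  (forall A B, measurable A -> measurable B ->
    P (f1 @^-1` A `&` f2 @^-1` B) = P (f1 @^-1` A) * P (f2 @^-1` B))%E ->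
  (\int[P]_w F (f1 w, f2 w) = \int[P]_w \int[P]_w' F (f1 w, f2 w'))%E.
Proof.
move=> indep; transitivity (\int[distribution P f12_mfun]_z F z)%E.
  by rewrite ge0_integral_pushforward // preimage_setT.
transitivity (\int[(distribution P f1) \x (distribution P f2)]_z F z)%E.
  have prodE := @product_measure_unique _ _ _ _ _ (distribution P f1) (distribution P f2)
    (distribution P f12_mfun) (fun A B mA mB => indep A B mA mB).
  by apply: eq_measure_integral => A mA _; rewrite -prodE.
rewrite fubini_tonelli1 // /fubini_F.
under eq_integral do rewrite inner_integralE.
rewrite ge0_integral_pushforward ?preimage_setT //; first exact: measurable_inner_integral.
by move=> x _; exact: integral_ge0.
Qed.

End IndependentPair.

Section IndependentCoordinates.
Context {R : realType} {dT dE : measure_display}.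
Context {T : measurableType dT} {E : measurableType dE}.
Variables (P : probability T R) (I : finType) (X : I -> T -> E).
Hypothesis mX : forall i, measurable_fun [set: T] (X i).
Hypothesis indepX : mutually_independent P X.
Variables (J K : {set I}) (F : (coord_sigma X J * coord_sigma X K)%type -> \bar R).
Hypothesis JK : [disjoint J & K]%B.
Hypothesis mF : measurable_fun setT F.
Hypothesis F_ge0 : forall x, (0 <= F x)%E.

Let mfun_coord L : {mfun T >-> coord_sigma X L} :=
  HB.pack (to_coord_sigma X L) (isMeasurableFun.Build _ _ _ _ _
    (@measurable_to_coord_sigma _ _ _ _ _ X mX L)).

Lemma ge0_integral_independent_coords :
  (\int[P]_w F (w, w) = \int[P]_w \int[P]_w' F (w, w'))%E.
Proof.
apply: (ge0_integral_independent_pair (f1 := mfun_coord J) (f2 := mfun_coord K)) => //.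
by move=> A B mA mB; exact: (coord_sigma_independent mX indepX JK).
Qed.

Lemma le_integral_independent_coords (G : T -> \bar R) : measurable_fun setT G ->
  (forall w : T, \int[P]_w' F (w, w') <= G w)%E ->
  (\int[P]_w F (w, w) <= \int[P]_w G w)%E.
Proof.
move=> mG FG; rewrite ge0_integral_independent_coords.
apply: ge0_le_integral => //; first by move=> w _; exact: integral_ge0.
apply: (measurableT_comp (measurable_inner_integral P (mfun_coord K) mF F_ge0)).
exact: measurable_to_coord_sigma.
Qed.

End IndependentCoordinates.

Section RealIntegrable.
Context {R : realType} {d : measure_display} {T : measurableType d}.
Variable P : probability T R.
Implicit Types f g : T -> R.

Definition Rintegrable f := P.-integrable setT (EFin \o f).

Lemma Rintegrable_measurable f : Rintegrable f -> measurable_fun setT f.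
Proof. by move=> /(measurable_int P)/measurable_EFinP. Qed.

Lemma EFin_Rintegral f : Rintegrable f -> (\int[P]_w (f w)%:E = (\int[P]_w f w)%R%:E)%E.
Proof. by move=> If; rewrite /Rintegral fineK //; exact: integrable_fin_num. Qed.

Lemma eq_Rintegrable f g : (forall w, f w = g w) -> Rintegrable f -> Rintegrable g.
Proof. by move=> /funext ->. Qed.

Lemma eq_RintegralT f g : (forall w, f w = g w) -> \int[P]_w f w = \int[P]_w g w.
Proof. by move=> /funext ->. Qed.

Lemma Rintegrable_cst c : Rintegrable (fun=> c).
Proof. exact: finite_measure_integrable_cst. Qed.

Lemma RintegrableD f g : Rintegrable f -> Rintegrable g -> Rintegrable (fun w => f w + g w).
Proof. by move=> If Ig; exact: (integrableD measurableT If Ig). Qed.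

Lemma RintegrableZ c f : Rintegrable f -> Rintegrable (fun w => c * f w).
Proof. by move=> If; exact: (integrableZl measurableT c If). Qed.

Lemma RintegrableN f : Rintegrable f -> Rintegrable (fun w => - f w).
Proof. by move=> /(RintegrableZ (-1)); apply: eq_Rintegrable => w; rewrite mulN1r. Qed.

Lemma RintegrableB f g : Rintegrable f -> Rintegrable g -> Rintegrable (fun w => f w - g w).
Proof. by move=> If /RintegrableN Ig; exact: RintegrableD. Qed.

Lemma Rintegrable_sum (I : Type) (s : seq I) (Q : pred I) (F : I -> T -> R) :
  (forall i, Q i -> Rintegrable (F i)) -> Rintegrable (fun w => \sum_(i <- s | Q i) F i w).
Proof.
move=> IF; elim: s => [|i s IH].
  by apply: eq_Rintegrable (Rintegrable_cst 0) => w; rewrite big_nil.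
apply: (@eq_Rintegrable (fun w => (if Q i then F i w else 0) + \sum_(i <- s | Q i) F i w)).
  by move=> w; rewrite big_cons; case: ifP => // _; rewrite add0r.
apply: RintegrableD => //.
by case: (boolP (Q i)) => Qi; [exact: IF | exact: Rintegrable_cst].
Qed.

Lemma Rintegrable_le f g :
  measurable_fun setT f -> (forall w, `|f w| <= g w) -> Rintegrable g -> Rintegrable f.
Proof.
move=> mf fg Ig; apply: (le_integrable measurableT _ _ Ig) => [|w _ /=].
  exact/measurable_EFinP.
by rewrite lee_fin (le_trans (fg w)) // ler_norm.
Qed.

Lemma ge0_Rintegrable f : measurable_fun setT f -> (forall w, 0 <= f w) ->
  (\int[P]_w (f w)%:E < +oo)%E -> Rintegrable f.
Proof.
move=> mf f0 f_fin; apply/integrableP; split; first exact/measurable_EFinP.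
by rewrite (eq_integral (fun w => (f w)%:E)) // => w _; rewrite gee0_abs // lee_fin.
Qed.

Lemma Rintegrable_norm f : Rintegrable f -> Rintegrable (fun w => `|f w|).
Proof.
move=> If; apply: Rintegrable_le (integrable_norm If) => [|w]; last by rewrite normr_id.
by apply: measurableT_comp => //; exact: Rintegrable_measurable.
Qed.

Lemma measurable_natr_bool (b : T -> bool) :
  measurable_fun setT b -> measurable_fun setT (fun w => (b w)%:R : R).
Proof.
move=> mb; rewrite (_ : (fun w => _) = fun w => if b w then 1 else 0).
  exact: measurable_fun_ifT.
by apply/funext => w; case: (b w).
Qed.

Lemma Rintegrable_bool (b : T -> bool) :
  measurable_fun setT b -> Rintegrable (fun w => (b w)%:R).
Proof.
move=> mb; apply: Rintegrable_le (Rintegrable_cst 1) => [|w]; last by case: (b w);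
  rewrite ?normr0 ?normr1.
exact: measurable_natr_bool.
Qed.

Lemma RintegralN f : Rintegrable f -> \int[P]_w (- f w) = - \int[P]_w f w.
Proof.
by move=> If; rewrite -mulN1r -RintegralZl //; apply: eq_RintegralT => w; rewrite mulN1r.
Qed.

Lemma Rintegral_cstT c : \int[P]_w c = c.
Proof. by rewrite /Rintegral integral_cst //= probability_setT mule1. Qed.

Lemma Rintegral_sum (I : Type) (s : seq I) (Q : pred I) (F : I -> T -> R) :
  (forall i, Q i -> Rintegrable (F i)) ->
  \int[P]_w (\sum_(i <- s | Q i) F i w) = \sum_(i <- s | Q i) \int[P]_w F i w.
Proof.
move=> IF; elim: s => [|i s IH].
  by rewrite big_nil -[RHS](Rintegral_cstT 0); apply: eq_RintegralT => w; rewrite big_nil.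
rewrite big_cons -IH; case: ifP => Qi; last by apply: eq_RintegralT => w; rewrite big_cons Qi.
rewrite -RintegralD //; [|exact: IF|exact: Rintegrable_sum].
by apply: eq_RintegralT => w; rewrite big_cons Qi.
Qed.

Lemma ler_Rintegral f g : Rintegrable f -> Rintegrable g -> (forall w, f w <= g w) ->
  \int[P]_w f w <= \int[P]_w g w.
Proof. by move=> If Ig fg; apply: le_Rintegral => // w _; exact: fg. Qed.

Lemma probability_le_Rintegral (b : T -> bool) (A : set T) : measurable_fun setT b ->
  measurable A -> (forall w, A w -> b w) -> (P A <= (\int[P]_w (b w)%:R)%R%:E)%E.
Proof.
move=> mb mA Ab; rewrite -EFin_Rintegral; last exact: Rintegrable_bool.
rewrite -(setIT A) -integral_indic //; apply: ge0_le_integral => //.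
- exact/measurable_EFinP/measurable_indic.
- by apply/measurable_EFinP; exact: measurable_natr_bool.
move=> w _; rewrite lee_fin indicE; case: (boolP (w \in A)) => // wA.
by rewrite Ab //; exact: set_mem.
Qed.

End RealIntegrable.

Lemma ge0_integral_normal_prob {R : realType} (m s : R) (f : R -> \bar R) :
  measurable_fun setT f -> (forall x, 0 <= f x)%E ->
  (\int[normal_prob m s]_x f x = \int[lebesgue_measure]_x (f x * (normal_pdf m s x)%:E))%E.
Proof.
move=> mf f0; have dom := normal_prob_dominates m s.
rewrite -(Radon_Nikodym_SigmaFinite.change_of_variables dom f0 measurableT mf).
have mRN := measurable_int _ (Radon_Nikodym_SigmaFinite.f_integrable dom).
have mpdf : measurable_fun setT (EFin \o normal_pdf m s).
  by apply/measurable_EFinP; exact: measurable_normal_pdf.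
apply: ge0_ae_eq_integral => //.
- exact: emeasurable_funM.
- exact: emeasurable_funM.
- by move=> x _; rewrite mule_ge0 // Radon_Nikodym_SigmaFinite.f_ge0.
- by move=> x _; rewrite mule_ge0 // lee_fin normal_pdf_ge0.
apply: ae_eqe_mul2l; apply: integral_ae_eq => //.
  exact: Radon_Nikodym_SigmaFinite.f_integrable.
by move=> A _ mA; rewrite -Radon_Nikodym_SigmaFinite.f_integral.
Qed.

Section NormalIntegral.
Context {R : realType} {d : measure_display} {T : measurableType d}.
Variables (P : probability T R) (v : R) (X : T -> R).
Hypothesis v_gt0 : 0 < v.
Hypothesis normalX : is_normal P 0 v X.
Let mu := @lebesgue_measure R.
Let s := Num.sqrt v.

Let s_sqr : s ^+ 2 = v. Proof. by rewrite sqr_sqrtr // ltW. Qed.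
Let s_neq0 : s != 0. Proof. by rewrite sqrtr_eq0 -ltNge. Qed.
Let mX : measurable_fun setT (X : T -> measurableTypeR R). Proof. by case: normalX. Qed.
Let X_mfun : {mfun T >-> measurableTypeR R} :=
  HB.pack X (isMeasurableFun.Build _ _ _ _ _ mX).

Let ge0_integral_pdf (c : R) (m s' : R) : 0 <= c -> s' != 0 ->
  (\int[mu]_x (c%:E * (normal_pdf m s' x)%:E) = c%:E)%E.
Proof.
move=> c0 s'0; rewrite ge0_integralZl ?lee_fin //.
- by rewrite integral_normal_pdf mule1.
- by apply/measurable_EFinP; exact: measurable_normal_pdf.
- by move=> x _; rewrite lee_fin normal_pdf_ge0.
Qed.

Lemma normal_integral (f : R -> R) : measurable_fun setT f -> (forall x, 0 <= f x) ->
  (\int[P]_w (f (X w))%:E = \int[mu]_x (f x * normal_pdf 0 s x)%:E)%E.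
Proof.
move=> mf f0; have mEf : measurable_fun setT (EFin \o f) by exact/measurable_EFinP.
transitivity (\int[pushforward P X_mfun]_x (f x)%:E)%E.
  rewrite ge0_integral_pushforward ?preimage_setT //.
  by move=> x _; rewrite lee_fin.
transitivity (\int[normal_prob 0 s]_x (f x)%:E)%E.
  by apply: eq_measure_integral => A mA _; exact: (normalX.2 A mA).
by rewrite ge0_integral_normal_prob // => x; rewrite lee_fin.
Qed.

Lemma normal_mgf (t : R) : (\int[P]_w (expR (t * X w))%:E = (expR (t ^+ 2 * v / 2))%:E)%E.
Proof.
rewrite (normal_integral (f := fun x => expR (t * x))); last by move=> x; exact: expR_ge0.
  rewrite -(ge0_integral_pdf (t * v) (expR_ge0 (t ^+ 2 * v / 2)) s_neq0).
  apply: eq_integral => x _; rewrite -EFinM; congr EFin.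
  rewrite !normal_pdfE // /normal_fun mulrCA [RHS]mulrCA; congr (_ * _).
  rewrite -!expRD s_sqr; congr expR; rewrite -mulr_natl; field.
  by rewrite gt_eqF.
by apply: measurableT_comp => //; apply: measurable_funM.
Qed.

Lemma normal_sqr_laplace (l : R) : 0 < 1 + 2 * l * v ->
  (\int[P]_w (expR (- l * X w ^+ 2))%:E = ((Num.sqrt (1 + 2 * l * v))^-1)%:E)%E.
Proof.
move=> lv_gt0; pose v' := v / (1 + 2 * l * v).
have v'_gt0 : 0 < v' by rewrite divr_gt0.
have s'_sqr : Num.sqrt v' ^+ 2 = v' by rewrite sqr_sqrtr // ltW.
have s'_neq0 : Num.sqrt v' != 0 by rewrite sqrtr_eq0 -ltNge.
rewrite (normal_integral (f := fun x => expR (- l * x ^+ 2))); last by move=> x; exact: expR_ge0.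
  have c_ge0 : 0 <= (Num.sqrt (1 + 2 * l * v))^-1 by rewrite invr_ge0 sqrtr_ge0.
  rewrite -(ge0_integral_pdf 0 c_ge0 s'_neq0).
  apply: eq_integral => x _; rewrite -EFinM; congr EFin.
  rewrite !normal_pdfE // /normal_fun mulrCA [RHS]mulrA -expRD s_sqr s'_sqr; congr (_ * expR _).
    rewrite /normal_peak s_sqr s'_sqr -invfM; congr (_^-1); rewrite -sqrtrM ?ltW //.
    congr Num.sqrt; rewrite /v' !mulr2n; field.
    by rewrite gt_eqF.
  rewrite /v' !subr0 !mulr2n; field.
  by rewrite (gt_eqF lv_gt0) (gt_eqF (addr_gt0 v_gt0 v_gt0)).
by apply: measurableT_comp => //; apply: measurable_funM => //; exact: measurable_funX.
Qed.

Lemma normal_symmetric (f : R -> R) : measurable_fun setT f -> (forall x, 0 <= f x) ->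
  (\int[P]_w (f (- X w))%:E = \int[P]_w (f (X w))%:E)%E.
Proof.
move=> mf f0; rewrite (normal_integral mf f0).
have mfN : measurable_fun setT (fun x : R => f (- x)) by exact: measurableT_comp.
rewrite (normal_integral mfN); last by move=> x; exact: f0.
pose opp : measurableTypeR R -> measurableTypeR R := -%R.
have mopp : measurable_fun setT opp by exact: oppr_measurable.
have mfpdf : measurable_fun setT (fun x : measurableTypeR R => (f x * normal_pdf 0 s x)%:E).
  by apply/measurable_EFinP; apply: measurable_funM => //; exact: measurable_normal_pdf.
have fpdf_ge0 : {in [set: measurableTypeR R], forall x, (0 <= (f x * normal_pdf 0 s x)%:E)%E}.
  by move=> x _; rewrite lee_fin mulr_ge0 // normal_pdf_ge0.
transitivity (\int[pushforward mu opp]_x (f x * normal_pdf 0 s x)%:E)%E.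
  rewrite (ge0_integral_pushforward mopp mu measurableT mfpdf fpdf_ge0) preimage_setT.
  apply: eq_integral => x _ /=; congr (_ * _)%:E.
  by rewrite !normal_pdfE // /normal_fun !subr0 sqrrN.
by apply: eq_measure_integral => A mA _; exact: lebesgue_measureN.
Qed.

End NormalIntegral.

(** * Gaussian moments *)

Lemma is_derive_ge0_ler (R : realType) (f f' : R -> R) (b : R) :
  (forall x : R, is_derive x 1 f (f' x)) -> (forall x, 0 <= x -> 0 <= f' x) ->
  0 <= b -> f 0 <= f b.
Proof.
move=> df f'_ge0 b0.
have derivable_f (x : R) : derivable f x 1 by case: (df x).
have continuous_f (x : R) : {for x, continuous f}.
  by apply: differentiable_continuous; apply/derivable1_diffP.
apply: (@ger0_derive1_le_cc R f 0 b) => //.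
- move=> x; rewrite in_itv /= => /andP[x0 _].
  by rewrite derive1E; case: (df x) => _ ->; rewrite f'_ge0 // ltW.
- by apply: continuous_subspaceT => x; exact: continuous_f.
- by rewrite in_itv /= lexx.
- by rewrite in_itv /= b0 lexx.
Qed.

Lemma expRN_taylor_bounds (R : realType) (a : R) : 0 <= a ->
  1 - a + a ^+ 2 / 2 - a ^+ 3 / 6 <= expR (- a) <= 1 - a + a ^+ 2 / 2.
Proof.
move=> a0.
pose f x := (1 - x + x ^+ 2 / 2 - expR (- x) : R).
pose f' x := (- 1 + x + expR (- x) : R).
pose g x := (expR (- x) - (1 - x + x ^+ 2 / 2 - x ^+ 3 / 6) : R).
have df (x : R) : is_derive x 1 f (f' x).
  rewrite /f /f'; apply: is_derive_eq; rewrite /GRing.scale /= !mulr1.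
  by field.
have dg (x : R) : is_derive x 1 g (f x).
  rewrite /g /f; apply: is_derive_eq; rewrite /GRing.scale /= !mulr1.
  by field.
have f_ge0 x : 0 <= x -> 0 <= f x.
  move=> x0; have := is_derive_ge0_ler df _ x0.
  rewrite (_ : f 0 = 0); last by rewrite /f oppr0 expR0; ring.
  by apply=> y y0; rewrite /f'; have := @expR_ge1Dx R (- y); lra.
have g_ge0 : 0 <= g a.
  have := is_derive_ge0_ler dg f_ge0 a0.
  by rewrite (_ : g 0 = 0) // /g oppr0 expR0; ring.
have := f_ge0 _ a0; rewrite /f /g in g_ge0 *.
by move=> f_ge0_a; apply/andP; split; lra.
Qed.

Lemma sqrt_inv_taylor_bounds (R : realType) (x : R) : 0 <= x ->
  1 - x + 3 / 2 * x ^+ 2 - 5 / 2 * x ^+ 3 <= (Num.sqrt (1 + 2 * x))^-1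
    <= 1 - x + 3 / 2 * x ^+ 2.
Proof.
move=> x0; set r := Num.sqrt _.
have x1_ge0 : 0 <= 1 + 2 * x by rewrite addr_ge0 // mulr_ge0.
have r_sqr : r ^+ 2 = 1 + 2 * x by rewrite sqr_sqrtr.
have r_ge1 : 1 <= r by rewrite -[leLHS]sqrtr1 ler_wsqrtr // lerDl mulr_ge0.
have r_gt0 : 0 < r by rewrite (lt_le_trans _ r_ge1).
have xE : x = (r ^+ 2 - 1) / 2 by rewrite r_sqr; field.
apply/andP; split.
  rewrite -[leRHS]mul1r ler_pdivlMr // xE -subr_ge0.
  rewrite (_ : 1 - _ = (r - 1) ^+ 4 * (5 * r ^+ 3 + 20 * r ^+ 2 + 29 * r + 16) / 16); last by field.
  rewrite divr_ge0 // mulr_ge0 ?exprn_ge0 ?subr_ge0 //.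
  by rewrite !addr_ge0 // ?mulr_ge0 ?exprn_ge0 // ltW.
rewrite -[leLHS]mul1r ler_pdivrMr // xE -subr_ge0.
rewrite (_ : _ - 1 = (r - 1) ^+ 3 * (3 * r ^+ 2 + 9 * r + 8) / 8); last by field.
by rewrite divr_ge0 // mulr_ge0 ?exprn_ge0 ?subr_ge0 //; nra.
Qed.

Lemma eq0_small (R : realFieldType) (x e : R) : 0 <= e ->
  (forall l, 0 < l <= 1 -> `|x| <= l * e) -> x = 0.
Proof.
move=> e0 x_le; apply/normr0_eq0/eqP; rewrite eq_le normr_ge0 andbT leNgt; apply/negP => x_gt0.
have l_gt0 : 0 < `|x| / (2 * e + `|x|) by rewrite divr_gt0 //; lra.
have l_le1 : `|x| / (2 * e + `|x|) <= 1 by rewrite ler_pdivrMr; lra.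
have := x_le _ (introT andP (conj l_gt0 l_le1)).
by rewrite mulrAC ler_pdivlMr; [nra | lra].
Qed.

Lemma quadratic_coefs_eq0 (R : realFieldType) (a b c : R) :
  (forall l, 0 < l <= 1 -> `|l * a + l ^+ 2 * b| <= c * l ^+ 3) -> a = 0 /\ b = 0.
Proof.
move=> small; have c0 : 0 <= c.
  have := small 1; rewrite lexx ltr01 => /(_ isT); rewrite !expr1n mulr1.
  exact: le_trans.
have small1 l : 0 < l <= 1 -> `|a + l * b| <= c * l ^+ 2.
  move=> l01; have := small l l01; case/andP: l01 => l0 l1.
  have -> : l * a + l ^+ 2 * b = l * (a + l * b) by ring.
  rewrite normrM gtr0_norm // (_ : c * l ^+ 3 = l * (c * l ^+ 2)); last by ring.
  by rewrite ler_pM2l.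
have a0 : a = 0.
  apply: (@eq0_small _ a (`|b| + c)); first by rewrite addr_ge0.
  move=> l /[dup] /small1 abl /andP[l0 l1]; rewrite mulrDr.
  have : `|a| <= `|a + l * b| + l * `|b|.
    rewrite -{2}(gtr0_norm l0) -normrM -{1}[a](addrK (l * b)).
    by rewrite (le_trans (ler_normB _ _)).
  have : c * l ^+ 2 <= l * c.
    by rewrite expr2 mulrA [l * c]mulrC ler_piMr // mulr_ge0 // ltW.
  by lra.
split=> //; apply: (eq0_small c0) => l /[dup] /small1 + /andP[l0 l1].
rewrite a0 add0r normrM gtr0_norm // (_ : c * l ^+ 2 = l * (l * c)); last by ring.
by rewrite ler_pM2l.
Qed.

Lemma exprn_le_fact_expR (R : realType) (a : R) k : 0 <= a -> a ^+ k <= k`!%:R * expR a.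
Proof.
move=> a0; case: k => [|k]; first by rewrite expr0 fact0 mul1r -[leLHS]expR0 ler_expR.
rewrite mulrC -ler_pdivrMr ?ltr0n ?fact_gt0 //.
by apply: le_trans (expR_ge1Dxn k a0); rewrite lerDr.
Qed.

Section NormalMoments.
Context {R : realType} {d : measure_display} {T : measurableType d}.
Variables (P : probability T R) (v : R) (X : T -> R).
Hypothesis v_gt0 : 0 < v.
Hypothesis normalX : is_normal P 0 v X.

Let mX : measurable_fun setT X. Proof. by case: normalX. Qed.

Lemma normal_sqr_laplace_integrable (l : R) : 0 < 1 + 2 * l * v ->
  Rintegrable P (fun w => expR (- l * X w ^+ 2)) /\
  \int[P]_w expR (- l * X w ^+ 2) = (Num.sqrt (1 + 2 * l * v))^-1.
Proof.
move=> lv_gt0; have laplaceE := normal_sqr_laplace v_gt0 normalX lv_gt0.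
split; last by rewrite /Rintegral laplaceE.
apply: ge0_Rintegrable => [|w|]; last by rewrite laplaceE ltry.
  apply: measurableT_comp => //; apply: measurable_funM => //.
  exact: measurable_funX.
exact: expR_ge0.
Qed.

Lemma normal_moment_even k : Rintegrable P (fun w => X w ^+ (2 * k)) /\
  \int[P]_w (X w ^+ (2 * k)) <= k`!%:R * (4 * v) ^+ k * 2.
Proof.
pose l := - (4 * v)^-1; have v4_ge0 : 0 <= 4 * v by rewrite mulr_ge0 // ltW.
have lv : 1 + 2 * l * v = 2^-1 by rewrite /l; field; rewrite gt_eqF.
have [|Ig int_g] := @normal_sqr_laplace_integrable l; first by rewrite lv invr_gt0.
have int_g_le2 : \int[P]_w expR (- l * X w ^+ 2) <= 2.
  rewrite int_g lv sqrtrV // invrK.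
  by rewrite -[leRHS]ger0_norm // -sqrtr_sqr ler_wsqrtr // expr2; lra.
have coef_ge0 : 0 <= k`!%:R * (4 * v) ^+ k by rewrite mulr_ge0 // exprn_ge0.
have power_le w : X w ^+ (2 * k) <= k`!%:R * (4 * v) ^+ k * expR (- l * X w ^+ 2).
  have -> : X w ^+ (2 * k) = (4 * v) ^+ k * (- l * X w ^+ 2) ^+ k.
    by rewrite exprM -exprMn; congr (_ ^+ k); rewrite /l; field; rewrite gt_eqF.
  rewrite [k`!%:R * _]mulrC -mulrA ler_wpM2l ?exprn_ge0 //.
  by apply: exprn_le_fact_expR; rewrite /l opprK mulr_ge0 ?sqr_ge0 // invr_ge0.
have IX : Rintegrable P (fun w => X w ^+ (2 * k)).
  apply: Rintegrable_le (RintegrableZ (k`!%:R * (4 * v) ^+ k) Ig) => [|w].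
    exact: measurable_funX.
  by rewrite ger0_norm // exprM exprn_ge0 // sqr_ge0.
split=> //; apply: le_trans (ler_Rintegral IX (RintegrableZ _ Ig) power_le) _.
by rewrite RintegralZl //; apply: ler_wpM2l.
Qed.

Lemma normal_moment_integrable k : Rintegrable P (fun w => X w ^+ k).
Proof.
apply: Rintegrable_le (RintegrableD (Rintegrable_cst P 1) (normal_moment_even k).1) => [|w].
  exact: measurable_funX.
rewrite mulnC exprM; set a := X w ^+ k.
by rewrite ler_norml; apply/andP; split; nra.
Qed.

(* The symmetry of [X] is applied to the nonnegative function
   [1 + x ^+ (2 * k) + x ^+ k]. *)
Lemma normal_moment_odd k : odd k -> \int[P]_w (X w ^+ k) = 0.
Proof.
move=> odd_k; pose h (x : R) := 1 + x ^+ (2 * k) + x ^+ k.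
have mh : measurable_fun setT h.
  by apply: measurable_funD; first apply: measurable_funD => //; exact: measurable_funX.
have h_ge0 x : 0 <= h x by rewrite /h mulnC exprM; set a := x ^+ k; nra.
have Ik := normal_moment_integrable k.
have I2k := RintegrableD (Rintegrable_cst P 1) (normal_moment_even k).1.
have : \int[P]_w h (- X w) = \int[P]_w h (X w).
  by rewrite /Rintegral (normal_symmetric v_gt0 normalX mh h_ge0).
rewrite (RintegralD measurableT I2k Ik).
rewrite (eq_RintegralT P (g := fun w => 1 + X w ^+ (2 * k) - X w ^+ k)) => [|w].
  by rewrite (RintegralB measurableT I2k Ik); lra.
by rewrite /h !exprM sqrrN [X in _ + X]exprNn -signr_odd odd_k expr1 mulN1r.
Qed.

Lemma normal_sqr_laplace_moment_bounds (l : R)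
    (m2 := \int[P]_w (X w ^+ 2)) (m4 := \int[P]_w (X w ^+ 4)) (m6 := \int[P]_w (X w ^+ 6)) :
  0 <= l -> 1 - l * m2 + l ^+ 2 / 2 * m4 - l ^+ 3 / 6 * m6 <=
    (Num.sqrt (1 + 2 * l * v))^-1 <= 1 - l * m2 + l ^+ 2 / 2 * m4.
Proof.
move=> l_ge0; have lv_gt0 : 0 < 1 + 2 * l * v.
  by rewrite (lt_le_trans ltr01) // lerDl !mulr_ge0 // ltW.
have [Ig <-] := normal_sqr_laplace_integrable lv_gt0.
have I2 := normal_moment_integrable 2; have I4 := normal_moment_integrable 4.
have I6 := normal_moment_integrable 6.
have J1 := RintegrableB (Rintegrable_cst P 1) (RintegrableZ l I2).
have J2 := RintegrableD J1 (RintegrableZ (l ^+ 2 / 2) I4).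
have J3 := RintegrableB J2 (RintegrableZ (l ^+ 3 / 6) I6).
have taylor w : 1 - l * X w ^+ 2 + l ^+ 2 / 2 * X w ^+ 4 - l ^+ 3 / 6 * X w ^+ 6 <=
    expR (- l * X w ^+ 2) <= 1 - l * X w ^+ 2 + l ^+ 2 / 2 * X w ^+ 4.
  have lX_ge0 : 0 <= l * X w ^+ 2 by rewrite mulr_ge0 ?sqr_ge0.
  have := expRN_taylor_bounds lX_ge0; rewrite -mulNr.
  rewrite (_ : (l * X w ^+ 2) ^+ 2 / 2 = l ^+ 2 / 2 * X w ^+ 4); last by field.
  by rewrite (_ : (l * X w ^+ 2) ^+ 3 / 6 = l ^+ 3 / 6 * X w ^+ 6); last by field.
have int2 : \int[P]_w (1 - l * X w ^+ 2 + l ^+ 2 / 2 * X w ^+ 4) = 1 - l * m2 + l ^+ 2 / 2 * m4.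
  rewrite RintegralD //; last exact: RintegrableZ.
  rewrite RintegralB //; [|exact: Rintegrable_cst|exact: RintegrableZ].
  by rewrite !RintegralZl // Rintegral_cstT.
apply/andP; split; last by rewrite -int2; apply: ler_Rintegral => // w; case/andP: (taylor w).
rewrite -int2 -RintegralZl // -RintegralB //; last exact: RintegrableZ.
by apply: ler_Rintegral => // w; case/andP: (taylor w).
Qed.

(* Both sides of [E exp(- l X^2) = (1 + 2 l v)^(-1/2)] are expanded to third
   order in [l]. *)
Lemma normal_moments24 :
  \int[P]_w (X w ^+ 2) = v /\ \int[P]_w (X w ^+ 4) = 3 * v ^+ 2.
Proof.
set m2 := \int[P]_w (X w ^+ 2); set m4 := \int[P]_w (X w ^+ 4).
set m6 := \int[P]_w (X w ^+ 6).
have m6_ge0 : 0 <= m6.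
  by apply: Rintegral_ge0 => w _; rewrite (exprM _ 2 3) exprn_ge0 // sqr_ge0.
suff [m2E m4E] : m2 - v = 0 /\ (3 * v ^+ 2 - m4) / 2 = 0 by split; lra.
apply: (@quadratic_coefs_eq0 _ _ _ (m6 / 6 + 5 / 2 * v ^+ 3)) => l /andP[l_gt0 l_le1].
have /andP[lower upper] := normal_sqr_laplace_moment_bounds (ltW l_gt0).
have lv_ge0 : 0 <= l * v by rewrite mulr_ge0 // ltW.
have := sqrt_inv_taylor_bounds lv_ge0.
rewrite [2 * (l * v)]mulrA !exprMn => /andP[sqrt_lower sqrt_upper].
rewrite -/m2 -/m4 -/m6 in lower upper.
have lv3_ge0 : 0 <= l ^+ 3 * v ^+ 3 by rewrite mulr_ge0 ?exprn_ge0 // ltW.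
have lm6_ge0 : 0 <= l ^+ 3 * m6 by rewrite mulr_ge0 // exprn_ge0 // ltW.
by rewrite ler_norml; apply/andP; split; lra.
Qed.

End NormalMoments.

Section IndependentProducts.
Context {R : realType} {dT dE : measure_display}.
Context {T : measurableType dT} {E : measurableType dE}.
Variables (P : probability T R) (I : finType) (X : I -> T -> E).
Hypothesis mX : forall i, measurable_fun [set: T] (X i).
Hypothesis indepX : mutually_independent P X.
Variables J K : {set I}.
Hypothesis JK : [disjoint J & K]%B.

Lemma ge0_integralM_independent (f g : T -> R) :
  coord_measurable X J f -> coord_measurable X K g ->
  (forall w, 0 <= f w) -> (forall w, 0 <= g w) ->
  (\int[P]_w (f w * g w)%:E = \int[P]_w (f w)%:E * \int[P]_w (g w)%:E)%E.
Proof.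
move=> mf mg f0 g0.
pose F (x : (coord_sigma X J * coord_sigma X K)%type) := ((f x.1 * g x.2)%:E : \bar R).
have mF : measurable_fun setT F.
  apply/measurable_EFinP; apply: measurable_funM.
  - by apply: (measurableT_comp mf); exact: measurable_fst.
  - by apply: (measurableT_comp mg); exact: measurable_snd.
have F_ge0 x : (0 <= F x)%E by rewrite lee_fin mulr_ge0.
have -> : (\int[P]_w (f w * g w)%:E = \int[P]_w F (w, w))%E by [].
rewrite (ge0_integral_independent_coords mX indepX JK mF F_ge0).
transitivity (\int[P]_w ((f w)%:E * \int[P]_w' (g w')%:E))%E.
  apply: eq_integral => w _; rewrite /F /=.
  under eq_integral do rewrite EFinM.
  rewrite ge0_integralZl ?lee_fin //; first exact/measurable_EFinP/(coord_measurable_fun mX mg).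
  by move=> x _; rewrite lee_fin.
rewrite ge0_integralZr //.
- exact/measurable_EFinP/(coord_measurable_fun mX mf).
- by move=> x _; rewrite lee_fin.
- by apply: integral_ge0 => w _; rewrite lee_fin.
Qed.

Let ge0_RintegralM_independent (f g : T -> R) :
  coord_measurable X J f -> coord_measurable X K g ->
  (forall w, 0 <= f w) -> (forall w, 0 <= g w) -> Rintegrable P f -> Rintegrable P g ->
  Rintegrable P (fun w => f w * g w) /\
  \int[P]_w (f w * g w) = \int[P]_w f w * \int[P]_w g w.
Proof.
move=> mf mg f0 g0 If Ig; have := ge0_integralM_independent mf mg f0 g0.
rewrite (EFin_Rintegral If) (EFin_Rintegral Ig) -EFinM => mulE.
split; last by rewrite {1}/Rintegral mulE.
apply: ge0_Rintegrable; last by rewrite mulE ltry.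
  apply: measurable_funM; first exact: (coord_measurable_fun mX mf).
  exact: (coord_measurable_fun mX mg).
by move=> w; rewrite mulr_ge0.
Qed.

Lemma RintegralM_independent (f g : T -> R) :
  coord_measurable X J f -> coord_measurable X K g -> Rintegrable P f -> Rintegrable P g ->
  Rintegrable P (fun w => f w * g w) /\
  \int[P]_w (f w * g w) = \int[P]_w f w * \int[P]_w g w.
Proof.
move=> mf mg If Ig.
have [mfp mfn] : coord_measurable X J f^\+ /\ coord_measurable X J f^\-.
  by split; [exact: measurable_funrpos | exact: measurable_funrneg].
have [mgp mgn] : coord_measurable X K g^\+ /\ coord_measurable X K g^\-.
  by split; [exact: measurable_funrpos | exact: measurable_funrneg].
have Ifp : Rintegrable P f^\+ by exact: integrable_funrpos.
have Ifn : Rintegrable P f^\- by exact: integrable_funrneg.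
have Igp : Rintegrable P g^\+ by exact: integrable_funrpos.
have Ign : Rintegrable P g^\- by exact: integrable_funrneg.
have posBneg (h : T -> R) w : h w = h^\+ w - h^\- w by rewrite -{1}[h]funrposBneg.
have [Ipp intpp] := ge0_RintegralM_independent mfp mgp (funrpos_ge0 f) (funrpos_ge0 g) Ifp Igp.
have [Ipn intpn] := ge0_RintegralM_independent mfp mgn (funrpos_ge0 f) (funrneg_ge0 g) Ifp Ign.
have [Inp intnp] := ge0_RintegralM_independent mfn mgp (funrneg_ge0 f) (funrpos_ge0 g) Ifn Igp.
have [Inn intnn] := ge0_RintegralM_independent mfn mgn (funrneg_ge0 f) (funrneg_ge0 g) Ifn Ign.
have fgE w : (f^\+ w * g^\+ w + f^\- w * g^\- w) -
    (f^\+ w * g^\- w + f^\- w * g^\+ w) = f w * g w.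
  by rewrite (posBneg f w) (posBneg g w); ring.
split; first by apply: eq_Rintegrable fgE _; apply: RintegrableB; exact: RintegrableD.
rewrite -(eq_RintegralT P fgE) RintegralB ?RintegralD //;
  [|exact: RintegrableD|exact: RintegrableD].
rewrite intpp intpn intnp intnn (eq_RintegralT P (posBneg f)) (eq_RintegralT P (posBneg g)).
by rewrite !RintegralB //; ring.
Qed.

End IndependentProducts.

Section ComplexParts.
Variable R : rcfType.
Implicit Types a b z : R[i].

Lemma complex_ReM a b :
  complex.Re (a * b) = complex.Re a * complex.Re b - complex.Im a * complex.Im b.
Proof. by case: a; case: b. Qed.

Lemma complex_ImM a b :
  complex.Im (a * b) = complex.Re a * complex.Im b + complex.Im a * complex.Re b.
Proof. by case: a; case: b. Qed.

Lemma Re_conjC z : complex.Re (Num.conj z) = complex.Re z.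
Proof. by case: z. Qed.

Lemma Im_conjC z : complex.Im (Num.conj z) = - complex.Im z.
Proof. by case: z. Qed.

Definition sqmod z : R := complex.Re z ^+ 2 + complex.Im z ^+ 2.

Lemma sqmod_ge0 z : 0 <= sqmod z.
Proof. by rewrite addr_ge0 ?sqr_ge0. Qed.

Lemma sqmodM a b : sqmod (a * b) = sqmod a * sqmod b.
Proof. by rewrite /sqmod complex_ReM complex_ImM; ring. Qed.

Lemma sqmod_conjC z : sqmod (Num.conj z) = sqmod z.
Proof. by rewrite /sqmod Re_conjC Im_conjC sqrrN. Qed.

Lemma sqmod_real (x : R) : sqmod x%:C = x ^+ 2.
Proof. by rewrite /sqmod /= expr0n addr0. Qed.

Lemma sqmod_nat n : sqmod (n%:R : R[i]) = n%:R ^+ 2.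
Proof. by rewrite -sqmod_real rmorph_nat. Qed.

Lemma sqmod_prod (I : Type) (s : seq I) (F : I -> R[i]) :
  sqmod (\prod_(i <- s) F i) = \prod_(i <- s) sqmod (F i).
Proof.
elim: s => [|i s IH]; last by rewrite !big_cons sqmodM IH.
by rewrite !big_nil (sqmod_nat 1) expr1n.
Qed.

Lemma sqmodB_le a b : sqmod (a - b) <= 2 * (sqmod a + sqmod b).
Proof.
case: a b => [a1 a2] [b1 b2]; rewrite /sqmod /=.
have : 0 <= (a1 + b1) ^+ 2 + (a2 + b2) ^+ 2 by rewrite addr_ge0 ?sqr_ge0.
by rewrite !expr2; lra.
Qed.

Lemma sqr_normC_sqmod z : `|z| ^+ 2 = (sqmod z)%:C.
Proof. by rewrite add_Re2_Im2. Qed.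

Lemma mul_conjC_sqmod z : z * Num.conj z = (sqmod z)%:C.
Proof. by rewrite -normCK sqr_normC_sqmod. Qed.

End ComplexParts.

Section ComplexMeasurable.
Context {R : realType} {d : measure_display} {T : measurableType d}.
Local Notation C := R[i].
Implicit Types f g : T -> C.

Definition Cmeasurable f := measurable_fun setT (fun w => complex.Re (f w)) /\
  measurable_fun setT (fun w => complex.Im (f w)).

Lemma eq_Cmeasurable f g : (forall w, f w = g w) -> Cmeasurable f -> Cmeasurable g.
Proof. by move=> /funext ->. Qed.

Lemma Cmeasurable_cst c : Cmeasurable (fun=> c).
Proof. by split; exact: measurable_cst. Qed.

Lemma Cmeasurable_real (f : T -> R) : measurable_fun setT f -> Cmeasurable (fun w => (f w)%:C).
Proof. by move=> mf; split=> //; exact: measurable_cst. Qed.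

Lemma CmeasurableD f g : Cmeasurable f -> Cmeasurable g -> Cmeasurable (fun w => f w + g w).
Proof.
by move=> [? ?] [? ?]; split; under eq_fun do rewrite raddfD; exact: measurable_funD.
Qed.

Lemma CmeasurableM f g : Cmeasurable f -> Cmeasurable g -> Cmeasurable (fun w => f w * g w).
Proof.
move=> [mf1 mf2] [mg1 mg2]; split.
  by under eq_fun do rewrite complex_ReM; apply: measurable_funB; exact: measurable_funM.
by under eq_fun do rewrite complex_ImM; apply: measurable_funD; exact: measurable_funM.
Qed.

Lemma Cmeasurable_conjC f : Cmeasurable f -> Cmeasurable (fun w => Num.conj (f w)).
Proof.
move=> [mf1 mf2]; split; first by under eq_fun do rewrite Re_conjC.
by under eq_fun do rewrite Im_conjC; exact: measurableT_comp.
Qed.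

Lemma Cmeasurable_sum (I : eqType) (s : seq I) (F : I -> T -> C) :
  (forall i, i \in s -> Cmeasurable (F i)) -> Cmeasurable (fun w => \sum_(i <- s) F i w).
Proof.
elim: s => [_|i s IH mF].
  by apply: eq_Cmeasurable (Cmeasurable_cst 0) => w; rewrite big_nil.
under eq_fun do rewrite big_cons; apply: CmeasurableD; first exact/mF/mem_head.
by apply: IH => j js; apply: mF; rewrite inE js orbT.
Qed.

Lemma Cmeasurable_prod (I : eqType) (s : seq I) (F : I -> T -> C) :
  (forall i, i \in s -> Cmeasurable (F i)) -> Cmeasurable (fun w => \prod_(i <- s) F i w).
Proof.
elim: s => [_|i s IH mF].
  by apply: eq_Cmeasurable (Cmeasurable_cst 1) => w; rewrite big_nil.
under eq_fun do rewrite big_cons; apply: CmeasurableM; first exact/mF/mem_head.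
by apply: IH => j js; apply: mF; rewrite inE js orbT.
Qed.

Lemma measurable_sqmod f : Cmeasurable f -> measurable_fun setT (fun w => sqmod (f w)).
Proof. by move=> [mf1 mf2]; apply: measurable_funD; exact: measurable_funX. Qed.

Lemma Cmeasurable_if (b : T -> bool) f g : measurable_fun setT b ->
  Cmeasurable f -> Cmeasurable g -> Cmeasurable (fun w => if b w then f w else g w).
Proof.
move=> mb [mf1 mf2] [mg1 mg2].
by split; under eq_fun do rewrite fun_if; exact: measurable_fun_ifT.
Qed.

Lemma Cmeasurable_inv f : Cmeasurable f -> Cmeasurable (fun w => (f w)^-1).
Proof.
move=> mf; apply: (eq_Cmeasurable (f := fun w => Num.conj (f w) * ((sqmod (f w)) `^ (-1))%:C)).
  move=> w; rewrite powR_inv1 ?sqmod_ge0 //.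
  have [->|f0] := eqVneq (f w) 0; first by rewrite rmorph0 mul0r invr0.
  apply: (mulfI f0); rewrite mulrA mul_conjC_sqmod mulfV // -rmorphM mulfV ?rmorph1 //.
  by apply: contraNneq f0 => fw0; rewrite -mul_conjC_eq0 mul_conjC_sqmod fw0.
apply: CmeasurableM; first exact: Cmeasurable_conjC.
apply: Cmeasurable_real; apply: (measurableT_comp (measurable_powR _)).
exact: measurable_sqmod.
Qed.

End ComplexMeasurable.

Lemma Cmeasurable_comp {R : realType} (d d' : measure_display) (T : measurableType d)
    (T' : measurableType d') (f : T -> R[i]) (h : T' -> T) :
  measurable_fun setT h -> Cmeasurable f -> Cmeasurable (fun w => f (h w)).
Proof.
move=> mh [mf1 mf2].
by split; [exact: (measurableT_comp mf1 mh) | exact: (measurableT_comp mf2 mh)].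
Qed.

Section ComplexIntegral.
Context {R : realType} {d : measure_display} {T : measurableType d}.
Variable P : probability T R.
Local Notation C := R[i].
Implicit Types f g : T -> C.

Definition Cintegrable f := Rintegrable P (fun w => complex.Re (f w)) /\
  Rintegrable P (fun w => complex.Im (f w)).

Definition Cintegral f : C :=
  (\int[P]_w complex.Re (f w)) +i* (\int[P]_w complex.Im (f w)).

Lemma eq_Cintegral f g : (forall w, f w = g w) -> Cintegral f = Cintegral g.
Proof. by move=> /funext ->. Qed.

Lemma eq_Cintegrable f g : (forall w, f w = g w) -> Cintegrable f -> Cintegrable g.
Proof. by move=> /funext ->. Qed.

Lemma Cintegrable_cst c : Cintegrable (fun=> c).
Proof. by split; exact: Rintegrable_cst. Qed.

Lemma Cintegral_cst c : Cintegral (fun=> c) = c.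
Proof. by rewrite /Cintegral !Rintegral_cstT; case: c. Qed.

Lemma Cintegral_real (f : T -> R) : Cintegral (fun w => (f w)%:C) = (\int[P]_w f w)%:C.
Proof. by rewrite /Cintegral /= Rintegral_cstT. Qed.

Lemma CintegrableD f g : Cintegrable f -> Cintegrable g -> Cintegrable (fun w => f w + g w).
Proof.
move=> [f1 f2] [g1 g2]; split.
  by apply: eq_Rintegrable (RintegrableD f1 g1) => w; rewrite raddfD.
by apply: eq_Rintegrable (RintegrableD f2 g2) => w; rewrite raddfD.
Qed.

Lemma CintegralD f g : Cintegrable f -> Cintegrable g ->
  Cintegral (fun w => f w + g w) = Cintegral f + Cintegral g.
Proof.
move=> [f1 f2] [g1 g2]; rewrite /Cintegral; apply/eqP; rewrite eq_complex /= -!RintegralD //.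
by apply/andP; split; apply/eqP; apply: eq_RintegralT => w; rewrite raddfD.
Qed.

Lemma CintegrableZ c f : Cintegrable f -> Cintegrable (fun w => c * f w).
Proof.
move=> [f1 f2]; split.
  apply: eq_Rintegrable (RintegrableB (RintegrableZ (complex.Re c) f1)
    (RintegrableZ (complex.Im c) f2)) => w.
  by rewrite complex_ReM.
apply: eq_Rintegrable (RintegrableD (RintegrableZ (complex.Re c) f2)
  (RintegrableZ (complex.Im c) f1)) => w.
by rewrite complex_ImM.
Qed.

Lemma CintegralZ c f : Cintegrable f -> Cintegral (fun w => c * f w) = c * Cintegral f.
Proof.
move=> [f1 f2]; apply/eqP; rewrite eq_complex complex_ReM complex_ImM /=; apply/andP; split;
  apply/eqP.
  rewrite -!RintegralZl // -RintegralB //; [|exact: RintegrableZ|exact: RintegrableZ].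
  by apply: eq_RintegralT => w; rewrite complex_ReM.
rewrite -!RintegralZl // -RintegralD //; [|exact: RintegrableZ|exact: RintegrableZ].
by apply: eq_RintegralT => w; rewrite complex_ImM.
Qed.

Lemma Cintegrable_sum (I : Type) (s : seq I) (Q : pred I) (F : I -> T -> C) :
  (forall i, Q i -> Cintegrable (F i)) -> Cintegrable (fun w => \sum_(i <- s | Q i) F i w).
Proof.
move=> IF; split.
  by apply: eq_Rintegrable (Rintegrable_sum s (fun i Qi => (IF i Qi).1)) => w; rewrite raddf_sum.
by apply: eq_Rintegrable (Rintegrable_sum s (fun i Qi => (IF i Qi).2)) => w; rewrite raddf_sum.
Qed.

Lemma Cintegral_sum (I : Type) (s : seq I) (Q : pred I) (F : I -> T -> C) :
  (forall i, Q i -> Cintegrable (F i)) ->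
  Cintegral (fun w => \sum_(i <- s | Q i) F i w) = \sum_(i <- s | Q i) Cintegral (F i).
Proof.
move=> IF; apply/eqP; rewrite eq_complex /= !raddf_sum /=.
rewrite -!Rintegral_sum; [|by move=> i /IF[]|by move=> i /IF[]].
by apply/andP; split; apply/eqP; apply: eq_RintegralT => w; rewrite raddf_sum.
Qed.

Lemma Cintegral_conjC f :
  Cintegrable f -> Cintegral (fun w => Num.conj (f w)) = Num.conj (Cintegral f).
Proof.
move=> [f1 f2]; rewrite /Cintegral /=; congr (_ +i* _).
  by apply: eq_RintegralT => w; rewrite Re_conjC.
by rewrite -RintegralN //; apply: eq_RintegralT => w; rewrite Im_conjC.
Qed.

Lemma sqmod_le_Cintegrable f (g : T -> R) : Cmeasurable f -> Rintegrable P g ->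
  (forall w, sqmod (f w) <= g w) -> Cintegrable f.
Proof.
move=> [mf1 mf2] Ig fg; have I1g := RintegrableD (Rintegrable_cst P 1) Ig.
split; apply: Rintegrable_le I1g => // w; have := fg w; rewrite /sqmod ler_norml.
  by have := sqr_ge0 (complex.Im (f w)); set x := complex.Re _ => ? ?; nra.
by have := sqr_ge0 (complex.Re (f w)); set x := complex.Im _ => ? ?; nra.
Qed.

End ComplexIntegral.

Definition part (R : rcfType) (b : bool) (z : R[i]) : R :=
  if b then complex.Re z else complex.Im z.

(* [kap] is the pseudo-variance, equal to 1 for real entries and to 0 for complex ones. *)
Record gaussian_entry {R : realType} {d : measure_display} {T : measurableType d}
  (P : probability T R) (kap : R) (z : T -> R[i]) : Prop := GaussianEntry {
  entry_measurable : Cmeasurable z;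
  entry_sqmod_integrable : forall k, Rintegrable P (fun w => sqmod (z w) ^+ k);
  entry_mean : Cintegral P z = 0;
  entry_pseudo_variance : Cintegral P (fun w => z w * z w) = kap%:C;
  entry_variance : Cintegral P (fun w => z w * Num.conj (z w)) = 1;
  entry_fourth_moment :
    Cintegral P (fun w => (z w * Num.conj (z w)) * (z w * Num.conj (z w))) = (2 + kap)%:C;
  entry_eighth_moment : \int[P]_w (sqmod (z w) ^+ 4) <= 24 * 2 ^+ 10;
  entry_subgaussian : forall (b : bool) (t : R),
    (\int[P]_w (expR (t * part b (z w)))%:E <= (expR (t ^+ 2 / 2))%:E)%E
}.

Lemma exprD_le (R : realDomainType) (a b : R) k : 0 <= a -> 0 <= b ->
  (a + b) ^+ k <= 2 ^+ k * (a ^+ k + b ^+ k).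
Proof.
move=> a0 b0; wlog ab : a b a0 b0 / a <= b.
  move=> le_wlog; have [ab|/ltW ba] := leP a b; first exact: le_wlog.
  by rewrite addrC [a ^+ k + _]addrC; exact: le_wlog.
apply: (@le_trans _ _ ((2 * b) ^+ k)); last first.
  by rewrite exprMn ler_wpM2l ?exprn_ge0 // lerDr exprn_ge0.
apply: lerXn2r; rewrite ?nnegrE ?addr_ge0 ?mulr_ge0 //.
by rewrite mulr_natl mulr2n lerD2r.
Qed.

Section GaussianEntries.
Context {R : realType} {d : measure_display} {T : measurableType d}.
Variable P : probability T R.

Lemma real_gaussian_entry (y : T -> R) :
  is_normal P 0 1 y -> gaussian_entry P 1 (fun w => (y w)%:C).
Proof.
move=> Ny; have [my _] := Ny.
have Iy k := normal_moment_integrable ltr01 Ny k.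
have [int_y2 int_y4] := normal_moments24 ltr01 Ny.
have int_y1 := normal_moment_odd ltr01 Ny (k := 1) isT.
have mulyyE w : (y w)%:C * Num.conj (y w)%:C = (y w ^+ 2)%:C by rewrite mul_conjC_sqmod sqmod_real.
split.
- exact: Cmeasurable_real.
- by move=> k; apply: eq_Rintegrable (Iy (2 * k)%N) => w; rewrite sqmod_real exprM.
- by rewrite Cintegral_real; congr (_%:C); rewrite -[RHS]int_y1; apply: eq_RintegralT => w;
    rewrite expr1.
- rewrite (eq_Cintegral P (g := fun w => (y w ^+ 2)%:C)) ?Cintegral_real ?int_y2 // => w.
  by rewrite -rmorphM expr2.
- by rewrite (eq_Cintegral P (g := fun w => (y w ^+ 2)%:C)) ?Cintegral_real ?int_y2.
- rewrite (eq_Cintegral P (g := fun w => (y w ^+ 4)%:C)) ?Cintegral_real ?int_y4 => [|w].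
    by rewrite expr1n mulr1; congr (_%:C); ring.
  by rewrite mulyyE -rmorphM -exprD.
- rewrite (eq_RintegralT P (g := fun w => y w ^+ (2 * 4))) => [|w];
    last by rewrite sqmod_real exprM.
  apply: le_trans (normal_moment_even ltr01 Ny 4).2 _.
  by rewrite mulr1 !factS fact0; lra.
- case=> t; first by rewrite (normal_mgf ltr01 Ny) mulr1.
  under eq_integral do rewrite /part /= mulr0 expR0.
  rewrite integral_cst //= probability_setT mule1 lee_fin -[leLHS]expR0 ler_expR.
  by rewrite mulr_ge0 ?sqr_ge0.
Qed.

Section ComplexEntry.
Variable z : T -> R[i].
Hypothesis normal_z : is_complex_normal P z.

Let half_gt0 : 0 < 1 / 2 :> R. Proof. by lra. Qed.
Let X b w := part b (z w).

Let normal_part b : is_normal P 0 (1 / 2) (X b).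
Proof. by case: normal_z => N1 N2 _; case: b. Qed.

Let measurable_part b : measurable_fun setT (X b).
Proof. by case: (normal_part b). Qed.

Let Cmeasurable_z : Cmeasurable z.
Proof. by split; [exact: (measurable_part true) | exact: (measurable_part false)]. Qed.

Let part_integrable b k : Rintegrable P (fun w => X b w ^+ k).
Proof. exact: normal_moment_integrable half_gt0 (normal_part b) k. Qed.

Let part_mean b : \int[P]_w X b w = 0.
Proof.
rewrite -(normal_moment_odd half_gt0 (normal_part b) (k := 1) isT).
by apply: eq_RintegralT => w; rewrite expr1.
Qed.

Let part_moments24 b : \int[P]_w (X b w ^+ 2) = 1 / 2 /\ \int[P]_w (X b w ^+ 4) = 3 * (1 / 2) ^+ 2.
Proof. exact: normal_moments24 half_gt0 (normal_part b). Qed.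

Let parts_product k l : Rintegrable P (fun w => X true w ^+ k * X false w ^+ l) /\
  \int[P]_w (X true w ^+ k * X false w ^+ l) =
  \int[P]_w (X true w ^+ k) * \int[P]_w (X false w ^+ l).
Proof.
have indepX : mutually_independent P X by case: normal_z.
have mpow b m : coord_measurable X [set b]%SET (fun w => X b w ^+ m).
  by apply: measurable_funX; apply: measurable_coord; rewrite inE.
apply: (RintegralM_independent measurable_part indepX _ (mpow true k) (mpow false l)) => //.
by rewrite disjoints1 inE.
Qed.

Let sqmod_powerE w k : sqmod (z w) ^+ k <= 2 ^+ k * (X true w ^+ (2 * k) + X false w ^+ (2 * k)).
Proof. by rewrite !exprM; apply: exprD_le; exact: sqr_ge0. Qed.

Let power_sum_integrable k :
  Rintegrable P (fun w => 2 ^+ k * (X true w ^+ (2 * k) + X false w ^+ (2 * k))).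
Proof. by apply/RintegrableZ/RintegrableD; exact: part_integrable. Qed.

Let sqmod_integrable k : Rintegrable P (fun w => sqmod (z w) ^+ k).
Proof.
apply: Rintegrable_le (power_sum_integrable k) => [|w].
  by apply: measurable_funX; exact: measurable_sqmod.
by rewrite ger0_norm ?exprn_ge0 ?sqmod_ge0.
Qed.

Let pseudo_variance : Cintegral P (fun w => z w * z w) = 0.
Proof.
rewrite /Cintegral; apply/eqP; rewrite eq_complex /=; apply/andP; split; apply/eqP.
  rewrite (eq_RintegralT P (g := fun w => X true w ^+ 2 - X false w ^+ 2)) => [|w].
    rewrite RintegralB //; [|exact: part_integrable|exact: part_integrable].
    by rewrite !(part_moments24 _).1 subrr.
  by rewrite complex_ReM !expr2.
rewrite (eq_RintegralT P (g := fun w => 2 * (X true w ^+ 1 * X false w ^+ 1))) => [|w].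
  rewrite RintegralZl ?(parts_product 1 1).2 //; last exact: (parts_product 1 1).1.
  by under eq_RintegralT do rewrite expr1; rewrite part_mean mul0r mulr0.
by rewrite complex_ImM /X /part; ring.
Qed.

Let variance : Cintegral P (fun w => z w * Num.conj (z w)) = 1.
Proof.
rewrite (eq_Cintegral P (g := fun w => (X true w ^+ 2 + X false w ^+ 2)%:C)) => [|w].
  rewrite Cintegral_real RintegralD //; [|exact: part_integrable|exact: part_integrable].
  by rewrite !(part_moments24 _).1; congr (_%:C); field.
by rewrite mul_conjC_sqmod.
Qed.

Let fourth_moment :
  Cintegral P (fun w => (z w * Num.conj (z w)) * (z w * Num.conj (z w))) = (2 + 0)%:C.
Proof.
rewrite (eq_Cintegral P (g := fun w => (X true w ^+ 4 + X false w ^+ 4 +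
    2 * (X true w ^+ 2 * X false w ^+ 2))%:C)) => [|w].
  have [I22 int22] := parts_product 2 2.
  rewrite Cintegral_real RintegralD //; last by exact: RintegrableZ.
    rewrite RintegralD //; [|exact: part_integrable|exact: part_integrable].
    by rewrite RintegralZl // int22 !(part_moments24 _).1 !(part_moments24 _).2; congr (_%:C);
      field.
  by apply: RintegrableD; exact: part_integrable.
by rewrite mul_conjC_sqmod -rmorphM; congr (_%:C); rewrite /sqmod /X /part; ring.
Qed.

Let eighth_moment : \int[P]_w (sqmod (z w) ^+ 4) <= 24 * 2 ^+ 10.
Proof.
apply: le_trans (ler_Rintegral (sqmod_integrable 4) (power_sum_integrable 4)
  (sqmod_powerE ^~ 4%N)) _.
have I8 b := part_integrable b (2 * 4).
rewrite RintegralZl //; last exact: RintegrableD.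
rewrite RintegralD //; [|exact: I8|exact: I8].
have := (normal_moment_even half_gt0 (normal_part true) 4).2.
have := (normal_moment_even half_gt0 (normal_part false) 4).2.
rewrite (_ : 4 * (1 / 2) = 2 :> R); last by field.
by rewrite !factS fact0; lra.
Qed.

Lemma complex_gaussian_entry : gaussian_entry P 0 z.
Proof.
split=> //; first by rewrite /Cintegral (part_mean true) (part_mean false).
move=> b t; rewrite (normal_mgf half_gt0 (normal_part b)) lee_fin ler_expR.
by have := sqr_ge0 t; lra.
Qed.

End ComplexEntry.

Definition entry_pseudo_variance_of (k : entry_kind) : R :=
  match k with RealEntries => 1 | ComplexEntries => 0 end.

Lemma gaussian_matrix_entries (k : entry_kind) (n p : nat) (G : T -> 'M[R[i]]_(n, p)) :
  gaussian_matrix k P G ->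
  (forall ij : 'I_n * 'I_p,
    gaussian_entry P (entry_pseudo_variance_of k) (fun w => G w ij.1 ij.2)) /\
  mutually_independent P (fun (ij : 'I_n * 'I_p) w =>
    (complex.Re (G w ij.1 ij.2), complex.Im (G w ij.1 ij.2))).
Proof.
case: k => /= [[G0 [N0 indep0] GE]|[N indep]]; last by split=> // ij; exact: complex_gaussian_entry.
have entryE ij w : G w ij.1 ij.2 = (G0 w ij.1 ij.2)%:C by rewrite GE mxE.
split=> [ij|J B mB].
  have := real_gaussian_entry (N0 ij.1 ij.2).
  by congr (gaussian_entry _ _ _); apply/funext => w; rewrite entryE.
pose B' ij := [set x : R | B ij (x, 0)].
have mB' ij : measurable (B' ij).
  have mpair : measurable_fun setT (fun x : R => (x, 0 : R)).
    apply/measurable_fun_pairP; split; first exact: measurable_id.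
    exact: measurable_cst.
  by have := mpair measurableT _ (mB ij); rewrite setTI.
have preimageE ij : (fun w => (complex.Re (G w ij.1 ij.2), complex.Im (G w ij.1 ij.2))) @^-1` B ij =
    (fun w => G0 w ij.1 ij.2) @^-1` B' ij.
  by apply/seteqP; split=> w /=; rewrite entryE.
have := indep0 J B' mB'; under eq_bigcapr do rewrite -preimageE.
by under eq_bigr do rewrite -preimageE.
Qed.

End GaussianEntries.

(** * Wick's formula *)

Lemma prodr_le_sum_exprn (R : realDomainType) (I : eqType) (s : seq I) (F : I -> R) :
  (forall i, 0 <= F i) -> \prod_(i <- s) F i <= 1 + \sum_(i <- s) F i ^+ size s.
Proof.
move=> F_ge0; pose M := \big[Num.max/0]_(i <- s) F i.
apply: (@le_trans _ _ (M ^+ size s)).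
  have -> : M ^+ size s = \prod_(i <- s) M by rewrite big_const_seq count_predT iter_mulr_1.
  rewrite big_seq [leRHS]big_seq; apply: ler_prod => i si; rewrite F_ge0 /=.
  exact: le_bigmax_seq.
rewrite /M; move: (size s) => n; elim: s {M} => [|i s IH].
  by rewrite !big_nil addr0; case: n => [|n]; rewrite ?expr0 // expr0n.
rewrite !big_cons; case: (leP (F i)) => _; last first.
  by rewrite addrCA lerDl addr_ge0 // sumr_ge0 // => j _; rewrite exprn_ge0.
by apply: le_trans IH _; rewrite lerD2l lerDr exprn_ge0.
Qed.

Section IndependentEntries.
Context {R : realType} {d : measure_display} {T : measurableType d}.
Local Notation C := R[i].
Variables (P : probability T R) (kap : R) (I : finType) (g : I -> T -> C).

Definition re_im (e : I) (w : T) : (R * R)%type := (complex.Re (g e w), complex.Im (g e w)).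

Definition coord_Cmeasurable (J : {set I}) (f : T -> C) :=
  Cmeasurable (f : coord_sigma re_im J -> C).

(* [letter (e, b)] is the entry [e], conjugated if [b]. *)
Definition letter (x : I * bool) (w : T) : C := if x.2 then Num.conj (g x.1 w) else g x.1 w.

Definition word (s : seq (I * bool)) (w : T) : C := \prod_(x <- s) letter x w.

Lemma coord_Cmeasurable_entry (J : {set I}) e : e \in J -> coord_Cmeasurable J (g e).
Proof. by move=> /(measurable_coord (X := re_im))/measurable_fun_pairP[]. Qed.

Lemma coord_measurable_part (b : bool) (J : {set I}) e :
  e \in J -> coord_measurable re_im J (fun w => part b (g e w)).
Proof. by move=> /coord_Cmeasurable_entry[]; case: b. Qed.

Lemma coord_Cmeasurable_word (J : {set I}) s :
  (forall x, x \in s -> x.1 \in J) -> coord_Cmeasurable J (word s).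
Proof.
move=> sJ; apply: (@Cmeasurable_prod _ _ (coord_sigma re_im J)) => -[e b] /sJ /= eJ.
rewrite /letter /=; case: b => /=; last exact: coord_Cmeasurable_entry.
exact/Cmeasurable_conjC/coord_Cmeasurable_entry.
Qed.

Lemma word_cat s t w : word (s ++ t) w = word s w * word t w.
Proof. exact: big_cat. Qed.

Hypothesis entries : forall e, gaussian_entry P kap (g e).
Hypothesis indep : mutually_independent P re_im.

Lemma measurable_re_im e : measurable_fun setT (re_im e).
Proof. by apply/measurable_fun_pairP; split; case: (entry_measurable (entries e)). Qed.

Lemma Cmeasurable_word s : Cmeasurable (word s).
Proof.
apply: Cmeasurable_prod => -[e b] _; rewrite /letter /=.
by case: b; [apply: Cmeasurable_conjC|]; exact: entry_measurable (entries e).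
Qed.

Lemma Cintegrable_word s : Cintegrable P (word s).
Proof.
pose bound w : R := 1 + \sum_(x <- s) sqmod (g x.1 w) ^+ size s.
apply: (@sqmod_le_Cintegrable _ _ _ _ _ bound); first exact: Cmeasurable_word.
  apply: RintegrableD; first exact: Rintegrable_cst.
  by apply: Rintegrable_sum => x _; exact: entry_sqmod_integrable (entries _) _.
move=> w; rewrite sqmod_prod (eq_bigr (fun x => sqmod (g x.1 w))) => [|x _].
  by apply: prodr_le_sum_exprn => x; exact: sqmod_ge0.
by rewrite /letter; case: ifP => _; rewrite ?sqmod_conjC.
Qed.

Lemma CintegralM_independent (J K : {set I}) (f h : T -> C) : [disjoint J & K]%B ->
  coord_Cmeasurable J f -> coord_Cmeasurable K h -> Cintegrable P f -> Cintegrable P h ->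
  Cintegral P (fun w => f w * h w) = Cintegral P f * Cintegral P h.
Proof.
move=> JK [mf1 mf2] [mh1 mh2] [f1 f2] [h1 h2].
have [I11 E11] := RintegralM_independent measurable_re_im indep JK mf1 mh1 f1 h1.
have [I12 E12] := RintegralM_independent measurable_re_im indep JK mf1 mh2 f1 h2.
have [I21 E21] := RintegralM_independent measurable_re_im indep JK mf2 mh1 f2 h1.
have [I22 E22] := RintegralM_independent measurable_re_im indep JK mf2 mh2 f2 h2.
apply/eqP; rewrite eq_complex complex_ReM complex_ImM /= -E11 -E12 -E21 -E22.
rewrite -RintegralB // -RintegralD //.
by apply/andP; split; apply/eqP; apply: eq_RintegralT => w; rewrite ?complex_ReM ?complex_ImM.
Qed.

Lemma Cintegral_word_cat (s t : seq (I * bool)) : (forall x y, x \in s -> y \in t -> x.1 != y.1) ->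
  Cintegral P (word (s ++ t)) = Cintegral P (word s) * Cintegral P (word t).
Proof.
move=> st; pose support (r : seq (I * bool)) : {set I} := [set e in [seq x.1 | x <- r]]%SET.
rewrite (eq_Cintegral P (word_cat s t)).
apply: (CintegralM_independent (J := support s) (K := support t)).
- rewrite disjoint_subset; apply/fintype.subsetP => e; rewrite !inE => /mapP[x xs ->].
  by apply/mapP => -[y yt xy]; have := st x y xs yt; rewrite xy eqxx.
- by apply: coord_Cmeasurable_word => x xs; rewrite inE map_f.
- by apply: coord_Cmeasurable_word => x xs; rewrite inE map_f.
- exact: Cintegrable_word.
- exact: Cintegrable_word.
Qed.

Lemma Cintegral_letter x : Cintegral P (word [:: x]) = 0.
Proof.
case: x => e b; have mean0 := entry_mean (entries e).
rewrite (eq_Cintegral P (g := letter (e, b))) => [|w]; last by rewrite /word big_seq1.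
rewrite /letter /=; case: b => //; rewrite Cintegral_conjC ?mean0 ?conjC0 //.
by apply: eq_Cintegrable (Cintegrable_word [:: (e, false)]) => w; rewrite /word big_seq1.
Qed.

Lemma Cintegral_isolated_letter x s : x.1 \notin [seq y.1 | y <- s] ->
  Cintegral P (word (x :: s)) = 0.
Proof.
move=> xs; rewrite (Cintegral_word_cat (s := [:: x]) (t := s)) ?Cintegral_letter ?mul0r //.
by move=> y z; rewrite inE => /eqP -> zs; apply: contraNneq xs => ->; exact: map_f.
Qed.

Lemma wick2 a b : Cintegral P (fun w => g a w * Num.conj (g b w)) = (a == b)%:R.
Proof.
case: eqVneq => [->|ab]; first exact: entry_variance (entries b).
rewrite mulr0n -(@Cintegral_isolated_letter (a, false) [:: (b, true)]) ?inE //.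
by apply: eq_Cintegral => w; rewrite /word !big_cons big_nil mulr1.
Qed.

Section FourthMoment.
Hypothesis kap_idem : kap * kap = kap.

Let quartic (a b c e : I) := [:: (a, false); (b, true); (c, false); (e, true)].

Let quarticE a b c e w :
  word (quartic a b c e) w = g a w * Num.conj (g b w) * (g c w * Num.conj (g e w)).
Proof. by rewrite /word !big_cons big_nil mulr1 !mulrA. Qed.

Let word2E x y w : word [:: x; y] w = letter x w * letter y w.
Proof. by rewrite /word !big_cons big_nil mulr1. Qed.

Let quartic_isolated x y z t a b c e : word (quartic a b c e) =1 word [:: x; y; z; t] ->
  x.1 != y.1 -> x.1 != z.1 -> x.1 != t.1 -> Cintegral P (word (quartic a b c e)) = 0.
Proof.
move=> /(eq_Cintegral P) -> xy xz xt.
by rewrite Cintegral_isolated_letter // !inE !negb_or xy xz xt.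
Qed.

Let quartic_isolated_first a b c e : a != b -> a != c -> a != e ->
  Cintegral P (word (quartic a b c e)) = 0.
Proof. exact: (@quartic_isolated (a, false) (b, true) (c, false) (e, true)). Qed.

Let quartic_isolated_second a b c e : b != a -> b != c -> b != e ->
  Cintegral P (word (quartic a b c e)) = 0.
Proof.
apply: (@quartic_isolated (b, true) (a, false) (c, false) (e, true)) => w.
by rewrite /word !big_cons; ring.
Qed.

Let quartic_isolated_third a b c e : c != a -> c != b -> c != e ->
  Cintegral P (word (quartic a b c e)) = 0.
Proof.
apply: (@quartic_isolated (c, false) (a, false) (b, true) (e, true)) => w.
by rewrite /word !big_cons; ring.
Qed.

Let quartic_isolated_fourth a b c e : e != a -> e != b -> e != c ->
  Cintegral P (word (quartic a b c e)) = 0.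
Proof.
apply: (@quartic_isolated (e, true) (a, false) (b, true) (c, false)) => w.
by rewrite /word !big_cons; ring.
Qed.

Let quartic_pairs x y z t a b c e : word (quartic a b c e) =1 word [:: x; y; z; t] ->
  x.1 = y.1 -> z.1 = t.1 -> x.1 != z.1 ->
  Cintegral P (word (quartic a b c e)) =
  Cintegral P (word [:: x; y]) * Cintegral P (word [:: z; t]).
Proof.
move=> /(eq_Cintegral P) -> xy zt xz.
rewrite (Cintegral_word_cat (s := [:: x; y]) (t := [:: z; t])) // => u v.
by rewrite !inE => /orP[]/eqP-> /orP[]/eqP->; rewrite -?xy -?zt.
Qed.

Let variance_word a : Cintegral P (word [:: (a, false); (a, true)]) = 1.
Proof. by rewrite (eq_Cintegral P (word2E _ _)) (entry_variance (entries a)). Qed.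

Let pseudo_variance_word a b : Cintegral P (word [:: (a, b); (a, b)]) = kap%:C.
Proof.
have squareE : Cintegral P (word [:: (a, false); (a, false)]) = kap%:C.
  by rewrite (eq_Cintegral P (word2E _ _)) (entry_pseudo_variance (entries a)).
case: b => //; rewrite -[RHS]conjC_real_complex -squareE -Cintegral_conjC;
  last exact: Cintegrable_word.
by apply: eq_Cintegral => w; rewrite !word2E rmorphM.
Qed.

Lemma wick4 a b c e :
  Cintegral P (fun w => g a w * Num.conj (g b w) * (g c w * Num.conj (g e w))) =
  ((a == b) && (c == e))%:R + ((a == e) && (b == c))%:R + kap%:C * ((a == c) && (b == e))%:R.
Proof.
rewrite -(eq_Cintegral P (quarticE a b c e)).
case: (eqVneq a b) => [<-{b}|ab].
- case: (eqVneq c e) => [<-{e}|ce].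
  + case: (eqVneq a c) => [<-{c}|ac].
      by rewrite (eq_Cintegral P (quarticE _ _ _ _)) (entry_fourth_moment (entries a)) rmorphD
        rmorph_nat mulr1 -natrD.
    rewrite (@quartic_pairs (a, false) (a, true) (c, false) (c, true)) //.
    by rewrite !variance_word mulr1 mulr0 !addr0.
  + case: (eqVneq a c) => [<-{c}|ac] in ce *.
      by rewrite quartic_isolated_fourth ?[e == _]eq_sym // (negPf ce) !andbF mulr0 !addr0.
    by rewrite quartic_isolated_third ?[c == a]eq_sym // !andbF mulr0 !addr0.
- case: (eqVneq a e) => [<-{e}|ae].
    case: (eqVneq b c) => [<-{c}|bc].
      rewrite (@quartic_pairs (a, false) (a, true) (b, false) (b, true)) // => [|w].
        by rewrite !variance_word (negPf ab) mulr1 mulr0 addr0 add0r.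
      by rewrite /word !big_cons; ring.
    by rewrite quartic_isolated_second ?[b == a]eq_sym // (negPf ab) !andbF mulr0 !addr0.
  case: (eqVneq a c) => [<-{c}|ac].
    case: (eqVneq b e) => [<-{e}|be] in ae *.
      rewrite (@quartic_pairs (a, false) (a, false) (b, true) (b, true)) // => [|w].
        by rewrite !pseudo_variance_word -rmorphM kap_idem mulr1 !add0r.
      by rewrite /word !big_cons; ring.
    by rewrite quartic_isolated_second ?[b == a]eq_sym // mulr0 !addr0.
  by rewrite quartic_isolated_first // mulr0 !addr0.
Qed.

End FourthMoment.

Lemma coord_measurable_part_sum (b : bool) (t : I -> R) (s : seq I) (J : {set I}) :
  {subset s <= J} -> coord_measurable re_im J (fun w => \sum_(e <- s) t e * part b (g e w)).
Proof.
move=> sJ.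
have restrictE w : \sum_(e <- s) t e * part b (g e w) =
    \sum_(e <- s) (if e \in s then t e * part b (g e w) else 0).
  by apply: eq_big_seq => e ->.
rewrite (funext restrictE).
apply: measurable_sum => e; case es: (e \in s); last exact: measurable_cst.
by apply: measurable_funM => //; exact: coord_measurable_part (sJ _ es).
Qed.

Lemma subgaussian_sum (b : bool) (t : I -> R) (s : seq I) : uniq s ->
  (\int[P]_w (expR (\sum_(e <- s) t e * part b (g e w)))%:E <=
   (expR (\sum_(e <- s) t e ^+ 2 / 2))%:E)%E.
Proof.
elim: s => [_|e s IH /= /andP[es us]].
  under eq_integral do rewrite big_nil expR0.
  by rewrite big_nil expR0 integral_cst //= probability_setT mule1.
under eq_integral do rewrite big_cons expRD.
pose rest : {set I} := [set x in s]%SET.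
have disj : [disjoint [set e]%SET & rest]%B by rewrite disjoints1 inE.
rewrite (ge0_integralM_independent measurable_re_im indep disj).
- rewrite big_cons expRD EFinM; apply: lee_pmul; rewrite ?IH //.
  + by apply: integral_ge0 => w _; rewrite lee_fin expR_ge0.
  + by apply: integral_ge0 => w _; rewrite lee_fin expR_ge0.
  + exact: entry_subgaussian (entries e) b (t e).
- apply: measurableT_comp => //; apply: measurable_funM => //.
  by apply: coord_measurable_part; rewrite inE.
- apply: measurableT_comp => //; apply: coord_measurable_part_sum.
  by move=> x xs; rewrite inE.
- by move=> w; exact: expR_ge0.
- by move=> w; exact: expR_ge0.
Qed.

End IndependentEntries.

(** * Operator norm of a column increment *)

Lemma ler_add_div_pow2 (R : archiRealFieldType) (x y b : R) :
  (forall k : nat, x <= y + b / 2 ^+ k) -> x <= y.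
Proof.
move=> xyb; rewrite leNgt; apply/negP => yx.
have gap_gt0 : 0 < x - y by rewrite subr_gt0.
pose k := Num.truncn (b / (x - y)).
have := xyb k; apply/negP; rewrite -ltNge -ltrBrDl ltr_pdivrMr ?exprn_gt0 // -ltr_pdivrMl // mulrC.
apply: (@lt_le_trans _ _ (k.+1)%:R); first exact: truncnS_gt.
by rewrite -natrX ler_nat; exact: ltn_expl.
Qed.

Section BilinearForm.
Variables (R : rcfType) (d : nat).
Implicit Types (x y : 'I_d -> R) (A : 'I_d -> 'I_d -> R).

Definition bilform A x y : R := \sum_i \sum_k x i * y k * A i k.

Definition sumsq x : R := \sum_i x i ^+ 2.

Lemma sumsq_ge0 x : 0 <= sumsq x.
Proof. by apply: sumr_ge0 => i _; exact: sqr_ge0. Qed.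

Lemma sumsqZ c x : sumsq (fun i => c * x i) = c ^+ 2 * sumsq x.
Proof. by rewrite /sumsq mulr_sumr; apply: eq_bigr => i _; rewrite exprMn. Qed.

Lemma sumsq_le0 x : sumsq x <= 0 -> forall i, x i = 0.
Proof.
move=> x_le0 i; have xx_ge0 (k : 'I_d) : true -> 0 <= x k ^+ 2 by move=> _; exact: sqr_ge0.
have /(psumr_eq0P xx_ge0)/(_ i isT)/eqP : sumsq x = 0 by apply/eqP; rewrite eq_le x_le0 sumsq_ge0.
by rewrite sqrf_eq0 => /eqP.
Qed.

Lemma sumsq_coord_le1 x i : sumsq x <= 1 -> `|x i| <= 1.
Proof.
move=> x1; rewrite -(@ler_pXn2r _ 2) ?nnegrE // expr1n real_normK ?num_real //.
apply: le_trans x1; rewrite /sumsq (bigD1 i) //= lerDl.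
by apply: sumr_ge0 => j _; exact: sqr_ge0.
Qed.

Lemma bilformDl A x x' y : bilform A (fun i => x i + x' i) y = bilform A x y + bilform A x' y.
Proof.
rewrite /bilform -big_split; apply: eq_bigr => i _; rewrite -big_split.
by apply: eq_bigr => k _ /=; rewrite !mulrDl.
Qed.

Lemma bilform_tr A x y : bilform (fun i k => A k i) x y = bilform A y x.
Proof.
rewrite /bilform exchange_big; apply: eq_bigr => i _; apply: eq_bigr => k _ /=.
by rewrite [x k * _]mulrC.
Qed.

Lemma bilformDr A x y y' : bilform A x (fun i => y i + y' i) = bilform A x y + bilform A x y'.
Proof. by rewrite -![bilform A x _]bilform_tr bilformDl. Qed.

Lemma bilformZl A c x y : bilform A (fun i => c * x i) y = c * bilform A x y.
Proof.
rewrite /bilform mulr_sumr; apply: eq_bigr => i _; rewrite mulr_sumr.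
by apply: eq_bigr => k _ /=; rewrite !mulrA.
Qed.

Lemma bilformZr A c x y : bilform A x (fun i => c * y i) = c * bilform A x y.
Proof. by rewrite -![bilform A x _]bilform_tr bilformZl. Qed.

Lemma bilformN A x y : bilform (fun i k => - A i k) x y = bilform A (fun i => -1 * x i) y.
Proof. by apply: eq_bigr => i _; apply: eq_bigr => k _; ring. Qed.

Definition bilform_le (c : R) A :=
  forall x y, bilform A x y <= c * Num.sqrt (sumsq x) * Num.sqrt (sumsq y).

Lemma bilform_le_tr c A : bilform_le c A -> bilform_le c (fun i k => A k i).
Proof. by move=> leA x y; rewrite bilform_tr mulrAC. Qed.

Lemma bilform_leN c A : bilform_le c A -> bilform_le c (fun i k => - A i k).
Proof.
by move=> leA x y; rewrite bilformN; apply: le_trans (leA _ _) _; rewrite sumsqZ sqrrN expr1n mul1r.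
Qed.

Lemma bilform_le_unit_ball c A : 0 <= c ->
  (forall x y, sumsq x <= 1 -> sumsq y <= 1 -> bilform A x y <= c) -> bilform_le c A.
Proof.
move=> c0 le_ball x y.
have [/sumsq_le0 x0|x_gt0] := leP (sumsq x) 0.
  rewrite /bilform big1 ?mulr_ge0 ?sqrtr_ge0 // => i _.
  by rewrite big1 // => k _; rewrite x0 !mul0r.
have [/sumsq_le0 y0|y_gt0] := leP (sumsq y) 0.
  rewrite /bilform big1 ?mulr_ge0 ?sqrtr_ge0 // => i _.
  by rewrite big1 // => k _; rewrite y0 mulr0 mul0r.
have normalized z : 0 < sumsq z -> sumsq (fun i => (Num.sqrt (sumsq z))^-1 * z i) <= 1.
  by move=> z_gt0; rewrite sumsqZ exprVn sqr_sqrtr ?sumsq_ge0 // mulVf ?gt_eqF.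
have := le_ball _ _ (normalized _ x_gt0) (normalized _ y_gt0); rewrite bilformZl bilformZr.
rewrite mulrA -invfM ler_pdivrMl ?mulr_gt0 ?sqrtr_gt0 // => /le_trans; apply.
by rewrite mulrC mulrA.
Qed.

Lemma bilform_le_sumsq (c : R) A x : 0 <= c -> bilform_le c A ->
  sumsq (fun k => \sum_i x i * A i k) <= c ^+ 2 * sumsq x.
Proof.
move=> c0 leA; set w := fun k => _.
have w_sqr : sumsq w = bilform A x w.
  rewrite /bilform exchange_big; apply: eq_bigr => k _ /=.
  by rewrite expr2 {2}/w mulr_sumr; apply: eq_bigr => i _; ring.
have sqrtK z : Num.sqrt (sumsq z) ^+ 2 = sumsq z by rewrite sqr_sqrtr ?sumsq_ge0.
have := leA x w; rewrite -w_sqr -(sqrtK w) -(sqrtK x) sqrtK sqrtK.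
rewrite -{1}(sqrtK w); set a := Num.sqrt (sumsq w); set b := Num.sqrt (sumsq x).
have a0 : 0 <= a by exact: sqrtr_ge0.
have b0 : 0 <= b by exact: sqrtr_ge0.
rewrite -(sqrtK w) -(sqrtK x) -exprMn -/a -/b => ab.
rewrite ler_sqr ?nnegrE ?mulr_ge0 //.
have [a_le0|a_gt0] := leP a 0; first by rewrite (le_trans a_le0) ?mulr_ge0.
by move: ab; rewrite expr2 ler_pM2r.
Qed.

End BilinearForm.

Section Net.
Variables (R : realType) (d n : nat).
Hypotheses (n_gt0 : (0 < n)%N) (fine_mesh : (16 * d <= n ^ 2)%N).
Implicit Types (x y : 'I_d -> R) (A : 'I_d -> 'I_d -> R) (f : {ffun 'I_d -> 'I_(2 * n).+1}).

(* The points of [-n, n]^d with integer coordinates. *)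
Definition grid f (i : 'I_d) : R := (f i)%:R - n%:R.

Let n_gt0R : 0 < n%:R :> R. Proof. by rewrite ltr0n. Qed.

Let mulVn2 : n%:R^-1 ^+ 2 * n%:R ^+ 2 = 1 :> R.
Proof. by rewrite -exprMn mulVf ?expr1n // gt_eqF. Qed.

(* Rounding towards 0, so that grid points do not leave the ball. *)
Lemma round_toward0 (s : R) : `|s| <= n%:R -> exists m : 'I_(2 * n).+1,
  `|m%:R - n%:R| <= `|s| /\ `|s - (m%:R - n%:R)| <= 1.
Proof.
move=> s_le; have r_ge0 := normr_ge0 s.
set r := Num.truncn `|s|; have /andP[rs sr] := truncn_itv r_ge0.
have rn : (r <= n)%N by rewrite -(ler_nat R) (le_trans rs).
have s_r : `| `|s| - r%:R| <= 1.
  by rewrite ger0_norm ?subr_ge0 // lerBlDl natr1 ltW.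
have [s0|s0] := leP 0 s.
  have lt_m : (n + r < (2 * n).+1)%N by lia.
  exists (Ordinal lt_m); rewrite /= natrD addrC addKr normr_nat; split=> //.
  by move: s_r; rewrite (ger0_norm s0).
have lt_m : (n - r < (2 * n).+1)%N by lia.
exists (Ordinal lt_m); rewrite /= natrB // addrAC subrr add0r normrN normr_nat; split=> //.
by move: s_r; rewrite (ltr0_norm s0) -normrN opprD !opprK.
Qed.

Lemma grid_approximation x : sumsq x <= 1 -> exists f,
  sumsq (grid f) <= n%:R ^+ 2 * sumsq x /\
  sumsq (fun i => x i - n%:R^-1 * grid f i) <= 4^-1 ^+ 2.
Proof.
move=> x1.
have scaled_le i : `|n%:R * x i| <= n%:R.
  by rewrite normrM normr_nat ler_piMr // sumsq_coord_le1.
have [f fP] := choice (fun i => round_toward0 (scaled_le i)).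
exists [ffun i => f i]; split.
  rewrite /sumsq mulr_sumr; apply: ler_sum => i _; rewrite /grid ffunE -exprMn.
  by rewrite -[leLHS]real_normK ?num_real // -[leRHS]real_normK ?num_real // lerXn2r ?nnegrE //;
    case: (fP i).
apply: (@le_trans _ _ (\sum_(i < d) n%:R^-1 ^+ 2)).
  apply: ler_sum => i _; rewrite /grid ffunE.
  rewrite (_ : x i - _ = n%:R^-1 * (n%:R * x i - ((f i)%:R - n%:R))); last first.
    by rewrite [RHS]mulrBr mulrA mulVf ?mul1r // gt_eqF.
  rewrite exprMn ler_piMr ?sqr_ge0 // -[leLHS]real_normK ?num_real //.
  by rewrite exprn_ile1 //; case: (fP i).
rewrite sumr_const card_ord -[leLHS]mulr_natl !exprVn ler_pdivrMr ?exprn_gt0 //.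
rewrite ler_pdivlMl ?exprn_gt0 // -!natrX -natrM ler_nat.
exact: fine_mesh.
Qed.

Section Chaining.
Variables (A : 'I_d -> 'I_d -> R) (tau : R).
Hypothesis tau_ge0 : 0 <= tau.
Hypothesis grid_bound : forall f f',
  sumsq (grid f) <= n%:R ^+ 2 -> sumsq (grid f') <= n%:R ^+ 2 ->
  `|bilform A (grid f) (grid f')| <= n%:R ^+ 2 * tau.

Let ball_bound b := forall x y, sumsq x <= 1 -> sumsq y <= 1 -> `|bilform A x y| <= b.

Let ball_bound_sum_norm : ball_bound (\sum_i \sum_k `|A i k|).
Proof.
move=> x y x1 y1; apply: le_trans (ler_norm_sum _ _ _) _; apply: ler_sum => i _.
apply: le_trans (ler_norm_sum _ _ _) _; apply: ler_sum => k _.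
by rewrite !normrM ler_piMl // mulr_ile1 //; exact: sumsq_coord_le1.
Qed.

Let small_scaled x : sumsq x <= 4^-1 ^+ 2 -> sumsq (fun i => 4 * x i) <= 1.
Proof. by rewrite sumsqZ !expr2; set q := sumsq x; lra. Qed.

Let grid_bilform_le f f' : sumsq (grid f) <= n%:R ^+ 2 -> sumsq (grid f') <= n%:R ^+ 2 ->
  `|bilform A (fun i => n%:R^-1 * grid f i) (fun i => n%:R^-1 * grid f' i)| <= tau.
Proof.
move=> f1 f'1; rewrite bilformZl bilformZr mulrA -expr2 normrM ger0_norm ?sqr_ge0 //.
rewrite (_ : tau = n%:R^-1 ^+ 2 * (n%:R ^+ 2 * tau)); last by rewrite mulrA mulVn2 mul1r.
by rewrite ler_wpM2l ?sqr_ge0 ?grid_bound.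
Qed.

Let ball_bound_contract b : ball_bound b -> ball_bound (tau + b / 2).
Proof.
move=> bA x y x1 y1.
have [f [f_le xf]] := grid_approximation x1; have [f' [f'_le yf']] := grid_approximation y1.
pose x0 i := n%:R^-1 * grid f i; pose y0 i := n%:R^-1 * grid f' i.
pose rx i := x i - x0 i; pose ry i := y i - y0 i.
have f_ball : sumsq (grid f) <= n%:R ^+ 2 by rewrite (le_trans f_le) ?ler_piMr ?sqr_ge0.
have f'_ball : sumsq (grid f') <= n%:R ^+ 2 by rewrite (le_trans f'_le) ?ler_piMr ?sqr_ge0.
have x0_ball : sumsq x0 <= 1.
  by rewrite sumsqZ -[leRHS]mulVn2 ler_wpM2l ?sqr_ge0.
have left_error : 4 * `|bilform A rx y| <= b.
  by have := bA _ y (small_scaled xf) y1; rewrite bilformZl normrM ger0_norm.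
have right_error : 4 * `|bilform A x0 ry| <= b.
  by have := bA x0 _ x0_ball (small_scaled yf'); rewrite bilformZr normrM ger0_norm.
have -> : bilform A x y = bilform A x0 y0 + bilform A x0 ry + bilform A rx y.
  have {1}-> : x = fun i => x0 i + rx i by apply/funext => i; rewrite /rx addrC subrK.
  rewrite bilformDl -bilformDr; congr (bilform A x0 _ + _).
  by apply/funext => i; rewrite /ry addrC subrK.
have := grid_bilform_le f_ball f'_ball.
by have := ler_normD (bilform A x0 y0 + bilform A x0 ry) (bilform A rx y);
  have := ler_normD (bilform A x0 y0) (bilform A x0 ry); lra.
Qed.

Lemma grid_bound_unit_ball x y : sumsq x <= 1 -> sumsq y <= 1 -> `|bilform A x y| <= 2 * tau.
Proof.
move=> x1 y1; apply: (@ler_add_div_pow2 _ _ _ (\sum_i \sum_k `|A i k|)) => k.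
elim: k x y x1 y1 => [|k IH] x y x1 y1.
  by rewrite expr0 divr1; apply: le_trans (ball_bound_sum_norm x1 y1) _; rewrite lerDr mulr_ge0.
apply: le_trans (ball_bound_contract IH x1 y1) _.
by rewrite exprS invfM le_eqVlt; apply/orP; left; apply/eqP; field; rewrite expf_neq0 // pnatr_eq0.
Qed.

Lemma grid_bound_bilform_le : bilform_le (2 * tau) A.
Proof.
apply: bilform_le_unit_ball => [|x y x1 y1]; first exact: mulr_ge0.
exact: le_trans (ler_norm _) (grid_bound_unit_ball x1 y1).
Qed.

End Chaining.
End Net.

Section ComplexBilinear.
Variables (R : rcfType) (d : nat).
Variables (G : 'I_d -> 'I_d -> R[i]) (c : R).
Hypothesis c0 : 0 <= c.
Hypothesis part_le : forall b, bilform_le c (fun i k => part b (G i k)).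

Lemma sum_sqmod_part (v : 'I_d -> R[i]) :
  \sum_i sqmod (v i) = sumsq (fun i => part true (v i)) + sumsq (fun i => part false (v i)).
Proof. by rewrite /sumsq -big_split. Qed.

Lemma bilform_le_sqmod (v : 'I_d -> R[i]) :
  \sum_k sqmod (\sum_i v i * G i k) <= 4 * c ^+ 2 * \sum_i sqmod (v i).
Proof.
pose L s b k := \sum_i part s (v i) * part b (G i k).
have ReE k : complex.Re (\sum_i v i * G i k) = L true true k - L false false k.
  by rewrite raddf_sum /L -sumrB; apply: eq_bigr => i _; rewrite /= complex_ReM.
have ImE k : complex.Im (\sum_i v i * G i k) = L true false k + L false true k.
  by rewrite raddf_sum /L -big_split; apply: eq_bigr => i _; rewrite /= complex_ImM.
apply: (@le_trans _ _ (2 * (sumsq (L true true) + sumsq (L false false) +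
    sumsq (L true false) + sumsq (L false true)))).
  rewrite /sumsq -!big_split /= mulr_sumr; apply: ler_sum => k _.
  rewrite /sqmod ReE ImE; set x := L _ _ _; set y := L _ _ _; set z := L _ _ _; set t := L _ _ _.
  have : 0 <= (x + y) ^+ 2 + (z - t) ^+ 2 by rewrite addr_ge0 ?sqr_ge0.
  rewrite !expr2; lra.
rewrite sum_sqmod_part.
have L_le s b : sumsq (L s b) <= c ^+ 2 * sumsq (fun i => part s (v i)).
  exact: bilform_le_sumsq (part_le b).
have := L_le true true; have := L_le false false; have := L_le true false; have := L_le false true.
by set a := sumsq (fun i => _ true _); lra.
Qed.

End ComplexBilinear.

Section ColumnPartialTranspose.
Variables (R : realType) (d : nat).
Local Notation C := R[i].

Definition swap_index (x y : 'I_(d * d)) : 'I_(d * d) :=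
  mxvec_index (block_index x).1 (block_index y).2.

Definition pt_square (v : 'cV[C]_(d * d)) : 'M[C]_(d * d) := partial_transpose (v *m v^t*).

Lemma pt_squareE (v : 'cV[C]_(d * d)) x y :
  pt_square v x y = v (swap_index x y) 0 * Num.conj (v (swap_index y x) 0).
Proof. by rewrite mxE /block_entry mxE big_ord1 !mxE. Qed.

Lemma pt_square_hermitian (v : 'cV[C]_(d * d)) : (pt_square v)^t* = pt_square v.
Proof. by apply/matrixP => x y; rewrite mxE mxE !pt_squareE rmorphM /= conjCK mulrC. Qed.

Lemma sqnorm_blocks (t : 'rV[C]_(d * d)) :
  sqnorm t = (\sum_i \sum_k sqmod (t 0 (mxvec_index i k)))%:C.
Proof.
rewrite sqnormE (reindex _ (curry_mxvec_bij _ _)) /= pair_bigA /= rmorph_sum.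
by apply: eq_bigr => -[i k] _; rewrite sqr_normC_sqmod.
Qed.

Lemma mulmx_pt_square (v : 'cV[C]_(d * d)) (u : 'rV[C]_(d * d)) a b :
  (u *m pt_square v) 0 (mxvec_index a b) =
  \sum_i (\sum_k u 0 (mxvec_index i k) * Num.conj (v (mxvec_index a k) 0)) * v (mxvec_index i b) 0.
Proof.
transitivity (\sum_i \sum_k u 0 (mxvec_index i k) *
    Num.conj (v (mxvec_index a k) 0) * v (mxvec_index i b) 0).
  rewrite mxE (reindex _ (curry_mxvec_bij _ _)) /= pair_bigA /=; apply: eq_bigr => -[i k] _.
  by rewrite pt_squareE /swap_index !mxvec_indexK /=; ring.
by apply: eq_bigr => i _; rewrite mulr_suml.
Qed.

Lemma pt_square_opnorm_le (v : 'cV[C]_(d * d)) (c : R) : 0 <= c ->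
  (forall b, bilform_le c (fun i k => part b (v (mxvec_index i k) 0))) ->
  opnorm_le (4 * c ^+ 2)%:C (pt_square v).
Proof.
move=> c0 v_le; split; first by rewrite ler0c mulr_ge0 ?sqr_ge0.
move=> u; rewrite !sqnorm_blocks -rmorphXn -rmorphM lecR /=.
have conj_le b : bilform_le c (fun k a => part b (Num.conj (v (mxvec_index a k) 0))).
  case: b; have := bilform_le_tr (v_le _).
    by move=> /(_ true); congr bilform_le; apply/funext => i; apply/funext => k;
      rewrite /= Re_conjC.
  move=> /(_ false)/bilform_leN; congr bilform_le.
  by apply/funext => i; apply/funext => k; rewrite /= Im_conjC.
pose U i a := \sum_k u 0 (mxvec_index i k) * Num.conj (v (mxvec_index a k) 0).
apply: (@le_trans _ _ (\sum_a 4 * c ^+ 2 * \sum_i sqmod (U i a))).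
  apply: ler_sum => a _; under eq_bigr do rewrite mulmx_pt_square -/(U _ a).
  exact: (bilform_le_sqmod c0 v_le (U^~ a)).
rewrite -mulr_sumr exchange_big /=.
apply: (@le_trans _ _ (4 * c ^+ 2 * \sum_i (4 * c ^+ 2 * \sum_k sqmod (u 0 (mxvec_index i k))))).
  apply: ler_wpM2l; first by rewrite mulr_ge0 ?sqr_ge0.
  by apply: ler_sum => i _; exact: (bilform_le_sqmod c0 conj_le (fun k => u 0 (mxvec_index i k))).
by rewrite -mulr_sumr mulrA -expr2.
Qed.

End ColumnPartialTranspose.

Lemma measurable_forallb (d : measure_display) (T : measurableType d) (J : finType)
  (b : J -> T -> bool) : (forall j, measurable_fun setT (b j)) ->
  measurable_fun setT (fun w => [forall j, b j w]).
Proof.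
move=> mb; rewrite (_ : (fun w => _) = (fun w => \big[andb/true]_(j <- enum J) b j w)); last first.
  apply/funext => w; rewrite big_all; apply/forallP/allP => [ball j _|ball j]; first exact: ball.
  by apply: ball; rewrite mem_enum.
elim: (enum J) => [|j s IH].
  by under eq_fun do rewrite big_nil; exact: measurable_cst.
by under eq_fun do rewrite big_cons; apply: measurable_and.
Qed.

Section NetEvent.
Context {R : realType} {dT : measure_display} {T : measurableType dT}.
Local Notation C := R[i].
Variables (P : probability T R) (kap : R) (d p : nat) (g : 'I_(d * d) * 'I_p -> T -> C).
Variables (c : 'I_p) (tau : R).
Local Notation gridpt := {ffun 'I_d -> 'I_(2 * (4 * d)).+1}.
Local Notation mesh := ((4 * d)%:R : R).

Definition in_ball (f : gridpt) : bool := sumsq (grid R f) <= mesh ^+ 2.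

Definition column_form (b : bool) (f f' : gridpt) (w : T) : R :=
  bilform (fun i k => part b (g (mxvec_index i k, c) w)) (grid R f) (grid R f').

Definition net_event (w : T) : bool :=
  [forall f, forall f', (in_ball f && in_ball f') ==>
    [forall b, `|column_form b f f' w| <= mesh ^+ 2 * tau]].

Lemma net_event_pt_square_opnorm_le w : (0 < d)%N -> 0 <= tau -> net_event w ->
  opnorm_le (16 * tau ^+ 2)%:C (pt_square (\col_r g (r, c) w)).
Proof.
move=> d0 tau0 /forallP net.
rewrite (_ : 16 * tau ^+ 2 = 4 * (2 * tau) ^+ 2); last by ring.
apply: pt_square_opnorm_le => [|b]; first exact: mulr_ge0.
apply: (@grid_bound_bilform_le _ _ (4 * d)) => [| |//|f f' f_ball f'_ball].
- by rewrite muln_gt0.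
- by nia.
have /forallP/(_ f') := net f; rewrite /in_ball f_ball f'_ball /= => /forallP/(_ b).
congr (`|_| <= _); apply: eq_bigr => i _; apply: eq_bigr => k _.
by rewrite mxE.
Qed.

Lemma measurable_net_event (dS : measure_display) (S : measurableType dS) (pr : S -> T) :
  (forall r b, measurable_fun setT (fun w => part b (g (r, c) (pr w)))) ->
  measurable_fun setT (fun w => net_event (pr w)).
Proof.
move=> mg; apply: measurable_forallb => f; apply: measurable_forallb => f'.
case: (_ && _); last by exact: measurable_cst.
apply: measurable_forallb => b; apply: measurable_fun_ler; last exact: measurable_cst.
apply: measurableT_comp => //; apply: measurable_sum => i; apply: measurable_sum => k.
by apply: measurable_funM => //; exact: measurable_cst.
Qed.

Hypothesis entries : forall e, gaussian_entry P kap (g e).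
Hypothesis indep : mutually_independent P (re_im g).

Lemma measurable_part_entry e b : measurable_fun setT (fun w => part b (g e w)).
Proof. by case: (entry_measurable (entries e)); case: b. Qed.

Let column_entries := [seq (r, c) | r <- enum 'I_(d * d)].

Let big_column (f : 'I_(d * d) * 'I_p -> R) :
  \sum_(z <- column_entries) f z = \sum_(i < d) \sum_(k < d) f (mxvec_index i k, c).
Proof.
rewrite big_map big_enum /= (reindex _ (curry_mxvec_bij _ _)) /= pair_bigA /=.
by apply: eq_bigr => -[i k] _.
Qed.

Lemma column_form_subgaussian (b : bool) (f f' : gridpt) (a : R) :
  (\int[P]_w (expR (a * column_form b f f' w))%:E <=
   (expR (a ^+ 2 * (sumsq (grid R f) * sumsq (grid R f')) / 2))%:E)%E.
Proof.
pose coef (z : 'I_(d * d) * 'I_p) := grid R f (block_index z.1).1 * grid R f' (block_index z.1).2.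
have uniq_column : uniq column_entries by rewrite map_inj_uniq ?enum_uniq // => r r' [].
have := subgaussian_sum entries indep b (fun z => a * coef z) uniq_column.
have -> : \sum_(z <- column_entries) (a * coef z) ^+ 2 / 2 =
    a ^+ 2 * (sumsq (grid R f) * sumsq (grid R f')) / 2.
  rewrite big_column /sumsq mulr_suml mulr_sumr mulr_suml; apply: eq_bigr => i _.
  rewrite !mulr_sumr mulr_suml; apply: eq_bigr => k _.
  by rewrite /coef mxvec_indexK /=; ring.
under [X in (X <= _)%E -> _]eq_integral => w _.
  rewrite big_column (_ : \sum_(i < d) _ = a * column_form b f f' w); last first.
    rewrite /column_form /bilform mulr_sumr; apply: eq_bigr => i _; rewrite mulr_sumr.
    by apply: eq_bigr => k _; rewrite /coef mxvec_indexK /= -mulrA.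
  over.
by [].
Qed.

Hypotheses (d_gt0 : (0 < d)%N) (tau_ge0 : 0 <= tau).

Let mesh_gt0 : 0 < mesh. Proof. by rewrite ltr0n muln_gt0. Qed.

(* The Chernoff majorant of the event [mesh ^+ 2 * tau < (-1) ^+ s * column_form b f f']. *)
Let chernoff (b s : bool) (f f' : gridpt) w : R :=
  expR (- tau ^+ 2) * expR ((-1) ^+ s * (tau / mesh ^+ 2) * column_form b f f' w).

Let chernoff_ge0 b s f f' w : 0 <= chernoff b s f f' w.
Proof. by rewrite mulr_ge0 ?expR_ge0. Qed.

Let chernoff_ge1 b f f' w : mesh ^+ 2 * tau < `|column_form b f f' w| ->
  1 <= chernoff b (column_form b f f' w < 0) f f' w.
Proof.
move=> large; rewrite /chernoff -expRD -[leLHS]expR0 ler_expR addrC subr_ge0.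
rewrite [_ * (tau / _)]mulrC -[leRHS]mulrA -normrEsign ?num_real //.
apply: le_trans (ler_wpM2l _ (ltW large)); last by rewrite divr_ge0 ?sqr_ge0.
by rewrite mulrA divfK ?expr2 // mulf_neq0 // gt_eqF.
Qed.

Let chernoff_Rintegral b s f f' : in_ball f && in_ball f' ->
  Rintegrable P (chernoff b s f f') /\ \int[P]_w chernoff b s f f' w <= expR (- tau ^+ 2 / 2).
Proof.
move=> /andP[f_ball f'_ball]; set a := (-1) ^+ s * (tau / mesh ^+ 2).
have mform : measurable_fun setT (fun w => expR (a * column_form b f f' w)).
  apply: measurableT_comp => //; apply: measurable_funM => //.
  apply: measurable_sum => i; apply: measurable_sum => k.
  by apply: measurable_funM => //; exact: measurable_part_entry.
have subgaussian := column_form_subgaussian b f f' a.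
have Iform : Rintegrable P (fun w => expR (a * column_form b f f' w)).
  by apply: ge0_Rintegrable => //; apply: le_lt_trans subgaussian _; rewrite ltry.
split; first exact: RintegrableZ.
rewrite /chernoff RintegralZl //.
have := subgaussian; rewrite EFin_Rintegral // lee_fin => int_le.
apply: (@le_trans _ _ (expR (- tau ^+ 2) * expR (tau ^+ 2 / 2))).
  apply: ler_wpM2l; first exact: expR_ge0.
  apply: le_trans int_le _; rewrite ler_expR ler_pM2r ?invr_gt0 //.
  rewrite /a exprMn sqrr_sign mul1r exprMn exprVn -mulrA ler_piMr ?sqr_ge0 //.
  by rewrite ler_pdivrMl ?exprn_gt0 // mulr1 expr2; apply: ler_pM => //; exact: sumsq_ge0.
by rewrite -expRD ler_expR; lra.
Qed.

Let chernoff_sum w : R :=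
  \sum_(q : (bool * bool) * (gridpt * gridpt) | in_ball q.2.1 && in_ball q.2.2)
     chernoff q.1.1 q.1.2 q.2.1 q.2.2 w.

Let net_failure_le w : (~~ net_event w)%:R <= chernoff_sum w.
Proof.
case: (boolP (net_event w)) => [_|] /=.
  by apply: sumr_ge0 => q _; exact: chernoff_ge0.
rewrite negb_forall => /existsP[f]; rewrite negb_forall => /existsP[f'].
rewrite negb_imply negb_forall => /andP[ball /existsP[b]]; rewrite -ltNge => large.
rewrite /chernoff_sum (bigD1 ((b, column_form b f f' w < 0), (f, f'))) //=.
apply: le_trans (chernoff_ge1 large) _.
by rewrite lerDl; apply: sumr_ge0 => q _; exact: chernoff_ge0.
Qed.

Lemma Rintegrable_net_failure : Rintegrable P (fun w => (~~ net_event w)%:R).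
Proof.
apply: Rintegrable_bool; apply: measurable_neg.
by apply: (@measurable_net_event _ _ id) => r b; exact: measurable_part_entry.
Qed.

Lemma net_failure_prob :
  \int[P]_w (~~ net_event w)%:R <= 4 * ((8 * d + 1)%:R ^+ d) ^+ 2 * expR (- tau ^+ 2 / 2).
Proof.
have Isum : Rintegrable P chernoff_sum.
  by apply: Rintegrable_sum => q ball; exact: (chernoff_Rintegral _ _ ball).1.
apply: le_trans (ler_Rintegral Rintegrable_net_failure Isum net_failure_le) _.
rewrite Rintegral_sum; last by move=> q ball; exact: (chernoff_Rintegral _ _ ball).1.
apply: (@le_trans _ _ (\sum_(q : (bool * bool) * (gridpt * gridpt)) expR (- tau ^+ 2 / 2))).
  rewrite big_mkcond /=; apply: ler_sum => q _.
  by case: ifP => [ball|_]; [exact: (chernoff_Rintegral _ _ ball).2 | exact: expR_ge0].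
rewrite sumr_const !card_prod card_bool card_ffun !card_ord -[leLHS]mulr_natl.
rewrite (_ : (2 * (4 * d)).+1 = 8 * d + 1)%N; last by lia.
by rewrite !natrM !natrX expr2 -!natrM.
Qed.

End NetEvent.

(** * Covariances and traces of the increments *)

Lemma ler_exprM_exprD (R : realDomainType) (x y : R) a b : 0 <= x -> 0 <= y ->
  x ^+ a * y ^+ b <= x ^+ (a + b) + y ^+ (a + b).
Proof.
move=> x0 y0; have [xy|yx] := leP x y.
  apply: (@le_trans _ _ (y ^+ (a + b))); last by rewrite lerDr exprn_ge0.
  by rewrite exprD ler_wpM2r ?exprn_ge0 // lerXn2r ?nnegrE.
apply: (@le_trans _ _ (x ^+ (a + b))); last by rewrite lerDl exprn_ge0.
by rewrite exprD ler_wpM2l ?exprn_ge0 // lerXn2r ?nnegrE // ltW.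
Qed.

Section PowerSums.
Variables (R : realFieldType) (n : nat) (r : 'I_n -> R).
Hypothesis r_ge0 : forall i, 0 <= r i.

Definition power_sum q : R := \sum_i r i ^+ q.

Lemma power_sum_ge0 q : 0 <= power_sum q.
Proof. by apply: sumr_ge0 => i _; rewrite exprn_ge0. Qed.

Lemma power_sumS_le K q : (forall i, r i <= K) -> power_sum q.+1 <= K * power_sum q.
Proof.
move=> rK; rewrite /power_sum mulr_sumr; apply: ler_sum => i _.
by rewrite exprS ler_wpM2r ?exprn_ge0.
Qed.

Let power_sumM a b : power_sum a * power_sum b =
  2^-1 * \sum_i \sum_j (r i ^+ a * r j ^+ b + r j ^+ a * r i ^+ b).
Proof.
have prodE : power_sum a * power_sum b = \sum_i \sum_j r i ^+ a * r j ^+ b.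
  by rewrite /power_sum mulr_suml; apply: eq_bigr => i _; rewrite mulr_sumr.
under [in RHS]eq_bigr do rewrite big_split /=.
rewrite big_split /= -prodE [X in _ + X]exchange_big /= -prodE.
by set t := power_sum a * _; lra.
Qed.

(* Chebyshev's sum inequality for the weights [r i ^+ 2]. *)
Lemma power_sum_mul_le a b :
  power_sum (2 + a) * power_sum (2 + b) <= power_sum 2 * power_sum (2 + (a + b)).
Proof.
rewrite !power_sumM ler_pM2l ?invr_gt0 //; apply: ler_sum => i _; apply: ler_sum => j _.
rewrite !exprD; set x := r i; set y := r j; rewrite -subr_ge0.
have -> : x ^+ 2 * (y ^+ 2 * (y ^+ a * y ^+ b)) + y ^+ 2 * (x ^+ 2 * (x ^+ a * x ^+ b)) -
  (x ^+ 2 * x ^+ a * (y ^+ 2 * y ^+ b) + y ^+ 2 * y ^+ a * (x ^+ 2 * x ^+ b)) =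
  (x ^+ 2 * y ^+ 2) * ((x ^+ a - y ^+ a) * (x ^+ b - y ^+ b)) by ring.
apply: mulr_ge0; first by rewrite mulr_ge0 ?sqr_ge0.
have x0 : 0 <= x by exact: r_ge0.
have y0 : 0 <= y by exact: r_ge0.
have [xy|yx] := leP x y.
  by rewrite mulr_le0 // subr_le0 lerXn2r ?nnegrE.
by rewrite mulr_ge0 // subr_ge0 lerXn2r ?nnegrE // ltW.
Qed.

Lemma weighted_power_sum_le a b (m : 'I_n -> 'I_n -> R) (c : R) : (forall i j, 0 <= m i j) ->
  (forall i, \sum_j m i j <= c) -> (forall j, \sum_i m i j <= c) ->
  \sum_i \sum_j r i ^+ a * r j ^+ b * m i j <= 2 * c * power_sum (a + b).
Proof.
move=> m0 row_le col_le.
apply: (@le_trans _ _ (\sum_i \sum_j (r i ^+ (a + b) * m i j + r j ^+ (a + b) * m i j))).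
  apply: ler_sum => i _; apply: ler_sum => j _; rewrite -mulrDl ler_wpM2r //.
  exact: ler_exprM_exprD.
under eq_bigr do rewrite big_split /=.
rewrite big_split /= [X in _ + X]exchange_big /= -mulrA mulrDl mul1r mulrC /power_sum !mulr_suml.
by apply: lerD; apply: ler_sum => i _; rewrite -mulr_sumr ler_wpM2l ?exprn_ge0.
Qed.

End PowerSums.

Section EigenbasisTraces.
Variables (C : numClosedFieldType) (n : nat).
Implicit Types (A P W M : 'M[C]_n) (D : 'rV[C]_n).

Lemma mxtrace_diag_mx2 D D' M M' :
  \tr (diag_mx D *m M *m diag_mx D' *m M') = \sum_i \sum_j D 0 i * D' 0 j * (M i j * M' j i).
Proof.
apply: eq_bigr => i _; rewrite mxE; apply: eq_bigr => j _.
by rewrite mul_mx_diag mxE mul_diag_mx mxE; ring.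
Qed.

Lemma spectral_dec_mxtrace2 A P D W a b : spectral_dec A P D ->
  \tr (A ^+ a * W * A ^+ b * W) =
  \sum_i \sum_j D 0 i ^+ a * D 0 j ^+ b * ((P *m W *m P^t*) i j * (P *m W *m P^t*) j i).
Proof.
move=> decA.
have [_ _ ->] := spectral_dec_exprn decA a; have [_ _ ->] := spectral_dec_exprn decA b.
rewrite -!mulmxE.
have -> X Y : P^t* *m X *m P *m W *m (P^t* *m Y *m P) *m W =
    P^t* *m (X *m (P *m W *m P^t*) *m Y *m (P *m W)) by rewrite !mulmxA.
rewrite mxtrace_mulC -[X in \tr X]mulmxA mxtrace_diag_mx2.
by apply: eq_bigr => i _; apply: eq_bigr => j _; rewrite !mxE.
Qed.

Lemma spectral_dec_mxtrace_trmx A P D a b : spectral_dec A P D ->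
  \tr (A ^+ a *m (A ^+ b)^T) =
  \sum_i \sum_j D 0 i ^+ a * D 0 j ^+ b * ((P *m P^T) i j * ((P *m P^T)^t*) j i).
Proof.
move=> decA.
have [_ _ ->] := spectral_dec_exprn decA a; have [_ _ ->] := spectral_dec_exprn decA b.
rewrite !trmx_mul tr_diag_mx.
have -> X Y : P^t* *m X *m P *m (P^T *m (Y *m P^t*^T)) =
    P^t* *m (X *m (P *m P^T) *m Y *m P^t*^T) by rewrite !mulmxA.
rewrite mxtrace_mulC -[X in \tr X]mulmxA.
have -> : P^t*^T *m P^t* = (P *m P^T)^t* by rewrite trmxC_mul trmxK map_trmx trmxK.
rewrite mxtrace_diag_mx2.
apply: eq_bigr => i _; apply: eq_bigr => j _; rewrite [in LHS](mxE _ _ 0 i) [in LHS](mxE _ _ 0 j).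
by rewrite trmx_mul.
Qed.

Lemma spectral_dec_mxtraceM A P D W a : spectral_dec A P D ->
  \tr (A ^+ a * W) = \sum_i D 0 i ^+ a * (P *m W *m P^t*) i i.
Proof.
move=> decA; have [_ _ ->] := spectral_dec_exprn decA a.
rewrite -!mulmxE -!mulmxA mxtrace_mulC -!mulmxA.
by apply: eq_bigr => i _; rewrite mul_diag_mx !mxE.
Qed.

End EigenbasisTraces.

Lemma sqnorm_row (C : numClosedFieldType) n (M : 'M[C]_n) i : sqnorm (row i M) = (M *m M^t*) i i.
Proof. by rewrite /sqnorm !mxE; apply: eq_bigr => j _; rewrite !mxE. Qed.

Lemma sum_sqmod_row (R : rcfType) n (M : 'M[R[i]]_n) i :
  (\sum_j sqmod (M i j))%:C = sqnorm (row i M).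
Proof.
rewrite sqnormE rmorph_sum /=; apply: eq_bigr => j _.
by rewrite -sqr_normC_sqmod [row _ _ _ _]mxE.
Qed.

Lemma sum_sqmod_row_unitary (R : rcfType) n (M : 'M[R[i]]_n) i : M *m M^t* = 1%:M ->
  \sum_j sqmod (M i j) = 1.
Proof.
move=> MM; apply: (@complexI R).
by rewrite [LHS]sum_sqmod_row sqnorm_row MM mxE eqxx rmorph1.
Qed.

Section HermitianTraces.
Variables (R : realType) (n : nat).
Local Notation C := R[i].
Variables (A P : 'M[C]_n) (r : 'I_n -> R).
Hypothesis decA : real_spectral_dec A P r.
Hypothesis r_ge0 : forall i, 0 <= r i.
Implicit Type W : 'M[C]_n.

Let PPt : P *m P^t* = 1%:M. Proof. by case: decA. Qed.
Let PtP : P^t* *m P = 1%:M. Proof. by case: decA. Qed.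

Let rowPPt i : row i P *m P^t* = row i 1%:M. Proof. by rewrite -row_mul PPt. Qed.

Let sqnorm_row1 i : sqnorm (row i (1%:M : 'M[C]_n)) = 1.
Proof. by rewrite sqnorm_row trmxC1 mulmx1 mxE eqxx. Qed.

Definition eigencoords W : 'M[C]_n := P *m W *m P^t*.

Definition pair_trace a b W : R :=
  \sum_i \sum_j r i ^+ a * r j ^+ b * sqmod (eigencoords W i j).

Lemma eigencoords_hermitian W : W^t* = W -> (eigencoords W)^t* = eigencoords W.
Proof. by move=> hermW; rewrite /eigencoords !trmxC_mul trmxCK hermW mulmxA. Qed.

Lemma eigencoords_conjC W i j : W^t* = W -> eigencoords W j i = Num.conj (eigencoords W i j).
Proof. by move=> hermW; rewrite -[in LHS](eigencoords_hermitian hermW) !mxE. Qed.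

Lemma mxtrace_pair W a b : W^t* = W ->
  \tr (A ^+ a * W * A ^+ b * W) = (pair_trace a b W)%:C.
Proof.
move=> hermW; rewrite (spectral_dec_mxtrace2 W a b decA) rmorph_sum; apply: eq_bigr => i _.
rewrite rmorph_sum; apply: eq_bigr => j _; rewrite -!/(eigencoords W).
rewrite [eigencoords W j i]eigencoords_conjC // mul_conjC_sqmod.
by rewrite [(\row__ _) 0 i]mxE [(\row__ _) 0 j]mxE !rmorphM !rmorphXn.
Qed.

Lemma pair_trace_ge0 a b W : 0 <= pair_trace a b W.
Proof.
by apply: sumr_ge0 => i _; apply: sumr_ge0 => j _; rewrite !mulr_ge0 ?exprn_ge0 ?sqmod_ge0.
Qed.

Lemma eigencoords_row_le W (c : R) i :
  opnorm_le c%:C W -> \sum_j sqmod (eigencoords W i j) <= c ^+ 2.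
Proof.
move=> [c0 Wc]; rewrite -lecR sum_sqmod_row /eigencoords row_mul row_mul.
rewrite -(spectral_dec_sqnorm decA); apply: le_trans (Wc _) _.
by rewrite (spectral_dec_sqnorm decA) rowPPt sqnorm_row1 mulr1 rmorphXn.
Qed.

Lemma pair_trace_opnorm_le W (c : R) a b : W^t* = W -> opnorm_le c%:C W ->
  pair_trace a b W <= 2 * c ^+ 2 * power_sum r (a + b).
Proof.
move=> hermW Wc; apply: weighted_power_sum_le => //; first by move=> i j; exact: sqmod_ge0.
  by move=> i; exact: eigencoords_row_le.
move=> j; under eq_bigr do rewrite (eigencoords_conjC _ _ hermW) sqmod_conjC.
exact: eigencoords_row_le.
Qed.

Lemma pair_trace_mxtrace_sqr_le W (K : R) a b : (forall i, r i <= K) -> W^t* = W ->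
  (pair_trace a b W)%:C <= (K ^+ (a + b))%:C * \tr (W * W).
Proof.
move=> rK hermW; have := mxtrace_pair 0 0 hermW; rewrite !expr0 mul1r mulr1 => ->.
rewrite -rmorphM lecR /pair_trace mulr_sumr; apply: ler_sum => i _.
rewrite mulr_sumr; apply: ler_sum => j _; rewrite !expr0 !mul1r ler_wpM2r ?sqmod_ge0 // exprD.
by apply: ler_pM; rewrite ?exprn_ge0 //; rewrite lerXn2r ?nnegrE // (le_trans (r_ge0 i)).
Qed.

Lemma mxtrace_mul_trmx a b :
  exists2 x : R, \tr (A ^+ a *m (A ^+ b)^T) = x%:C & 0 <= x <= 2 * power_sum r (a + b).
Proof.
pose u := P *m P^T.
have uuC : u *m u^t* = 1%:M.
  rewrite /u trmxC_mul mulmxA -[P *m P^T *m _]mulmxA.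
  have -> : P^T *m (P^T)^t* = (P^t* *m P)^T by rewrite trmx_mul -map_trmx.
  by rewrite PtP trmx1 mulmx1 PPt.
have uCu : u^t* *m u^t*^t* = 1%:M by rewrite trmxCK; apply/mulmx1C.
exists (\sum_i \sum_j r i ^+ a * r j ^+ b * sqmod (u i j)).
  rewrite (spectral_dec_mxtrace_trmx a b decA) rmorph_sum; apply: eq_bigr => i _.
  rewrite rmorph_sum; apply: eq_bigr => j _.
  rewrite -/u [(\row__ _) 0 i]mxE [(\row__ _) 0 j]mxE !rmorphM !rmorphXn /=; congr (_ * _).
  by rewrite -mul_conjC_sqmod; congr (_ * _); rewrite mxE mxE.
apply/andP; split.
  by apply: sumr_ge0 => i _; apply: sumr_ge0 => j _; rewrite !mulr_ge0 ?exprn_ge0 ?sqmod_ge0.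
rewrite -[2]mulr1; apply: weighted_power_sum_le => // [i j|i|j]; first exact: sqmod_ge0.
  by rewrite sum_sqmod_row_unitary.
rewrite -(sum_sqmod_row_unitary j uCu).
by apply: ler_sum => i _; rewrite !mxE sqmod_conjC.
Qed.

Lemma mxtraceM_opnorm_le W (c : R) a : opnorm_le c%:C W ->
  `|\tr (A ^+ a * W)| <= (c * power_sum r a)%:C.
Proof.
move=> Wc; rewrite (spectral_dec_mxtraceM W a decA); apply: le_trans (ler_norm_sum _ _ _) _.
rewrite /power_sum mulr_sumr rmorph_sum; apply: ler_sum => i _.
rewrite [(\row__ _) 0 i]mxE normrM -rmorphXn normC_real_complex (ger0_norm (exprn_ge0 a (r_ge0 i))).
rewrite [leLHS]mulrC rmorphM /=; apply: ler_wpM2r; first by rewrite ler0c exprn_ge0.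
have -> : (P *m W *m P^t*) i i = quadform W (row i P).
  by rewrite /quadform -row_mul !mxE; apply: eq_bigr => j _; rewrite !mxE.
apply: le_trans (opnorm_le_quadform _ Wc) _.
by rewrite (spectral_dec_sqnorm decA) rowPPt sqnorm_row1 mulr1.
Qed.

Lemma mxtraceM_real W a : W^t* = W -> complex.Im (\tr (A ^+ a * W)) = 0.
Proof.
move=> hermW; rewrite (spectral_dec_mxtraceM W a decA) raddf_sum /= big1 // => i _.
rewrite [(\row__ _) 0 i]mxE -rmorphXn complex_ImM /= mul0r addr0.
have := congr1 (@complex.Im R) (eigencoords_conjC i i hermW).
rewrite Im_conjC -/(eigencoords W); set x := complex.Im _ => xN.
by rewrite (_ : x = 0) ?mulr0 //; lra.
Qed.

End HermitianTraces.

Section CovarianceTraces.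
Context {R : realType} {dT : measure_display} {T : measurableType dT}.
Local Notation C := R[i].
Variables (P : probability T R) (n : nat) (kap v : R).

(* The first two moments of a Hermitian matrix whose entries have variance [v] and
   pseudo-covariance [kap * v], in the form in which traces see them. *)
Record increment_moments (Z : T -> 'M[C]_n) : Prop := IncrementMoments {
  increment_hermitian : forall w, (Z w)^t* = Z w;
  increment_Cintegrable : forall M, Cintegrable P (fun w => \tr (M * Z w));
  increment_mean : forall M, Cintegral P (fun w => \tr (M * Z w)) = 0;
  increment_Cintegrable2 : forall M M', Cintegrable P (fun w => \tr (M * Z w * M' * Z w));
  increment_mxtrace2 : forall M M', Cintegral P (fun w => \tr (M * Z w * M' * Z w)) =
    v%:C * (\tr M * \tr M' + kap%:C * \tr (M *m M'^T));
  increment_Cintegrable_sqr : forall M, Cintegrable P (fun w => \tr (M * Z w) ^+ 2);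
  increment_mxtrace_sqr : forall M, Cintegral P (fun w => \tr (M * Z w) ^+ 2) =
    v%:C * (\tr (M * M) + kap%:C * \tr (M *m M^T))
}.

Variable Z : T -> 'M[C]_n.
Hypothesis hermZ : forall w, (Z w)^t* = Z w.
Hypothesis IZ : forall x y, Cintegrable P (fun w => Z w x y).
Hypothesis meanZ : forall x y, Cintegral P (fun w => Z w x y) = 0.
Hypothesis IZZ : forall x y a b, Cintegrable P (fun w => Z w x y * Z w a b).
Hypothesis covZ : forall x y a b, Cintegral P (fun w => Z w x y * Z w a b) =
  v%:C * (((x == b) && (y == a))%:R + kap%:C * ((x == a) && (y == b))%:R).

Local Notation pairs := ('I_n * 'I_n)%type.
Implicit Types (M : 'M[C]_n) (z t : pairs).

Let sum_pairs (f : pairs -> C) : \sum_z f z = \sum_x \sum_y f (x, y).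
Proof. by rewrite pair_bigA; apply: eq_bigr => -[]. Qed.

Let mxtrace_pairs M w : \tr (M * Z w) = \sum_z M z.1 z.2 * Z w z.2 z.1.
Proof. by rewrite sum_pairs; apply: eq_bigr => x _; rewrite mxE. Qed.

Let IMZ M z : Cintegrable P (fun w => M z.1 z.2 * Z w z.2 z.1).
Proof. exact: CintegrableZ. Qed.

Let Cintegrable_mxtrace M : Cintegrable P (fun w => \tr (M * Z w)).
Proof.
apply: (eq_Cintegrable (f := fun w => \sum_z M z.1 z.2 * Z w z.2 z.1)) => [w|].
  by rewrite mxtrace_pairs.
exact: Cintegrable_sum.
Qed.

Let Cintegral_mxtrace M : Cintegral P (fun w => \tr (M * Z w)) = 0.
Proof.
rewrite (eq_Cintegral P (mxtrace_pairs M)) Cintegral_sum //.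
by apply: big1 => z _; rewrite CintegralZ // meanZ mulr0.
Qed.

Let quadratic (K : pairs -> pairs -> C) w :=
  \sum_z \sum_t K z t * (Z w z.2 z.1 * Z w t.2 t.1).

Let Cintegrable_quadratic K : Cintegrable P (quadratic K).
Proof.
by apply: Cintegrable_sum => z _; apply: Cintegrable_sum => t _; exact: CintegrableZ.
Qed.

Let sum_eq_pair z (f : pairs -> C) : \sum_t (t == z)%:R * f t = f z.
Proof.
by rewrite (bigD1 z) //= eqxx mul1r big1 ?addr0 // => t /negPf->; rewrite mul0r.
Qed.

Let Cintegral_quadratic K : Cintegral P (quadratic K) =
  v%:C * (\sum_z K z (z.2, z.1) + kap%:C * \sum_z K z z).
Proof.
have IK z t : Cintegrable P (fun w => K z t * (Z w z.2 z.1 * Z w t.2 t.1)) by exact: CintegrableZ.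
rewrite Cintegral_sum => [|z _]; last exact: Cintegrable_sum.
rewrite !mulr_sumr -big_split mulr_sumr; apply: eq_bigr => z _ /=.
rewrite Cintegral_sum // -[K z (z.2, z.1)]sum_eq_pair -[K z z]sum_eq_pair.
rewrite !mulr_sumr -big_split mulr_sumr; apply: eq_bigr => t _ /=.
rewrite CintegralZ // covZ; case: z t => x y [a b] /=; rewrite !xpair_eqE.
by rewrite [x == b]eq_sym [y == a]eq_sym [y == b]eq_sym [x == a]eq_sym ![(b == _) && _]andbC; ring.
Qed.

Lemma covariance_increment_moments : increment_moments Z.
Proof.
have mxtrace2E M M' w : \tr (M * Z w * M' * Z w) =
    quadratic (fun z t => M z.1 t.2 * M' t.1 z.2) w.
  rewrite /quadratic sum_pairs; apply: eq_bigr => x _ /=.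
  rewrite mxE; apply: eq_bigr => y _ /=.
  rewrite mxE mulr_suml sum_pairs; apply: eq_bigr => a _ /=.
  by rewrite mxE !mulr_suml; apply: eq_bigr => b _ /=; ring.
have mxtrace_sqrE M w : \tr (M * Z w) ^+ 2 = quadratic (fun z t => M z.1 z.2 * M t.1 t.2) w.
  rewrite expr2 mxtrace_pairs mulr_suml; apply: eq_bigr => z _; rewrite mulr_sumr.
  by apply: eq_bigr => t _; ring.
split=> // [M M'|M M'|M|M].
- by rewrite (funext (mxtrace2E M M')).
- rewrite (funext (mxtrace2E M M')) Cintegral_quadratic !sum_pairs /=.
  congr (_ * (_ + _ * _)); first by rewrite mulr_suml; apply: eq_bigr => x _; rewrite mulr_sumr.
  by apply: eq_bigr => x _; rewrite mxE; apply: eq_bigr => y _; rewrite mxE.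
- by rewrite (funext (mxtrace_sqrE M)).
- rewrite (funext (mxtrace_sqrE M)) Cintegral_quadratic !sum_pairs /=.
  congr (_ * (_ + _ * _)); first by apply: eq_bigr => x _; rewrite mxE.
  by apply: eq_bigr => x _; rewrite mxE; apply: eq_bigr => y _; rewrite mxE.
Qed.

End CovarianceTraces.

Section SwapIndex.
Variable d : nat.
Implicit Types x y a b : 'I_(d * d).

Lemma block_index_inj : injective (@block_index d).
Proof. by move=> x y /enum_val_inj/cast_ord_inj. Qed.

Lemma swap_index_eq x y a b : (swap_index x y == swap_index a b) =
  ((block_index x).1 == (block_index a).1) && ((block_index y).2 == (block_index b).2).
Proof.
apply/eqP/andP => [/(congr1 (@block_index d))|[/eqP rows /eqP cols]].
  by rewrite !mxvec_indexK => -[-> ->].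
by rewrite /swap_index rows cols.
Qed.

Lemma swap_index_eq2 x y a b :
  (swap_index x y == swap_index a b) && (swap_index y x == swap_index b a) =
  (x == a) && (y == b).
Proof.
rewrite !swap_index_eq -!(inj_eq block_index_inj).
case: (block_index x) => x1 x2; case: (block_index y) => y1 y2.
case: (block_index a) => a1 a2; case: (block_index b) => b1 b2; rewrite !xpair_eqE /=.
by do 4!case: (_ == _).
Qed.

Lemma swap_index_diag x y : (swap_index x y == swap_index y x) = (x == y).
Proof.
have := swap_index_eq2 x y y x; rewrite [swap_index y x == _]eq_sym andbb => ->.
by rewrite [y == x]eq_sym andbb.
Qed.

End SwapIndex.

Section ColumnIncrement.
Context {R : realType} {dT : measure_display} {T : measurableType dT}.
Local Notation C := R[i].
Variables (d p : nat) (g : 'I_(d * d) * 'I_p -> T -> C) (c : 'I_p) (sc : R).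
Local Notation I := 'I_(d * d).

Definition column_increment (w : T) : 'M[C]_(d * d) :=
  sc%:C *: (pt_square (\col_r g (r, c) w) - 1%:M).

Let entry_product (x y : I) w := g (swap_index x y, c) w * Num.conj (g (swap_index y x, c) w).

Lemma column_incrementE w x y :
  column_increment w x y = sc%:C * (entry_product x y w - (x == y)%:R).
Proof. by rewrite mxE mxE pt_squareE 4!mxE. Qed.

Lemma column_increment_hermitian w : (column_increment w)^t* = column_increment w.
Proof.
rewrite linearZ /= map_mxZ linearB /= map_mxB pt_square_hermitian trmx1 map_mx1.
by rewrite conjC_real_complex.
Qed.

Lemma Cmeasurable_column_increment (dS : measure_display) (S : measurableType dS)
  (pr : S -> T) x y :
  (forall r, Cmeasurable (fun w => g (r, c) (pr w))) ->
  Cmeasurable (fun w => column_increment (pr w) x y).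
Proof.
move=> mg; apply: (eq_Cmeasurable (f := fun w =>
    sc%:C * (entry_product x y (pr w) + - (x == y)%:R))) => [w|].
  by rewrite column_incrementE.
apply: CmeasurableM; first exact: Cmeasurable_cst.
apply: CmeasurableD; last exact: Cmeasurable_cst.
by apply: CmeasurableM => //; exact: Cmeasurable_conjC.
Qed.

Lemma column_increment_opnorm_le w (tau : R) : (0 < d)%N -> 0 <= tau -> net_event g c tau w ->
  opnorm_le (`|sc| * (16 * tau ^+ 2 + 1))%:C (column_increment w).
Proof.
move=> d0 tau0 /(net_event_pt_square_opnorm_le d0 tau0) pt_le.
rewrite rmorphM /= -normC_real_complex; apply: opnorm_leZ; rewrite rmorphD; apply: opnorm_leD => //.
by apply: opnorm_leN; exact: opnorm_le1.
Qed.

Variables (P : probability T R) (kap : R).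
Hypothesis entries : forall e, gaussian_entry P kap (g e).
Hypothesis indep : mutually_independent P (re_im g).
Hypothesis kap_idem : kap * kap = kap.

Let entry_word (x y : I) := [:: ((swap_index x y, c), false); ((swap_index y x, c), true)].

Let entry_wordE x y : word g (entry_word x y) =1 entry_product x y.
Proof. by move=> w; rewrite /word !big_cons big_nil mulr1. Qed.

Let Iproduct x y : Cintegrable P (entry_product x y).
Proof. exact: eq_Cintegrable (entry_wordE x y) (Cintegrable_word entries _). Qed.

Let Iproduct2 x y a b : Cintegrable P (fun w => entry_product x y w * entry_product a b w).
Proof.
apply: eq_Cintegrable (Cintegrable_word entries (entry_word x y ++ entry_word a b)) => w.
by rewrite word_cat !entry_wordE.
Qed.

Let Cintegral_product x y : Cintegral P (entry_product x y) = (x == y)%:R.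
Proof. by rewrite (wick2 entries indep) xpair_eqE eqxx andbT swap_index_diag. Qed.

Let Cintegral_product2 x y a b :
  Cintegral P (fun w => entry_product x y w * entry_product a b w) =
  ((x == y) && (a == b))%:R + ((x == b) && (y == a))%:R + kap%:C * ((x == a) && (y == b))%:R.
Proof.
rewrite (wick4 entries indep kap_idem) !xpair_eqE eqxx !andbT !swap_index_diag.
by rewrite !swap_index_eq2.
Qed.

Lemma column_increment_moments : increment_moments P kap (sc ^+ 2) column_increment.
Proof.
have Icentered x y : Cintegrable P (fun w => entry_product x y w + - (x == y)%:R).
  by apply: CintegrableD => //; exact: Cintegrable_cst.
have incE x y w : column_increment w x y = sc%:C * (entry_product x y w + - (x == y)%:R).
  exact: column_incrementE.
have I3 x y a b : Cintegrable P (fun w => entry_product x y w * entry_product a b w +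
    (- (a == b)%:R) * entry_product x y w + (- (x == y)%:R) * entry_product a b w).
  by apply: CintegrableD; [apply: CintegrableD => //|]; exact: CintegrableZ.
pose expansion x y a b w := (sc ^+ 2)%:C * (entry_product x y w * entry_product a b w +
  (- (a == b)%:R) * entry_product x y w + (- (x == y)%:R) * entry_product a b w +
  (x == y)%:R * (a == b)%:R).
have inc2E x y a b w : column_increment w x y * column_increment w a b = expansion x y a b w.
  by rewrite !column_incrementE /expansion rmorphXn /=; ring.
apply: covariance_increment_moments => [w|x y|x y|x y a b|x y a b].
- exact: column_increment_hermitian.
- by rewrite (funext (incE x y)); exact: CintegrableZ.
- rewrite (funext (incE x y)) CintegralZ // CintegralD //; last exact: Cintegrable_cst.
  by rewrite Cintegral_product Cintegral_cst subrr mulr0.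
- rewrite (funext (inc2E x y a b)).
  by apply: CintegrableZ; apply: CintegrableD => //; exact: Cintegrable_cst.
- rewrite (funext (inc2E x y a b)) CintegralZ; last by apply: CintegrableD => //;
    exact: Cintegrable_cst.
  rewrite CintegralD //; last exact: Cintegrable_cst.
  rewrite CintegralD; [|by apply: CintegrableD => //; exact: CintegrableZ|exact: CintegrableZ].
  rewrite CintegralD //; last exact: CintegrableZ.
  rewrite Cintegral_cst !CintegralZ // Cintegral_product2 !Cintegral_product.
  by rewrite -!mulnb !natrM; ring.
Qed.

End ColumnIncrement.

Section MxtraceSqr.
Variables (R : realType) (n : nat).
Implicit Type M : 'M[R[i]]_n.

Definition mxtrace_sqr M : R := complex.Re (\tr (M * M)).

Lemma mxtrace_sqr_complex M : M^t* = M -> \tr (M * M) = (\sum_x \sum_y sqmod (M x y))%:C.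
Proof.
move=> hermM; rewrite rmorph_sum; apply: eq_bigr => x _; rewrite mxE rmorph_sum.
by apply: eq_bigr => y _ /=; rewrite -mul_conjC_sqmod -[in M y x]hermM mxE mxE.
Qed.

Lemma mxtrace_sqrE M : M^t* = M -> mxtrace_sqr M = \sum_x \sum_y sqmod (M x y).
Proof. by move=> hermM; rewrite /mxtrace_sqr mxtrace_sqr_complex. Qed.

Lemma mxtrace_sqr_ge0 M : M^t* = M -> 0 <= mxtrace_sqr M.
Proof.
by move=> /mxtrace_sqrE->; apply: sumr_ge0 => x _; apply: sumr_ge0 => y _; exact: sqmod_ge0.
Qed.

End MxtraceSqr.

Record increment_truncation {R : realType} {dT : measure_display} {T : measurableType dT}
    (P : probability T R) n (Z : T -> 'M[R[i]]_n) (N : T -> bool) (kz nu : R) : Prop :=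
  IncrementTruncation {
  truncation_measurable : measurable_fun setT N;
  truncation_opnorm_le : forall w, N w -> opnorm_le kz%:C (Z w);
  truncation_prob : \int[P]_w (~~ N w)%:R <= nu;
  truncation_Rintegrable : Rintegrable P (fun w => (~~ N w)%:R * mxtrace_sqr (Z w));
  truncation_mxtrace_sqr : \int[P]_w ((~~ N w)%:R * mxtrace_sqr (Z w)) <= nu
}.

Lemma bool_mul_sqr_le (R : realFieldType) (b : bool) (a L : R) : 0 < L ->
  b%:R * a ^+ 2 <= 2^-1 * (L * b%:R + L^-1 * a ^+ 4).
Proof.
move=> L0; case: b => /=; last first.
  rewrite mul0r mulr0 add0r; apply: mulr_ge0; first by rewrite invr_ge0.
  by apply: mulr_ge0; [rewrite invr_ge0 ltW | rewrite exprn_even_ge0].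
rewrite mul1r mulr1; have : 0 <= L^-1 * (L - a ^+ 2) ^+ 2.
  by rewrite mulr_ge0 ?sqr_ge0 // invr_ge0 ltW.
have -> : L^-1 * (L - a ^+ 2) ^+ 2 = L - 2 * a ^+ 2 + L^-1 * a ^+ 4.
  by field; rewrite gt_eqF.
by set z := a ^+ 2; set t := L^-1 * _; lra.
Qed.

Section TruncatedTrace.
Context {R : realType} {dT : measure_display} {T : measurableType dT}.
Local Notation C := R[i].
Variables (P : probability T R) (kap : R) (d p : nat) (g : 'I_(d * d) * 'I_p -> T -> C).
Hypothesis entries : forall e, gaussian_entry P kap (g e).
Variables (c : 'I_p) (sc : R) (N : T -> bool) (L failure : R).
Hypotheses (mN : measurable_fun setT N) (L_gt0 : 0 < L).
Hypothesis failure_le : \int[P]_w (~~ N w)%:R <= failure.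
Local Notation Z := (column_increment g c sc).
Local Notation I := 'I_(d * d).

Let failed w : R := (~~ N w)%:R.

Let Ifailed : Rintegrable P failed.
Proof. by apply: Rintegrable_bool; exact: measurable_neg. Qed.

(* Bounds [failed * sqmod (g e) ^+ 2] by AM-GM, so that only the eighth moment is needed. *)
Let majorant e w : R := 2^-1 * (L * failed w + L^-1 * sqmod (g e w) ^+ 4).

Let Imajorant e : Rintegrable P (majorant e).
Proof.
apply: RintegrableZ; apply: RintegrableD; apply: RintegrableZ => //.
exact: entry_sqmod_integrable (entries e) _.
Qed.

Let Rintegral_majorant e : \int[P]_w majorant e w <= 2^-1 * (L * failure + 24 * 2 ^+ 10 / L).
Proof.
have I4 : Rintegrable P (fun w => sqmod (g e w) ^+ 4) := entry_sqmod_integrable (entries e) 4.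
have IL : Rintegrable P (fun w => L * failed w) by exact: RintegrableZ.
have IL4 : Rintegrable P (fun w => L^-1 * sqmod (g e w) ^+ 4) by exact: RintegrableZ.
rewrite RintegralZl //; last exact: RintegrableD.
rewrite ler_pM2l ?invr_gt0 // RintegralD // !RintegralZl //.
apply: lerD; first by rewrite ler_pM2l.
by rewrite mulrC ler_pM2r ?invr_gt0 //; exact: entry_eighth_moment (entries e).
Qed.

Let total w : R := \sum_(x : I) \sum_(y : I)
  (majorant (swap_index x y, c) w + majorant (swap_index y x, c) w + failed w).

Let Isummand x y : Rintegrable P (fun w =>
  majorant (swap_index x y, c) w + majorant (swap_index y x, c) w + failed w).
Proof. by apply: RintegrableD => //; exact: RintegrableD. Qed.

Let Itotal : Rintegrable P total.
Proof. by apply: Rintegrable_sum => x _; apply: Rintegrable_sum => y _; exact: Isummand. Qed.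

Let Rintegral_total :
  \int[P]_w total w <= d%:R ^+ 4 * (L * failure + 24 * 2 ^+ 10 / L + failure).
Proof.
rewrite Rintegral_sum => [|x _]; last by apply: Rintegrable_sum => y _; exact: Isummand.
apply: (@le_trans _ _ (\sum_(x : I) \sum_(y : I) (L * failure + 24 * 2 ^+ 10 / L + failure))).
  apply: ler_sum => x _; rewrite Rintegral_sum => [|y _]; last exact: Isummand.
  apply: ler_sum => y _; rewrite RintegralD //; last exact: RintegrableD.
  rewrite RintegralD //; [|exact: Imajorant|exact: Imajorant]; apply: lerD => //.
  apply: le_trans (lerD (Rintegral_majorant _) (Rintegral_majorant _)) _.
  by set z := L * failure + _; lra.
rewrite !sumr_const card_ord -mulrnA -[leLHS]mulr_natl.
by rewrite (_ : (d * d * (d * d))%:R = d%:R ^+ 4) // -natrX !expnS expn0 muln1 !mulnA.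
Qed.

Let failed_mxtrace_sqr_le w : failed w * mxtrace_sqr (Z w) <= 2 * sc ^+ 2 * total w.
Proof.
rewrite (mxtrace_sqrE (column_increment_hermitian _ _ _ _)) /total !mulr_sumr.
apply: ler_sum => x _; rewrite !mulr_sumr; apply: ler_sum => y _.
rewrite column_incrementE sqmodM sqmod_real mulrCA [2 * _]mulrC -[leRHS]mulrA.
apply: ler_wpM2l; first exact: sqr_ge0.
set a := g _ w; set b := g _ w.
have prod_le : sqmod (a * Num.conj b - (x == y)%:R) <= 2 * (sqmod a ^+ 2 + sqmod b ^+ 2 + 1).
  apply: le_trans (sqmodB_le _ _) _; rewrite ler_pM2l // sqmodM sqmod_conjC.
  apply: lerD; last by rewrite sqmod_nat; case: (x == y); rewrite ?expr1n ?expr0n.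
  set s := sqmod a; set t := sqmod b; have := sqr_ge0 (s - t); have := sqr_ge0 (s + t).
  by rewrite !expr2; lra.
apply: le_trans (ler_wpM2l (ler0n _ _) prod_le) _; rewrite mulrCA ler_pM2l // !mulrDr mulr1.
by apply: lerD => //; apply: lerD; exact: bool_mul_sqr_le.
Qed.

Lemma truncated_mxtrace_sqr_le :
  Rintegrable P (fun w => (~~ N w)%:R * mxtrace_sqr (Z w)) /\
  \int[P]_w ((~~ N w)%:R * mxtrace_sqr (Z w)) <=
    2 * sc ^+ 2 * (d%:R ^+ 4 * (L * failure + 24 * 2 ^+ 10 / L + failure)).
Proof.
have Ibound : Rintegrable P (fun w => 2 * sc ^+ 2 * total w) by exact: RintegrableZ.
have mtrace : measurable_fun setT (fun w => mxtrace_sqr (Z w)).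
  under eq_fun do rewrite (mxtrace_sqrE (column_increment_hermitian _ _ _ _)).
  apply: measurable_sum => x; apply: measurable_sum => y; apply: measurable_sqmod.
  by apply: (@Cmeasurable_column_increment _ _ _ _ _ g c sc _ _ id) => r;
    exact: entry_measurable (entries _).
have Itrace : Rintegrable P (fun w => failed w * mxtrace_sqr (Z w)).
  apply: (Rintegrable_le _ _ Ibound) => [|w].
    by apply: measurable_funM => //; exact: Rintegrable_measurable Ifailed.
  rewrite ger0_norm ?failed_mxtrace_sqr_le // mulr_ge0 ?ler0n //.
  exact/mxtrace_sqr_ge0/column_increment_hermitian.
split=> //; apply: le_trans (ler_Rintegral Itrace Ibound failed_mxtrace_sqr_le) _.
by rewrite RintegralZl //; apply: ler_wpM2l => //; rewrite mulr_ge0 ?sqr_ge0.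
Qed.

End TruncatedTrace.

(** * Trace moments of the resolvent *)

Section PsdBounded.
Variables (R : realType) (n : nat).
Local Notation C := R[i].
Implicit Types (A W M : 'M[C]_n) (K : R) (b c q : nat).

Definition psd_le K A :=
  exists P r, real_spectral_dec A P r /\ forall i, 0 <= r i <= K.

Definition trace_moment A q : R := complex.Re (\tr (A ^+ q)) / n%:R.

Definition cross_trace A b c W : R := complex.Re (\tr (A ^+ b * W * A ^+ c * W)).

Lemma psd_le_opnorm_le K A : 0 <= K -> psd_le K A -> opnorm_le K%:C A.
Proof.
move=> K0 [P [r [decA rK]]]; apply: (real_spectral_dec_opnorm_le decA K0) => i.
by have /andP[r0 rle] := rK i; rewrite ger0_norm.
Qed.

Lemma psd_le_hermitian K A : psd_le K A -> A^t* = A.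
Proof. by move=> [P [r [/real_spectral_dec_hermitian]]]. Qed.

Hypothesis n_gt0 : (0 < n)%N.

Let nR_gt0 : 0 < n%:R :> R. Proof. by rewrite ltr0n. Qed.

Let nR_neq0 : n%:R != 0 :> R. Proof. by rewrite gt_eqF. Qed.

Lemma trace_moment0 A : trace_moment A 0 = 1.
Proof. by rewrite /trace_moment expr0 mxtrace1 -(rmorph_nat (real_complex R)) /= divff. Qed.

Section Bounds.
Variables (A : 'M[C]_n) (K : R).
Hypothesis psdA : psd_le K A.

Let trace_momentE P r q : real_spectral_dec A P r -> n%:R * trace_moment A q = power_sum r q.
Proof.
by move=> decA; rewrite /trace_moment (real_spectral_dec_mxtrace_exprn decA) /= mulrC divfK.
Qed.

Lemma mxtrace_exprn_trace_moment q : \tr (A ^+ q) = (n%:R * trace_moment A q)%:C.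
Proof.
have [P [r [decA _]]] := psdA; rewrite (trace_momentE q decA).
exact: real_spectral_dec_mxtrace_exprn decA q.
Qed.

Lemma trace_moment_ge0 q : 0 <= trace_moment A q.
Proof.
have [P [r [decA rK]]] := psdA; rewrite -(pmulr_rge0 _ nR_gt0) (trace_momentE q decA).
by apply: power_sum_ge0 => i; case/andP: (rK i).
Qed.

Lemma trace_momentS_le q : trace_moment A q.+1 <= K * trace_moment A q.
Proof.
have [P [r [decA rK]]] := psdA; rewrite -(ler_pM2l nR_gt0) [leRHS]mulrCA !(trace_momentE _ decA).
by apply: power_sumS_le => i; case/andP: (rK i).
Qed.

Lemma trace_moment_le q : 0 <= K -> trace_moment A q <= K ^+ q.
Proof.
move=> K0; elim: q => [|q IH]; first by rewrite trace_moment0.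
by apply: le_trans (trace_momentS_le q) _; rewrite exprS ler_wpM2l.
Qed.

Lemma trace_moment_mul_le a b : trace_moment A (2 + a) * trace_moment A (2 + b) <=
  trace_moment A 2 * trace_moment A (2 + (a + b)).
Proof.
have [P [r [decA rK]]] := psdA; have nn_gt0 : 0 < n%:R * n%:R :> R by rewrite mulr_gt0.
rewrite -(ler_pM2l nn_gt0) mulrACA [leRHS]mulrACA !(trace_momentE _ decA).
by apply: power_sum_mul_le => i; case/andP: (rK i).
Qed.

Lemma cross_trace_complex b c W : W^t* = W ->
  \tr (A ^+ b * W * A ^+ c * W) = (cross_trace A b c W)%:C.
Proof.
by move=> hermW; have [P [r [decA _]]] := psdA; rewrite /cross_trace (mxtrace_pair decA).
Qed.

Lemma cross_trace_ge0 b c W : W^t* = W -> 0 <= cross_trace A b c W.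
Proof.
move=> hermW; have [P [r [decA rK]]] := psdA.
rewrite /cross_trace (mxtrace_pair decA) //=; apply: pair_trace_ge0 => i.
by case/andP: (rK i).
Qed.

Lemma cross_trace_opnorm_le b c W (k : R) : W^t* = W -> opnorm_le k%:C W ->
  cross_trace A b c W <= 2 * k ^+ 2 * (n%:R * trace_moment A (b + c)).
Proof.
move=> hermW Wk; have [P [r [decA rK]]] := psdA.
rewrite /cross_trace (mxtrace_pair decA) //= (trace_momentE _ decA).
by apply: (pair_trace_opnorm_le decA) => // i; case/andP: (rK i).
Qed.

Lemma cross_trace_mxtrace_sqr_le b c W : W^t* = W ->
  cross_trace A b c W <= K ^+ (b + c) * mxtrace_sqr W.
Proof.
move=> hermW; have [P [r [decA rK]]] := psdA.
have r_ge0 i : 0 <= r i by case/andP: (rK i).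
have rle i : r i <= K by case/andP: (rK i).
rewrite -lecR -cross_trace_complex // rmorphM /= /mxtrace_sqr.
rewrite -complex_Im0; last by rewrite (mxtrace_sqr_complex hermW).
by rewrite (mxtrace_pair decA) //; exact: (pair_trace_mxtrace_sqr_le decA).
Qed.

Lemma mxtrace_mul_trmx_le b c : exists2 x : R,
  \tr (A ^+ b *m (A ^+ c)^T) = x%:C & 0 <= x <= 2 * (n%:R * trace_moment A (b + c)).
Proof.
have [P [r [decA rK]]] := psdA; rewrite (trace_momentE _ decA).
by apply: (mxtrace_mul_trmx decA) => i; case/andP: (rK i).
Qed.

Lemma Im_mxtraceM m W : W^t* = W -> complex.Im (\tr (A ^+ m * W)) = 0.
Proof. by have [P [r [decA _]]] := psdA; exact: (mxtraceM_real decA). Qed.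

Lemma Re_mxtraceM_opnorm_le m W (k : R) : opnorm_le k%:C W ->
  `|complex.Re (\tr (A ^+ m * W))| <= k * (n%:R * trace_moment A m).
Proof.
move=> Wk; have [P [r [decA rK]]] := psdA; apply: ler_norm_Re; rewrite (trace_momentE _ decA).
by apply: (mxtraceM_opnorm_le decA) => // i; case/andP: (rK i).
Qed.

End Bounds.
End PsdBounded.

Section SumOrd2.
Variable R : realDomainType.

Lemma natr_mul_le_sqr q (m : R) : 0 <= m -> q%:R * m <= q%:R ^+ 2 * m.
Proof.
by move=> m0; rewrite ler_wpM2r // -natrX ler_nat -mulnn; case: q => // q; exact: leq_pmulr.
Qed.

Lemma sum_ord2_le q (f : nat -> nat -> R) (m : R) : 0 <= m ->
  (forall i k, (k < i)%N -> (i < q)%N -> f i k <= m) ->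
  \sum_(i < q) \sum_(k < i) f i k <= q%:R ^+ 2 * m.
Proof.
move=> m0 fm; apply: (@le_trans _ _ (\sum_(i < q) \sum_(k < q) m)).
  apply: ler_sum => i _; rewrite (big_ord_widen q (fun k => f i k)) ?(ltnW (ltn_ord i)) //.
  by rewrite big_mkcond; apply: ler_sum => k _; case: ifP => // ki; exact: fm.
by rewrite !sumr_const !card_ord -mulrnA -[leLHS]mulr_natl natrM expr2.
Qed.

End SumOrd2.

Section SecondOrderTerms.
Variables (R : realType) (n : nat).
Local Notation C := R[i].
Implicit Types (A B W : 'M[C]_n) (q : nat).

Definition linear_term A q W : R := q%:R * complex.Re (\tr (A ^+ q.+1 * W)) / n%:R.

Definition quadratic_term A q W : R := (q%:R * cross_trace A q.+1 1 W +
  \sum_(i < q) \sum_(k < i) cross_trace A (q + 1 - i + k) (i + 1 - k) W) / n%:R.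

Lemma second_order_exponents q i k : (k < i)%N -> (i < q)%N ->
  [/\ (q + 1 - i + k + (i + 1 - k) = q.+2)%N,
      (q + 1 - i + k = 2 + (q - 1 - i + k))%N, (i + 1 - k = 2 + (i - 1 - k))%N &
      (q = 2 + ((q - 1 - i + k) + (i - 1 - k)))%N].
Proof. by move=> ki iq; split; lia. Qed.

Hypothesis n_gt0 : (0 < n)%N.

Let nR_gt0 : 0 < n%:R :> R. Proof. by rewrite ltr0n. Qed.

Section Bounds.
Variables (A W : 'M[C]_n) (K : R).
Hypotheses (psdA : psd_le K A) (hermW : W^t* = W).

Lemma quadratic_term_ge0 q : 0 <= quadratic_term A q W.
Proof.
apply: divr_ge0; last exact: ltW.
apply: addr_ge0; first by rewrite mulr_ge0 // (cross_trace_ge0 psdA).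
by apply: sumr_ge0 => i _; apply: sumr_ge0 => k _; exact: (cross_trace_ge0 psdA).
Qed.

Lemma quadratic_term_le (k : R) q : opnorm_le k%:C W ->
  quadratic_term A q W <= q%:R ^+ 2 * (4 * k ^+ 2) * trace_moment A q.+2.
Proof.
move=> Wk; rewrite /quadratic_term ler_pdivrMr //.
pose m := 2 * k ^+ 2 * (n%:R * trace_moment A q.+2).
have m_ge0 : 0 <= m by apply: mulr_ge0; apply: mulr_ge0;
  rewrite ?sqr_ge0 ?(trace_moment_ge0 n_gt0 psdA).
have cross_le b c : (b + c = q.+2)%N -> cross_trace A b c W <= m.
  by move=> bc; rewrite /m -bc; exact: (cross_trace_opnorm_le n_gt0 psdA).
apply: (@le_trans _ _ (q%:R ^+ 2 * m + q%:R ^+ 2 * m)); last first.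
  by rewrite /m; set x := trace_moment _ _; lra.
apply: lerD.
  by apply: le_trans (natr_mul_le_sqr q m_ge0); rewrite ler_wpM2l // cross_le // addn1.
apply: (sum_ord2_le (f := fun i j => cross_trace A (q + 1 - i + j) (i + 1 - j) W)) => // i j ji iq.
by apply: cross_le; have [] := second_order_exponents ji iq.
Qed.

Lemma resolvent_order2E q : resolvent_order2 A W q =
  (n%:R * (trace_moment A q + linear_term A q W + quadratic_term A q W))%:C.
Proof.
have -> : n%:R * (trace_moment A q + linear_term A q W + quadratic_term A q W) =
    n%:R * trace_moment A q + q%:R * complex.Re (\tr (A ^+ q.+1 * W)) +
    q%:R * cross_trace A q.+1 1 W +
    \sum_(i < q) \sum_(k < i) cross_trace A (q + 1 - i + k) (i + 1 - k) W.
  rewrite /linear_term /quadratic_term; set s := \sum_(i < q) _; set t := complex.Re _.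
  by field; rewrite gt_eqF.
rewrite /resolvent_order2 (mxtrace_exprn_trace_moment n_gt0 psdA).
rewrite (complex_Im0 (Im_mxtraceM psdA _ hermW)).
have := cross_trace_complex psdA q.+1 1 hermW; rewrite expr1 => ->.
rewrite !rmorphD !rmorphM !rmorph_nat /=; congr (_ + _).
rewrite rmorph_sum; apply: eq_bigr => i _; rewrite rmorph_sum; apply: eq_bigr => k _.
by rewrite (cross_trace_complex psdA).
Qed.

End Bounds.

Section Expansion.
Variables (A B W : 'M[C]_n) (K kap : R).
Hypotheses (psdA : psd_le K A) (hermB : B^t* = B) (hermW : W^t* = W).
Hypothesis resolvent_id : B = A + B * W * A.
Hypotheses (K_ge0 : 0 <= K) (opB : opnorm_le (2 * K)%:C B) (opW : opnorm_le kap%:C W).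
Let eps := 2 * K * kap.
Hypothesis eps_le1 : eps <= 1.

Let opA : opnorm_le K%:C A. Proof. exact: psd_le_opnorm_le. Qed.

Let twoKE : (2 * K)%:C = 2 * K%:C. Proof. by rewrite rmorphM rmorph_nat. Qed.

Let epsE : eps%:C = 2 * K%:C * kap%:C. Proof. by rewrite /eps !rmorphM rmorph_nat. Qed.

Let opB' : opnorm_le (2 * K%:C) B. Proof. by rewrite -twoKE. Qed.

Let trace_moment_remainder q (b : R) :
  `|\tr (B ^+ q) - resolvent_order2 A W q| <= (n%:R * b)%:C ->
  `|trace_moment B q - trace_moment A q - linear_term A q W - quadratic_term A q W| <= b.
Proof.
rewrite (resolvent_order2E psdA hermW) => /ler_norm_Re; rewrite raddfB /= => Re_le.
set x := trace_moment A q; set y := linear_term A q W; set z := quadratic_term A q W.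
have -> : trace_moment B q - x - y - z =
    n%:R^-1 * (complex.Re (\tr (B ^+ q)) - n%:R * (x + y + z)).
  by rewrite {1}/trace_moment; field; rewrite gt_eqF.
by rewrite normrM ger0_norm ?invr_ge0 ?ler0n // ler_pdivrMl.
Qed.

Lemma trace_moment1_expansion :
  `|trace_moment B 1 - trace_moment A 1 - linear_term A 1 W - quadratic_term A 1 W| <=
  eps ^+ 3 * K.
Proof.
apply: trace_moment_remainder; rewrite expr1.
apply: le_trans (resolvent_expansion_trace resolvent_id opA opB' opW) _.
by rewrite -epsE -(rmorph_nat (real_complex R) n) -rmorphXn -!rmorphM /= lecR mulrC.
Qed.

Lemma trace_moment_dyadic_expansion j q : q = (2 ^ j.+1)%N ->
  `|trace_moment B q - trace_moment A q - linear_term A q W - quadratic_term A q W| <=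
  expansion_const R q * eps ^+ 3 * trace_moment A q.
Proof.
move=> qE; apply: trace_moment_remainder.
have eps_leC : 2 * K%:C * kap%:C <= 1 by rewrite -epsE -(rmorph1 (real_complex R)) lecR.
have := resolvent_expansion_dyadic (psd_le_hermitian psdA) hermB hermW resolvent_id opA opB' opW
  eps_leC j.
rewrite -qE => /le_trans; apply; rewrite (mxtrace_exprn_trace_moment n_gt0 psdA) -epsE.
have -> : expansion_const C q = (expansion_const R q)%:C.
  by rewrite /expansion_const !rmorphD !rmorphM !rmorphXn !rmorph_nat.
rewrite -rmorphXn -!rmorphM lecR.
by set c := expansion_const R q; set s := trace_moment A q; set f := eps ^+ 3; rewrite mulrCA.
Qed.

End Expansion.
End SecondOrderTerms.

Definition shift_increment (R : rcfType) n (a : R) (Z : 'M[R[i]]_n) : 'M[R[i]]_n := Z - (a%:C)%:M.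

Lemma shift_increment_hermitian (R : rcfType) n (a : R) (Z : 'M[R[i]]_n) :
  Z^t* = Z -> (shift_increment a Z)^t* = shift_increment a Z.
Proof. by move=> hermZ; rewrite trmxC_sub hermZ trmxC_real_scalar. Qed.

Section ShiftedTerms.
Variables (R : realType) (n : nat) (A Z : 'M[R[i]]_n) (K a : R).
Hypotheses (n_gt0 : (0 < n)%N) (psdA : psd_le K A) (hermZ : Z^t* = Z).
Local Notation W := (shift_increment a Z).

Let mxtrace_mul_shift (M : 'M[R[i]]_n) : \tr (M * W) = \tr (M * Z) - a%:C * \tr M.
Proof.
rewrite /shift_increment mulrBr raddfB /=; congr (_ - _).
by rewrite -mulmxE mul_mx_scalar linearZ.
Qed.

Lemma linear_term_shift q : linear_term A q W =
  q%:R / n%:R * complex.Re (\tr (A ^+ q.+1 * Z)) - q%:R * a * trace_moment A q.+1.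
Proof.
rewrite /linear_term mxtrace_mul_shift (mxtrace_exprn_trace_moment n_gt0 psdA) -rmorphM raddfB /=.
set t := complex.Re _; set x := trace_moment _ _.
by field; rewrite pnatr_eq0 -lt0n.
Qed.

Lemma cross_trace_shift b c : cross_trace A b c W =
  complex.Re (\tr (A ^+ b * Z * A ^+ c * Z)) - 2 * a * complex.Re (\tr (A ^+ (b + c) * Z)) +
  a ^+ 2 * (n%:R * trace_moment A (b + c)).
Proof.
set t := \tr (A ^+ (b + c) * Z); set s := n%:R * trace_moment A (b + c).
have trE : \tr (A ^+ (b + c)) = s%:C := mxtrace_exprn_trace_moment n_gt0 psdA (b + c).
have tE : t = (complex.Re t)%:C := complex_Im0 (Im_mxtraceM psdA (b + c) hermZ).
have middleE : A ^+ b * W * A ^+ c = A ^+ b * Z * A ^+ c - a%:C *: A ^+ (b + c).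
  rewrite mulrBr mulrBl exprD; congr (_ - _).
  by rewrite -!mulmxE mul_mx_scalar scalemxAl.
have trace_middle : \tr (A ^+ b * W * A ^+ c) = t - a%:C * s%:C.
  rewrite middleE raddfB /= linearZ /= trE; congr (_ - _).
  by rewrite /t -mulrA mxtrace_mulrC -mulrA -exprD mxtrace_mulrC addnC.
have trace_scaled : \tr (a%:C *: A ^+ (b + c) * Z) = a%:C * t.
  by rewrite /t -!mulmxE -scalemxAl mxtraceZ.
rewrite /cross_trace mxtrace_mul_shift trace_middle middleE mulrBl [\tr (_ - _)]raddfB /=.
rewrite trace_scaled tE -!(rmorphM, rmorphB) !raddfB /=.
by set z := complex.Re (\tr _); set y := complex.Re t; ring.
Qed.

End ShiftedTerms.

Section Expectations.
Context {R : realType} {dT : measure_display} {T : measurableType dT}.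
Local Notation C := R[i].
Variables (P : probability T R) (n : nat) (kap p a K : R) (Z : T -> 'M[C]_n) (A : 'M[C]_n).
Hypotheses (n_gt0 : (0 < n)%N) (p_gt0 : 0 < p) (kap_ge0 : 0 <= kap) (kap_le1 : kap <= 1).
Hypothesis moments : increment_moments P kap (p * n%:R)^-1 Z.
Hypothesis psdA : psd_le K A.
Local Notation X := (trace_moment A).
Local Notation W w := (shift_increment a (Z w)).

Let nR_gt0 : 0 < n%:R :> R. Proof. by rewrite ltr0n. Qed.
Let n_neq0 : n%:R != 0 :> R. Proof. by rewrite gt_eqF. Qed.
Let p_neq0 : p != 0. Proof. by rewrite gt_eqF. Qed.
Let pn_gt0 : 0 < p * n%:R. Proof. exact: mulr_gt0. Qed.
Let hermZ w : (Z w)^t* = Z w := increment_hermitian moments w.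
Let hermW w : (W w)^t* = W w. Proof. exact: shift_increment_hermitian. Qed.
Let X_ge0 q : 0 <= X q := trace_moment_ge0 n_gt0 psdA q.

Definition variance_error : R := 2 / (p * n%:R) + a ^+ 2.

Lemma variance_error_ge0 : 0 <= variance_error.
Proof. by rewrite addr_ge0 ?sqr_ge0 // divr_ge0 // ltW. Qed.

Lemma Rintegrable_Re_mxtraceM M : Rintegrable P (fun w => complex.Re (\tr (M * Z w))).
Proof. exact: (increment_Cintegrable moments M).1. Qed.

Lemma Rintegral_Re_mxtraceM M : \int[P]_w complex.Re (\tr (M * Z w)) = 0.
Proof. by have := congr1 (@complex.Re R) (increment_mean moments M). Qed.

Lemma Rintegrable_linear_term q : Rintegrable P (fun w => linear_term A q (W w)).
Proof.
apply: eq_Rintegrable (fun w => esym (linear_term_shift (Z w) a n_gt0 psdA q)) _.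
apply: RintegrableB; last exact: Rintegrable_cst.
by apply: RintegrableZ; exact: Rintegrable_Re_mxtraceM.
Qed.

Lemma Rintegral_linear_term q : \int[P]_w linear_term A q (W w) = - (q%:R * a * X q.+1).
Proof.
have I1 := RintegrableZ (q%:R / n%:R) (Rintegrable_Re_mxtraceM (A ^+ q.+1)).
rewrite (eq_RintegralT P (fun w => linear_term_shift (Z w) a n_gt0 psdA q)).
rewrite RintegralB //; last exact: Rintegrable_cst.
rewrite Rintegral_cstT RintegralZl //; last exact: Rintegrable_Re_mxtraceM.
by rewrite Rintegral_Re_mxtraceM mulr0 sub0r.
Qed.

Lemma Rintegrable_cross_trace b c : Rintegrable P (fun w => cross_trace A b c (W w)).
Proof.
apply: eq_Rintegrable (fun w => esym (cross_trace_shift a n_gt0 psdA (hermZ w) b c)) _.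
apply: RintegrableD; last exact: Rintegrable_cst.
apply: RintegrableB; first exact: (increment_Cintegrable2 moments _ _).1.
by apply: RintegrableZ; exact: Rintegrable_Re_mxtraceM.
Qed.

Lemma Rintegral_cross_trace b c : exists2 x : R, 0 <= x <= 2 * (n%:R * X (b + c)) &
  \int[P]_w cross_trace A b c (W w) =
  (p * n%:R)^-1 * (n%:R * X b * (n%:R * X c) + kap * x) + a ^+ 2 * (n%:R * X (b + c)).
Proof.
have I2 := (increment_Cintegrable2 moments (A ^+ b) (A ^+ c)).1.
have I1 := RintegrableZ (2 * a) (Rintegrable_Re_mxtraceM (A ^+ (b + c))).
have [x xE x_itv] := mxtrace_mul_trmx_le n_gt0 psdA b c; exists x => //.
rewrite (eq_RintegralT P (fun w => cross_trace_shift a n_gt0 psdA (hermZ w) b c)).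
rewrite RintegralD //; [|exact: RintegrableB|exact: Rintegrable_cst].
rewrite Rintegral_cstT RintegralB // RintegralZl //; last exact: Rintegrable_Re_mxtraceM.
rewrite Rintegral_Re_mxtraceM mulr0 subr0; congr (_ + _).
have := congr1 (@complex.Re R) (increment_mxtrace2 moments (A ^+ b) (A ^+ c)).
by rewrite !(mxtrace_exprn_trace_moment n_gt0 psdA) xE -!rmorphM -rmorphD -rmorphM.
Qed.

Lemma Rintegral_cross_trace_bounds b c :
  n%:R * (X b * X c / p) <= \int[P]_w cross_trace A b c (W w) <=
  n%:R * (X b * X c / p + variance_error * X (b + c)).
Proof.
have [x /andP[x_ge0 x_le] ->] := Rintegral_cross_trace b c.
have -> : (p * n%:R)^-1 * (n%:R * X b * (n%:R * X c) + kap * x) + a ^+ 2 * (n%:R * X (b + c)) =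
    n%:R * (X b * X c / p) + ((p * n%:R)^-1 * (kap * x) + a ^+ 2 * (n%:R * X (b + c))).
  by field; rewrite n_neq0.
have kx_le : kap * x <= 2 * (n%:R * X (b + c)) by rewrite (le_trans _ x_le) // ler_piMl.
have pn_inv : 0 <= (p * n%:R)^-1 by rewrite invr_ge0 ltW.
apply/andP; split.
  rewrite lerDl addr_ge0 ?(mulr_ge0 pn_inv) ?(mulr_ge0 kap_ge0) //.
  by rewrite mulr_ge0 ?sqr_ge0 // mulr_ge0.
rewrite mulrDr lerD2l /variance_error mulrDl mulrDr; apply: lerD; last by rewrite mulrCA.
apply: le_trans (ler_wpM2l pn_inv kx_le) _.
by rewrite le_eqVlt; apply/orP; left; apply/eqP; ring.
Qed.

Definition mean_quadratic q : R := (q%:R * (X q.+1 * X 1) +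
  \sum_(i < q) \sum_(k < i) X (q + 1 - i + k) * X (i + 1 - k)) / p.

Let Rintegrable_quadratic_numerator q : Rintegrable P (fun w => q%:R * cross_trace A q.+1 1 (W w) +
  \sum_(i < q) \sum_(k < i) cross_trace A (q + 1 - i + k) (i + 1 - k) (W w)).
Proof.
apply: RintegrableD; first by apply: RintegrableZ; exact: Rintegrable_cross_trace.
by apply: Rintegrable_sum => i _; apply: Rintegrable_sum => k _; exact: Rintegrable_cross_trace.
Qed.

Lemma Rintegrable_quadratic_term q : Rintegrable P (fun w => quadratic_term A q (W w)).
Proof.
apply: eq_Rintegrable (RintegrableZ n%:R^-1 (Rintegrable_quadratic_numerator q)) => w.
exact: mulrC.
Qed.

Let Rintegral_quadratic_term q : n%:R * \int[P]_w quadratic_term A q (W w) =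
  q%:R * \int[P]_w cross_trace A q.+1 1 (W w) +
  \sum_(i < q) \sum_(k < i) \int[P]_w cross_trace A (q + 1 - i + k) (i + 1 - k) (W w).
Proof.
have IX b c := Rintegrable_cross_trace b c.
have I2 (i : nat) :
    Rintegrable P (fun w => \sum_(k < i) cross_trace A (q + 1 - i + k) (i + 1 - k) (W w)).
  by apply: Rintegrable_sum => k _; exact: IX.
rewrite -RintegralZl //; last exact: Rintegrable_quadratic_term.
under eq_Rintegral do rewrite mulrC divfK //.
rewrite RintegralD //; [|exact: RintegrableZ|exact: Rintegrable_sum].
rewrite RintegralZl //; last exact: IX.
rewrite Rintegral_sum //; congr (_ + _).
by apply: eq_bigr => i _; rewrite Rintegral_sum.
Qed.

Lemma Rintegral_quadratic_term_ge q : mean_quadratic q <= \int[P]_w quadratic_term A q (W w).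
Proof.
have cross_ge b c : n%:R * (X b * X c / p) <= \int[P]_w cross_trace A b c (W w).
  by case/andP: (Rintegral_cross_trace_bounds b c).
rewrite -(ler_pM2l nR_gt0) Rintegral_quadratic_term /mean_quadratic mulrDl mulrDr; apply: lerD.
  apply: le_trans (ler_wpM2l (ler0n R q) (cross_ge q.+1 1%N)).
  by rewrite le_eqVlt; apply/orP; left; apply/eqP; ring.
rewrite mulr_suml mulr_sumr; apply: ler_sum => i _.
rewrite mulr_suml mulr_sumr; apply: ler_sum => k _; exact: cross_ge.
Qed.

Lemma Rintegral_quadratic_term_le q : \int[P]_w quadratic_term A q (W w) <=
  mean_quadratic q + q%:R ^+ 2 * (2 * variance_error) * X q.+2.
Proof.
have cross_le b c : \int[P]_w cross_trace A b c (W w) <=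
    n%:R * (X b * X c / p + variance_error * X (b + c)).
  by case/andP: (Rintegral_cross_trace_bounds b c).
pose m := variance_error * X q.+2.
have m_ge0 : 0 <= m by rewrite mulr_ge0 ?variance_error_ge0.
rewrite -(ler_pM2l nR_gt0) Rintegral_quadratic_term /mean_quadratic.
apply: (@le_trans _ _ (n%:R * (q%:R * (X q.+1 * X 1) / p +
   (\sum_(i < q) \sum_(k < i) X (q + 1 - i + k) * X (i + 1 - k)) / p +
   (q%:R * m + \sum_(i < q) \sum_(k < i) m)))).
  rewrite addrACA mulrDr; apply: lerD.
    apply: le_trans (ler_wpM2l (ler0n R q) (cross_le q.+1 1%N)) _.
    by rewrite addn1 -/m le_eqVlt; apply/orP; left; apply/eqP; ring.
  rewrite mulr_suml -big_split mulr_sumr; apply: ler_sum => i _ /=.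
  rewrite mulr_suml -big_split mulr_sumr; apply: ler_sum => k _ /=.
  apply: le_trans (cross_le _ _) _.
  by have [-> _ _ _] := second_order_exponents (ltn_ord k) (ltn_ord i).
rewrite ler_pM2l // mulrDl lerD2l.
apply: le_trans (lerD (natr_mul_le_sqr q m_ge0)
  (sum_ord2_le (f := fun _ _ => m) m_ge0 (fun i k _ _ => lexx m))) _.
by rewrite /m le_eqVlt; apply/orP; left; apply/eqP; ring.
Qed.

Lemma mean_quadratic_le q : (2 <= q)%N ->
  mean_quadratic q <= (q%:R * (X q.+1 * X 1) + q%:R ^+ 2 * (X 2 * X q)) / p.
Proof.
move=> q2; rewrite /mean_quadratic ler_pM2r ?invr_gt0 // lerD2l.
apply: (sum_ord2_le (f := fun i k => X (q + 1 - i + k) * X (i + 1 - k))) => [|i k ki iq].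
  by rewrite mulr_ge0.
have [_ -> -> qE] := second_order_exponents ki iq.
have -> : X q = X (2 + ((q - 1 - i + k) + (i - 1 - k))) by rewrite -qE.
exact: (trace_moment_mul_le n_gt0 psdA).
Qed.

Let linear_term_sqrE q w : linear_term A q (W w) ^+ 2 = q%:R ^+ 2 *
  ((n%:R ^+ 2)^-1 * complex.Re (\tr (A ^+ q.+1 * Z w) ^+ 2) +
   - (2 * a * X q.+1 / n%:R) * complex.Re (\tr (A ^+ q.+1 * Z w)) + a ^+ 2 * X q.+1 ^+ 2).
Proof.
rewrite (linear_term_shift _ _ n_gt0 psdA).
rewrite [\tr _ ^+ 2](_ : _ = ((complex.Re (\tr (A ^+ q.+1 * Z w))) ^+ 2)%:C) /=.
  by set t := complex.Re _; set x := trace_moment _ _; field.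
by rewrite [in LHS](complex_Im0 (Im_mxtraceM psdA _ (hermZ w))) -rmorphXn.
Qed.

Lemma Rintegrable_linear_term_sqr q : Rintegrable P (fun w => linear_term A q (W w) ^+ 2).
Proof.
apply: eq_Rintegrable (fun w => esym (linear_term_sqrE q w)) _; apply: RintegrableZ.
apply: RintegrableD; last exact: Rintegrable_cst.
apply: RintegrableD; apply: RintegrableZ; last exact: Rintegrable_Re_mxtraceM.
exact: (increment_Cintegrable_sqr moments _).1.
Qed.

Lemma Rintegral_linear_term_sqr_le q : \int[P]_w (linear_term A q (W w) ^+ 2) <=
  q%:R ^+ 2 * (3 / (p * n%:R ^+ 2) * X (q.+1 + q.+1) + a ^+ 2 * X q.+1 ^+ 2).
Proof.
have I2 := (increment_Cintegrable_sqr moments (A ^+ q.+1)).1.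
have I1 := Rintegrable_Re_mxtraceM (A ^+ q.+1).
have J2 := RintegrableZ (n%:R ^+ 2)^-1 I2.
have J1 := RintegrableZ (- (2 * a * X q.+1 / n%:R)) I1.
have Jcst := Rintegrable_cst P (a ^+ 2 * X q.+1 ^+ 2).
have [x xE /andP[x_ge0 x_le]] := mxtrace_mul_trmx_le n_gt0 psdA q.+1 q.+1.
rewrite (eq_RintegralT P (linear_term_sqrE q)) RintegralZl //; last by do 2?apply: RintegrableD.
rewrite ler_wpM2l ?sqr_ge0 // RintegralD //; last exact: RintegrableD.
rewrite Rintegral_cstT RintegralD // !RintegralZl // Rintegral_Re_mxtraceM mulr0 addr0 lerD2r.
have -> : \int[P]_w complex.Re (\tr (A ^+ q.+1 * Z w) ^+ 2) =
    (p * n%:R)^-1 * (n%:R * X (q.+1 + q.+1) + kap * x).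
  have := congr1 (@complex.Re R) (increment_mxtrace_sqr moments (A ^+ q.+1)).
  by rewrite -exprD (mxtrace_exprn_trace_moment n_gt0 psdA) xE -!rmorphM -rmorphD -rmorphM.
have -> : 3 / (p * n%:R ^+ 2) * X (q.+1 + q.+1) =
    (n%:R ^+ 2)^-1 * ((p * n%:R)^-1 * (3 * (n%:R * X (q.+1 + q.+1)))).
  by field; rewrite n_neq0.
rewrite ler_pM2l ?invr_gt0 ?exprn_gt0 // ler_pM2l ?invr_gt0 //.
have kx_le : kap * x <= 2 * (n%:R * X (q.+1 + q.+1)) by rewrite (le_trans _ x_le) // ler_piMl.
by move: kx_le; set y := kap * x; set z := n%:R * _; lra.
Qed.

End Expectations.

(** * The Lyapunov function over one step *)

Definition resolvent (R : rcfType) n (u : R) (S : 'M[R[i]]_n) : 'M[R[i]]_n := invmx (u%:C%:M - S).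

Definition above_spectrum (R : realType) n (u : R) (S : 'M[R[i]]_n) :=
  exists P l, real_spectral_dec S P l /\ forall i, 0 < u - l i.

(* Quantities governing the addition of one of the [steps] increments: the matrix size, the
   distance [barrier_move] covered by the barrier in all steps, bounds on the resolvent, on an
   increment and on the probability of its truncation, the square root of the weight of the first
   trace moment in the Lyapunov function, and a bound on the expected second trace moment. *)
Record step_params (R : realType) := StepParams {
  dim : nat;
  steps : R;
  barrier_move : R;
  res_bound : R;
  inc_bound : R;
  fail_bound : R;
  dev_weight : R;
  slope_cap : R
}.

Section StepParams.
Variables (R : realType) (s : step_params R).

Definition shift := barrier_move s / steps s.
Definition pert_bound := inc_bound s + shift.
Definition step_size := 2 * res_bound s * pert_bound.
Definition moment_error := variance_error (dim s) (steps s) shift.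

Record step_regime : Prop := StepRegime {
  dim_gt0 : (0 < dim s)%N;
  steps_ge1 : 1 <= steps s;
  barrier_move_itv : 0 <= barrier_move s <= 1;
  res_bound_ge1 : 1 <= res_bound s;
  inc_bound_ge0 : 0 <= inc_bound s;
  res_bound_le_dev_weight : res_bound s <= dev_weight s;
  slope_cap_ge0 : 0 <= slope_cap s;
  step_size_le1 : step_size <= 1;
  step_size_cube_le : step_size ^+ 3 <= (steps s)^-1;
  moment_error_le : moment_error * res_bound s ^+ 2 <= (steps s)^-1;
  fail_bound_le : fail_bound s * res_bound s <= (steps s)^-1
}.

Hypothesis regime : step_regime.

Lemma steps_gt0 : 0 < steps s.
Proof. exact: lt_le_trans ltr01 (steps_ge1 regime). Qed.

Lemma res_bound_ge0 : 0 <= res_bound s.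
Proof. exact: le_trans ler01 (res_bound_ge1 regime). Qed.

Lemma dev_weight_gt0 : 0 < dev_weight s.
Proof.
exact: lt_le_trans (lt_le_trans ltr01 (res_bound_ge1 regime)) (res_bound_le_dev_weight regime).
Qed.

Lemma shift_itv : 0 <= shift <= 1.
Proof.
have /andP[phi0 phi1] := barrier_move_itv regime; have p1 := steps_ge1 regime.
have p0 := steps_gt0; rewrite /shift divr_ge0 ?(ltW p0) //=.
by rewrite ler_pdivrMr // mul1r (le_trans phi1).
Qed.

Lemma pert_bound_ge0 : 0 <= pert_bound.
Proof. by rewrite addr_ge0 ?(inc_bound_ge0 regime) //; case/andP: shift_itv. Qed.

Lemma step_size_ge0 : 0 <= step_size.
Proof. by rewrite !mulr_ge0 ?res_bound_ge0 ?pert_bound_ge0. Qed.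

Lemma moment_error_ge0 : 0 <= moment_error.
Proof.
by apply: variance_error_ge0; [exact: dim_gt0 regime | exact: steps_gt0].
Qed.

End StepParams.

Section LyapunovFunction.
Variables (R : realType) (s : step_params R).
Local Notation n := (dim s).
Local Notation p := (steps s).
Local Notation K := (res_bound s).
Local Notation nu := (fail_bound s).
Local Notation sD := (dev_weight s).
Local Notation Y := (slope_cap s).
Local Notation a := (shift s).
Local Notation eps := (step_size s).
Local Notation delta := (moment_error s).

(* [y] is the value around which the second trace moment is expected to stay. *)
Definition lyapunov (q : nat) (y : R) (A : 'M[R[i]]_n) : R :=
  sD ^+ 2 * (trace_moment A 1 - barrier_move s) ^+ 2 +
  Num.max 0 (trace_moment A 2 - y) ^+ 2 + trace_moment A q / n%:R.

Definition square_error (q : nat) (b : R) : R :=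
  3 * (q%:R ^+ 2 * (3 / (p * n%:R ^+ 2) * K ^+ (q.+1 + q.+1) + a ^+ 2 * K ^+ (q.+1 + q.+1)) +
       (q%:R ^+ 2 * (4 * pert_bound s ^+ 2) * K ^+ q.+2) ^+ 2 + b ^+ 2).

Definition first_remainder : R := eps ^+ 3 * K.

Definition first_drift_error : R :=
  2 * delta * K ^+ 3 + 3 * nu * K ^+ 2 + 4 * K ^+ 3 * nu + first_remainder.

Definition second_remainder : R := expansion_const R 2 * eps ^+ 3 * (Y + 1).

Definition second_drift_error : R :=
  8 * delta * K ^+ 4 + 6 * nu * K ^+ 3 + second_remainder +
  2 * K * (Y + 1) / (sD * p) + nu * Y ^+ 2.

Definition first_rate : R := 2 * (Y + 1).

Definition second_rate : R := 2 * (2 * Y + 1).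

Definition power_rate (q : nat) : R :=
  q%:R + q%:R ^+ 2 * (Y + 1) + 2 * q%:R ^+ 2 + 3 * q%:R + expansion_const R q.

Definition lyapunov_rate (q : nat) : R := first_rate + second_rate + power_rate q.

Definition lyapunov_error : R :=
  2 * sD * first_drift_error + sD ^+ 2 * square_error 1 first_remainder +
  2 * second_drift_error + 2 * square_error 2 second_remainder + 2 * (Y ^+ 2 / p) ^+ 2 + nu.

Hypothesis Y_ge0 : 0 <= Y.

Lemma expansion_const_ge0 q : 0 <= expansion_const R q.
Proof. by rewrite /expansion_const !addr_ge0 ?mulr_ge0 ?exprn_ge0. Qed.

Lemma first_rate_ge0 : 0 <= first_rate.
Proof. by rewrite mulr_ge0 // addr_ge0. Qed.

Lemma second_rate_ge0 : 0 <= second_rate.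
Proof. by rewrite mulr_ge0 // addr_ge0 // mulr_ge0. Qed.

Lemma power_rate_ge0 q : 0 <= power_rate q.
Proof.
have q2_ge0 : 0 <= q%:R ^+ 2 :> R by exact: exprn_ge0.
have Y1_ge0 : 0 <= Y + 1 by rewrite addr_ge0.
have const_ge0 := expansion_const_ge0 q.
by rewrite /power_rate !addr_ge0 // mulr_ge0.
Qed.

Lemma lyapunov_rate_ge0 q : 0 <= lyapunov_rate q.
Proof. exact: addr_ge0 (addr_ge0 first_rate_ge0 second_rate_ge0) (power_rate_ge0 q). Qed.

End LyapunovFunction.

Arguments lyapunov {R} s q y A.

Lemma max0_sqr_le (R : realDomainType) (x : R) : Num.max 0 x ^+ 2 <= x ^+ 2.
Proof. by case: (leP 0 x) => // _; rewrite expr0n sqr_ge0. Qed.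

Lemma max0D_sqr_le (R : realDomainType) (x t : R) :
  Num.max 0 (x + t) ^+ 2 <= Num.max 0 x ^+ 2 + 2 * Num.max 0 x * t + t ^+ 2.
Proof.
case: (leP 0 x) => x0.
  rewrite (_ : x ^+ 2 + 2 * x * t + t ^+ 2 = (x + t) ^+ 2); [exact: max0_sqr_le | by ring].
rewrite expr0n mulr0 mul0r !add0r; case: (leP 0 (x + t)) => xt; last by rewrite expr0n sqr_ge0.
by rewrite lerXn2r ?nnegrE //; lra.
Qed.

Lemma sqr_sum3_le (R : realDomainType) (x y z : R) :
  (x + y + z) ^+ 2 <= 3 * (x ^+ 2 + y ^+ 2 + z ^+ 2).
Proof.
rewrite -subr_ge0 (_ : _ - _ = (x - y) ^+ 2 + (y - z) ^+ 2 + (x - z) ^+ 2); last by ring.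
by rewrite !addr_ge0 ?sqr_ge0.
Qed.

Lemma above_spectrum_resolvent (R : realType) n (u : R) (S : 'M[R[i]]_n) : above_spectrum u S ->
  (exists P r, real_spectral_dec (resolvent u S) P r /\ forall i, 0 <= r i).
Proof.
move=> [P [l [decS ul]]]; have [_ decA] := real_spectral_dec_resolvent decS ul.
by exists P, (fun i => (u - l i)^-1); split=> // i; rewrite invr_ge0 ltW.
Qed.

Lemma resolvent_le_eigenvalue (R : realType) n (u K : R) (S P : 'M[R[i]]_n) l :
  psd_le K (resolvent u S) -> real_spectral_dec S P l -> (forall i, 0 < u - l i) ->
  forall i, (u - l i)^-1 <= K.
Proof.
move=> [P' [r [decA rK]]] decS ul i; have [_ decA'] := real_spectral_dec_resolvent decS ul.
have [k /complexI ->] := real_spectral_dec_eigenvalueP decA (real_spectral_dec_eigenvalue decA' i).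
by case/andP: (rK k).
Qed.

Lemma mxtrace_sqr_shift_le (R : realType) n (a : R) (Z : 'M[R[i]]_n) : Z^t* = Z ->
  mxtrace_sqr (shift_increment a Z) <= 2 * mxtrace_sqr Z + 2 * (a ^+ 2 * n%:R).
Proof.
move=> hermZ; rewrite !mxtrace_sqrE ?shift_increment_hermitian //.
have -> : a ^+ 2 * n%:R = \sum_(x < n) \sum_(y < n) sqmod ((a%:C)%:M x y : R[i]).
  under eq_bigr => x _.
    rewrite (bigD1 x) //= big1 ?addr0 => [|y yx]; last first.
      by rewrite !mxE eq_sym (negPf yx) mulr0n sqmod_real expr0n.
    rewrite mxE eqxx mulr1n sqmod_real; over.
  by rewrite sumr_const card_ord mulr_natr.
rewrite -mulrDr -big_split mulr_sumr; apply: ler_sum => x _ /=.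
rewrite -big_split mulr_sumr; apply: ler_sum => y _ /=.
have -> : shift_increment a Z x y = Z x y - ((a%:C)%:M : 'M[R[i]]_n) x y.
  by rewrite mxE [X in _ + X]mxE.
exact: sqmodB_le.
Qed.

Section OneStep.
Context {R : realType} {dT : measure_display} {T : measurableType dT}.
Local Notation C := R[i].
Variables (P : probability T R) (s : step_params R) (kap u : R).
Local Notation n := (dim s).
Local Notation p := (steps s).
Local Notation K := (res_bound s).
Local Notation kz := (inc_bound s).
Local Notation nu := (fail_bound s).
Local Notation a := (shift s).
Local Notation eps := (step_size s).
Local Notation delta := (moment_error s).
Variables (Z : T -> 'M[C]_n) (N : T -> bool) (S : 'M[C]_n).
Hypothesis regime : step_regime s.
Hypotheses (kap_ge0 : 0 <= kap) (kap_le1 : kap <= 1).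
Hypothesis moments : increment_moments P kap (p * n%:R)^-1 Z.
Hypothesis truncation : increment_truncation P Z N kz nu.
Hypothesis above : above_spectrum u S.
Local Notation A := (resolvent u S).
Hypothesis psdA : psd_le K A.

Local Notation X := (trace_moment A).
Local Notation W w := (shift_increment a (Z w)).
Local Notation B w := (resolvent (u + a) (S + Z w)).
Local Notation X' q w := (trace_moment (B w) q).
Local Notation linear q w := (linear_term A q (W w)).
Local Notation quadratic q w := (quadratic_term A q (W w)).
Local Notation mean_quad q := (mean_quadratic p A q).

Let n_gt0 : (0 < n)%N := dim_gt0 regime.
Let nR_gt0 : 0 < n%:R :> R. Proof. by rewrite ltr0n. Qed.
Let p_gt0 : 0 < p := steps_gt0 regime.
Let K_ge0 : 0 <= K := res_bound_ge0 regime.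
Let hermZ w : (Z w)^t* = Z w := increment_hermitian moments w.
Let hermW w : (W w)^t* = W w. Proof. exact: shift_increment_hermitian. Qed.
Let X_ge0 q : 0 <= X q := trace_moment_ge0 n_gt0 psdA q.
Let mN : measurable_fun setT N := truncation_measurable truncation.

Let quadratic_ge0 q w : 0 <= quadratic q w.
Proof. exact: (quadratic_term_ge0 n_gt0 psdA (hermW w)). Qed.

Let opnorm_le_W w : N w -> opnorm_le (pert_bound s)%:C (W w).
Proof.
move=> Nw; rewrite rmorphD; apply: opnorm_leD; first exact: truncation_opnorm_le truncation w Nw.
apply: opnorm_leN; have := opnorm_le_scalar n (a%:C); apply: opnorm_le_trans.
by rewrite normC_real_complex ger0_norm //; case/andP: (shift_itv regime).
Qed.

Lemma next_resolvent w : N w -> [/\ above_spectrum (u + a) (S + Z w),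
  B w = A + B w * W w * A & opnorm_le (2 * K)%:C (B w)].
Proof.
move=> Nw; have [Pm [l [decS ul]]] := above.
have K_gt0 : 0 < K := lt_le_trans ltr01 (res_bound_ge1 regime).
have shiftE : (u + a)%:C%:M - (S + Z w) = u%:C%:M - S - W w.
  rewrite /shift_increment rmorphD raddfD /= !opprD opprK !addrA [RHS]addrAC; congr (_ - _).
  by rewrite [RHS]addrAC.
have [] := resolvent_perturbation decS ul (resolvent_le_eigenvalue psdA decS ul) K_gt0 (hermW w)
  (opnorm_le_W Nw) (step_size_le1 regime) shiftE.
by split.
Qed.

Lemma next_resolvent_hermitian w : N w -> (B w)^t* = B w.
Proof.
move=> /next_resolvent[/above_spectrum_resolvent[Pm [r [decB _]]] _ _].
exact: real_spectral_dec_hermitian decB.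
Qed.

Lemma next_trace_moment_le q w : N w -> `|X' q w| <= (2 * K) ^+ q.
Proof.
move=> /next_resolvent[_ _ opB].
rewrite /trace_moment normrM [`|n%:R^-1|]ger0_norm ?invr_ge0 ?ler0n // ler_pdivrMr //.
apply: ler_norm_Re; have := opnorm_le_mxtrace (opnorm_leX q opB) => /le_trans; apply.
by rewrite -rmorphXn -(rmorph_nat (real_complex R) n) -rmorphM /=.
Qed.

Lemma next_remainder1 w : N w ->
  `|X' 1 w - X 1 - linear 1 w - quadratic 1 w| <= eps ^+ 3 * K.
Proof.
move=> Nw; have [_ BE opB] := next_resolvent Nw.
exact: (trace_moment1_expansion n_gt0 psdA (hermW w) BE K_ge0 opB (opnorm_le_W Nw)).
Qed.

Lemma next_remainder_dyadic j q w : q = (2 ^ j.+1)%N -> N w ->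
  `|X' q w - X q - linear q w - quadratic q w| <= expansion_const R q * eps ^+ 3 * X q.
Proof.
move=> qE Nw; have [_ BE opB] := next_resolvent Nw.
exact: (trace_moment_dyadic_expansion n_gt0 psdA (next_resolvent_hermitian Nw) (hermW w) BE K_ge0
  opB (opnorm_le_W Nw) (step_size_le1 regime) qE).
Qed.

Section Truncation.

Let Ifail : Rintegrable P (fun w => (~~ N w)%:R).
Proof. by apply: Rintegrable_bool; exact: measurable_neg. Qed.

Let Itrace : Rintegrable P (fun w => (~~ N w)%:R * mxtrace_sqr (Z w)) :=
  truncation_Rintegrable truncation.

Let mxtrace_sqrZ_ge0 w : 0 <= mxtrace_sqr (Z w). Proof. exact: mxtrace_sqr_ge0. Qed.

Let Re_mxtraceM_le m w :
  `|complex.Re (\tr (A ^+ m * Z w))| <= (1 + mxtrace_sqr (Z w)) * (n%:R * X m).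
Proof.
apply: (Re_mxtraceM_opnorm_le n_gt0 psdA); apply: frobenius_opnorm_le.
  by rewrite ler0c addr_ge0.
rewrite hermZ mulmxE -rmorphXn (mxtrace_sqr_complex (hermZ w)) -(mxtrace_sqrE (hermZ w)) lecR.
by have := mxtrace_sqrZ_ge0 w; set t := mxtrace_sqr _ => t0; rewrite sqrrD !expr2; nra.
Qed.

Lemma linear_term_le q w :
  `|linear q w| <= q%:R * ((1 + mxtrace_sqr (Z w)) * X q.+1 + X q.+1).
Proof.
have /andP[a_ge0 a_le1] := shift_itv regime.
rewrite (linear_term_shift _ _ n_gt0 psdA) -mulrA -[q%:R * a * _]mulrA -mulrBr normrM normr_nat.
apply: ler_wpM2l => //; apply: le_trans (ler_normB _ _) _; apply: lerD.
  rewrite normrM ger0_norm ?invr_ge0 ?ler0n // ler_pdivrMl // mulrCA; exact: Re_mxtraceM_le.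
have aX_ge0 : 0 <= a * X q.+1 by exact: mulr_ge0.
by rewrite (ger0_norm aX_ge0); apply: ler_piMl.
Qed.

Lemma truncated_linear_term q : Rintegrable P (fun w => (~~ N w)%:R * `|linear q w|) /\
  \int[P]_w ((~~ N w)%:R * `|linear q w|) <= 3 * q%:R * nu * X q.+1.
Proof.
pose f w := q%:R * X q.+1 * ((~~ N w)%:R * mxtrace_sqr (Z w) + 2 * (~~ N w)%:R).
have I2 : Rintegrable P (fun w => 2 * (~~ N w)%:R) by exact: RintegrableZ.
have Isum := RintegrableD Itrace I2.
have If : Rintegrable P f by exact: RintegrableZ.
have le_f w : (~~ N w)%:R * `|linear q w| <= f w.
  have -> : f w = (~~ N w)%:R * (q%:R * ((1 + mxtrace_sqr (Z w)) * X q.+1 + X q.+1)).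
    by rewrite /f; ring.
  by apply: ler_wpM2l => //; exact: linear_term_le.
have I1 : Rintegrable P (fun w => (~~ N w)%:R * `|linear q w|).
  apply: Rintegrable_le If => [|w]; last by rewrite ger0_norm // mulr_ge0.
  apply: measurable_funM; first exact: Rintegrable_measurable Ifail.
  apply: measurableT_comp => //.
  exact: Rintegrable_measurable (Rintegrable_linear_term a n_gt0 moments psdA q).
split=> //; apply: le_trans (ler_Rintegral I1 If le_f) _.
rewrite RintegralZl // RintegralD // RintegralZl //.
rewrite [leRHS](_ : _ = q%:R * X q.+1 * (nu + 2 * nu)); last by ring.
apply: ler_wpM2l; first by rewrite mulr_ge0.
apply: lerD; first exact: truncation_mxtrace_sqr truncation.
by rewrite ler_pM2l //; exact: truncation_prob truncation.
Qed.

Lemma quadratic_term1_le w : quadratic 1 w <= K ^+ 3 * 2 * (mxtrace_sqr (Z w) + 1).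
Proof.
have /andP[a_ge0 a_le1] := shift_itv regime.
rewrite /quadratic_term big_ord_recl !big_ord0 !addr0 mul1r ler_pdivrMr //.
apply: le_trans (cross_trace_mxtrace_sqr_le psdA 2 1 (hermW w)) _.
rewrite [leRHS](_ : _ = K ^+ 3 * (2 * ((mxtrace_sqr (Z w) + 1) * n%:R))); last by ring.
apply: ler_wpM2l; first exact: exprn_ge0.
apply: le_trans (mxtrace_sqr_shift_le a (hermZ w)) _; rewrite -mulrDr ler_pM2l // mulrDl mul1r.
apply: lerD; last by rewrite ler_piMl // exprn_ile1.
by rewrite ler_peMr // ler1n.
Qed.

Lemma truncated_quadratic_term1 : Rintegrable P (fun w => (~~ N w)%:R * quadratic 1 w) /\
  \int[P]_w ((~~ N w)%:R * quadratic 1 w) <= 4 * K ^+ 3 * nu.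
Proof.
pose f w := K ^+ 3 * 2 * ((~~ N w)%:R * mxtrace_sqr (Z w) + (~~ N w)%:R).
have Isum := RintegrableD Itrace Ifail.
have If : Rintegrable P f by exact: RintegrableZ.
have le_f w : (~~ N w)%:R * quadratic 1 w <= f w.
  have -> : f w = (~~ N w)%:R * (K ^+ 3 * 2 * (mxtrace_sqr (Z w) + 1)) by rewrite /f; ring.
  by apply: ler_wpM2l => //; exact: quadratic_term1_le.
have I1 : Rintegrable P (fun w => (~~ N w)%:R * quadratic 1 w).
  apply: Rintegrable_le If => [|w]; last by rewrite ger0_norm // mulr_ge0.
  apply: measurable_funM; first exact: Rintegrable_measurable Ifail.
  exact: Rintegrable_measurable (Rintegrable_quadratic_term a n_gt0 moments psdA 1).
split=> //; apply: le_trans (ler_Rintegral I1 If le_f) _.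
rewrite RintegralZl // RintegralD //.
rewrite [leRHS](_ : _ = K ^+ 3 * 2 * (nu + nu)); last by ring.
apply: ler_wpM2l; first by rewrite mulr_ge0 // exprn_ge0.
by apply: lerD; [exact: truncation_mxtrace_sqr truncation | exact: truncation_prob truncation].
Qed.

End Truncation.
Section Drift.
Hypothesis measurable_next : forall q, measurable_fun setT (fun w => X' q w).

Let mNR : measurable_fun setT (fun w => (N w)%:R : R).
Proof. exact: measurable_natr_bool. Qed.

Let IN : Rintegrable P (fun w => (N w)%:R). Proof. exact: Rintegrable_bool. Qed.

Lemma Rintegrable_next_sqr q x : Rintegrable P (fun w => (N w)%:R * (X' q w - x) ^+ 2).
Proof.
apply: Rintegrable_le (Rintegrable_cst P (((2 * K) ^+ q + `|x|) ^+ 2)) => [|w].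
  by apply: measurable_funM => //; apply: measurable_funX; exact: measurable_funB.
rewrite normrM; case: (boolP (N w)) => [/next_trace_moment_le next_le|_]; last first.
  by rewrite normr0 mul0r sqr_ge0.
rewrite normr1 mul1r normrX lerXn2r ?nnegrE ?addr_ge0 ?exprn_ge0 ?mulr_ge0 //.
by apply: le_trans (ler_normB _ _) _; rewrite lerD2r.
Qed.

Lemma Rintegrable_next q : Rintegrable P (fun w => (N w)%:R * X' q w).
Proof.
apply: Rintegrable_le (Rintegrable_cst P ((2 * K) ^+ q)) => [|w]; first exact: measurable_funM.
rewrite normrM; case: (boolP (N w)) => [/next_trace_moment_le next_le|_].
  by rewrite normr1 mul1r.
by rewrite normr0 mul0r exprn_ge0 // mulr_ge0.
Qed.

Lemma Rintegrable_next_drift q : Rintegrable P (fun w => (N w)%:R * (X' q w - X q)).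
Proof.
apply: eq_Rintegrable (RintegrableB (Rintegrable_next q) (RintegrableZ (X q) IN)) => w.
by rewrite mulrBr [X q * _]mulrC.
Qed.

Section Remainder.
Variables (q : nat) (b : R).
Hypothesis b_ge0 : 0 <= b.
Hypothesis remainder_le : forall w, N w -> `|X' q w - X q - linear q w - quadratic q w| <= b.

Let Ilin : Rintegrable P (fun w => linear q w).
Proof. exact: Rintegrable_linear_term n_gt0 moments psdA q. Qed.

Let Iquad : Rintegrable P (fun w => quadratic q w).
Proof. exact: Rintegrable_quadratic_term n_gt0 moments psdA q. Qed.

Let Rintegral_lin : \int[P]_w linear q w = - (q%:R * a * X q.+1).
Proof. exact: Rintegral_linear_term n_gt0 moments psdA q. Qed.

Lemma drift_le : \int[P]_w ((N w)%:R * (X' q w - X q)) <=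
  - (q%:R * a * X q.+1) + mean_quad q + q%:R ^+ 2 * (2 * delta) * X q.+2 +
  3 * q%:R * nu * X q.+1 + b.
Proof.
have [Itrunc trunc_le] := truncated_linear_term q.
have quad_le := Rintegral_quadratic_term_le a n_gt0 p_gt0 kap_ge0 kap_le1 moments psdA q.
have Iterms := RintegrableD Ilin Iquad.
have Ierr := RintegrableD Itrunc (Rintegrable_cst P b).
apply: le_trans (ler_Rintegral (Rintegrable_next_drift q) (RintegrableD Iterms Ierr) _) _.
  move=> w; case: (boolP (N w)) => [Nw|_] /=.
    rewrite mul1r mul0r add0r; have := ler_norm (X' q w - X q - linear q w - quadratic q w).
    have := remainder_le Nw; move: (linear q w) (quadratic q w) (X' q w) (X q) => x y z t.
    by set r := `|_|; lra.
  rewrite mul0r mul1r; have := quadratic_ge0 q w; have := ler_norm (- linear q w); rewrite normrN.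
  by move: b_ge0; move: (linear q w) (quadratic q w) => x y; lra.
rewrite RintegralD // RintegralD // Rintegral_lin RintegralD //; last exact: Rintegrable_cst.
rewrite Rintegral_cstT; move: quad_le trunc_le; rewrite -/delta.
set int_quad := Rintegral _ _ _; set int_trunc := Rintegral _ _ _; set z := mean_quad q.
by set t := q%:R * a * _; set e := 3 * _ * _ * _; set v := _ * _ * X q.+2; lra.
Qed.

Lemma drift_square_le : \int[P]_w ((N w)%:R * (X' q w - X q) ^+ 2) <= square_error s q b.
Proof.
pose m := q%:R ^+ 2 * (4 * pert_bound s ^+ 2) * K ^+ q.+2.
have coef_ge0 : 0 <= q%:R ^+ 2 * (4 * pert_bound s ^+ 2).
  by rewrite mulr_ge0 ?exprn_ge0 // mulr_ge0 // sqr_ge0.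
have Isqr := Rintegrable_linear_term_sqr a n_gt0 moments psdA q.
have Icst c := Rintegrable_cst P c.
have Isum := RintegrableD (RintegrableD Isqr (Icst (m ^+ 2))) (Icst (b ^+ 2)).
apply: le_trans (ler_Rintegral (Rintegrable_next_sqr q (X q)) (RintegrableZ 3 Isum) _) _ => [w|].
  case: (boolP (N w)) => [Nw|_] /=; last by rewrite mul0r mulr_ge0 // !addr_ge0 ?sqr_ge0.
  rewrite mul1r; have := remainder_le Nw.
  set r := X' q w - X q - linear q w - quadratic q w => r_le.
  have -> : X' q w - X q = linear q w + quadratic q w + r.
    by rewrite /r; move: (linear q w) (quadratic q w) (X' q w) (X q) => x y z t; ring.
  have quad_le : quadratic q w <= m.
    apply: le_trans (quadratic_term_le n_gt0 psdA (hermW w) q (opnorm_le_W Nw)) _.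
    by apply: ler_wpM2l => //; exact: (trace_moment_le n_gt0 psdA).
  apply: le_trans (sqr_sum3_le _ _ _) _; rewrite ler_pM2l //; apply: lerD; last first.
    by rewrite -[leLHS]real_normK ?num_real // lerXn2r ?nnegrE.
  rewrite lerD2l lerXn2r ?nnegrE ?quadratic_ge0 //.
  exact: le_trans (quadratic_ge0 q w) quad_le.
rewrite RintegralZl // RintegralD //; [|exact: RintegrableD|exact: Icst].
rewrite RintegralD //; last exact: Icst.
rewrite !Rintegral_cstT /square_error -/m ler_pM2l // !lerD2r.
apply: le_trans (Rintegral_linear_term_sqr_le a n_gt0 p_gt0 kap_le1 moments psdA q) _.
apply: ler_wpM2l; first exact: exprn_ge0.
apply: lerD; apply: ler_wpM2l.
- by apply: divr_ge0 => //; apply: mulr_ge0; [exact: ltW | exact: exprn_ge0].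
- exact: (trace_moment_le n_gt0 psdA).
- exact: sqr_ge0.
rewrite exprD -expr2; apply: lerXn2r; rewrite ?nnegrE ?exprn_ge0 //.
exact: (trace_moment_le n_gt0 psdA).
Qed.

End Remainder.

Let first_remainder_ge0 : 0 <= first_remainder s.
Proof. by rewrite mulr_ge0 // exprn_ge0 // step_size_ge0. Qed.

Lemma first_drift_bound : `|\int[P]_w ((N w)%:R * (X' 1 w - X 1))| <=
  X 2 * `|X 1 - barrier_move s| / p + 2 * delta * X 3 + 3 * nu * X 2 + 4 * K ^+ 3 * nu +
  first_remainder s.
Proof.
have [Ilin_trunc lin_trunc_le] := truncated_linear_term 1.
have [Iquad_trunc quad_trunc_le] := truncated_quadratic_term1.
have Ilin := Rintegrable_linear_term a n_gt0 moments psdA 1.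
have Iquad := Rintegrable_quadratic_term a n_gt0 moments psdA 1.
have quad_ge := Rintegral_quadratic_term_ge a n_gt0 p_gt0 kap_ge0 kap_le1 moments psdA 1.
have quad_le := Rintegral_quadratic_term_le a n_gt0 p_gt0 kap_ge0 kap_le1 moments psdA 1.
have Iterms := RintegrableD Ilin Iquad.
have Idrift := Rintegrable_next_drift 1.
have Ierr := RintegrableD (RintegrableD Ilin_trunc Iquad_trunc)
  (Rintegrable_cst P (first_remainder s)).
pose drift := \int[P]_w ((N w)%:R * (X' 1 w - X 1)).
pose terms := \int[P]_w (linear 1 w + quadratic 1 w).
have drift_terms : `|drift - terms| <= 3 * nu * X 2 + 4 * K ^+ 3 * nu + first_remainder s.
  rewrite /drift /terms -RintegralB //; apply: le_trans (le_normr_Rintegral _ _) _ => //.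
    exact: RintegrableB.
  apply: le_trans (ler_Rintegral (Rintegrable_norm (RintegrableB Idrift Iterms)) Ierr _) _ => [w|].
    case: (boolP (N w)) => [Nw|_] /=.
      by rewrite mul1r !mul0r !add0r opprD addrA; exact: next_remainder1.
    rewrite mul0r !mul1r sub0r normrN; apply: le_trans (ler_normD _ _) _.
    by rewrite [`|quadratic 1 w|]ger0_norm // lerDl.
  rewrite RintegralD //; [|exact: RintegrableD|exact: Rintegrable_cst].
  rewrite RintegralD // Rintegral_cstT lerD2r; apply: lerD => //.
  by move: lin_trunc_le; rewrite mulr1.
have terms_le : `|terms| <= X 2 * `|X 1 - barrier_move s| / p + 2 * delta * X 3.
  rewrite /terms RintegralD // (Rintegral_linear_term a n_gt0 moments psdA 1).
  move: quad_ge quad_le; rewrite /mean_quadratic big_ord_recl !big_ord0 !addr0 expr1n !mul1r.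
  have pV_ge0 : 0 <= p^-1 by rewrite invr_ge0 ltW.
  have -> : X 2 * `|X 1 - barrier_move s| / p = `|X 2 * X 1 / p - a * X 2|.
    rewrite (_ : _ - a * X 2 = X 2 * (X 1 - barrier_move s) * p^-1); last by rewrite /shift; ring.
    by rewrite (normrM (X 2 * _)) (normrM (X 2)) (ger0_norm pV_ge0) (ger0_norm (X_ge0 2)).
  rewrite -/delta.
  set x := Rintegral _ _ _; set y := X 2 * X 1 / p; set z := a * X 2;
    set t := 2 * delta * _ => yx xy.
  rewrite (_ : - z + x = (y - z) + (x - y)); last by ring.
  apply: le_trans (ler_normD _ _) _; rewrite lerD2l ger0_norm ?subr_ge0 //.
  by rewrite lerBlDl.
have := ler_normD (drift - terms) terms; rewrite subrK => /le_trans; apply.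
apply: le_trans (lerD drift_terms terms_le) _.
by rewrite addrC !addrA.
Qed.

Section LyapunovStep.
Variables (q j : nat) (y y' : R).
Local Notation phi := (barrier_move s).
Local Notation Y := (slope_cap s).
Local Notation sD := (dev_weight s).
Hypothesis qE : q = (2 ^ j.+1)%N.
Hypotheses (y_ge0 : 0 <= y) (y_le : y <= y') (y'_le : y' <= Y) (y'E : y' - y = y * y' / p).
Hypothesis lyapunov_le1 : lyapunov s q y A <= 1.

Let x1 := X 1 - phi.
Let excess := Num.max 0 (X 2 - y).

Let Y_ge0 : 0 <= Y := slope_cap_ge0 regime.
Let sD_gt0 : 0 < sD := dev_weight_gt0 regime.
Let pV_ge0 : 0 <= p^-1. Proof. by rewrite invr_ge0 ltW. Qed.
Let delta_ge0 : 0 <= delta := moment_error_ge0 regime.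
Let nu_ge0 : 0 <= nu.
Proof. by apply: le_trans (truncation_prob truncation); apply: Rintegral_ge0. Qed.
Let eps3_ge0 : 0 <= eps ^+ 3. Proof. by rewrite exprn_ge0 // step_size_ge0. Qed.
Let X_le m : X m <= K ^+ m. Proof. exact: (trace_moment_le n_gt0 psdA). Qed.
Let XS_le m : X m.+1 <= K * X m. Proof. exact: (trace_momentS_le n_gt0 psdA). Qed.
Let excess_ge0 : 0 <= excess. Proof. by rewrite le_max lexx. Qed.
Let Xqn_ge0 : 0 <= X q / n%:R. Proof. by rewrite divr_ge0 // ltW. Qed.
Let sD_x1_le1 : sD * `|x1| <= 1.
Proof.
have sDx_ge0 : 0 <= sD * `|x1| by rewrite mulr_ge0 // ltW.
rewrite -(@ler_pXn2r _ 2) ?nnegrE // expr1n exprMn real_normK ?num_real //.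
by apply: le_trans lyapunov_le1; rewrite /lyapunov -/x1 -addrA lerDl addr_ge0 ?sqr_ge0.
Qed.

Let K_x1_le1 : K * `|x1| <= 1.
Proof. by apply: le_trans sD_x1_le1; rewrite ler_wpM2r // res_bound_le_dev_weight. Qed.

Let excess_le1 : excess <= 1.
Proof.
rewrite -(@ler_pXn2r _ 2) ?nnegrE // expr1n; apply: le_trans lyapunov_le1.
rewrite /lyapunov -/excess -addrA addrCA lerDl; apply: addr_ge0 => //.
by rewrite mulr_ge0 ?sqr_ge0.
Qed.

Let X2_le : X 2 <= Y + 1.
Proof.
have : X 2 - y <= excess by rewrite le_max lexx orbT.
by move: excess_le1 (le_trans y_le y'_le); lra.
Qed.

Let second_remainder_ge0 : 0 <= second_remainder s.
Proof. by rewrite mulr_ge0 ?addr_ge0 // mulr_ge0 // expansion_const_ge0. Qed.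

Let second_remainder_le w : N w ->
  `|X' 2 w - X 2 - linear 2 w - quadratic 2 w| <= second_remainder s.
Proof.
move=> Nw; apply: le_trans (@next_remainder_dyadic 0 2 w erefl Nw) _.
by apply: ler_wpM2l => //; rewrite mulr_ge0 ?expansion_const_ge0.
Qed.

Let first_drift_le :
  `|\int[P]_w ((N w)%:R * (X' 1 w - X 1))| <= (Y + 1) * `|x1| / p + first_drift_error s.
Proof.
apply: le_trans first_drift_bound _; rewrite /first_drift_error !addrA lerD2r.
apply: lerD => //; apply: lerD; first apply: lerD.
- by rewrite ler_pM2r ?invr_gt0 //; exact: ler_wpM2r.
- by apply: ler_wpM2l => //; exact: mulr_ge0.
by apply: ler_wpM2l => //; exact: mulr_ge0.
Qed.

Let first_drift_error_ge0 : 0 <= first_drift_error s.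
Proof. by rewrite /first_drift_error !addr_ge0 // !mulr_ge0 ?exprn_ge0. Qed.

Lemma first_term_le : sD ^+ 2 * \int[P]_w ((N w)%:R * (X' 1 w - phi) ^+ 2) <=
  sD ^+ 2 * x1 ^+ 2 * (1 + first_rate s / p) + 2 * sD * first_drift_error s +
  sD ^+ 2 * square_error s 1 (first_remainder s).
Proof.
have Idrift := RintegrableZ (2 * x1) (Rintegrable_next_drift 1).
have Isqr := Rintegrable_next_sqr 1 (X 1).
have Icst := Rintegrable_cst P (x1 ^+ 2).
pose drift := \int[P]_w ((N w)%:R * (X' 1 w - X 1)).
have expand_le : \int[P]_w ((N w)%:R * (X' 1 w - phi) ^+ 2) <=
    x1 ^+ 2 + (2 * x1 * drift + square_error s 1 (first_remainder s)).
  have pointwise w : (N w)%:R * (X' 1 w - phi) ^+ 2 <=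
      x1 ^+ 2 + (2 * x1 * ((N w)%:R * (X' 1 w - X 1)) + (N w)%:R * (X' 1 w - X 1) ^+ 2).
    rewrite /x1; move: (X' 1 w) (X 1) => t x; case: (N w); last first.
      by rewrite !mul0r mulr0 !addr0 sqr_ge0.
    by rewrite !mul1r le_eqVlt; apply/orP; left; apply/eqP; ring.
  apply: le_trans (ler_Rintegral (Rintegrable_next_sqr 1 phi)
    (RintegrableD Icst (RintegrableD Idrift Isqr)) pointwise) _.
  rewrite RintegralD //; last exact: RintegrableD.
  rewrite Rintegral_cstT RintegralD // RintegralZl //; last exact: Rintegrable_next_drift.
  rewrite lerD2l lerD2l; apply: drift_square_le => //; exact: next_remainder1.
have drift_term_le : 2 * x1 * drift <= 2 * `|x1| * ((Y + 1) * `|x1| / p + first_drift_error s).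
  apply: le_trans (ler_norm _) _; rewrite !normrM normr_nat.
  by apply: ler_wpM2l => //; rewrite mulr_ge0.
have x1_sqr : `|x1| * `|x1| = x1 ^+ 2 by rewrite -expr2 real_normK ?num_real.
have D_x1_le : sD ^+ 2 * `|x1| <= sD by rewrite expr2 -mulrA ler_piMr // ltW.
apply: le_trans (ler_wpM2l (sqr_ge0 sD) expand_le) _.
apply: (@le_trans _ _ (sD ^+ 2 * x1 ^+ 2 +
    sD ^+ 2 * (2 * `|x1| * ((Y + 1) * `|x1| / p + first_drift_error s)) +
    sD ^+ 2 * square_error s 1 (first_remainder s))).
  by rewrite -!mulrDr ler_wpM2l ?sqr_ge0 // -addrA lerD2l lerD2r.
rewrite lerD2r.
have -> : sD ^+ 2 * x1 ^+ 2 + sD ^+ 2 * (2 * `|x1| * ((Y + 1) * `|x1| / p + first_drift_error s)) =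
    sD ^+ 2 * x1 ^+ 2 * (1 + first_rate s / p) + 2 * (sD ^+ 2 * `|x1|) * first_drift_error s.
  by rewrite -x1_sqr /first_rate; ring.
by rewrite lerD2l; apply: ler_wpM2r => //; rewrite ler_pM2l.
Qed.

Let second_drift_error_ge0 : 0 <= second_drift_error s.
Proof.
have ratio_ge0 : 0 <= 2 * K * (Y + 1) / (sD * p).
  by rewrite divr_ge0 ?mulr_ge0 ?addr_ge0 // ltW.
have expansion_ge0 : 0 <= 8 * delta * K ^+ 4 + 6 * nu * K ^+ 3 + second_remainder s.
  by rewrite !addr_ge0 // !mulr_ge0 ?exprn_ge0.
exact: addr_ge0 (addr_ge0 expansion_ge0 ratio_ge0) (mulr_ge0 nu_ge0 (sqr_ge0 Y)).
Qed.

Let second_drift_le : \int[P]_w ((N w)%:R * (X' 2 w - X 2)) <=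
  X 2 ^+ 2 / p + (second_drift_error s - nu * Y ^+ 2).
Proof.
apply: le_trans (drift_le second_remainder_ge0 second_remainder_le) _.
have mean_quad2 : mean_quad 2 = (2 * (X 3 * X 1) + X 2 * X 2) / p.
  by rewrite /mean_quadratic !big_ord_recl !big_ord0 /= !addr0 !add0r.
have leading : - (2 * a * X 3) + (2 * (X 3 * X 1) + X 2 * X 2) / p =
    X 2 ^+ 2 / p + 2 * (X 3 * x1) / p by rewrite /x1 /shift; ring.
have X3_x1_le : X 3 * `|x1| <= K * (Y + 1) / sD.
  rewrite ler_pdivlMr // -mulrA [`|x1| * sD]mulrC.
  apply: (@le_trans _ _ (X 3 * 1)); first exact: (ler_wpM2l (X_ge0 3) sD_x1_le1).
  by rewrite mulr1; apply: le_trans (XS_le 2) _; exact: (ler_wpM2l K_ge0 X2_le).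
have leading_error : 2 * (X 3 * x1) / p <= 2 * K * (Y + 1) / (sD * p).
  rewrite [leRHS](_ : _ = 2 * (K * (Y + 1) / sD) / p); last by rewrite invfM; ring.
  rewrite ler_pM2r ?invr_gt0 // ler_pM2l //; apply: le_trans X3_x1_le.
  by apply: ler_wpM2l => //; exact: ler_norm.
have X4_le : 2%:R ^+ 2 * (2 * delta) * X 4 <= 8 * delta * K ^+ 4.
  rewrite (_ : 2%:R ^+ 2 * (2 * delta) = 8 * delta); last by ring.
  by apply: ler_wpM2l => //; exact: mulr_ge0.
have X3_le : 3 * 2 * nu * X 3 <= 6 * nu * K ^+ 3.
  rewrite (_ : 3 * 2 * nu = 6 * nu); last by ring.
  by apply: ler_wpM2l => //; exact: mulr_ge0.
rewrite mean_quad2 leading /second_drift_error.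
move: X3_le X4_le leading_error; set t3 := _ * X 3; set t4 := _ * X 4.
set e1 := 2 * (X 3 * _) / p; set e2 := 2 * K * _ / _; set e3 := 8 * delta * _.
set e4 := 6 * nu * _; set sr := second_remainder s; set z := X 2 ^+ 2 / p; set v := nu * _.
lra.
Qed.

Let dy := y' - y.
Let dy_ge0 : 0 <= dy. Proof. by rewrite subr_ge0. Qed.

Let dy_le : dy <= Y ^+ 2 / p.
Proof.
rewrite /dy y'E ler_pM2r ?invr_gt0 // expr2; apply: ler_pM => //.
  exact: le_trans y_le.
exact: le_trans y_le y'_le.
Qed.

Let dy_le_sqr : dy <= Y ^+ 2.
Proof. by apply: le_trans dy_le _; rewrite ler_piMr ?sqr_ge0 // invf_le1 // steps_ge1. Qed.

Let success_prob_ge : 1 - nu <= \int[P]_w (N w)%:R.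
Proof.
have Ifail : Rintegrable P (fun w => (~~ N w)%:R) by apply: Rintegrable_bool; exact: measurable_neg.
rewrite (eq_RintegralT P (g := fun w => 1 - (~~ N w)%:R)) => [|w]; last first.
  by case: (N w); rewrite /= ?subr0 ?subrr.
rewrite RintegralB //; last exact: Rintegrable_cst.
by rewrite Rintegral_cstT lerD2l lerN2; exact: truncation_prob truncation.
Qed.

Let Iexcess_drift : Rintegrable P (fun w => (N w)%:R * (X' 2 w - X 2) - dy * (N w)%:R).
Proof.
by apply: RintegrableB; [exact: Rintegrable_next_drift | exact: RintegrableZ].
Qed.

Let excess_drift_le : \int[P]_w ((N w)%:R * (X' 2 w - X 2) - dy * (N w)%:R) <=
  (X 2 ^+ 2 - y * y') / p + second_drift_error s.
Proof.
rewrite RintegralB //; [|exact: Rintegrable_next_drift|exact: RintegrableZ].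
rewrite [X in _ - X]RintegralZl //.
have dy_success : dy * (1 - nu) <= dy * \int[P]_w (N w)%:R by apply: ler_wpM2l.
have dy_failure : dy * nu <= nu * Y ^+ 2 by rewrite mulrC; apply: ler_wpM2l.
rewrite (_ : (X 2 ^+ 2 - y * y') / p = X 2 ^+ 2 / p - dy); last by rewrite /dy y'E; ring.
move: dy_success dy_failure second_drift_le; rewrite mulrBr mulr1.
set t := dy * Rintegral _ _ _; set f := dy * nu; set i := Rintegral _ _ _; set v := nu * _.
by set sde := second_drift_error s; set z := _ / p; lra.
Qed.

Let excess_growth : excess * (X 2 ^+ 2 - y * y') <= excess ^+ 2 * (2 * Y + 1).
Proof.
have [X2y|yX2] := leP (X 2 - y) 0.
  by rewrite (_ : excess = 0) ?mul0r ?expr0n ?mul0r //; apply/max_idPl.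
have excessE : excess = X 2 - y by apply/max_idPr; exact: ltW.
rewrite [excess ^+ 2]expr2 -[leRHS]mulrA; apply: ler_wpM2l => //.
have yy_le : y * y <= y * y' by apply: ler_wpM2l.
have excess_y : excess * y <= excess * Y by apply: ler_wpM2l => //; exact: le_trans y_le y'_le.
have excess_sqr : excess * excess <= excess * 1 by apply: ler_wpM2l.
have -> : X 2 = y + excess by rewrite excessE; ring.
move: yy_le excess_y excess_sqr; rewrite sqrrD !expr2 !mulr1.
rewrite (_ : excess * (2 * Y + 1) = 2 * (excess * Y) + excess); last by ring.
rewrite (_ : y * excess *+ 2 = 2 * (excess * y)); last by rewrite -mulr_natl; ring.
set t1 := y * y; set t2 := y * y'; set t3 := excess * y; set t4 := excess * Y.
by set t5 := excess * excess; lra.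
Qed.

Lemma Rintegrable_second_term :
  Rintegrable P (fun w => (N w)%:R * Num.max 0 (X' 2 w - y') ^+ 2).
Proof.
apply: Rintegrable_le (Rintegrable_next_sqr 2 y') => [|w].
  apply: measurable_funM => //; apply: measurable_funX; apply: measurable_maxr => //.
  exact: measurable_funB.
rewrite ger0_norm; last by apply: mulr_ge0 => //; exact: sqr_ge0.
by apply: ler_wpM2l => //; exact: max0_sqr_le.
Qed.

Let second_term_pointwise w : (N w)%:R * Num.max 0 (X' 2 w - y') ^+ 2 <=
  excess ^+ 2 + (2 * excess * ((N w)%:R * (X' 2 w - X 2) - dy * (N w)%:R) +
    (2 * ((N w)%:R * (X' 2 w - X 2) ^+ 2) + 2 * dy ^+ 2)).
Proof.
case: (N w); last first.
  by rewrite !(mul0r, mulr0) subr0 mulr0 !add0r addr_ge0 ?mulr_ge0 ?sqr_ge0.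
rewrite !mul1r mulr1.
have -> : X' 2 w - y' = (X 2 - y) + (X' 2 w - X 2 - dy).
  by rewrite /dy; move: (X' 2 w) (X 2) => t x; ring.
apply: le_trans (max0D_sqr_le _ _) _; rewrite -/excess -addrA !lerD2l.
set t := X' 2 w - X 2; rewrite -subr_ge0.
by rewrite (_ : _ - _ = (t + dy) ^+ 2); [exact: sqr_ge0 | ring].
Qed.

Lemma second_term_le : \int[P]_w ((N w)%:R * Num.max 0 (X' 2 w - y') ^+ 2) <=
  excess ^+ 2 * (1 + second_rate s / p) + 2 * second_drift_error s +
  2 * square_error s 2 (second_remainder s) + 2 * (Y ^+ 2 / p) ^+ 2.
Proof.
have Isqr := Rintegrable_next_sqr 2 (X 2).
have Icst c := Rintegrable_cst P c.
have Idrift := RintegrableZ (2 * excess) Iexcess_drift.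
have Ifluct := RintegrableD (RintegrableZ 2 Isqr) (Icst (2 * dy ^+ 2)).
apply: le_trans (ler_Rintegral Rintegrable_second_term
  (RintegrableD (Icst (excess ^+ 2)) (RintegrableD Idrift Ifluct)) second_term_pointwise) _.
rewrite RintegralD //; [|exact: Icst|exact: RintegrableD].
rewrite Rintegral_cstT RintegralD // RintegralZl // RintegralD //;
  [|exact: RintegrableZ|exact: Icst].
rewrite Rintegral_cstT RintegralZl //.
have square_le := drift_square_le second_remainder_ge0 second_remainder_le.
have drift_part : 2 * excess * \int[P]_w ((N w)%:R * (X' 2 w - X 2) - dy * (N w)%:R) <=
    excess ^+ 2 * (second_rate s / p) + 2 * second_drift_error s.
  apply: le_trans (ler_wpM2l _ excess_drift_le) _; first exact: mulr_ge0.
  rewrite mulrDr; apply: lerD; last by rewrite -[leLHS]mulrA ler_pM2l //; exact: ler_piMl.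
  rewrite (_ : 2 * excess * (_ / p) = (excess * (X 2 ^+ 2 - y * y')) * (2 / p)); last by ring.
  rewrite (_ : excess ^+ 2 * _ = excess ^+ 2 * (2 * Y + 1) * (2 / p)).
    by apply: ler_wpM2r => //; rewrite divr_ge0 // ltW.
  by rewrite /second_rate; ring.
have dy_part : dy ^+ 2 <= (Y ^+ 2 / p) ^+ 2.
  by rewrite lerXn2r ?nnegrE //; exact: le_trans dy_le.
apply: (@le_trans _ _ (excess ^+ 2 + (excess ^+ 2 * (second_rate s / p) + 2 * second_drift_error s +
    (2 * square_error s 2 (second_remainder s) + 2 * (Y ^+ 2 / p) ^+ 2)))).
  rewrite lerD2l; apply: lerD => //; apply: lerD; first by rewrite ler_pM2l.
  by rewrite ler_pM2l.
by rewrite [excess ^+ 2 * (1 + _)]mulrDr mulr1 !addrA.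
Qed.

Let q_ge2 : (2 <= q)%N. Proof. by rewrite qE expnS leq_pmulr // expn_gt0. Qed.

Let power_drift_leading : - (q%:R * a * X q.+1) + mean_quad q <=
  X q * (q%:R / p) + X q * (q%:R ^+ 2 * (Y + 1) / p).
Proof.
apply: (@le_trans _ _ (q%:R * (X q.+1 * x1) / p + q%:R ^+ 2 * (X 2 * X q) / p)).
  apply: le_trans (lerD (lexx _) (mean_quadratic_le n_gt0 p_gt0 psdA q_ge2)) _.
  by rewrite le_eqVlt; apply/orP; left; apply/eqP; rewrite /x1 /shift; ring.
apply: lerD.
  rewrite (_ : X q * (q%:R / p) = q%:R * X q / p); last by ring.
  apply: ler_wpM2r => //; apply: ler_wpM2l => //.
  apply: (@le_trans _ _ (X q.+1 * `|x1|)); first by apply: ler_wpM2l => //; exact: ler_norm.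
  apply: le_trans (ler_wpM2r (normr_ge0 _) (XS_le q)) _.
  by rewrite mulrAC -[leRHS]mul1r; apply: ler_wpM2r.
rewrite (_ : X q * (_ / p) = q%:R ^+ 2 * ((Y + 1) * X q) / p); last by ring.
by apply: ler_wpM2r => //; apply: ler_wpM2l; [exact: exprn_ge0 | exact: ler_wpM2r].
Qed.

Let power_drift_variance : q%:R ^+ 2 * (2 * delta) * X q.+2 <= X q * (2 * q%:R ^+ 2 / p).
Proof.
have X_le2 : X q.+2 <= K ^+ 2 * X q.
  by apply: le_trans (XS_le q.+1) _; rewrite expr2 -mulrA; exact: (ler_wpM2l K_ge0 (XS_le q)).
have delta_X : delta * X q.+2 <= p^-1 * X q.
  apply: le_trans (ler_wpM2l delta_ge0 X_le2) _; rewrite mulrA.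
  by apply: ler_wpM2r => //; exact: moment_error_le.
rewrite (_ : _ * X q.+2 = 2 * q%:R ^+ 2 * (delta * X q.+2)); last by ring.
rewrite (_ : X q * _ = 2 * q%:R ^+ 2 * (p^-1 * X q)); last by ring.
by apply: ler_wpM2l => //; apply: mulr_ge0 => //; exact: exprn_ge0.
Qed.

Let power_drift_failure : 3 * q%:R * nu * X q.+1 <= X q * (3 * q%:R / p).
Proof.
have nu_X : nu * X q.+1 <= p^-1 * X q.
  apply: le_trans (ler_wpM2l nu_ge0 (XS_le q)) _; rewrite mulrA.
  by apply: ler_wpM2r => //; exact: fail_bound_le.
rewrite (_ : _ * X q.+1 = 3 * q%:R * (nu * X q.+1)); last by ring.
rewrite (_ : X q * _ = 3 * q%:R * (p^-1 * X q)); last by ring.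
by apply: ler_wpM2l => //; exact: mulr_ge0.
Qed.

Lemma power_term_le : \int[P]_w ((N w)%:R * X' q w) <= X q * (1 + power_rate s q / p).
Proof.
have remainder_ge0 : 0 <= expansion_const R q * eps ^+ 3 * X q.
  by rewrite mulr_ge0 // mulr_ge0 // expansion_const_ge0.
have drift := drift_le remainder_ge0 (fun w => next_remainder_dyadic (w := w) qE).
have -> : \int[P]_w ((N w)%:R * X' q w) =
    \int[P]_w ((N w)%:R * (X' q w - X q)) + X q * \int[P]_w (N w)%:R.
  rewrite -RintegralZl // -RintegralD //; [|exact: Rintegrable_next_drift|exact: RintegrableZ].
  by apply: eq_RintegralT => w; rewrite mulrBr [X q * _]mulrC subrK.
have success_part : X q * \int[P]_w (N w)%:R <= X q.
  rewrite ler_piMr // -[leRHS](Rintegral_cstT P 1).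
  by apply: ler_Rintegral => // [|w]; [exact: Rintegrable_cst | case: (N w)].
have remainder_part : expansion_const R q * eps ^+ 3 * X q <= X q * (expansion_const R q / p).
  rewrite (_ : X q * _ = expansion_const R q * p^-1 * X q); last by ring.
  apply: ler_wpM2r => //; apply: ler_wpM2l; first exact: expansion_const_ge0.
  exact: step_size_cube_le.
apply: le_trans (lerD (le_trans drift (lerD (lerD (lerD power_drift_leading power_drift_variance)
  power_drift_failure) remainder_part)) success_part) _.
by rewrite /power_rate le_eqVlt; apply/orP; left; apply/eqP; ring.
Qed.

Let lyapunov_split w : sD ^+ 2 * ((N w)%:R * (X' 1 w - phi) ^+ 2) +
  (N w)%:R * Num.max 0 (X' 2 w - y') ^+ 2 + n%:R^-1 * ((N w)%:R * X' q w) + (~~ N w)%:R =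
  if N w then lyapunov s q y' (B w) else 1.
Proof.
rewrite /lyapunov; case: (N w) => /=; last by rewrite !(mul0r, mulr0) !add0r.
by rewrite !mul1r addr0 [n%:R^-1 * _]mulrC.
Qed.

Let Isplit1 : Rintegrable P (fun w => sD ^+ 2 * ((N w)%:R * (X' 1 w - phi) ^+ 2)).
Proof. by apply: RintegrableZ; exact: Rintegrable_next_sqr. Qed.

Let Isplit12 : Rintegrable P (fun w => sD ^+ 2 * ((N w)%:R * (X' 1 w - phi) ^+ 2) +
  (N w)%:R * Num.max 0 (X' 2 w - y') ^+ 2).
Proof. by apply: RintegrableD => //; exact: Rintegrable_second_term. Qed.

Let Ipower : Rintegrable P (fun w => n%:R^-1 * ((N w)%:R * X' q w)).
Proof. by apply: RintegrableZ; exact: Rintegrable_next. Qed.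

Let Ifail : Rintegrable P (fun w => (~~ N w)%:R).
Proof. by apply: Rintegrable_bool; exact: measurable_neg. Qed.

Let Isplit : Rintegrable P (fun w => sD ^+ 2 * ((N w)%:R * (X' 1 w - phi) ^+ 2) +
  (N w)%:R * Num.max 0 (X' 2 w - y') ^+ 2 + n%:R^-1 * ((N w)%:R * X' q w)).
Proof. exact: RintegrableD. Qed.

Lemma Rintegrable_lyapunov_next :
  Rintegrable P (fun w => if N w then lyapunov s q y' (B w) else 1).
Proof. by apply: eq_Rintegrable lyapunov_split _; exact: RintegrableD. Qed.

Lemma lyapunov_step : \int[P]_w (if N w then lyapunov s q y' (B w) else 1) <=
  lyapunov s q y A * (1 + lyapunov_rate s q / p) + lyapunov_error s.
Proof.
rewrite -(eq_RintegralT P lyapunov_split) RintegralD // RintegralD // RintegralD //; last first.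
  exact: Rintegrable_second_term.
rewrite RintegralZl //; last exact: Rintegrable_next_sqr.
rewrite RintegralZl //; last exact: Rintegrable_next.
have power_le : n%:R^-1 * \int[P]_w ((N w)%:R * X' q w) <= X q / n%:R * (1 + power_rate s q / p).
  by rewrite mulrC [leRHS]mulrAC; apply: ler_wpM2r power_term_le; rewrite invr_ge0 ltW.
have fail_le := truncation_prob truncation.
apply: le_trans (lerD (lerD (lerD first_term_le second_term_le) power_le) fail_le) _.
have term_ge0 : [/\ 0 <= sD ^+ 2 * x1 ^+ 2, 0 <= excess ^+ 2 & 0 <= X q / n%:R].
  by rewrite mulr_ge0 ?sqr_ge0.
have rate_ge0 : [/\ 0 <= first_rate s / p, 0 <= second_rate s / p & 0 <= power_rate s q / p].
  by split; rewrite mulr_ge0 // ?first_rate_ge0 ?second_rate_ge0 ?power_rate_ge0.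
have rateE : lyapunov_rate s q / p = first_rate s / p + second_rate s / p + power_rate s q / p.
  by rewrite [lyapunov_rate s q / p]mulrDl [X in X + _ = _]mulrDl.
rewrite rateE /lyapunov -/x1 -/excess /lyapunov_error.
case: term_ge0 rate_ge0; set t1 := sD ^+ 2 * x1 ^+ 2; set t2 := excess ^+ 2; set t3 := X q / _.
set r1 := first_rate s / p; set r2 := second_rate s / p; set r3 := power_rate s q / p.
set e1 := 2 * sD * _; set e2 := sD ^+ 2 * square_error _ _ _; set e3 := 2 * second_drift_error s.
set e4 := 2 * square_error _ _ _; set e5 := 2 * _ ^+ 2.
move=> t1_ge0 t2_ge0 t3_ge0 [r1_ge0 r2_ge0 r3_ge0].
have := mulr_ge0 t1_ge0 r2_ge0; have := mulr_ge0 t1_ge0 r3_ge0.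
have := mulr_ge0 t2_ge0 r1_ge0; have := mulr_ge0 t2_ge0 r3_ge0.
have := mulr_ge0 t3_ge0 r1_ge0; have := mulr_ge0 t3_ge0 r2_ge0.
by lra.
Qed.

End LyapunovStep.
End Drift.
End OneStep.

Section MatrixMeasurable.
Context {R : realType} {d : measure_display} {T : measurableType d}.
Local Notation C := R[i].

Definition mx_measurable m n (M : T -> 'M[C]_(m, n)) :=
  forall i j, Cmeasurable (fun w => M w i j).

Lemma mx_measurable_cst m n (A : 'M[C]_(m, n)) : mx_measurable (fun=> A).
Proof. by move=> i j; exact: Cmeasurable_cst. Qed.

Lemma mx_measurableM m n p (A : T -> 'M[C]_(m, n)) (B : T -> 'M[C]_(n, p)) :
  mx_measurable A -> mx_measurable B -> mx_measurable (fun w => A w *m B w).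
Proof.
move=> mA mB i j; apply: (eq_Cmeasurable (f := fun w => \sum_k A w i k * B w k j)) => [w|].
  by rewrite mxE.
by apply: Cmeasurable_sum => k _; exact: CmeasurableM.
Qed.

Lemma mx_measurableD m n (A B : T -> 'M[C]_(m, n)) :
  mx_measurable A -> mx_measurable B -> mx_measurable (fun w => A w + B w).
Proof.
move=> mA mB i j; apply: (eq_Cmeasurable (f := fun w => A w i j + B w i j)) => [w|].
  by rewrite mxE.
exact: CmeasurableD.
Qed.

Lemma mx_measurableB m n (A B : T -> 'M[C]_(m, n)) :
  mx_measurable A -> mx_measurable B -> mx_measurable (fun w => A w - B w).
Proof.
move=> mA mB i j; apply: (eq_Cmeasurable (f := fun w => A w i j + -1 * B w i j)) => [w|].
  by rewrite !mxE mulN1r.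
by apply: CmeasurableD => //; apply: CmeasurableM => //; exact: Cmeasurable_cst.
Qed.

Lemma mx_measurable_sum (I : eqType) (s : seq I) m n (A : I -> T -> 'M[C]_(m, n)) :
  (forall i, mx_measurable (A i)) -> mx_measurable (fun w => \sum_(i <- s) A i w).
Proof.
move=> mA i j; apply: (eq_Cmeasurable (f := fun w => \sum_(k <- s) A k w i j)) => [w|].
  by rewrite summxE.
by apply: Cmeasurable_sum => k _; exact: mA.
Qed.

Lemma mx_measurableX n (A : T -> 'M[C]_n) k :
  mx_measurable A -> mx_measurable (fun w => A w ^+ k).
Proof.
move=> mA; elim: k => [|k IH]; first exact: mx_measurable_cst.
under eq_fun do rewrite exprS; exact: mx_measurableM.
Qed.

Lemma Cmeasurable_mxtrace n (A : T -> 'M[C]_n) :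
  mx_measurable A -> Cmeasurable (fun w => \tr (A w)).
Proof. by move=> mA; apply: Cmeasurable_sum => i _; exact: mA. Qed.

Lemma Cmeasurable_det n (A : T -> 'M[C]_n) :
  mx_measurable A -> Cmeasurable (fun w => \det (A w)).
Proof.
move=> mA; apply: Cmeasurable_sum => s _; apply: CmeasurableM; first exact: Cmeasurable_cst.
by apply: Cmeasurable_prod => i _; exact: mA.
Qed.

Lemma mx_measurable_inv n (A : T -> 'M[C]_n) :
  mx_measurable A -> mx_measurable (fun w => invmx (A w)).
Proof.
move=> mA i j; have mdet := Cmeasurable_det mA.
pose singular w := (complex.Re (\det (A w)) == 0) && (complex.Im (\det (A w)) == 0).
apply: (eq_Cmeasurable (f := fun w =>
    if singular w then A w i j else (\det (A w))^-1 * \adj (A w) i j)) => [w|].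
  have -> : singular w = (\det (A w) == 0) by rewrite eq_complex.
  by rewrite /invmx unitmxE unitfE; case: (_ == 0); rewrite //= [RHS]mxE.
apply: Cmeasurable_if => //.
  by apply: measurable_and; apply: measurable_fun_eqr => //; [exact: mdet.1 | exact: mdet.2].
apply: CmeasurableM; first exact: Cmeasurable_inv.
apply: (eq_Cmeasurable (f := fun w => (-1) ^+ (j + i) * \det (row' j (col' i (A w))))) => [w|].
  by rewrite mxE.
apply: CmeasurableM; first exact: Cmeasurable_cst.
apply: Cmeasurable_det => k k'.
by apply: (eq_Cmeasurable (f := fun w => A w (lift j k) (lift i k'))) => // w; rewrite !mxE.
Qed.

Lemma mx_measurable_resolvent n (u : R) (S : T -> 'M[C]_n) :
  mx_measurable S -> mx_measurable (fun w => resolvent u (S w)).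
Proof.
by move=> mS; apply: mx_measurable_inv; apply: mx_measurableB => //; exact: mx_measurable_cst.
Qed.

Lemma measurable_trace_moment n (A : T -> 'M[C]_n) q :
  mx_measurable A -> measurable_fun setT (fun w => trace_moment (A w) q).
Proof.
move=> mA; apply: measurable_funM; last exact: measurable_cst.
by have [] := Cmeasurable_mxtrace (mx_measurableX q mA).
Qed.

Lemma measurable_lyapunov (s : step_params R) q y (A : T -> 'M[C]_(dim s)) :
  mx_measurable A -> measurable_fun setT (fun w => lyapunov s q y (A w)).
Proof.
move=> mA; have mtm k := measurable_trace_moment k mA.
apply: measurable_funD; last by apply: measurable_funM.
apply: measurable_funD; first by apply: measurable_funM => //; apply: measurable_funX;
  exact: measurable_funB.
by apply: measurable_funX; apply: measurable_maxr => //; exact: measurable_funB.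
Qed.

End MatrixMeasurable.

Section LyapunovBounds.
Variables (R : realType) (s : step_params R) (q : nat) (y : R) (A P : 'M[R[i]]_(dim s)).
Variable r : 'I_(dim s) -> R.
Hypotheses (decA : real_spectral_dec A P r) (r_ge0 : forall i, 0 <= r i).

Let trace_moment_dec m : trace_moment A m = power_sum r m / (dim s)%:R.
Proof. by rewrite /trace_moment (real_spectral_dec_mxtrace_exprn decA). Qed.

Let power_part_ge0 : 0 <= trace_moment A q / (dim s)%:R.
Proof. by rewrite trace_moment_dec !divr_ge0 // power_sum_ge0. Qed.

Lemma lyapunov_ge0 : 0 <= lyapunov s q y A.
Proof. by rewrite addr_ge0 // addr_ge0 ?sqr_ge0 // mulr_ge0 ?sqr_ge0. Qed.

Lemma lyapunov_first_le : lyapunov s q y A <= 1 -> 0 <= dev_weight s ->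
  dev_weight s * `|trace_moment A 1 - barrier_move s| <= 1.
Proof.
move=> lyap1 sD_ge0.
have prod_ge0 := mulr_ge0 sD_ge0 (normr_ge0 (trace_moment A 1 - barrier_move s)).
rewrite -(@ler_pXn2r _ 2) ?nnegrE // expr1n exprMn real_normK ?num_real //.
apply: le_trans lyap1; rewrite /lyapunov -addrA lerDl addr_ge0 ?sqr_ge0 //.
Qed.

(* One eigenvalue is controlled by the [q]-th moment, since [n ^ 2 <= K ^ q]. *)
Lemma lyapunov_psd_le (K : R) : (0 < dim s)%N -> (0 < q)%N -> 0 <= K ->
  (dim s)%:R ^+ 2 <= K ^+ q -> lyapunov s q y A <= 1 -> psd_le K A.
Proof.
move=> n_gt0 q_gt0 K_ge0 nK lyap1; exists P, r; split=> // i; rewrite r_ge0 /=.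
have nR_gt0 : 0 < (dim s)%:R :> R by rewrite ltr0n.
have power_le : power_sum r q <= (dim s)%:R ^+ 2.
  rewrite expr2 -ler_pdivrMr // -[leRHS]mul1r -ler_pdivrMr // -trace_moment_dec.
  apply: le_trans lyap1; rewrite /lyapunov lerDr addr_ge0 ?sqr_ge0 //.
  by rewrite mulr_ge0 ?sqr_ge0.
rewrite -(@ler_pXn2r _ q) ?nnegrE //; apply: le_trans nK; apply: le_trans power_le.
by rewrite /power_sum (bigD1 i) //= lerDl; apply: sumr_ge0 => k _; rewrite exprn_ge0.
Qed.

End LyapunovBounds.

Lemma gronwall (R : realFieldType) (e : nat -> R) (rho err : R) (m : nat) : 0 <= rho -> 0 <= err ->
  (forall j, (j < m)%N -> e j.+1 <= e j * (1 + rho) + err) ->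
  0 <= e 0%N -> e m <= (1 + rho) ^+ m * (e 0%N + m%:R * err).
Proof.
move=> rho0 err0 step e00; elim: m step => [|m IH] step; first by rewrite expr0 mul0r addr0 mul1r.
apply: le_trans (step m (ltnSn m)) _.
have {}IH := IH (fun j jm => step j (ltnW jm)).
have growth1 : 1 <= (1 + rho) ^+ m.+1 by rewrite exprn_ege1 // lerDl.
apply: (@le_trans _ _ ((1 + rho) ^+ m.+1 * (e 0%N + m%:R * err) + (1 + rho) ^+ m.+1 * err)).
  apply: lerD; last by rewrite ler_peMl.
  rewrite exprSr -mulrA [leRHS]mulrCA mulrC; apply: ler_wpM2l => //.
  by rewrite addr_ge0.
by rewrite -mulrDr -natr1 mulrDl mul1r addrA.
Qed.

(** * The stopped process *)

Section Process.
Context {R : realType}.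
Local Notation C := R[i].

Definition column_scale (d p : nat) : R := (Num.sqrt (p%:R * (d * d)%:R))^-1.

Definition process_params (d p : nat) (u0 tau K nu sD : R) : step_params R := {|
  dim := d * d;
  steps := p%:R;
  barrier_move := u0^-1;
  res_bound := K;
  inc_bound := column_scale d p * (16 * tau ^+ 2 + 1);
  fail_bound := nu;
  dev_weight := sD;
  slope_cap := ((1 + u0 ^+ 2) / 2 - 1)^-1
|}.

Context {dT : measure_display} {T : measurableType dT}.
Variables (P : probability T R) (kap : R) (d p : nat) (g : 'I_(d * d) * 'I_p.+1 -> T -> C).
Variables (neg : bool) (u0 tau K nu sD : R) (q : nat).
Local Notation n := (d * d)%N.
Local Notation pR := (p.+1%:R : R).
Local Notation s := (process_params d p.+1 u0 tau K nu sD).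

Definition column_step (j : nat) (w : T) : 'M[C]_n :=
  column_increment g (inord j) ((-1) ^+ neg * column_scale d p.+1) w.

Definition partial_sum (j : nat) (w : T) : 'M[C]_n := \sum_(k < j) column_step k w.

Definition column_net (j : nat) (w : T) : bool := net_event g (inord j) tau w.

Definition barrier (j : nat) : R := u0 + j%:R * shift s.

(* The solution of [y j.+1 - y j = y j * y j.+1 / p]; it starts above [u0 ^- 2], the second
   trace moment of the initial resolvent. *)
Definition slope (j : nat) : R := ((1 + u0 ^+ 2) / 2 - j%:R / pR)^-1.

Definition potential (j : nat) (w : T) : R :=
  lyapunov s q (slope j) (resolvent (barrier j) (partial_sum j w)).

Fixpoint good (j : nat) (w : T) : bool :=
  if j is k.+1 then good k w && column_net k w && (potential k.+1 w <= 1) else true.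

Definition stopped_potential (j : nat) (w : T) : R := if good j w then potential j w else 1.

Definition next_potential (j : nat) (w w' : T) : R :=
  lyapunov s q (slope j.+1) (resolvent (barrier j.+1) (partial_sum j w + column_step j w')).

Definition next_stopped (j : nat) (w w' : T) : R :=
  if good j w then if column_net j w' then next_potential j w w' else 1 else 1.

Lemma partial_sumS j w : partial_sum j.+1 w = partial_sum j w + column_step j w.
Proof. by rewrite /partial_sum big_ord_recr. Qed.

Lemma barrierS j : barrier j.+1 = barrier j + shift s.
Proof. by rewrite /barrier -natr1 mulrDl mul1r addrA. Qed.

Section Measurability.
Variables (dS : measure_display) (S : measurableType dS) (pr : S -> T).

Lemma mx_measurable_column_step j : (forall r, Cmeasurable (fun z => g (r, inord j) (pr z))) ->
  mx_measurable (fun z => column_step j (pr z)).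
Proof. by move=> mg x y; exact: Cmeasurable_column_increment. Qed.

Lemma measurable_column_net j : (forall r, Cmeasurable (fun z => g (r, inord j) (pr z))) ->
  measurable_fun setT (fun z => column_net j (pr z)).
Proof. by move=> mg; apply: measurable_net_event => r b; case: (mg r); case: b. Qed.

Variable j : nat.
Hypothesis mg : forall r k, (k < j)%N -> Cmeasurable (fun z => g (r, inord k) (pr z)).

Lemma mx_measurable_partial_sum k : (k <= j)%N -> mx_measurable (fun z => partial_sum k (pr z)).
Proof.
move=> kj; apply: mx_measurable_sum => i; apply: mx_measurable_column_step => r.
exact: mg (leq_trans (ltn_ord i) kj).
Qed.

Lemma measurable_good k : (k <= j)%N -> measurable_fun setT (fun z => good k (pr z)).
Proof.
elim: k => [_|k IH kj]; first exact: measurable_cst.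
rewrite /=; apply: measurable_and.
  apply: measurable_and; first exact: IH (ltnW kj).
  by apply: measurable_column_net => r; exact: mg.
apply: measurable_fun_ler => //; apply: measurable_lyapunov; apply: mx_measurable_resolvent.
exact: mx_measurable_partial_sum.
Qed.

End Measurability.

Hypothesis entries : forall e, gaussian_entry P kap (g e).

Let mg (r : 'I_n) k : Cmeasurable (fun w => g (r, inord k) w).
Proof. exact: entry_measurable (entries _). Qed.

Lemma measurable_goodT j : measurable_fun setT (good j).
Proof. by apply: (@measurable_good _ _ id j). Qed.

Lemma measurable_stopped_potential j : measurable_fun setT (stopped_potential j).
Proof.
apply: measurable_fun_ifT => //; first exact: measurable_goodT.
apply: measurable_lyapunov; apply: mx_measurable_resolvent.
by apply: (@mx_measurable_partial_sum _ _ id j).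
Qed.

Hypothesis indep : mutually_independent P (re_im g).
Hypotheses (kap_idem : kap * kap = kap) (kap_ge0 : 0 <= kap) (kap_le1 : kap <= 1).
Hypothesis regime : step_regime s.
Hypotheses (u0_gt1 : 1 < u0) (tau_ge0 : 0 <= tau).
Hypothesis size_le : n%:R ^+ 2 <= K ^+ q.

Let n_gt0 : (0 < n)%N := dim_gt0 regime.
Let d_gt0 : (0 < d)%N. Proof. by move: n_gt0; rewrite muln_gt0 andbb. Qed.
Let pn_gt0 : 0 < pR * n%:R. Proof. by rewrite mulr_gt0 // ltr0n. Qed.
Let K_ge0 : 0 <= K := res_bound_ge0 regime.
Let u0_gt0 : 0 < u0. Proof. exact: lt_trans u0_gt1. Qed.

Let scale_ge0 : 0 <= column_scale d p.+1. Proof. by rewrite invr_ge0 sqrtr_ge0. Qed.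

Let scale_sqr : ((-1) ^+ neg * column_scale d p.+1) ^+ 2 = (pR * n%:R)^-1.
Proof. by rewrite exprMn sqrr_sign mul1r /column_scale exprVn sqr_sqrtr // ltW. Qed.

Lemma column_step_moments j : increment_moments P kap (pR * n%:R)^-1 (column_step j).
Proof. by rewrite -scale_sqr; exact: column_increment_moments. Qed.

Section Steps.
Variables (jq : nat) (L failure : R).
Hypothesis qE : q = (2 ^ jq.+1)%N.
Hypothesis L_gt0 : 0 < L.
Hypothesis net_failure_le : 4 * ((8 * d + 1)%:R ^+ d) ^+ 2 * expR (- tau ^+ 2 / 2) <= failure.
Hypothesis failure_le : failure <= nu.
Hypothesis truncated_le :
  2 * (pR * n%:R)^-1 * (d%:R ^+ 4 * (L * failure + 24 * 2 ^+ 10 / L + failure)) <= nu.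

Let q_gt0 : (0 < q)%N. Proof. by rewrite qE expn_gt0. Qed.

Lemma column_step_truncation j :
  increment_truncation P (column_step j) (column_net j) (inc_bound s) nu.
Proof.
have mnet : measurable_fun setT (column_net j) by exact: (@measurable_column_net _ _ id j).
have net_le := le_trans (net_failure_prob (inord j) entries indep d_gt0 tau_ge0) net_failure_le.
have [Itr tr_le] := truncated_mxtrace_sqr_le entries (inord j)
  ((-1) ^+ neg * column_scale d p.+1) mnet L_gt0 net_le.
split=> // [w net_w||].
- rewrite /column_step; have := column_increment_opnorm_le ((-1) ^+ neg * column_scale d p.+1)
    d_gt0 tau_ge0 net_w.
  by rewrite normrM normrX normrN1 expr1n mul1r ger0_norm.
- exact: le_trans net_le failure_le.
- by apply: le_trans tr_le _; rewrite scale_sqr.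
Qed.

Let slope_den_gt0 j : (j <= p.+1)%N -> 0 < (1 + u0 ^+ 2) / 2 - j%:R / pR /\
  (1 + u0 ^+ 2) / 2 - 1 <= (1 + u0 ^+ 2) / 2 - j%:R / pR.
Proof.
move=> jp; have ratio_le1 : j%:R / pR <= 1 by rewrite ler_pdivrMr // mul1r ler_nat.
have c_gt1 : 1 < (1 + u0 ^+ 2) / 2.
  by have : 1 < u0 ^+ 2; [rewrite exprn_egt1 | set x := u0 ^+ 2; lra].
by split; [rewrite subr_gt0 (le_lt_trans ratio_le1) | rewrite lerD2l lerN2].
Qed.

Let slope_ge0 j : (j <= p.+1)%N -> 0 <= slope j.
Proof. by move=> /slope_den_gt0[den_gt0 _]; rewrite invr_ge0 ltW. Qed.

Let slope_le_cap j : (j <= p.+1)%N -> slope j <= slope_cap s.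
Proof.
move=> /slope_den_gt0[den_gt0 den_ge]; rewrite lef_pV2 ?posrE //.
have : 1 < u0 ^+ 2 by rewrite exprn_egt1.
by set x := u0 ^+ 2; lra.
Qed.

Let slope_recurrence j : (j < p.+1)%N -> slope j.+1 - slope j = slope j * slope j.+1 / pR.
Proof.
move=> jp; have [den_gt0 _] := slope_den_gt0 (ltnW jp); have [denS_gt0 _] := slope_den_gt0 jp.
rewrite /slope; move: den_gt0 denS_gt0; set a := _ - j%:R / pR; set b := _ - _ => a_gt0 b_gt0.
have -> : pR^-1 = a - b by rewrite /a /b -[j.+1%:R]natr1; ring.
by field; rewrite !lt0r_neq0.
Qed.

Let barrier0 : barrier 0 = u0. Proof. by rewrite /barrier mul0r addr0. Qed.

Let partial_sum0 w : partial_sum 0 w = 0. Proof. exact: big_ord0. Qed.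

Let above_spectrum0 w : above_spectrum (barrier 0) (partial_sum 0 w).
Proof.
rewrite barrier0 partial_sum0; exists 1%:M, (fun=> 0); split=> [|i]; last by rewrite subr0.
split; rewrite ?trmxC1 ?mulmx1 ?mul1mx //.
by apply/matrixP => i k; rewrite !mxE mul0rn.
Qed.

Let potential0_le w : potential 0 w <= n%:R^-1.
Proof.
rewrite /potential barrier0 partial_sum0 /resolvent subr0 invmx_scalar.
have trace_moment0E m : trace_moment ((u0%:C^-1)%:M : 'M[C]_n) m = u0^-1 ^+ m.
  rewrite /trace_moment -fmorphV -rmorphXn /= -rmorphXn mxtrace_scalar.
  by rewrite -[_ *+ _]mulr_natr -(rmorph_nat (real_complex R)) -rmorphM /= mulfK // pnatr_eq0 -lt0n.
rewrite /lyapunov !trace_moment0E expr1 subrr expr0n mulr0 add0r.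
have -> : Num.max 0 (u0^-1 ^+ 2 - slope 0) = 0.
  have [den_gt0 _] := slope_den_gt0 (leq0n p.+1).
  apply/max_idPl; rewrite subr_le0 /slope exprVn lef_pV2 ?posrE ?exprn_gt0 //.
  by have : 1 < u0 ^+ 2; [rewrite exprn_egt1 | rewrite mul0r subr0; set x := u0 ^+ 2; lra].
rewrite expr0n add0r -[leRHS]mul1r; apply: ler_wpM2r; first by rewrite invr_ge0.
by rewrite exprn_ile1 ?invr_ge0 ?ltW // invf_lt1.
Qed.

Let potential_psd j w : above_spectrum (barrier j) (partial_sum j w) -> potential j w <= 1 ->
  psd_le K (resolvent (barrier j) (partial_sum j w)).
Proof.
move=> /above_spectrum_resolvent[Q [r [decA r_ge0]]].
exact: (lyapunov_psd_le (s := s) decA r_ge0 n_gt0 q_gt0 K_ge0 size_le).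
Qed.

Let next_above j w w' : above_spectrum (barrier j) (partial_sum j w) -> potential j w <= 1 ->
  column_net j w' -> above_spectrum (barrier j.+1) (partial_sum j w + column_step j w').
Proof.
move=> above pot1 net_w'; rewrite barrierS.
by have [] := next_resolvent regime (column_step_moments j) (column_step_truncation j) above
  (potential_psd above pot1) net_w'.
Qed.

Lemma good_invariant j w : good j w ->
  above_spectrum (barrier j) (partial_sum j w) /\ potential j w <= 1.
Proof.
elim: j => [_|j IH].
  split; first exact: above_spectrum0.
  by apply: le_trans (potential0_le w) _; rewrite invf_le1 ?ltr0n // ler1n.
move=> /= /andP[/andP[/IH[above pot1] net_w] potS]; split=> //.
by rewrite partial_sumS; exact: next_above.
Qed.

Let potential_ge0 j w : above_spectrum (barrier j) (partial_sum j w) -> 0 <= potential j w.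
Proof.
move=> /above_spectrum_resolvent[Q [r [decA r_ge0]]].
exact: (lyapunov_ge0 (s := s) q _ decA r_ge0).
Qed.

Let stopped_potential_itv j w : 0 <= stopped_potential j w <= 1.
Proof.
rewrite /stopped_potential; case: ifP => [/good_invariant[above ->]|_]; last by rewrite ler01 lexx.
by rewrite potential_ge0.
Qed.

Let Rintegrable_stopped j : Rintegrable P (stopped_potential j).
Proof.
apply: Rintegrable_le (measurable_stopped_potential j) _ (Rintegrable_cst P 1) => w.
by have /andP[ge0 le1] := stopped_potential_itv j w; rewrite ger0_norm.
Qed.

Local Notation rate := (lyapunov_rate s q).
Local Notation err := (lyapunov_error s).

Lemma next_potential_le j w : (j < p.+1)%N -> good j w ->
  Rintegrable P (fun w' => if column_net j w' then next_potential j w w' else 1) /\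
  \int[P]_w' (if column_net j w' then next_potential j w w' else 1) <=
  potential j w * (1 + rate / pR) + err.
Proof.
move=> jp /good_invariant[above pot1]; have psdA := potential_psd above pot1.
have mnext m : measurable_fun setT (fun w' =>
    trace_moment (resolvent (barrier j + shift s) (partial_sum j w + column_step j w')) m).
  apply: measurable_trace_moment; apply: mx_measurable_resolvent; apply: mx_measurableD.
    exact: mx_measurable_cst.
  exact: (@mx_measurable_column_step _ _ id j).
have slope_le : slope j <= slope j.+1.
  by rewrite -subr_ge0 slope_recurrence // divr_ge0 ?mulr_ge0 ?slope_ge0 // ltnW.
rewrite /next_potential barrierS; split.
  exact: (Rintegrable_lyapunov_next regime (column_step_moments j) (column_step_truncation j)
    above psdA mnext).
exact: (lyapunov_step regime kap_ge0 kap_le1 (column_step_moments j) (column_step_truncation j)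
  above psdA mnext qE (slope_ge0 (ltnW jp)) slope_le (slope_le_cap jp) (slope_recurrence jp) pot1).
Qed.

Hypothesis err_ge0 : 0 <= err.

Let rate_ge0 : 0 <= rate. Proof. exact/lyapunov_rate_ge0/(slope_cap_ge0 regime). Qed.

Let next_stopped_ge0 j w w' : 0 <= next_stopped j w w'.
Proof.
rewrite /next_stopped; case: ifP => // /good_invariant[above pot1]; case: ifP => // net_w'.
have [Q [r [decA r_ge0]]] := above_spectrum_resolvent (next_above above pot1 net_w').
exact: (lyapunov_ge0 (s := s) q _ decA r_ge0).
Qed.

Let next_stopped_mean_le j w : (j < p.+1)%N ->
  (\int[P]_w' (next_stopped j w w')%:E <= (stopped_potential j w * (1 + rate / pR) + err)%:E)%E.
Proof.
move=> jp; rewrite /next_stopped /stopped_potential; case: ifP => gw.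
  by have [Inext next_le] := next_potential_le jp gw; rewrite EFin_Rintegral // lee_fin.
rewrite integral_cst //= probability_setT mule1 lee_fin mul1r.
by rewrite -addrA lerDl addr_ge0 ?divr_ge0.
Qed.

Let stopped_le_next j w : stopped_potential j.+1 w <= next_stopped j w w.
Proof.
rewrite /stopped_potential /next_stopped /next_potential -partial_sumS /=.
case: (good j w) => //=; case: (column_net j w) => //=.
by case: (leP (potential j.+1 w) 1) => // pot_gt1; exact: ltW.
Qed.

Let past j : {set 'I_n * 'I_p.+1} := [set e : 'I_n * 'I_p.+1 | (e.2 < j)%N]%SET.
Let present j : {set 'I_n * 'I_p.+1} := [set e : 'I_n * 'I_p.+1 | e.2 == inord j]%SET.

Let past_present_disjoint j : (j < p.+1)%N -> [disjoint past j & present j]%B.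
Proof.
move=> jp; rewrite disjoint_subset; apply/fintype.subsetP => e; rewrite !inE => ej.
by apply: contraTneq ej => ->; rewrite inordK // ltnn.
Qed.

Let measurable_next_stopped j : (j < p.+1)%N ->
  measurable_fun setT (fun z : coord_sigma (re_im g) (past j) * coord_sigma (re_im g) (present j) =>
    next_stopped j z.1 z.2).
Proof.
move=> jp; pose Omega := (coord_sigma (re_im g) (past j) * coord_sigma (re_im g) (present j))%type.
have mpast (r : 'I_n) k : (k < j)%N -> Cmeasurable (fun z : Omega => g (r, inord k) z.1).
  move=> kj; have past_k : (r, inord k) \in past j by rewrite inE /= inordK // (ltn_trans kj).
  exact: (Cmeasurable_comp (@measurable_fst _ _ _ _) (coord_Cmeasurable_entry g past_k)).
have mpresent (r : 'I_n) : Cmeasurable (fun z : Omega => g (r, inord j) z.2).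
  have present_j : (r, inord j) \in present j by rewrite inE.
  exact: (Cmeasurable_comp (@measurable_snd _ _ _ _) (coord_Cmeasurable_entry g present_j)).
apply: measurable_fun_ifT => //; first exact: (@measurable_good _ Omega fst j mpast j (leqnn j)).
apply: measurable_fun_ifT => //; first exact: (@measurable_column_net _ Omega snd j mpresent).
apply: measurable_lyapunov; apply: mx_measurable_resolvent; apply: mx_measurableD.
  exact: (@mx_measurable_partial_sum _ Omega fst j mpast j (leqnn j)).
exact: (@mx_measurable_column_step _ Omega snd j mpresent).
Qed.

Let measurable_next_stopped_diag j : measurable_fun setT (fun w => next_stopped j w w).
Proof.
apply: measurable_fun_ifT => //; first exact: measurable_goodT.
apply: measurable_fun_ifT => //; first exact: (@measurable_column_net _ _ id j).
apply: measurable_lyapunov; apply: mx_measurable_resolvent; apply: mx_measurableD.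
  exact: (@mx_measurable_partial_sum _ _ id j).
exact: (@mx_measurable_column_step _ _ id j).
Qed.

Lemma stopped_potential_step j : (j < p.+1)%N ->
  \int[P]_w stopped_potential j.+1 w <= (\int[P]_w stopped_potential j w) * (1 + rate / pR) + err.
Proof.
move=> jp; pose G w := (1 + rate / pR) * stopped_potential j w + err.
have Iscaled : Rintegrable P (fun w => (1 + rate / pR) * stopped_potential j w).
  exact: RintegrableZ.
have IG : Rintegrable P G by apply: RintegrableD => //; exact: Rintegrable_cst.
have -> : (\int[P]_w stopped_potential j w) * (1 + rate / pR) + err = \int[P]_w G w.
  rewrite RintegralD //; last exact: Rintegrable_cst.
  by rewrite Rintegral_cstT RintegralZl 1?mulrC //; exact: Rintegrable_stopped.
rewrite -lee_fin -!EFin_Rintegral //.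
apply: (@le_trans _ _ (\int[P]_w (next_stopped j w w)%:E)%E).
  apply: ge0_le_integral => //.
  - by move=> w _; rewrite lee_fin; case/andP: (stopped_potential_itv j.+1 w).
  - exact/measurable_EFinP/measurable_stopped_potential.
  - exact/measurable_EFinP.
  - by move=> w _; rewrite lee_fin.
apply: (le_integral_independent_coords (measurable_re_im entries) indep (past_present_disjoint jp)
  (F := fun z => (next_stopped j z.1 z.2)%:E)) => //.
- by apply/measurable_EFinP; exact: measurable_next_stopped.
- by move=> z; rewrite lee_fin.
- by apply/measurable_EFinP; exact: Rintegrable_measurable IG.
- by move=> w; rewrite /G mulrC; exact: next_stopped_mean_le.
Qed.

Lemma failure_probability_le :
  \int[P]_w (~~ good p.+1 w)%:R <= expR rate * (n%:R^-1 + pR * err).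
Proof.
have rho_ge0 : 0 <= rate / pR by rewrite divr_ge0.
have start_ge0 : 0 <= \int[P]_w stopped_potential 0 w.
  by apply: Rintegral_ge0 => w _; case/andP: (stopped_potential_itv 0 w).
have start_le : \int[P]_w stopped_potential 0 w <= n%:R^-1.
  rewrite -[leRHS](Rintegral_cstT P); apply: ler_Rintegral => [||w];
    first exact: Rintegrable_stopped.
    exact: Rintegrable_cst.
  exact: potential0_le.
have fail_le : \int[P]_w (~~ good p.+1 w)%:R <= \int[P]_w stopped_potential p.+1 w.
  apply: ler_Rintegral => // [|w].
    by apply: Rintegrable_bool; apply: measurable_neg; exact: measurable_goodT.
  have /andP[] := stopped_potential_itv p.+1 w; rewrite /stopped_potential.
  by case: good.
apply: le_trans fail_le _.
apply: le_trans (gronwall (e := fun j => \int[P]_w stopped_potential j w) rho_ge0 err_ge0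
  stopped_potential_step start_ge0) _.
apply: ler_pM; rewrite ?exprn_ge0 ?addr_ge0 ?mulr_ge0 ?lerD2r //.
apply: (@le_trans _ _ (expR (rate / pR) ^+ p.+1)).
  by rewrite lerXn2r ?nnegrE ?expR_ge0 ?addr_ge0 //; exact: expR_ge1Dx.
by rewrite -expRM_natl mulrC divfK // gt_eqF.
Qed.

Lemma good_final w : good p.+1 w -> above_spectrum (u0 + u0^-1) (partial_sum p.+1 w) /\
  sD * `|trace_moment (resolvent (u0 + u0^-1) (partial_sum p.+1 w)) 1 - u0^-1| <= 1.
Proof.
move=> /good_invariant[above pot1].
have barrierE : barrier p.+1 = u0 + u0^-1 by rewrite /barrier /shift mulrC divfK // gt_eqF.
rewrite -barrierE; split=> //.
have [Q [r [decA r_ge0]]] := above_spectrum_resolvent above.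
by apply: (lyapunov_first_le (s := s) decA r_ge0 pot1); rewrite ltW // dev_weight_gt0.
Qed.

End Steps.
End Process.

(** * The scaling regime *)

Section Growth.
Context {R : realType} (t : nat -> R).
Hypothesis t_cvgy : t @ \oo --> +oo.
Implicit Types (f g : nat -> R) (m k : int).

Definition growth_le f m :=
  exists2 c : R, 0 <= c & \forall d \near \oo, 0 <= f d <= c * t d ^ m.

Lemma near_scale_ge (M : R) : \forall d \near \oo, M <= t d.
Proof. by move/cvgryPge: t_cvgy. Qed.

Lemma near_scale_gt0 : \forall d \near \oo, 0 < t d.
Proof. by near=> d; apply: (lt_le_trans ltr01); near: d; exact: near_scale_ge.
Unshelve. all: by end_near. Qed.

Lemma growth_le_dominated f g m :
  (\forall d \near \oo, 0 <= f d <= g d) -> growth_le g m -> growth_le f m.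
Proof.
move=> f_le [c c_ge0 g_le]; exists c => //; near=> d.
have /andP[f_ge0 fg] : 0 <= f d <= g d by near: d.
have /andP[_ gc] : 0 <= g d <= c * t d ^ m by near: d.
by rewrite f_ge0 (le_trans fg).
Unshelve. all: by end_near. Qed.

Lemma growth_le_trans f m k : growth_le f m -> m <= k -> growth_le f k.
Proof.
move=> [c c_ge0 f_le] mk; exists c => //; near=> d.
have /andP[f_ge0 fc] : 0 <= f d <= c * t d ^ m by near: d.
rewrite f_ge0 (le_trans fc) // ler_wpM2l // ler_weXz2l //.
by near: d; exact: near_scale_ge.
Unshelve. all: by end_near. Qed.

Lemma growth_le_cst (c : R) : 0 <= c -> growth_le (fun=> c) 0.
Proof. by move=> c_ge0; exists c => //; near=> d; rewrite c_ge0 expr0z mulr1 /=.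
Unshelve. all: by end_near. Qed.

Lemma growth_leD f g m k :
  growth_le f m -> growth_le g k -> growth_le (fun d => f d + g d) (Num.max m k).
Proof.
move=> /(@growth_le_trans _ _ (Num.max m k)); rewrite le_max lexx => /(_ isT)[a a_ge0 f_le].
move=> /(@growth_le_trans _ _ (Num.max m k)); rewrite le_max lexx orbT => /(_ isT)[b b_ge0 g_le].
exists (a + b); first exact: addr_ge0.
near=> d; have /andP[f_ge0 fa] : 0 <= f d <= a * t d ^ Num.max m k by near: d.
have /andP[g_ge0 gb] : 0 <= g d <= b * t d ^ Num.max m k by near: d.
by rewrite addr_ge0 // mulrDl lerD.
Unshelve. all: by end_near. Qed.

Lemma growth_leM f g m k :
  growth_le f m -> growth_le g k -> growth_le (fun d => f d * g d) (m + k).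
Proof.
move=> [a a_ge0 f_le] [b b_ge0 g_le]; exists (a * b); first exact: mulr_ge0.
near=> d; have /andP[f_ge0 fa] : 0 <= f d <= a * t d ^ m by near: d.
have /andP[g_ge0 gb] : 0 <= g d <= b * t d ^ k by near: d.
have t_ge1 : 1 <= t d by near: d; exact: near_scale_ge.
by rewrite mulr_ge0 //= expfzDr ?gt_eqF ?(lt_le_trans ltr01) // mulrACA ler_pM.
Unshelve. all: by end_near. Qed.

Lemma growth_leX f m (k : nat) : growth_le f m -> growth_le (fun d => f d ^+ k) (m * k%:Z).
Proof.
move=> [c c_ge0 f_le]; exists (c ^+ k); first exact: exprn_ge0.
near=> d; have /andP[f_ge0 fc] : 0 <= f d <= c * t d ^ m by near: d.
by rewrite exprn_ge0 //= -exprz_exp -exprnP -exprMn lerXn2r // ?nnegrE (le_trans f_ge0).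
Unshelve. all: by end_near. Qed.

Lemma growth_le_scale : growth_le t 1.
Proof.
exists 1 => //; near=> d; rewrite mul1r expr1z lexx andbT.
by near: d; exact: near_scale_ge.
Unshelve. all: by end_near. Qed.

Lemma growth_leV f (k : nat) (c : R) : 0 < c -> (\forall d \near \oo, c * t d ^+ k <= f d) ->
  growth_le (fun d => (f d)^-1) (- k%:Z).
Proof.
move=> c_gt0 f_ge; exists c^-1; first by rewrite invr_ge0 ltW.
near=> d; have fc : c * t d ^+ k <= f d by near: d.
have t_gt0 : 0 < t d by near: d; exact: near_scale_gt0.
have tk_gt0 : 0 < c * t d ^+ k by rewrite mulr_gt0 // exprn_gt0.
have f_gt0 : 0 < f d by exact: lt_le_trans fc.
by rewrite invr_ge0 ltW //= -exprnN -invfM lef_pV2.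
Unshelve. all: by end_near. Qed.

Lemma growth_leVM f g m k : growth_le (fun d => (f d)^-1) m -> growth_le (fun d => (g d)^-1) k ->
  growth_le (fun d => (f d * g d)^-1) (m + k).
Proof.
move=> f_m /(growth_leM f_m); congr (growth_le _ _).
by apply/funext => d; rewrite invfM.
Qed.

Lemma growth_leVX f m (k : nat) : growth_le (fun d => (f d)^-1) m ->
  growth_le (fun d => (f d ^+ k)^-1) (m * k%:Z).
Proof.
move=> /(growth_leX k); congr (growth_le _ _).
by apply/funext => d; rewrite exprVn.
Qed.

Lemma growth_le_near f m (eps : R) : growth_le f m -> m <= -1 -> 0 < eps ->
  \forall d \near \oo, f d <= eps.
Proof.
move=> f_m m_lt0 eps_gt0; have [c c_ge0 f_le] := growth_le_trans f_m m_lt0; near=> d.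
have /andP[_ fc] : 0 <= f d <= c * t d ^ -1 by near: d.
have t_gt0 : 0 < t d by near: d; exact: near_scale_gt0.
apply: le_trans fc _; rewrite exprN1 ler_pdivrMr // mulrC -ler_pdivrMr //.
by near: d; exact: near_scale_ge.
Unshelve. all: by end_near. Qed.

Lemma growth_le_near_ge0 f m : growth_le f m -> \forall d \near \oo, 0 <= f d.
Proof. by move=> [c _]; apply: filterS => d /andP[]. Qed.

End Growth.

Ltac growth_bound :=
  match goal with
  | |- cvg_to _ _ => eassumption
  | bound : growth_le _ ?f _ |- growth_le _ ?f _ => exact: bound
  | |- growth_le _ (fun _ => ?c) _ => by apply: growth_le_cst
  | |- growth_le _ (fun d => @?f d + @?g d) _ => apply: (growth_leD _ (f := f) (g := g));
    growth_bound
  | |- growth_le _ (fun d => @?f d * @?g d) _ => apply: (growth_leM _ (f := f) (g := g));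
    growth_bound
  | |- growth_le _ (fun d => @?f d ^+ ?k) _ => apply: (growth_leX k (f := f)); growth_bound
  | |- growth_le _ (fun d => (@?f d * @?g d)^-1) _ =>
    apply: (growth_leVM _ (f := f) (g := g)); growth_bound
  | |- growth_le _ (fun d => (@?f d ^+ ?k)^-1) _ => apply: (growth_leVX k (f := f)); growth_bound
  end.

Ltac growth_bound_le := apply: growth_le_trans; [eassumption | growth_bound | by []].

Section ErrorGrowth.
Context {R : realType} (t : nat -> R) (s : nat -> step_params R).
Hypothesis t_cvgy : t @ \oo --> +oo.
Hypothesis growth_dimV : growth_le t (fun d => (dim (s d))%:R^-1) (- 128%:Z).
Hypothesis growth_steps : growth_le t (fun d => steps (s d)) 128.
Hypothesis growth_stepsV : growth_le t (fun d => (steps (s d))^-1) (- 128%:Z).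
Hypothesis growth_barrier_move : growth_le t (fun d => barrier_move (s d)) 0.
Hypothesis growth_res_bound : growth_le t (fun d => res_bound (s d)) 4.
Hypothesis growth_inc_bound : growth_le t (fun d => inc_bound (s d)) (- 62%:Z).
Hypothesis growth_fail_bound : growth_le t (fun d => fail_bound (s d)) (- 180%:Z).
Hypothesis growth_dev_weight : growth_le t (fun d => dev_weight (s d)) 32.
Hypothesis growth_dev_weightV : growth_le t (fun d => (dev_weight (s d))^-1) (- 32%:Z).
Hypothesis growth_slope_cap : growth_le t (fun d => slope_cap (s d)) 0.

Let growth_shift : growth_le t (fun d => shift (s d)) (- 128%:Z).
Proof. by rewrite /shift; growth_bound_le. Qed.

Let growth_pert_bound : growth_le t (fun d => pert_bound (s d)) (- 62%:Z).
Proof. by rewrite /pert_bound; growth_bound_le. Qed.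

Let growth_step_size : growth_le t (fun d => step_size (s d)) (- 58%:Z).
Proof. by rewrite /step_size; growth_bound_le. Qed.

Let growth_moment_error : growth_le t (fun d => moment_error (s d)) (- 256%:Z).
Proof. by rewrite /moment_error /variance_error; growth_bound_le. Qed.

Let growth_square_error (q : nat) f : (q <= 2)%N -> growth_le t f (- 168%:Z) ->
  growth_le t (fun d => square_error (s d) q (f d)) (- 216%:Z).
Proof.
by move: q => [|[|[|//]]] _ growth_f; rewrite /square_error; growth_bound_le.
Qed.

Let growth_first_remainder : growth_le t (fun d => first_remainder (s d)) (- 170%:Z).
Proof. by rewrite /first_remainder; growth_bound_le. Qed.

Let growth_second_remainder : growth_le t (fun d => second_remainder (s d)) (- 174%:Z).
Proof.
have const_ge0 := expansion_const_ge0 R 2.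
by rewrite /second_remainder; growth_bound_le.
Qed.

Lemma growth_lyapunov_error : growth_le t (fun d => lyapunov_error (s d)) (- 129%:Z).
Proof.
have sq1 : growth_le t (fun d => square_error (s d) 1 (first_remainder (s d))) (- 216%:Z).
  by apply: growth_square_error => //; apply: growth_le_trans growth_first_remainder _.
have sq2 : growth_le t (fun d => square_error (s d) 2 (second_remainder (s d))) (- 216%:Z).
  by apply: growth_square_error => //; apply: growth_le_trans growth_second_remainder _.
by rewrite /lyapunov_error /first_drift_error /second_drift_error; growth_bound_le.
Qed.

Hypothesis near_dim_gt0 : \forall d \near \oo, (0 < dim (s d))%N.
Hypothesis near_steps_ge1 : \forall d \near \oo, 1 <= steps (s d).
Hypothesis near_barrier_move_itv : \forall d \near \oo, 0 <= barrier_move (s d) <= 1.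
Hypothesis near_res_bound_ge1 : \forall d \near \oo, 1 <= res_bound (s d).
Hypothesis near_res_bound_le_dev_weight : \forall d \near \oo, res_bound (s d) <= dev_weight (s d).

Lemma near_step_regime : \forall d \near \oo, step_regime (s d).
Proof.
have near_leV f m : m <= - 129%:Z -> growth_le t f m ->
    \forall d \near \oo, f d <= (steps (s d))^-1.
  move=> m_le /growth_le_trans-/(_ t_cvgy _ m_le) growth_f.
  have /growth_le_near-/(_ t_cvgy _ isT ltr01) := growth_leM t_cvgy growth_steps growth_f.
  move=> near_le1; near=> d; rewrite -[leRHS]mulr1 ler_pdivlMl.
    by near: d.
  by apply: (lt_le_trans ltr01); near: d.
near=> d; split; near: d => //.
- exact: growth_le_near_ge0 growth_inc_bound.
- exact: growth_le_near_ge0 growth_slope_cap.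
- exact: (growth_le_near t_cvgy growth_step_size).
- by apply: (near_leV _ (- 174%:Z)) => //; growth_bound_le.
- by apply: (near_leV _ (- 248%:Z)) => //; growth_bound_le.
- by apply: (near_leV _ (- 176%:Z)) => //; growth_bound_le.
Unshelve. all: by end_near. Qed.

End ErrorGrowth.

Section ScalingRegime.
Context {R : realType}.
Implicit Types d : nat.

Definition root64 d : R := d%:R `^ 64%:R^-1.

Lemma root64_exp d : root64 d ^+ 64 = d%:R.
Proof. by rewrite -powR_mulrn ?powR_ge0 // -powRrM mulVf ?powRr1 // pnatr_eq0. Qed.

Lemma root64_ge0 d : 0 <= root64 d. Proof. exact: powR_ge0. Qed.

Lemma root64_cvgy : root64 @ \oo --> +oo.
Proof.
apply/cvgryPge => A; near=> d.
apply: (@le_trans _ _ (Num.max A 0)); first by rewrite le_max lexx.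
rewrite -(@ler_pXn2r _ 64) ?nnegrE ?root64_ge0 ?le_max ?lexx ?orbT // root64_exp.
by near: d; exact: nbhs_infty_ger.
Unshelve. all: by end_near. Qed.

Local Notation t := root64.

Let t_cvgy := root64_cvgy.

Let near_t_ge (A : R) : \forall d \near \oo, A <= t d. Proof. exact: near_scale_ge. Qed.

Let growth_t : growth_le t t 1. Proof. exact: growth_le_scale. Qed.

Let growth_tV (k : nat) : growth_le t (fun d => (t d ^+ k)^-1) (- k%:Z).
Proof. by apply: (growth_leV t_cvgy ltr01); near=> d; rewrite mul1r.
Unshelve. all: by end_near. Qed.

Let sqr_dimE d : d%:R ^+ 2 = t d ^+ 128. Proof. by rewrite -root64_exp -exprM. Qed.

Let dimE d : (d * d)%:R = t d ^+ 128. Proof. by rewrite natrM -expr2 sqr_dimE. Qed.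

Variables alpha u0 : R.
Hypotheses (alpha_gt0 : 0 < alpha) (u0_gt1 : 1 < u0).

Let u0V_ge0 : 0 <= u0^-1. Proof. by rewrite invr_ge0 (le_trans ler01) // ltW. Qed.

Definition columns d : nat := Num.truncn (alpha * d%:R ^+ 2).

Lemma near_columns_itv :
  \forall d \near \oo, alpha / 2 * t d ^+ 128 <= (columns d)%:R <= alpha * t d ^+ 128.
Proof.
near=> d; have t_ge1 : 1 <= t d by near: d; exact: near_t_ge.
have prod_ge0 : 0 <= alpha * d%:R ^+ 2 by rewrite mulr_ge0 ?sqr_ge0 // ltW.
have := truncn_itv prod_ge0; rewrite -/(columns d) -natr1 => /andP[columns_le columns_lt].
have prod_ge2 : 2 <= alpha * d%:R ^+ 2.
  rewrite sqr_dimE mulrC -ler_pdivrMr //; apply: (@le_trans _ _ (t d)).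
    by near: d; exact: near_t_ge.
  by rewrite -[leLHS]expr1 ler_weXn2l.
rewrite sqr_dimE in columns_le columns_lt prod_ge2 *; rewrite columns_le andbT.
by move: columns_lt prod_ge2; set x := (columns d)%:R; set y := t d ^+ 128; lra.
Unshelve. all: by end_near. Qed.

Let growth_columns : growth_le t (fun d => (columns d)%:R) 128.
Proof.
apply: (growth_le_dominated (g := fun d => alpha * t d ^+ 128)).
  by apply: filterS near_columns_itv => d /andP[_ ->]; rewrite ler0n.
by have alpha_ge0 := ltW alpha_gt0; growth_bound_le.
Qed.

Let growth_columnsV : growth_le t (fun d => (columns d)%:R^-1) (- 128%:Z).
Proof.
apply: (growth_leV t_cvgy (c := alpha / 2)); first exact: divr_gt0.
by apply: filterS near_columns_itv => d /andP[].
Qed.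

Let growth_dimV : growth_le t (fun d => (d * d)%:R^-1) (- 128%:Z).
Proof. by apply: (growth_leV t_cvgy ltr01); near=> d; rewrite mul1r dimE.
Unshelve. all: by end_near. Qed.

Definition net_failure d : R := 4 * ((8 * d + 1)%:R ^+ d) ^+ 2 * expR (- (t d ^+ 33) ^+ 2 / 2).

Definition truncation_loss d : R := 2 / ((columns d)%:R * (d * d)%:R) *
  (d%:R ^+ 4 * (t d ^+ 180 * net_failure d + 24 * 2 ^+ 10 / t d ^+ 180 + net_failure d)).

(* The net has exp (O (d log d)) points and d = t ^ 64, so that the Gaussian tail at t ^ 33 wins. *)
Lemma net_exponent_le (x : R) : 1012 <= x ->
  (9 + 64 * x) * (2 * x ^+ 64) + 360 * x <= (x ^+ 33) ^+ 2 / 2.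
Proof.
move=> x_ge; have x_ge1 : 1 <= x by apply: le_trans x_ge; lra.
have -> : (x ^+ 33) ^+ 2 = x * (x * x ^+ 64) by rewrite -exprM -!exprS.
have : 1 <= x ^+ 64 by exact: exprn_ege1.
move: (x ^+ 64) => y y_ge1.
have y_le : y <= x * y by rewrite ler_peMl // (le_trans ler01).
have x_le : x <= x * y by rewrite ler_peMr // (le_trans ler01).
have := ler_wpM2r (le_trans (le_trans ler01 y_ge1) y_le) x_ge.
rewrite (_ : (9 + 64 * x) * (2 * y) = 18 * y + 128 * (x * y)); last by ring.
by move: y_le x_le; set z := x * y; set v := x * z; lra.
Qed.

Lemma le_expR_mul (k : nat) (x : R) : 0 <= x -> x ^+ k <= expR (k%:R * x).
Proof.
move=> x_ge0; rewrite expRM_natl lerXn2r ?nnegrE ?expR_ge0 //.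
by apply: le_trans (expR_ge1Dx x); rewrite lerDr.
Qed.

Lemma net_card_le d : (0 < d)%N ->
  ((8 * d + 1)%:R ^+ d) ^+ 2 <= expR ((9 + 64 * t d) * (2 * t d ^+ 64)).
Proof.
move=> d_gt0; rewrite -exprM root64_exp.
rewrite (_ : expR _ = expR (9 + 64 * t d) ^+ (d * 2)); last first.
  by rewrite -expRM_natl natrM; congr expR; ring.
rewrite lerXn2r ?nnegrE ?expR_ge0 //; apply: (@le_trans _ _ (9 * d%:R)).
  by rewrite -natrM ler_nat; lia.
rewrite expRD -(root64_exp d); apply: ler_pM; rewrite ?exprn_ge0 ?root64_ge0 //.
  by apply: le_trans (expR_ge1Dx _); lra.
exact: le_expR_mul _ (root64_ge0 d).
Qed.

Lemma near_net_failure_le : \forall d \near \oo, 0 <= net_failure d <= 4 * (t d ^+ 360)^-1.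
Proof.
near=> d; have t_ge : 1012 <= t d by near: d; exact: near_t_ge.
have t_gt0 : 0 < t d by apply: lt_le_trans t_ge; lra.
rewrite /net_failure !mulr_ge0 ?expR_ge0 ?sqr_ge0 //= -mulrA ler_pM2l //.
rewrite -[leRHS]div1r ler_pdivlMr ?exprn_gt0 //.
apply: (@le_trans _ _ (expR ((9 + 64 * t d) * (2 * t d ^+ 64)) *
    expR (- (t d ^+ 33) ^+ 2 / 2) * expR (360 * t d))).
  apply: ler_pM; rewrite ?mulr_ge0 ?expR_ge0 ?exprn_ge0 ?sqr_ge0 ?root64_ge0 //.
    by rewrite ler_pM2r ?expR_gt0 // net_card_le //; near: d; exact: nbhs_infty_gt.
  exact: le_expR_mul _ (ltW t_gt0).
rewrite -!expRD -[leRHS]expR0 ler_expR.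
by have := net_exponent_le t_ge; set x := (_ * _); set y := _ ^+ 2; lra.
Unshelve. all: by end_near. Qed.

Let growth_net_failure : growth_le t net_failure (- 360%:Z).
Proof.
apply: (growth_le_dominated near_net_failure_le).
by have growth_tV360 := growth_tV 360; growth_bound_le.
Qed.

Let growth_truncation_loss : growth_le t truncation_loss (- 180%:Z).
Proof.
have growth_dim4 : growth_le t (fun d => d%:R ^+ 4) 256.
  have -> : (fun d => d%:R ^+ 4) = (fun d => t d ^+ 256) :> (nat -> R).
    by apply/funext => d; rewrite -root64_exp -exprM.
  by growth_bound_le.
by have growth_tV180 := growth_tV 180; rewrite /truncation_loss; growth_bound_le.
Qed.

Let growth_column_scale : growth_le t (fun d => column_scale d (columns d)) (- 128%:Z).
Proof.
apply: (growth_leV t_cvgy (c := Num.sqrt (alpha / 2))); first by rewrite sqrtr_gt0 divr_gt0.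
apply: filterS near_columns_itv => d /andP[columns_ge _].
have td_ge0 : 0 <= t d ^+ 128 by rewrite exprn_ge0 ?root64_ge0.
rewrite dimE -[t d ^+ 128 as X in _ * X <= _]ger0_norm // -sqrtr_sqr -sqrtrM.
  by rewrite ler_wsqrtr // expr2 mulrA ler_wpM2r.
by rewrite divr_ge0 // ltW.
Qed.

Definition regime_params d : step_params R :=
  process_params d (columns d) u0 (t d ^+ 33) (t d ^+ 4) (net_failure d + truncation_loss d)
    (t d ^+ 32).

Lemma near_columns_gt0 : \forall d \near \oo, (0 < columns d)%N.
Proof.
near=> d; have /andP[columns_ge _] : alpha / 2 * t d ^+ 128 <= (columns d)%:R <= alpha * t d ^+ 128.
  by near: d; exact: near_columns_itv.
rewrite -(ltr0n R); apply: lt_le_trans columns_ge; rewrite mulr_gt0 ?divr_gt0 ?exprn_gt0 //.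
by near: d; exact: near_scale_gt0 t_cvgy.
Unshelve. all: by end_near. Qed.

Let slope_cap_ge0 : 0 <= ((1 + u0 ^+ 2) / 2 - 1)^-1.
Proof.
have : 1 < u0 ^+ 2 by rewrite exprn_egt1.
by rewrite invr_ge0; set x := u0 ^+ 2; lra.
Qed.

Let growth_inc_bound : growth_le t (fun d => inc_bound (regime_params d)) (- 62%:Z).
Proof. by rewrite /regime_params /=; growth_bound_le. Qed.

Let growth_fail_bound : growth_le t (fun d => fail_bound (regime_params d)) (- 180%:Z).
Proof. by rewrite /regime_params /=; growth_bound_le. Qed.

Let growth_res_bound : growth_le t (fun d => res_bound (regime_params d)) 4.
Proof. by rewrite /regime_params /=; growth_bound_le. Qed.

Let growth_dev_weight : growth_le t (fun d => dev_weight (regime_params d)) 32.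
Proof. by rewrite /regime_params /=; growth_bound_le. Qed.

Lemma growth_regime_error : growth_le t (fun d => lyapunov_error (regime_params d)) (- 129%:Z).
Proof.
exact: (growth_lyapunov_error (s := regime_params) t_cvgy growth_dimV growth_columnsV
  (growth_le_cst _ u0V_ge0) growth_res_bound growth_inc_bound growth_fail_bound growth_dev_weight
  (growth_tV 32) (growth_le_cst _ slope_cap_ge0)).
Qed.

Lemma near_regime : \forall d \near \oo, step_regime (regime_params d).
Proof.
apply: (near_step_regime (s := regime_params) t_cvgy growth_dimV growth_columns growth_columnsV
  (growth_le_cst _ u0V_ge0) growth_res_bound growth_inc_bound growth_fail_bound
  (growth_le_cst _ slope_cap_ge0)); near=> d => /=.
- by rewrite muln_gt0 andbb; near: d; exact: nbhs_infty_gt.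
- by rewrite ler1n; near: d; exact: near_columns_gt0.
- by rewrite u0V_ge0 invf_le1 ?ltW // (lt_trans ltr01).
- by rewrite exprn_ege1 //; near: d; exact: near_t_ge.
- by rewrite ler_weXn2l //; near: d; exact: near_t_ge.
Unshelve. all: by end_near. Qed.

Lemma near_failure_probability (q : nat) (eps : R) : 0 < eps -> \forall d \near \oo,
  expR (lyapunov_rate (regime_params d) q) *
    ((d * d)%:R^-1 + (columns d)%:R * lyapunov_error (regime_params d)) <= eps.
Proof.
move=> eps_gt0; have growth_err := growth_regime_error.
have growth_rate : growth_le t (fun d => expR (lyapunov_rate (regime_params d) q)) 0.
  exact: (growth_le_cst _ (expR_ge0 (lyapunov_rate (regime_params 0) q))).
by apply: (growth_le_near t_cvgy (m := -1) _ _ eps_gt0) => //; growth_bound_le.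
Qed.

Lemma near_dev_weightV (eps : R) : 0 < eps -> \forall d \near \oo, (t d ^+ 32)^-1 <= eps.
Proof. by move=> eps_gt0; apply: (growth_le_near t_cvgy (growth_tV 32)). Qed.

Lemma near_regime_losses : \forall d \near \oo,
  [/\ 0 <= net_failure d, 0 <= truncation_loss d & 0 <= lyapunov_error (regime_params d)].
Proof.
near=> d; split; near: d.
- exact: growth_le_near_ge0 growth_net_failure.
- exact: growth_le_near_ge0 growth_truncation_loss.
- exact: growth_le_near_ge0 growth_regime_error.
Unshelve. all: by end_near. Qed.

End ScalingRegime.

Section Likely.
Context {R : realType} {dT : measure_display} {T : measurableType dT} (P : probability T R).

Definition likely (eps : R) (Q : T -> Prop) :=
  exists E : T -> bool, [/\ measurable_fun setT E, \int[P]_w (~~ E w)%:R <= eps &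
    forall w, E w -> Q w].

Lemma likelyI eps1 eps2 Q1 Q2 : likely eps1 Q1 -> likely eps2 Q2 ->
  likely (eps1 + eps2) (fun w => Q1 w /\ Q2 w).
Proof.
move=> [E1 [mE1 E1_le E1Q]] [E2 [mE2 E2_le E2Q]]; exists (fun w => E1 w && E2 w).
have Ineg E : measurable_fun setT E -> Rintegrable P (fun w => (~~ E w)%:R).
  by move=> mE; apply: Rintegrable_bool; exact: measurable_neg.
have [I1 I2] := (Ineg _ mE1, Ineg _ mE2).
split=> [||w /andP[/E1Q Q1w /E2Q Q2w]] //; first exact: measurable_and.
apply: le_trans (lerD E1_le E2_le); rewrite -RintegralD //.
apply: ler_Rintegral => [||w]; [exact/Ineg/measurable_and | exact: RintegrableD |].
by case: (E1 w); case: (E2 w); rewrite /= ?addr0 ?add0r ?lexx // lerDl.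
Qed.

Lemma likelyW eps eps' Q Q' : eps <= eps' -> (forall w, Q w -> Q' w) ->
  likely eps Q -> likely eps' Q'.
Proof.
move=> eps_le QQ' [E [mE E_le EQ]]; exists E; split=> // [|w Ew]; first exact: le_trans eps_le.
exact/QQ'/EQ.
Qed.

End Likely.

Record gaussian_ensemble (R : realType) (dT : measure_display) (T : measurableType dT)
    (P : probability T R) (kap : R) (d p : nat) (g : 'I_(d * d) * 'I_p -> T -> R[i]) : Prop :=
  GaussianEnsemble {
  ensemble_entries : forall e, gaussian_entry P kap (g e);
  ensemble_indep : mutually_independent P (re_im g);
  ensemble_idem : kap * kap = kap
}.

Definition joukowski (K : fieldType) (a : K) : K := a + a^-1.

(* The semicircle law on [-2, 2] predicts the value [a^-1], for [a > 1]. *)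
Definition resolvent_trace_at (R : realType) n (a : R) (S : 'M[R[i]]_n) : R :=
  trace_moment (resolvent (joukowski a) S) 1.

Lemma near_barrier (R : realType) (alpha u0 eps : R) : 0 < alpha -> 1 < u0 -> 0 < eps ->
  \forall d \near \oo, forall (dT : measure_display) (T : measurableType dT)
    (P : probability T R) (kap : R) (p : nat) (g : 'I_(d * d) * 'I_p.+1 -> T -> R[i]) (neg : bool),
  p.+1 = columns alpha d -> gaussian_ensemble P kap g ->
  likely P eps (fun w => above_spectrum (joukowski u0) (partial_sum g neg p.+1 w) /\
    `|resolvent_trace_at u0 (partial_sum g neg p.+1 w) - u0^-1| <= eps).
Proof.
move=> alpha_gt0 u0_gt1 eps_gt0; near=> d => dT T P kap p g neg columnsE [entries indep idem].
pose t : R := root64 d; pose failure : R := net_failure d.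
pose nu := failure + truncation_loss alpha d.
pose s := process_params d p.+1 u0 (t ^+ 33) (t ^+ 4) nu (t ^+ 32).
have paramsE : regime_params alpha u0 d = s by rewrite /s columnsE.
have regime : step_regime (regime_params alpha u0 d) by near: d; exact: near_regime.
have rate_le : expR (lyapunov_rate (regime_params alpha u0 d) (2 ^ 6)) *
    ((d * d)%:R^-1 + (columns alpha d)%:R * lyapunov_error (regime_params alpha u0 d)) <= eps.
  by near: d; exact: near_failure_probability.
have dev_le : (root64 d ^+ 32)^-1 <= eps by near: d; exact: near_dev_weightV.
have [failure_ge0 loss_ge0 err_ge0] : [/\ 0 <= net_failure d :> R, 0 <= truncation_loss alpha d &
    0 <= lyapunov_error (regime_params alpha u0 d)].
  by near: d; exact: near_regime_losses.
have t_gt0 : 0 < root64 d :> R by near: d; exact: (near_scale_gt0 root64_cvgy).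
rewrite paramsE -columnsE in regime rate_le err_ge0.
have size_le : (d * d)%:R ^+ 2 <= (t ^+ 4) ^+ (2 ^ 6).
  by rewrite natrM -root64_exp -exprD -!exprM.
have /andP[kap_ge0 kap_le1] : 0 <= kap <= 1.
  have /eqP : kap * (kap - 1) = 0 by rewrite mulrBr idem mulr1 subrr.
  by rewrite mulf_eq0 subr_eq0 => /orP[] /eqP ->; rewrite lexx ler01.
have L_gt0 : 0 < t ^+ 180 by rewrite exprn_gt0.
have tau_ge0 : 0 <= t ^+ 33 by rewrite exprn_ge0 // ltW.
have failure_le : failure <= nu by rewrite lerDl.
have loss_le : truncation_loss alpha d <= nu by rewrite lerDr.
rewrite /truncation_loss -columnsE in loss_le.
exists (good g neg u0 (t ^+ 33) (t ^+ 4) nu (t ^+ 32) (2 ^ 6) p.+1); split.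
- exact: measurable_goodT.
- apply: le_trans rate_le.
  exact: (failure_probability_le neg entries indep idem kap_ge0 kap_le1 regime u0_gt1 tau_ge0
    size_le (erefl _) L_gt0 (lexx _) failure_le loss_le err_ge0).
move=> w /(good_final entries indep idem regime u0_gt1 tau_ge0 size_le (erefl _) L_gt0 (lexx _)
  failure_le loss_le)[above dev]; split=> //.
by apply: le_trans dev_le; rewrite -[leRHS]mulr1 ler_pdivlMl // exprn_gt0.
Unshelve. all: by end_near. Qed.

(** * The edge of the spectrum *)

Lemma joukowskiB (K : fieldType) (a b : K) : a != 0 -> b != 0 ->
  joukowski b - joukowski a = (b - a) * (a * b - 1) / (a * b).
Proof. by move=> a_neq0 b_neq0; rewrite /joukowski; field; rewrite a_neq0 b_neq0. Qed.

Lemma joukowski_le (R : realFieldType) (a b : R) : 1 <= a -> a <= b -> joukowski a <= joukowski b.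
Proof.
move=> a_ge1 ab; have b_ge1 := le_trans a_ge1 ab.
have [a_gt0 b_gt0] : 0 < a /\ 0 < b by split; exact: lt_le_trans ltr01 _.
rewrite -subr_ge0 joukowskiB ?gt_eqF //; apply: divr_ge0; last by rewrite mulr_ge0 // ltW.
by rewrite mulr_ge0 ?subr_ge0 // mulr_ege1.
Qed.

Lemma mean_invB_le (R : realFieldType) (n : nat) (l : 'I_n -> R) (u v del : R) : (0 < n)%N ->
  0 < del -> u <= v -> (forall i, del <= u - l i) ->
  (\sum_i (u - l i)^-1) / n%:R - (\sum_i (v - l i)^-1) / n%:R <= (v - u) / del ^+ 2.
Proof.
move=> n_gt0 del_gt0 uv ul; rewrite -mulrBl -sumrB ler_pdivrMr ?ltr0n //.
apply: (@le_trans _ _ (\sum_(i < n) (v - u) / del ^+ 2)); last first.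
  by rewrite sumr_const card_ord -[leLHS]mulr_natr.
apply: ler_sum => i _; have vl : del <= v - l i by rewrite (le_trans (ul i)) // lerD2r.
have [ul_gt0 vl_gt0] : 0 < u - l i /\ 0 < v - l i.
  by split; [exact: lt_le_trans (ul i) | exact: lt_le_trans vl].
have -> : (u - l i)^-1 - (v - l i)^-1 = (v - u) / ((u - l i) * (v - l i)).
  by field; rewrite !gt_eqF.
apply: ler_wpM2l; first by rewrite subr_ge0.
by rewrite lef_pV2 ?posrE ?mulr_gt0 ?exprn_gt0 // expr2 ler_pM // ltW.
Qed.

Lemma resolvent_trace_atE (R : realType) n (a : R) (S P : 'M[R[i]]_n) l :
  real_spectral_dec S P l -> (forall i, 0 < joukowski a - l i) ->
  resolvent_trace_at a S = (\sum_i (joukowski a - l i)^-1) / n%:R.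
Proof.
move=> decS above; have [_ decA] := real_spectral_dec_resolvent decS above.
rewrite /resolvent_trace_at /trace_moment (real_spectral_dec_mxtrace_exprn decA) /=.
by congr (_ / _); apply: eq_bigr => i _; rewrite expr1.
Qed.

(* Were the spectrum below [2 - del], the resolvent trace could not fall between the two barriers
   as fast as the square-root singularity of the semicircle law at 2 makes it. *)
Lemma spectrum_reaches_edge (R : realType) n (S P : 'M[R[i]]_n) l (del h : R) : (0 < n)%N ->
  real_spectral_dec S P l -> (forall i, 0 < joukowski (1 + h) - l i) ->
  0 < del -> 0 < h <= 1 -> 3 * h + 2 * h ^+ 2 <= del ^+ 2 / 2 ->
  `|resolvent_trace_at (1 + h) S - (1 + h)^-1| <= h / 25 ->
  `|resolvent_trace_at (1 + 2 * h) S - (1 + 2 * h)^-1| <= h / 25 ->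
  exists i, 2 - del < l i.
Proof.
move=> n_gt0 decS above del_gt0 /andP[h_gt0 h_le1] h_small; set a := 1 + h; set b := 1 + 2 * h.
have [a_ge1 ab] : 1 <= a /\ a <= b by rewrite /a /b; lra.
have [a_gt0 b_gt0] : 0 < a /\ 0 < b by rewrite /a /b; lra.
have prod_gt0 : 0 < a * b by rewrite mulr_gt0.
have hE : b - a = h by rewrite /a /b; ring.
have prodE : a * b - 1 = 3 * h + 2 * h ^+ 2 by rewrite /a /b; ring.
have jou_le := joukowski_le a_ge1 ab.
have above_b i : 0 < joukowski b - l i by rewrite (lt_le_trans (above i)) // lerD2r.
rewrite (resolvent_trace_atE decS above) (resolvent_trace_atE decS above_b).
move=> /ler_normlP[trace_a _] /ler_normlP[_ trace_b]; apply: contrapT => below.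
have jou_ge2 : 2 <= joukowski a.
  have -> : 2 = joukowski 1 :> R by rewrite /joukowski invr1.
  exact: joukowski_le.
have below_edge i : del <= joukowski a - l i.
  rewrite lerBrDr -lerBrDl leNgt; apply/negP => reach; apply: below; exists i.
  by apply: le_lt_trans reach; rewrite lerD2r.
have := mean_invB_le n_gt0 del_gt0 jou_le below_edge.
rewrite joukowskiB ?gt_eqF // prodE hE => gap.
have gap_le : h * (3 * h + 2 * h ^+ 2) / (a * b) / del ^+ 2 <= h / (a * b) / 2.
  rewrite ler_pdivrMr ?exprn_gt0 // mulrAC [leRHS](_ : _ = h / (a * b) * (del ^+ 2 / 2));
    last by ring.
  by rewrite ler_wpM2l // divr_ge0 // ltW.
have h_div6 : h / 6 <= h / (a * b).
  apply: ler_wpM2l; first exact: ltW.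
  rewrite lef_pV2 ?posrE // -[a * b](subrK 1) prodE.
  have : h ^+ 2 <= 1 by rewrite exprn_ile1 // ltW.
  by set y := h ^+ 2; lra.
have invB : a^-1 - b^-1 = h / (a * b) by rewrite -hE; field; rewrite !gt_eqF.
move: gap gap_le h_div6 invB trace_a trace_b; set z := h / (a * b); set y := _ / del ^+ 2.
set x := _ / n%:R; set x' := _ / n%:R; set av := a^-1; set bv := b^-1.
by lra.
Qed.

Definition edge_within (R : realType) n (del : R) (S : 'M[R[i]]_n) :=
  exists P l, [/\ real_spectral_dec S P l, forall i, l i < 2 + del & exists i, 2 - del < l i].

Lemma edge_within_barriers (R : realType) n (S : 'M[R[i]]_n) (del h : R) : (0 < n)%N ->
  0 < del -> 0 < h <= 1 -> h <= del -> 3 * h + 2 * h ^+ 2 <= del ^+ 2 / 2 ->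
  above_spectrum (joukowski (1 + h)) S ->
  `|resolvent_trace_at (1 + h) S - (1 + h)^-1| <= h / 25 ->
  `|resolvent_trace_at (1 + 2 * h) S - (1 + 2 * h)^-1| <= h / 25 -> edge_within del S.
Proof.
move=> n_gt0 del_gt0 h_itv h_le h_small [P [l [decS above]]] trace_a trace_b; exists P, l.
split=> // [i|]; last first.
  exact: (spectrum_reaches_edge n_gt0 decS above del_gt0 h_itv h_small trace_a trace_b).
have /andP[h_gt0 _] := h_itv.
have : (1 + h)^-1 <= 1 by rewrite invf_le1; lra.
by have := above i; rewrite /joukowski; set x := _^-1; lra.
Qed.

Lemma near_edge (R : realType) (alpha del eps : R) : 0 < alpha -> 0 < del -> 0 < eps ->
  \forall d \near \oo, forall (dT : measure_display) (T : measurableType dT)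
    (P : probability T R) (kap : R) (p : nat) (g : 'I_(d * d) * 'I_p.+1 -> T -> R[i]) (neg : bool),
  p.+1 = columns alpha d -> gaussian_ensemble P kap g ->
  likely P eps (fun w => edge_within del (partial_sum g neg p.+1 w)).
Proof.
move=> alpha_gt0 del_gt0 eps_gt0; pose h : R := Num.min (Num.min 1 (del ^+ 2 / 10)) del.
have h_gt0 : 0 < h by rewrite !lt_min ltr01 del_gt0 divr_gt0 // exprn_gt0.
have [h_le1 h_le_sqr h_le_del] : [/\ h <= 1, h <= del ^+ 2 / 10 & h <= del].
  by rewrite !ge_min !lexx !orbT.
have h_small : 3 * h + 2 * h ^+ 2 <= del ^+ 2 / 2.
  have : h ^+ 2 <= h by rewrite expr2 ler_piMl // ltW.
  by move: h_le_sqr; set x := h ^+ 2; set y := del ^+ 2; lra.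
pose e := Num.min (eps / 2) (h / 25).
have e_gt0 : 0 < e by rewrite lt_min !divr_gt0.
have [e_le_eps e_le_h] : e <= eps / 2 /\ e <= h / 25 by rewrite !ge_min !lexx orbT.
have a_gt1 : 1 < 1 + h by rewrite ltrDl.
have b_gt1 : 1 < 1 + 2 * h by rewrite ltrDl mulr_gt0.
have n_near : \forall d \near \oo, (0 < d)%N by exact: nbhs_infty_gt.
apply: filterS3 n_near (near_barrier alpha_gt0 a_gt1 e_gt0) (near_barrier alpha_gt0 b_gt1 e_gt0).
move=> d d_gt0 near_a near_b dT T P kap p g neg columnsE ensemble.
apply: likelyW (likelyI (near_a _ _ _ _ _ _ neg columnsE ensemble)
  (near_b _ _ _ _ _ _ neg columnsE ensemble)) => [|w [[above trace_a] [_ trace_b]]].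
  by move: e_le_eps; lra.
apply: (edge_within_barriers _ del_gt0 _ h_le_del h_small above (le_trans trace_a e_le_h)
  (le_trans trace_b e_le_h)); first by rewrite muln_gt0 d_gt0.
by rewrite h_gt0.
Qed.

Section PositivePowerSums.
Context {R : realType} (n : nat).
Implicit Types l : 'I_n -> R.

Lemma sum_exprn_lt1 (x : 'I_n -> R) : (forall i, `|x i| < 1) -> exists m, \sum_i x i ^+ m < 1.
Proof.
move=> x_lt1; have [m _ /(_ m (leqnn m)) small] :
    \forall m \near \oo, forall i, x i ^+ m < n.+1%:R^-1.
  by apply: filter_forall => i; apply: (cvgr_lt _ (cvg_expr (x_lt1 i))); rewrite invr_gt0.
exists m; apply: (@le_lt_trans _ _ (\sum_(i < n) n.+1%:R^-1)); first by apply: ler_sum => i _;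
  exact: ltW.
by rewrite sumr_const card_ord -[ltLHS]mulr_natl ltr_pdivrMr // mul1r ltr_nat.
Qed.

(* The right-hand side is a countable union of conditions on traces of powers. *)
Lemma all_gt0_power_sums l : (forall i, 0 < l i) <->
  exists u m : nat, \sum_i (u.+1%:R - l i) ^+ (2 * m) < u.+1%:R ^+ (2 * m).
Proof.
split=> [l_gt0|[u [m sum_lt]] i]; last first.
  have u_gt0 : 0 < u.+1%:R :> R by rewrite ltr0n.
  rewrite ltNge; apply/negP => li_le0; move: sum_lt; apply/negP; rewrite -leNgt.
  apply: (@le_trans _ _ ((u.+1%:R - l i) ^+ (2 * m))).
    by rewrite lerXn2r ?nnegrE ?(ltW u_gt0) //; lra.
  by rewrite (bigD1 i) //= lerDl sumr_ge0 // => k _; rewrite exprM exprn_ge0 // sqr_ge0.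
pose u := Num.truncn (\sum_i l i); have u_gt0 : 0 < u.+1%:R :> R by rewrite ltr0n.
have l_lt i : l i < u.+1%:R.
  apply: le_lt_trans (truncnS_gt _); rewrite (bigD1 i) //= lerDl sumr_ge0 // => k _.
  exact: ltW.
have ratio_lt1 i : `|(1 - l i / u.+1%:R) ^+ 2| < 1.
  have : 0 < l i / u.+1%:R < 1 by rewrite divr_gt0 // ltr_pdivrMr // mul1r l_lt.
  set r := _ / _ => /andP[r_gt0 r_lt1].
  by rewrite normrX ger0_norm ?exprn_ilt1 // ?subr_ge0; lra.
have [m sum_lt1] := sum_exprn_lt1 ratio_lt1; exists u, m.
have powE i : (u.+1%:R - l i) ^+ (2 * m) = u.+1%:R ^+ (2 * m) * ((1 - l i / u.+1%:R) ^+ 2) ^+ m.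
  by rewrite -exprM -exprMn; congr (_ ^+ _); field; rewrite gt_eqF.
under eq_bigr do rewrite powE.
by rewrite -mulr_sumr -[ltRHS]mulr1 ltr_pM2l // exprn_gt0.
Qed.

End PositivePowerSums.

Section LambdaMaxMeasurable.
Context {R : realType} {d : measure_display} {T : measurableType d} (n : nat).
Local Notation C := R[i].

Lemma hermsymmxP (S : 'M[C]_n) : S \is hermsymmx <-> S^t* = S.
Proof.
split=> [/is_hermitianmxP|hermS]; first by rewrite expr0 scale1r => <-.
by apply/is_hermitianmxP; rewrite expr0 scale1r.
Qed.

Lemma lambda_max_lt_traces (S : 'M[C]_n) (x : R) : (0 < n)%N -> S \is hermsymmx ->
  lambda_max S < x <-> exists u m : nat,
    complex.Re (\tr ((u.+1%:R%:C%:M - (x%:C%:M - S)) ^+ (2 * m))) < u.+1%:R ^+ (2 * m).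
Proof.
move=> n_gt0 hermS; have [max_eig max_ge] := lambda_maxP n_gt0 hermS.
have [P [l decS]] := hermitian_real_spectral_dec ((hermsymmxP S).1 hermS).
have traceE (u : R) m :
    complex.Re (\tr ((u%:C%:M - (x%:C%:M - S)) ^+ m)) = \sum_i (u - (x - l i)) ^+ m.
  have decB := real_spectral_dec_shift (real_spectral_dec_shift decS x) u.
  by rewrite (real_spectral_dec_mxtrace_exprn decB).
have below : lambda_max S < x <-> forall i, 0 < x - l i.
  split=> [max_lt i|l_lt].
    rewrite subr_gt0; apply: le_lt_trans max_lt; apply: max_ge.
    exact: real_spectral_dec_eigenvalue decS i.
  have [i /complexI ->] := real_spectral_dec_eigenvalueP decS max_eig.
  by rewrite -subr_gt0.
split=> [/below/all_gt0_power_sums[u [m sum_lt]]|[u [m]]]; first by exists u, m; rewrite traceE.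
by rewrite traceE => sum_lt; apply/below/all_gt0_power_sums; exists u, m.
Qed.

Lemma measurable_lambda_max (A : T -> 'M[C]_n) : (0 < n)%N -> mx_measurable A ->
  (forall w, A w \is hermsymmx) -> measurable_fun setT (fun w => lambda_max (A w)).
Proof.
move=> n_gt0 mA hermA; apply: (measurability _ (RGenInftyO.measurableE R)) => _ [_ [x ->] <-].
pose trace_lt u m w := complex.Re (\tr ((u.+1%:R%:C%:M - (x%:C%:M - A w)) ^+ (2 * m))) <
  u.+1%:R ^+ (2 * m).
have -> : setT `&` (fun w => lambda_max (A w)) @^-1` `]-oo, x[ =
    \bigcup_u \bigcup_m [set w | trace_lt u m w].
  rewrite setTI; apply/seteqP; split=> w /=; rewrite in_itv /=.
    move=> /(lambda_max_lt_traces x n_gt0 (hermA w))[u [m tr_lt]].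
    by exists u => //; exists m.
  by move=> [u _ [m _ tr_lt]]; apply/(lambda_max_lt_traces x n_gt0 (hermA w)); exists u, m.
apply: bigcup_measurable => u _; apply: bigcup_measurable => m _.
rewrite -[X in measurable X]setTI; apply: measurable_fun_ltr => //.
apply: (Cmeasurable_mxtrace _).1; apply: mx_measurableX; apply: mx_measurableB.
  exact: mx_measurable_cst.
by apply: mx_measurableB => //; exact: mx_measurable_cst.
Qed.

End LambdaMaxMeasurable.

Section AffineSpectrum.
Context {R : realType} (n : nat).
Local Notation C := R[i].
Implicit Type Y : 'M[C]_n.

Lemma eigenvalue_affine Y (k x : C) : k != 0 ->
  eigenvalue (k *: (Y - 1%:M)) (k * (x - 1)) = eigenvalue Y x.
Proof.
move=> k_neq0; apply/eigenvalueP/eigenvalueP => -[v vE v_neq0]; exists v => //.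
  move: vE; rewrite -scalemxAr -scalerA mulmxBr mulmx1 => /(scalerI k_neq0).
  by rewrite scalerBl scale1r => /addIr.
by rewrite -scalemxAr -scalerA mulmxBr mulmx1 vE scalerBl scale1r.
Qed.

Hypothesis n_gt0 : (0 < n)%N.

Lemma lambda_max_eq Y x : Y \is hermsymmx -> eigenvalue Y x%:C ->
  (forall y : R, eigenvalue Y y%:C -> y <= x) -> lambda_max Y = x.
Proof.
move=> hermY eig_x ub_x; have [max_eig max_ge] := lambda_maxP n_gt0 hermY.
apply/eqP; rewrite eq_le; apply/andP; split.
  exact: (ub_x _ max_eig).
exact: (max_ge _ eig_x).
Qed.

Variables (Y : 'M[C]_n) (k : R).
Hypothesis hermY : Y \is hermsymmx.

Lemma hermitian_affine : k%:C *: (Y - 1%:M) \is hermsymmx.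
Proof.
apply/hermsymmxP; rewrite linearZ map_mxZ /= trmxC_sub trmxC1 ((hermsymmxP Y).1 hermY).
by congr (_ *: _); exact: conjc_real.
Qed.

Let eigenvalue_affine_real (x : R) : k != 0 ->
  eigenvalue (k%:C *: (Y - 1%:M)) (k * (x - 1))%:C = eigenvalue Y x%:C.
Proof.
move=> k_neq0; have -> : (k * (x - 1))%:C = k%:C * (x%:C - 1) :> C.
  by rewrite rmorphM rmorphB rmorph1.
by apply: eigenvalue_affine; rewrite (inj_eq (@complexI R)).
Qed.

Let affine_root (y : R) : k != 0 -> y = k * (y / k + 1 - 1).
Proof. by move=> k_neq0; field. Qed.

Lemma lambda_max_affine_gt0 : 0 < k -> lambda_max (k%:C *: (Y - 1%:M)) = k * (lambda_max Y - 1).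
Proof.
move=> k_gt0; have k_neq0 := lt0r_neq0 k_gt0; have [max_eig max_ge] := lambda_maxP n_gt0 hermY.
apply: lambda_max_eq hermitian_affine _ _ => [|y].
  by rewrite (eigenvalue_affine_real _ k_neq0).
rewrite (affine_root y k_neq0) (eigenvalue_affine_real _ k_neq0) => /max_ge.
by rewrite ler_pM2l // lerD2r.
Qed.

Lemma lambda_max_affine_lt0 : k < 0 -> lambda_max (k%:C *: (Y - 1%:M)) = k * (lambda_min Y - 1).
Proof.
move=> k_lt0; have k_neq0 := ltr0_neq0 k_lt0; have [min_eig min_le] := lambda_minP n_gt0 hermY.
apply: lambda_max_eq hermitian_affine _ _ => [|y].
  by rewrite (eigenvalue_affine_real _ k_neq0).
rewrite (affine_root y k_neq0) (eigenvalue_affine_real _ k_neq0) => /min_le.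
by rewrite ler_nM2l // lerD2r.
Qed.

End AffineSpectrum.

Lemma edge_within_lambda_max (R : realType) n (del : R) (S : 'M[R[i]]_n) : (0 < n)%N ->
  S \is hermsymmx -> edge_within del S -> `|lambda_max S - 2| <= del.
Proof.
move=> n_gt0 hermS [P [l [decS upper [i lower]]]]; have [max_eig max_ge] := lambda_maxP n_gt0 hermS.
have [j maxE] := real_spectral_dec_eigenvalueP decS max_eig.
have := max_ge _ (real_spectral_dec_eigenvalue decS i).
by rewrite (complexI maxE) ler_norml => l_le; have := upper j; lra.
Qed.

(** * Wishart matrices *)

Section EdgeScale.
Context {R : realType} (alpha : R).
Hypothesis alpha_gt0 : 0 < alpha.

Definition edge_scale (p d : nat) : R := p%:R * column_scale d p.

Lemma edge_scaleE p d : edge_scale p d = Num.sqrt (p%:R / (d * d)%:R).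
Proof.
rewrite /edge_scale /column_scale !sqrtrM ?ler0n // sqrtrV ?ler0n // invfM mulrA.
have [->|p_gt0] := posnP p; first by rewrite sqrtr0 mul0r mul0r.
congr (_ / _); rewrite -{1}(sqr_sqrtr (ler0n R p)) expr2 mulfK //.
by rewrite gt_eqF // sqrtr_gt0 ltr0n.
Qed.

Lemma cvg_columns_ratio : (columns alpha d)%:R / (d * d)%:R @[d --> \oo] --> alpha.
Proof.
apply/cvgrPdist_le => e e_gt0; near=> d.
have d_gt0 : (0 < d)%N by near: d; exact: nbhs_infty_gt.
have n_gt0 : 0 < (d * d)%:R :> R by rewrite ltr0n muln_gt0 d_gt0.
have := @truncn_itv _ (alpha * (d * d)%:R) (mulr_ge0 (ltW alpha_gt0) (ler0n R _)).
rewrite natrM -expr2 -/(columns alpha d) -natr1 expr2 -natrM => /andP[columns_le columns_gt].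
have -> : alpha - (columns alpha d)%:R / (d * d)%:R =
    (alpha * (d * d)%:R - (columns alpha d)%:R) / (d * d)%:R by rewrite mulrBl mulfK // gt_eqF.
rewrite ger0_norm ?divr_ge0 ?subr_ge0 ?ler0n // ler_pdivrMr //.
apply: (@le_trans _ _ 1); first by rewrite lerBlDl ltW.
apply: (@le_trans _ _ (e * d%:R)); last by rewrite ler_pM2l // ler_nat leq_pmulr.
by rewrite mulrC -ler_pdivrMr // div1r; near: d; exact: nbhs_infty_ger.
Unshelve. all: by end_near. Qed.

Lemma cvg_edge_scale : edge_scale (columns alpha d) d @[d --> \oo] --> Num.sqrt alpha.
Proof.
under eq_fun do rewrite edge_scaleE.
exact: (cvg_comp _ _ cvg_columns_ratio (@sqrt_continuous R alpha)).
Qed.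

Lemma near_edge_scale (eps : R) : 0 < eps -> \forall d \near \oo,
  Num.sqrt alpha / 2 <= edge_scale (columns alpha d) d /\
  `|2 / edge_scale (columns alpha d) d - 2 / Num.sqrt alpha| <= eps.
Proof.
move=> eps_gt0; have sqrt_gt0 : 0 < Num.sqrt alpha by rewrite sqrtr_gt0.
near=> d; split; near: d.
  apply: (cvgr_ge _ cvg_edge_scale); rewrite ltr_pdivrMr // ltr_pMr //; lra.
have cvg_inv : 2 / edge_scale (columns alpha d) d @[d --> \oo] --> 2 / Num.sqrt alpha.
  by apply: cvgMr; apply: cvgV cvg_edge_scale; rewrite gt_eqF.
by apply: cvgr_distC_le cvg_inv _ eps_gt0.
Unshelve. all: by end_near. Qed.

End EdgeScale.

Section EdgeLocation.
Context {R : realType}.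
Local Notation C := R[i].

(* The displacement from 1 of the largest eigenvalue, or of the smallest one if [neg], outwards. *)
Definition edge_displacement n (neg : bool) (Y : 'M[C]_n) : R :=
  if neg then 1 - lambda_min Y else lambda_max Y - 1.

Lemma dist_lambda_max n (Y : 'M[C]_n) a :
  `|lambda_max Y - (1 + a)| = `|edge_displacement false Y - a|.
Proof. by rewrite opprD addrA. Qed.

Lemma dist_lambda_min n (Y : 'M[C]_n) a :
  `|lambda_min Y - (1 - a)| = `|edge_displacement true Y - a|.
Proof. by rewrite distrC addrAC. Qed.

Lemma lambda_max_affine n (neg : bool) (k : R) (Y : 'M[C]_n) : (0 < n)%N -> Y \is hermsymmx ->
  0 < k -> lambda_max (((-1) ^+ neg * k)%:C *: (Y - 1%:M)) = k * edge_displacement neg Y.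
Proof.
move=> n_gt0 hermY k_gt0; case: neg; rewrite /edge_displacement.
  by rewrite mulN1r (lambda_max_affine_lt0 n_gt0 hermY) ?oppr_lt0 //; ring.
by rewrite mul1r (lambda_max_affine_gt0 n_gt0 hermY).
Qed.

Lemma measurable_edge_displacement (dT : measure_display) (T : measurableType dT) n neg
    (Y : T -> 'M[C]_n) : (0 < n)%N -> mx_measurable Y -> (forall w, Y w \is hermsymmx) ->
  measurable_fun setT (fun w => edge_displacement neg (Y w)).
Proof.
move=> n_gt0 mY hermY.
under eq_fun do rewrite -[edge_displacement _ _]mul1r -(lambda_max_affine _ n_gt0 (hermY _) ltr01).
apply: measurable_lambda_max => // [x y|w]; last exact: hermitian_affine.
under eq_fun do rewrite mxE; apply: CmeasurableM; first exact: Cmeasurable_cst.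
by apply: mx_measurableB.
Qed.

Lemma dist_edge_displacement (c t x eps : R) : 0 < c -> 0 < t -> t / 2 <= c ->
  `|2 / c - 2 / t| <= eps / 2 -> `|c * x - 2| <= eps * t / 4 -> `|x - 2 / t| <= eps.
Proof.
move=> c_gt0 t_gt0 c_ge c_near x_near.
rewrite (_ : x - 2 / t = c^-1 * (c * x - 2) + (2 / c - 2 / t)); last by field; rewrite !gt_eqF.
apply: le_trans (ler_normD _ _) _; rewrite [leRHS]splitr lerD //.
rewrite normrM ger0_norm ?invr_ge0 ?(ltW c_gt0) // ler_pdivrMl //; apply: le_trans x_near _.
rewrite (_ : eps * t / 4 = t / 2 * (eps / 2)); last by field.
apply: ler_wpM2r => //; exact: le_trans (normr_ge0 _) c_near.
Qed.

End EdgeLocation.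

Lemma likely_probability_le (R : realType) (dT : measure_display) (T : measurableType dT)
    (P : probability T R) (eps : R) (Q : T -> Prop) (A : set T) : measurable A ->
  (forall w, Q w -> ~ A w) -> likely P eps Q -> (P A <= eps%:E)%E.
Proof.
move=> mA QA [E [mE E_le EQ]].
apply: (le_trans (probability_le_Rintegral P (measurable_neg mE) mA _)); last by rewrite lee_fin.
by move=> w Aw; apply/negP => /EQ/QA.
Qed.

Section WishartEdge.
Context {R : realType}.
Local Notation C := R[i].

Lemma partial_sum_wishart (dT : measure_display) (T : measurableType dT) (d p : nat)
    (G : T -> 'M[C]_(d * d, p.+1)) (neg : bool) (w : T) :
  partial_sum (fun ij w => G w ij.1 ij.2) neg p.+1 w = ((-1) ^+ neg * edge_scale p.+1 d)%:C *:
    (partial_transpose (p.+1%:R^-1 *: (G w *m (G w)^t*)) - 1%:M).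
Proof.
have p_neq0 : (p.+1%:R : C) != 0 by rewrite pnatr_eq0.
have sumE : \sum_(k < p.+1) pt_square (\col_r G w r k) =
    p.+1%:R *: partial_transpose (p.+1%:R^-1 *: (G w *m (G w)^t*)).
  apply/matrixP => r s; rewrite summxE 2!mxE /block_entry mxE mulrA mulfV // mul1r mxE.
  by apply: eq_bigr => k _; rewrite pt_squareE !mxE.
transitivity (\sum_(k < p.+1) ((-1) ^+ neg * column_scale d p.+1)%:C *:
    (pt_square (\col_r G w r k) - 1%:M)).
  by apply: eq_bigr => k _; rewrite /column_step /column_increment inord_val.
rewrite -scaler_sumr sumrB sumE sumr_const card_ord -[1%:M *+ _]scaler_nat -scalerBr scalerA.
rewrite -(rmorph_nat (real_complex R)) -rmorphM; congr (_%:C *: _).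
by rewrite /edge_scale; ring.
Qed.

Lemma gaussian_matrix_ensemble (kind : entry_kind) (dT : measure_display) (T : measurableType dT)
    (P : probability T R) (d p : nat) (G : T -> 'M[C]_(d * d, p)) : gaussian_matrix kind P G ->
  gaussian_ensemble P (entry_pseudo_variance_of kind) (fun ij w => G w ij.1 ij.2).
Proof.
move=> /gaussian_matrix_entries[entries indep]; split=> //.
by case: (kind); rewrite /= ?mulr1 ?mulr0.
Qed.

Lemma mx_measurable_partial_transpose (dT : measure_display) (T : measurableType dT) (d : nat)
    (A : T -> 'M[C]_(d * d)) : mx_measurable A -> mx_measurable (fun w => partial_transpose (A w)).
Proof. by move=> mA r s; under eq_fun do rewrite mxE; exact: mA. Qed.

Lemma mx_measurable_wishart (kind : entry_kind) (dT : measure_display) (T : measurableType dT)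
    (P : probability T R) (n p : nat) (W : T -> 'M[C]_n) : is_wishart kind P p W -> mx_measurable W.
Proof.
move=> [G /gaussian_matrix_entries[entries _] WE] r s.
have mG i j : Cmeasurable (fun w => G w i j) by exact: (entry_measurable (entries (i, j))).
apply: (eq_Cmeasurable (f := fun w => p%:R^-1 * \sum_k G w r k * Num.conj (G w s k))) => [w|].
  by rewrite WE !mxE; congr (_ * _); apply: eq_bigr => k _; rewrite !mxE.
apply: CmeasurableM; first exact: Cmeasurable_cst.
by apply: Cmeasurable_sum => k _; apply: CmeasurableM => //; exact: Cmeasurable_conjC.
Qed.

Lemma near_wishart_edge (kind : entry_kind) (neg : bool) (alpha eps eta : R) :
  0 < alpha -> 0 < eps -> 0 < eta -> \forall d \near \oo,
  forall (dT : measure_display) (T : measurableType dT) (P : probability T R)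
    (W : T -> 'M[C]_(d * d)), is_wishart kind P (columns alpha d) W ->
  (P [set w | (eps < `|edge_displacement neg (partial_transpose (W w)) - 2 / Num.sqrt alpha|)%R]
    <= eta%:E)%E.
Proof.
move=> alpha_gt0 eps_gt0 eta_gt0; have sqrt_gt0 : 0 < Num.sqrt alpha by rewrite sqrtr_gt0.
have del_gt0 : 0 < eps * Num.sqrt alpha / 4 by rewrite divr_gt0 // mulr_gt0.
have half_gt0 : 0 < eps / 2 by rewrite divr_gt0.
apply: filterS3 (nbhs_infty_gt 0) (near_edge_scale alpha_gt0 half_gt0)
  (filterI (near_columns_gt0 alpha_gt0) (near_edge alpha_gt0 del_gt0 eta_gt0)).
move=> d d_gt0 [scale_ge scale_near] [columns_gt0 edge] dT T P W wishart_W.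
have n_gt0 : (0 < d * d)%N by rewrite muln_gt0 d_gt0.
have scale_gt0 : (0 : R) < edge_scale (columns alpha d) d.
  by apply: lt_le_trans scale_ge; rewrite divr_gt0.
have hermY w : partial_transpose (W w) \is hermsymmx.
  by apply: partial_transpose_hermitian; exact: (wishart_hermitian w wishart_W).
have mY := mx_measurable_partial_transpose (mx_measurable_wishart wishart_W).
have [G gaussian_G WE] := wishart_W.
move: columns_gt0 scale_ge scale_near scale_gt0 edge gaussian_G WE.
case columnsE : (columns alpha d) G => [//|p] G _ scale_ge scale_near scale_gt0 edge gaussian_G WE.
apply: likely_probability_le (edge _ _ _ _ _ _ neg (esym erefl)
  (gaussian_matrix_ensemble gaussian_G)) => [|w].
  rewrite -[X in measurable X]setTI; apply: measurable_fun_ltr => //.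
  apply: measurableT_comp => //; apply: measurable_funB => //.
  exact: measurable_edge_displacement.
rewrite partial_sum_wishart -WE => edge_w /=; apply/negP; rewrite -leNgt.
apply: (dist_edge_displacement scale_gt0 sqrt_gt0 scale_ge scale_near).
rewrite -(lambda_max_affine _ n_gt0 (hermY w) scale_gt0).
by apply: edge_within_lambda_max => //; exact: hermitian_affine.
Qed.

End WishartEdge.

Lemma cvg0_near_le (R : realType) (x : nat -> \bar R) : (forall d, 0 <= x d)%E ->
  (forall eta : R, 0 < eta -> \forall d \near \oo, (x d <= eta%:E)%E) ->
  x d @[d --> \oo] --> (0%R)%:E.
Proof.
move=> x_ge0 x_small.
have fin_x d (eta : R) : (x d <= eta%:E)%E -> x d \is a fin_num.
  by move=> x_le; rewrite ge0_fin_numE // (le_lt_trans x_le) // ltry.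
apply/fine_cvgP; split; first by apply: filterS (x_small 1 ltr01) => d; exact: fin_x.
apply/cvgr0Pnorm_le => eta eta_gt0; apply: filterS (x_small _ eta_gt0) => d x_le /=.
by rewrite ger0_norm ?fine_ge0 // -lee_fin fineK //; exact: fin_x x_le.
Qed.

Theorem theorem2 (R : realType) (kind : entry_kind) (alpha : R)
    (alpha_gt0 : 0 < alpha)
    (disp : nat -> measure_display) (T : forall d : nat, measurableType (disp d))
    (P : forall d : nat, probability (T d) R)
    (W : forall d : nat, T d -> 'M[R[i]]_(d * d))
    (W_wishart : forall d : nat, (0 < d)%N ->
      (1 <= Num.truncn (alpha * d%:R ^+ 2))%N ->
      is_wishart kind (P d) (Num.truncn (alpha * d%:R ^+ 2)) (W d)) :
  forall eps : R, 0 < eps ->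
    (P d [set w : T d |
       eps < `|lambda_max (partial_transpose (W d w)) - (1 + 2 / Num.sqrt alpha)|]
       @[d --> \oo] --> (0%R)%:E) /\
    (P d [set w : T d |
       eps < `|lambda_min (partial_transpose (W d w)) - (1 - 2 / Num.sqrt alpha)|]
       @[d --> \oo] --> (0%R)%:E).
Proof.
move=> eps eps_gt0.
have edge neg : P d [set w | eps < `|edge_displacement neg (partial_transpose (W d w)) -
    2 / Num.sqrt alpha|] @[d --> \oo] --> (0%R)%:E.
  apply: cvg0_near_le => [d|eta eta_gt0]; first exact: measure_ge0.
  apply: filterS3 (nbhs_infty_gt 0) (near_columns_gt0 alpha_gt0)
    (near_wishart_edge kind neg alpha_gt0 eps_gt0 eta_gt0) => d d_gt0 columns_gt0; apply.
  exact: W_wishart.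
split; under eq_fun do under eq_set do rewrite ?dist_lambda_max ?dist_lambda_min.
  exact: edge false.
exact: edge true.
Qed.
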